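(* Let $\Omega\subset\mathbb{R}^N$ ($N\ge2$) be a bounded domain and $\mu$ a regular Borel measure on $\partial\Omega$ such that $\Gamma_\mu$ is $\mathrm{Cap}_{2,\Omega}$-admissible with respect to $\mu$, and either $\mathrm{Cap}_{2,\Omega}(\Gamma_\mu^\infty)>0$ or $\mu(\Gamma_\mu)>0$. Assume also that either $\mu=\sigma$ or $\mathcal{V}\hookrightarrow L^{2q}(\Omega)$ continuously for some $q=q(N,\Omega)>1$. Let $f\in C^1(\mathbb R)$ satisfy either (i) for some $p>1$ and positive constants, $C_f|s|^p-c_f\le f(s)s\le\widetilde C_f|s|^p+\widetilde c_f$ and $f'(s)\ge-C_f$ for all $s\in\mathbb R$; or (ii) $\liminf_{|s|\to+\infty}f(s)/s>-\lambda_*$ for some constant $\lambda_*\in[0,C_\Omega)$. Then the functional $$\mathcal L_\Theta(u(t)):=\tfrac12\mathcal{A}_{\Theta,\mu}(u(t),u(t))+\int_\Omega F(u(t))\,dx,\qquad F(s)=\int_0^sf(y)\,dy,$$ has, along the strong solutions of $$\partial_t u-\Delta u+f(u)=0\ \text{in }\Omega\times(0,\infty),\qquad \partial_\nu u\,d\sigma+(u+\Theta_\mu(u))\,d\mu=0\ \text{on }\partial\Omega\times(0,\infty),\qquad u(0)=u_0,$$ the derivative $$\frac{d}{dt}\mathcal L_\Theta(u(t))=-\int_\Omega|\partial_tu(t)|^2dx\quad\text{for a.e. }t>0 .$$ In other words, $\mathcal L_\Theta$ is decreasing, and becomes stationary exactly on equilibria $u_*$, which are solutions of the system $$-\Delta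 u+f(u)=0\ \text{in }\Omega,\qquad \partial_\nu u\,d\sigma+(u+\Theta_\mu(u))\,d\mu=0\ \text{on }\partial\Omega .$$
   Context: Setting. $s\in(0,1)$ (the exponent in the kernel $K_s$) is fixed, $\sigma=\mathcal{H}^{N-1}|_{\partial\Omega}$. A Borel measure $\mu$ on $\partial\Omega$ is regular if every $A\subset\partial\Omega$ is contained in a Borel set $B$ with $\mu(A)=\mu(B)$. Convention: ''$\mu=\sigma$'' also designates the case where $\mu$ is absolutely continuous with respect to $\sigma$. Put $\Gamma_\mu^\infty=\{z\in\partial\Omega:\mu(B(z,r)\cap\partial\Omega)=\infty\ \forall r>0\}$ and $\Gamma_\mu=\partial\Omega\setminus\Gamma_\mu^\infty$. Let $\mathcal{W}^{1,2}(\Omega)$ be the closure of $W^{1,2}(\Omega)\cap C(\overline\Omega)$ in $W^{1,2}(\Omega)$. For $A\subset\overline\Omega$, $\mathrm{Cap}_{2,\Omega}(A)=\inf\{\|u\|^2_{W^{1,2}(\Omega)}: u\in\mathcal{W}^{1,2}(\Omega),\ \exists\, O\subset\mathbb{R}^N\text{ open},\ A\subset O,\ u\ge 1\text{ a.e. on }\Omega\cap O\}$; ''q.e.'' means outside a set of zero $\mathrm{Cap}_{2,\Omega}$. $\Gamma_\mu$ is $\mathrm{Cap}_{2,\Omega}$-admissible with respect to $\mu$ if every Borel set $A\subset\Gamma_\mu$ with $\mathrm{Cap}_{2,\Omega}(A)=0$ satisfies $\mu(A)=0$. Each $u\in\mathcal{W}^{1,2}(\Omega)$ is identified with its $\mathrm{Cap}_{2,\Omega}$-quasi-continuous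 version on $\overline\Omega$ (unique q.e.). Let $K_s(x,y)=|x-y|^{-(N-1+2s)}$. The space $\mathcal{V}=\mathcal{V}_\Theta^{1,2}(\Omega,\partial\Omega,\mu)$ is the completion of the functions $u\in W^{1,2}(\Omega)\cap C(\overline\Omega)$ with finite norm $$\|u\|_{\mathcal V}=\Big(\|u\|_{W^{1,2}(\Omega)}^2+\int_{\partial\Omega}|u|^2d\mu+\iint_{\partial\Omega\times\partial\Omega}K_s(x,y)|u(x)-u(y)|^2d\mu_xd\mu_y\Big)^{1/2},$$ and is described as the set of $u\in\mathcal{W}^{1,2}(\Omega)$ with $u=0$ q.e. on $\Gamma_\mu^\infty$, $\int_{\Gamma_\mu}|u|^2d\mu<\infty$ and $\iint_{\Gamma_\mu\times\Gamma_\mu}K_s|u(x)-u(y)|^2d\mu_xd\mu_y<\infty$. On $\mathcal{V}$ let $$\mathcal{A}_{\Theta,\mu}(u,v)=\int_\Omega\nabla u\cdot\nabla v\,dx+\int_{\Gamma_\mu}uv\,d\mu+\iint_{\Gamma_\mu\times\Gamma_\mu}K_s(x,y)(u(x)-u(y))(v(x)-v(y))\,d\mu_xd\mu_y ;$$ under the hypotheses $\mathcal{A}_{\Theta,\mu}(u,u)^{1/2}$ is an equivalent norm on $\mathcal V$. $\Theta_\mu$ is the nonlocal operator $\langle\Theta_\mu(u),v\rangle=\iint_{\partial\Omega\times\partial\Omega} K_s(x,y)(u(x)-u(y))(v(x)-v(y))d\mu_xd\mu_y$. $A_{\Theta,\mu}$ is the self-adjoint operator on $L^2(\Omega)$ associated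 with the closed form $\mathcal{A}_{\Theta,\mu}$. Both boundary value problems are understood through this form (equilibria: $\mathcal{A}_{\Theta,\mu}(u_*,\xi)+\int_\Omega f(u_* )\xi\,dx=0$ for all test functions $\xi$). $C_\Omega>0$ is the largest constant with $C_\Omega\|u\|_{L^2(\Omega)}^2\le\mathcal{A}_{\Theta,\mu}(u,u)$ for all $u\in\mathcal V$. Strong solution with $u_0\in L^\infty(\Omega)$: for every $T>0$, $u\in L^2(0,T;\mathcal V)$, $\partial_tu\in L^2(0,T;\mathcal V^* )$, $u\in W^{1,\infty}_{\mathrm{loc}}((0,T];L^2(\Omega))\cap C([0,T];L^\infty(\Omega))$, $u(t)\in D(A_{\Theta,\mu})$ for a.e. $t\in(0,T)$, $u(0)=u_0$ a.e., $\langle\partial_tu(t),\xi\rangle+\mathcal{A}_{\Theta,\mu}(u(t),\xi)+\int_\Omega f(u(t))\xi\,dx=0$ for all $\xi\in\mathcal V$ and a.e. $t$, and $\frac12\|u(t)\|_{L^2}^2+\int_0^t[\mathcal{A}_{\Theta,\mu}(u,u)+\int_\Omega f(u)u\,dx]ds=\frac12\|u_0\|_{L^2}^2$. *)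

(* Defs.v *)
From HB Require Import structures.
From mathcomp Require Import all_boot all_order all_algebra.
From mathcomp Require Import all_classical all_reals all_analysis.

Set Implicit Arguments.
Unset Strict Implicit.
Unset Printing Implicit Defensive.
Import Order.TTheory GRing.Theory Num.Theory.
Import numFieldNormedType.Exports.

Local Open Scope classical_set_scope.
Local Open Scope ring_scope.

Section euclidean.
Context {R : realType} {N : nat}.
Implicit Types (x y : 'rV[R]_N) (A X : set 'rV[R]_N).

(* The library norm of 'rV is the sup norm; only the topology is taken from it. *)
Definition edist x y : R := Num.sqrt (\sum_(i < N) (x 0 i - y 0 i) ^+ 2).

Definition eball x (r : R) : set 'rV[R]_N := [set y | edist x y < r].

Definition ediam A : \bar R :=
  ereal_sup [set (edist x.1 x.2)%:E | x in A `*` A].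

Definition borel : set (set 'rV[R]_N) := <<s [set A | open A] >>.

Definition boundary A : set 'rV[R]_N := closure A `\` A°.

Definition evec (i : 'I_N) : 'rV[R]_N := delta_mx 0 i.

Definition box x y : set 'rV[R]_N :=
  [set z | forall i, x 0 i <= z 0 i <= y 0 i].

(* Volume of the smallest box containing A; it is +oo when A is unbounded. *)
Definition box_volume A : \bar R :=
  if `[< A = set0 >] then 0%E else
  ereal_inf [set (\prod_(i < N) (p.2 0 i - p.1 0 i))%:E | p in
    [set p : 'rV[R]_N * 'rV[R]_N |
      (forall i, p.1 0 i <= p.2 0 i) /\ A `<=` box p.1 p.2]].

Definition lebesgue_outer X : \bar R :=
  ereal_inf [set (\sum_(k <oo) box_volume (A k))%E | A in
    [set A : (set 'rV[R]_N)^nat | X `<=` \bigcup_k A k]].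

Lemma box_volume0 : box_volume set0 = 0%E.
Proof. by rewrite /box_volume asboolT. Qed.

Lemma box_volume_ge0 A : (0 <= box_volume A)%E.
Proof.
rewrite /box_volume; case: ifP => // _.
apply: le_ereal_inf_tmp => _ [[a b] /= [ab _] <-].
by rewrite lee_fin; apply: prodr_ge0 => i _; rewrite subr_ge0.
Qed.

Let allT := g_sigma_algebraType [set: set 'rV[R]_N].

Let lebesgue_outerE :
  lebesgue_outer = mu_ext (box_volume : set allT -> \bar R).
Proof.
apply/funext => X; rewrite /lebesgue_outer /mu_ext; congr (ereal_inf (_ @` _)).
apply/seteqP; split => [A XA|A [_ XA]] //=.
by split => // i; exact: sub_sigma_algebra.
Qed.

Let lebesgue_outer0 : lebesgue_outer set0 = 0%E.
Proof.
by rewrite lebesgue_outerE mu_ext0//; [exact: box_volume0|exact: box_volume_ge0].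
Qed.

Let lebesgue_outer_ge0 X : (0 <= lebesgue_outer X)%E.
Proof. by rewrite lebesgue_outerE; apply: mu_ext_ge0; exact: box_volume_ge0. Qed.

Let le_lebesgue_outer :
  {homo lebesgue_outer : A B / A `<=` B >-> (A <= B)%E}.
Proof.
rewrite lebesgue_outerE => A B AB.
by apply: (@le_mu_ext _ allT R box_volume).
Qed.

Let lebesgue_outer_sigma_subadditive : sigma_subadditive lebesgue_outer.
Proof.
rewrite lebesgue_outerE.
exact: (@mu_ext_sigma_subadditive _ allT R box_volume box_volume_ge0).
Qed.

HB.instance Definition _ := isOuterMeasure.Build R 'rV[R]_N lebesgue_outer
  lebesgue_outer0 lebesgue_outer_ge0 le_lebesgue_outer
  lebesgue_outer_sigma_subadditive.

End euclidean.

Arguments lebesgue_outer {R} N X.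

Definition cara_measure {R : realType} {T : pointedType}
    (mu : {outer_measure set T -> \bar R}) :
    {measure set (caratheodory_type mu) -> \bar R} :=
  (mu : set (caratheodory_type mu) -> \bar R).

(* N-dimensional Lebesgue measure, on the Caratheodory (hence complete)
   sigma-algebra of [lebesgue_outer N]. *)
Definition leb {R : realType} (N : nat) :=
  cara_measure (lebesgue_outer N : {outer_measure set 'rV[R]_N -> \bar R}).

Section hausdorff.
Context {R : realType} {N : nat}.
Local Open Scope ereal_scope.

(* Volume of the unit ball of R^d. *)
Fixpoint ball_volume (d : nat) : R :=
  match d with
  | 0%N => 1%R
  | 1%N => 2%R
  | d'.+2 => (2 * pi / d'.+2%:R * ball_volume d')%R
  end.

Definition hausdorff_pre (d : nat) (delta : R) (X : set 'rV[R]_N) : \bar R :=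
  ereal_inf [set \sum_(k <oo) (ball_volume d * (fine (ediam (A k)) / 2) ^+ d)%:E
    | A in [set A : (set 'rV[R]_N)^nat | X `<=` \bigcup_k A k /\
        forall k, ediam (A k) <= delta%:E]].

Definition hausdorff (d : nat) (X : set 'rV[R]_N) : \bar R :=
  ereal_sup [set hausdorff_pre d delta X | delta in [set delta | (0 < delta)%R]].

End hausdorff.

Section sobolev.
Context {R : realType} {N : nat} (Om : set 'rV[R]_N).
Local Notation RN := 'rV[R]_N.
Local Notation lebN := (@leb R N).
Implicit Types (u v phi : RN -> R) (g : 'I_N -> RN -> R) (A : set RN).

Definition ae_in (P : RN -> Prop) : Prop :=
  {ae lebN, forall x, Om x -> P x}.

Definition measurable_in u : Prop :=
  measurable_fun (Om : set (caratheodory_type (@lebesgue_outer R N)))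
    (u : caratheodory_type (@lebesgue_outer R N) -> R).

Definition L2norm u : \bar R :=
  ((\int[lebN]_(x in Om) ((u x) ^+ 2)%:E) `^ 2^-1)%E.

Definition L2 : set (RN -> R) :=
  [set u | measurable_in u /\ (L2norm u < +oo)%E].

Definition L2dot u v : R := \int[lebN]_(x in Om) (u x * v x).

Definition Linf : set (RN -> R) :=
  [set u | measurable_in u /\ exists M : R, ae_in (fun x => `|u x| <= M)].

Fixpoint Ck (k : nat) phi : Prop :=
  match k with
  | 0%N => continuous phi
  | k'.+1 => continuous phi /\ forall i,
      (forall x, derivable phi x (evec i)) /\ Ck k' ('D_(evec i) phi)
  end.

Definition test_fun : set (RN -> R) :=
  [set phi | (forall k, Ck k phi) /\
    exists K : set RN, [/\ compact K, K `<=` Om & forall x, ~ K x -> phi x = 0]].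

Definition weak_gradient u g : Prop :=
  (forall i, L2 (g i)) /\
  forall phi i, test_fun phi ->
    \int[lebN]_(x in Om) (u x * 'D_(evec i) phi x) =
    - \int[lebN]_(x in Om) (g i x * phi x).

Definition W12 : set (RN -> R) :=
  [set u | L2 u /\ exists g, weak_gradient u g].

(* Weak gradients are unique almost everywhere, and the chosen one depends only
   on the almost-everywhere class of u. *)
Definition grad u : 'I_N -> RN -> R := get [set g | weak_gradient u g].

Definition W12norm2 u : \bar R :=
  (\int[lebN]_(x in Om) ((u x) ^+ 2 + \sum_(i < N) (grad u i x) ^+ 2)%:E)%E.

Definition W12C : set (RN -> R) :=
  [set u | W12 u /\ {within closure Om, continuous u}].

Definition W12tilde : set (RN -> R) :=
  [set u | W12 u /\ forall e : R, 0 < e ->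
    exists v, W12C v /\ (W12norm2 (fun x => u x - v x)%R < e%:E)%E].

Definition cap A : \bar R :=
  ereal_inf [set W12norm2 u | u in [set u | W12tilde u /\
    exists O : set RN, [/\ open O, A `<=` O &
      ae_in (fun x => O x -> 1 <= u x)]]].

Definition quasi_continuous u : Prop :=
  forall e : R, 0 < e -> exists O : set RN,
    [/\ open O, (cap (O `&` closure Om) < e%:E)%E &
        {within closure Om `\` O, continuous u}].

(* The quasi-continuous version on the closure of Om; like [grad], it depends
   only on the almost-everywhere class of u. *)
Definition qc u : RN -> R :=
  get [set v | quasi_continuous v /\ ae_in (fun x => v x = u x)].

End sobolev.

Section form.
Context {R : realType} {N : nat} (s : R) (Om : set 'rV[R]_N).
Context (mu : {outer_measure set 'rV[R]_N -> \bar R}).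
Local Notation RN := 'rV[R]_N.
Local Notation lebN := (@leb R N).
Implicit Types (u v xi : RN -> R).

(* The library integral is taken on the measurable space of Caratheodory
   mu-measurable sets. *)
Definition bmeas := cara_measure mu.

(* A measure on the boundary of Om is extended to R^N by zero. *)
Definition regular_borel_on_boundary : Prop :=
  [/\ mu (~` boundary Om) = 0%E,
      forall A, borel A -> caratheodory_measurable mu A &
      forall A, A `<=` boundary Om ->
        exists B, [/\ borel B, A `<=` B & mu A = mu B]].

Definition Gamma_inf : set RN :=
  [set z | boundary Om z /\
    forall r : R, 0 < r -> mu (eball z r `&` boundary Om) = +oo%E].

Definition Gamma : set RN := boundary Om `\` Gamma_inf.

Definition admissible : Prop :=
  forall A, borel A -> A `<=` Gamma -> cap Om A = 0%E -> mu A = 0%E.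

Definition Ks (x y : RN) : R := edist x y `^ (- (N%:R - 1 + 2 * s)).

Definition Vnorm2 u : \bar R :=
  (W12norm2 Om u
   + \int[bmeas]_(x in Gamma) ((qc Om u x) ^+ 2)%:E
   + \int[bmeas]_(x in Gamma) \int[bmeas]_(y in Gamma)
       (Ks x y * (qc Om u x - qc Om u y) ^+ 2)%:E)%E.

Definition Vnorm u : \bar R := (Vnorm2 u `^ 2^-1)%E.

Definition V : set (RN -> R) :=
  [set u | [/\ W12tilde Om u,
    cap Om [set x | Gamma_inf x /\ qc Om u x != 0] = 0%E,
    (\int[bmeas]_(x in Gamma) ((qc Om u x) ^+ 2)%:E < +oo)%E &
    (\int[bmeas]_(x in Gamma) \int[bmeas]_(y in Gamma)
       (Ks x y * (qc Om u x - qc Om u y) ^+ 2)%:E < +oo)%E]].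

Definition Aform u v : R :=
  \int[lebN]_(x in Om) (\sum_(i < N) grad Om u i x * grad Om v i x)
  + \int[bmeas]_(x in Gamma) (qc Om u x * qc Om v x)
  + \int[bmeas]_(x in Gamma) \int[bmeas]_(y in Gamma)
      (Ks x y * (qc Om u x - qc Om u y) * (qc Om v x - qc Om v y)).

Definition dom_A : set (RN -> R) :=
  [set u | V u /\ exists g, L2 Om g /\
    forall v, V v -> Aform u v = L2dot Om g v].

Definition C_Om : \bar R :=
  ereal_sup [set c%:E | c in
    [set c : R | forall u, V u -> c * L2dot Om u u <= Aform u u]].

Definition V_embeds_Lr (r : R) : Prop :=
  exists C : R, 0 < C /\ forall u, V u ->
    ((\int[lebN]_(x in Om) (`|u x| `^ r)%:E) `^ r^-1 <= C%:E * Vnorm u)%E.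

Definition dual_norm (l : (RN -> R) -> R) : \bar R :=
  ereal_sup [set (`|l v|)%:E | v in [set v | V v /\ (Vnorm v <= 1)%E]].

Definition Vdual : set ((RN -> R) -> R) :=
  [set l | (forall (a : R) u v, V u -> V v ->
              l (fun x => a * u x + v x) = a * l u + l v) /\
           (dual_norm l < +oo)%E].

End form.

Section bochner.
Context {R : realType} {X : Type}.
Implicit Types (D : set (X -> R)) (nrm : (X -> R) -> \bar R) (I : set R)
  (w : R -> X -> R).
Local Notation lebR := (@lebesgue_measure R).

Definition simple_in D w : Prop :=
  exists (m : nat) (A : 'I_m -> set R) (v : 'I_m -> X -> R),
    [/\ forall i, measurable (A i), forall i, D (v i) &
        w = fun t x => \sum_(i < m) \1_(A i) t * v i x].

Definition strongly_measurable D nrm I w : Prop :=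
  exists sn : nat -> R -> X -> R, (forall n, simple_in D (sn n)) /\
    {ae lebR, forall t, I t ->
       D (w t) /\ nrm (fun x => sn n t x - w t x) @[n --> \oo] --> 0%E}.

Definition L2_time D nrm I w : Prop :=
  strongly_measurable D nrm I w /\
  (\int[lebR]_(t in I) (nrm (w t) ^+ 2) < +oo)%E.

Definition Linf_time D nrm I w : Prop :=
  strongly_measurable D nrm I w /\
  exists M : R, {ae lebR, forall t, I t -> (nrm (w t) <= M%:E)%E}.

End bochner.

Definition test_time {R : realType} (a b : R) : set (R -> R) :=
  [set phi | (forall n x, derivable (derive1n n phi) x 1) /\
    exists c d, [/\ a < c, d < b & forall t, ~~ (c <= t <= d) -> phi t = 0]].

Definition C1 {R : realType} (f : R -> R) : Prop :=
  (forall x, derivable f x 1) /\ continuous (derive1 f).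

(* The filter |x| -> +oo. *)
Definition abs_pinfty {R : realType} : set (set R) :=
  [set A | exists M : R, forall x, M < `|x| -> A x].

(* The integral of f from 0 to x, for either sign of x. *)
Definition primitive {R : realType} (f : R -> R) (x : R) : R :=
  \int[@lebesgue_measure R]_(y in `[0, x]) f y
  - \int[@lebesgue_measure R]_(y in `[x, 0]) f y.

Section evolution.
Context {R : realType} {N : nat} (s : R) (Om : set 'rV[R]_N).
Context (mu : {outer_measure set 'rV[R]_N -> \bar R}) (f : R -> R).
Local Notation RN := 'rV[R]_N.
Local Notation lebR := (@lebesgue_measure R).
Local Notation VV := (V s Om mu).
Local Notation Af := (Aform s Om mu).
Implicit Types (u ut : R -> RN -> R) (w : RN -> R).

(* u lies in W^{1,oo}(a, b; L^2(Om)) with derivative ut: the identity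
   int phi' u dt = - int phi ut dt between Bochner integrals in L^2(Om) is
   tested against every element of L^2(Om). *)
Definition W1inf_time (a b : R) u ut : Prop :=
  [/\ Linf_time (L2 Om) (L2norm Om) `]a, b[ u,
      Linf_time (L2 Om) (L2norm Om) `]a, b[ ut &
      forall phi psi, test_time a b phi -> L2 Om psi ->
        \int[lebR]_(t in `]a, b[) (derive1 phi t * L2dot Om (u t) psi) =
        - \int[lebR]_(t in `]a, b[) (phi t * L2dot Om (ut t) psi)].

Definition C_time_Linf (T : R) u : Prop :=
  (forall t, 0 <= t <= T -> Linf Om (u t)) /\
  forall t, 0 <= t <= T -> forall e : R, 0 < e -> exists d : R, 0 < d /\
    forall r, 0 <= r <= T -> `|r - t| < d ->
      ae_in Om (fun x => `|u r x - u t x| <= e).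

(* ut is the time derivative of u. Elements of L^2(Om) act on V through the
   L^2 pairing. *)
Record strong_solution (u0 : RN -> R) u ut : Prop := StrongSolution {
  strong_L2V : forall T : R, 0 < T -> L2_time VV (Vnorm s Om mu) `]0, T[ u;
  strong_L2dual : forall T : R, 0 < T ->
    L2_time (Vdual s Om mu) (dual_norm s Om mu) `]0, T[
      (fun t => L2dot Om (ut t));
  strong_W1inf : forall d T : R, 0 < d < T -> W1inf_time d T u ut;
  strong_C : forall T : R, 0 < T -> C_time_Linf T u;
  strong_dom : {ae lebR, forall t, 0 < t -> dom_A s Om mu (u t)};
  strong_init : ae_in Om (fun x => u 0 x = u0 x);
  strong_eq : {ae lebR, forall t, 0 < t -> forall xi, VV xi ->
    L2dot Om (ut t) xi + Af (u t) xi + L2dot Om (f \o u t) xi = 0};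
  strong_energy : forall t, 0 <= t ->
    L2dot Om (u t) (u t) / 2
    + \int[lebR]_(r in `[0, t]) (Af (u r) (u r) + L2dot Om (f \o u r) (u r))
    = L2dot Om u0 u0 / 2 }.

Definition Lyapunov w : R :=
  Af w w / 2 + \int[leb N]_(x in Om) primitive f (w x).

Definition equilibrium w : Prop :=
  [/\ VV w, Linf Om w &
      forall xi, VV xi -> Af w xi + L2dot Om (f \o w) xi = 0].

End evolution.

(* Main.v *)
Require Import Defs.
From HB Require Import structures.
From mathcomp Require Import all_boot all_order all_algebra.
From mathcomp Require Import all_classical all_reals all_analysis.
From mathcomp Require Import measurable_realfun simple_functions.
From mathcomp Require Import ring lra.
Import Order.TTheory GRing.Theory Num.Theory.
Import numFieldNormedType.Exports.
Import HBNNSimple.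
Local Open Scope classical_set_scope.
Local Open Scope ring_scope.
Set Implicit Arguments.
Unset Strict Implicit.
Unset Printing Implicit Defensive.

(* The form A is closed: a sequence of V that converges in L^2 and is Cauchy for
   d(u, w) = A(u, u) - 2 A(u, w) + A(w, w) = A(u - w, u - w) converges in V,
   because quasi-continuous versions converge quasi-everywhere along a
   subsequence and sets of capacity zero are mu-null in Gamma.

   Let u be a strong solution. At almost every time t the equation holds with
   ut t in L^2, and testing it with u t and u r gives d(u t, u r) <= C |t - r|
   and |A(u t, u t) - A(u r, u r)| <= C |t - r|; closedness extends both V (u t)
   and the Lipschitz bound to all t > 0. Convexity of A and the C^1 bound on f
   give, for almost every t and every r,
     L(u r) - L(u t) >= - (ut t, u r - u t) - C (r - t)^2,
   where (ut t, u r - u t) = (r - t) |ut t|^2 + o(r - t). Applied on both sides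
   of t this bounds the Dini derivatives of the Lipschitz function L(u) by
   - |ut t|^2 from below on the right and from above on the left, and a Fatou
   argument on difference quotients gives L(u b) - L(u a) = - int_a^b |ut|^2.

   If L(u) takes the same value at t1 < t2, then ut = 0 on ]t1, t2[, u is
   constant there and u t1 solves the stationary equation. Conversely, if w = u t1
   is an equilibrium, then (ut t, u t - w) <= K |u t - w|^2 and Gronwall's
   inequality forces u t = w for t >= t1. *)

(** * The Hilbert space of square-integrable functions *)

(** The energy has no chain rule at hand: [ut t] is only an element of L^2, and membership in [V]
    and the equation are known at almost every time only. What replaces a chain rule is that at such
    a time [A (u t, .)] is represented by an L^2 vector, [- residual t]; the equations at two times
    share the mixed term [A (u t, u r)] by symmetry, so energies are compared through L^2 products.
    Convexity yields a single inequality, but division by [r - t] reverses it to the left of [t],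
    which is why it bounds the quotients on the two sides from opposite directions. All estimates
    live on windows []a, b[] with [a > 0]: there [ut] is bounded in L^2 and the values of [u] stay
    in a compact interval, on which [f] is bounded and Lipschitz. The other half of the work comes
    from the definitions: [grad] and [qc] are choices among objects determined up to exceptional
    sets, so uniqueness of weak gradients, and existence and uniqueness of quasi-continuous
    versions, precede any computation with the form. *)

Section null_change.
Context d (T : measurableType d) (R : realType) (m : {measure set T -> \bar R}).
Implicit Types (D : set T).

(** The integral of a nonnegative function is a supremum over simple functions below it, which makes
    sense without measurability. A simple function below [f], cut to the complement of the null set,
    lies below [g] and has the same integral. Thus integrals such as [L2dot] depend only on classes,
    whatever representative is chosen. *)
Lemma ge0_le_integral_ae_nonmeasurable (f g : T -> \bar R) :
  (forall x, 0 <= f x)%E -> (forall x, 0 <= g x)%E ->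
  {ae m, forall x, f x = g x} -> (\int[m]_x f x <= \int[m]_x g x)%E.
Proof.
move=> f0 g0 [Z [mZ Z0 fgZ]].
have mZc : measurable (~` Z) by exact: measurableC.
rewrite ge0_integralTE//; apply: ge_ereal_sup => _ [h /= hf <-].
rewrite -integralT_nnsfun (ge0_negligible_integral mZ)//; last 2 first.
  exact/measurable_EFinP.
  by move=> x _; rewrite lee_fin; exact: fun_ge0.
rewrite setTD integral_mkcond ge0_integralTE; last first.
  by move=> x; rewrite patchE; case: ifP => // _; rewrite lee_fin; exact: fun_ge0.
rewrite ge0_integralTE//; apply: ereal_sup_le => _ [k /= kh <-].
exists k => //= x.
apply: (le_trans (kh x)); rewrite patchE; case: ifPn => //.
rewrite inE => nZ.
have : f x = g x by apply: contrapT => fg; apply: nZ; exact: fgZ.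
by move=> <-.
Qed.

Lemma integral_ae_eq_nonmeasurable D (f g : T -> \bar R) :
  {ae m, forall x, D x -> f x = g x} ->
  (\int[m]_(x in D) f x = \int[m]_(x in D) g x)%E.
Proof.
move=> fg; rewrite integralE [RHS]integralE.
suff H (a b : T -> \bar R) : (forall x, 0 <= a x)%E -> (forall x, 0 <= b x)%E ->
    {ae m, forall x, D x -> a x = b x} ->
    (\int[m]_(x in D) a x = \int[m]_(x in D) b x)%E.
  have [fp fn] := (ae_eq_funeposneg m D f g).1 fg.
  by congr (_ - _)%E; apply: H => // x; rewrite ?funepos_ge0 ?funeneg_ge0.
move=> a0 b0 ab; rewrite integral_mkcond [RHS]integral_mkcond.
have a0' x : (0 <= (a \_ D) x)%E by rewrite patchE; case: ifP.
have b0' x : (0 <= (b \_ D) x)%E by rewrite patchE; case: ifP.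
apply/eqP; rewrite eq_le; apply/andP; split;
  apply: ge0_le_integral_ae_nonmeasurable => //;
  apply: filterS ab => x h; rewrite !patchE; case: ifPn => //; rewrite inE => Dx.
- exact: h.
- by rewrite h.
Qed.

Lemma Rintegral_ae_eq D (f g : T -> R) :
  {ae m, forall x, D x -> f x = g x} ->
  \int[m]_(x in D) f x = \int[m]_(x in D) g x.
Proof.
move=> fg; rewrite /Rintegral; congr fine; apply: integral_ae_eq_nonmeasurable.
by apply: filterS fg => x h Dx; rewrite h.
Qed.

End null_change.

Lemma Rintegral_dominated_convergence d (T : measurableType d) (R : realType)
    (m : {measure set T -> \bar R}) (D : set T) (f : nat -> T -> R) (F G : T -> R) :
  measurable D -> (forall n, measurable_fun D (f n)) -> measurable_fun D F ->
  {ae m, forall x, D x -> f n x @[n --> \oo] --> F x} ->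
  m.-integrable D (EFin \o G) -> (forall n x, D x -> `|f n x| <= G x) ->
  \int[m]_(x in D) f n x @[n --> \oo] --> \int[m]_(x in D) F x.
Proof.
move=> mD mf mF fF iG fG.
have ae1 : {ae m, forall x, D x -> EFin \o f^~ x @ \oo --> (F x)%:E}.
  apply: filterS fF => x h Dx; apply: cvg_EFin; first exact: nearW.
  exact: h.
have ae2 : {ae m, forall x n, D x -> (`|(f n x)%:E| <= (G x)%:E)%E}.
  by apply: aeW => x n Dx /=; rewrite lee_fin fG.
have [iF _ H] := dominated_convergence mD
  (fun n => (measurable_EFinP _ _).2 (mf n)) ((measurable_EFinP _ _).2 mF) ae1 iG ae2.
have FE : (\int[m]_(x in D) F x)%:E = (\int[m]_(x in D) (F x)%:E)%E.
  by rewrite /Rintegral fineK//; exact: integrable_fin_num.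
by rewrite -FE in H; have /fine_cvgP[] := H.
Qed.

(** * L^2 over a measurable set: Cauchy-Schwarz, Fatou, Riesz-Fischer *)

Section square_integrable.
Context d (T : measurableType d) (R : realType) (m : {measure set T -> \bar R}).
Variables (D : set T) (mD : measurable D).
Implicit Types (f g h : T -> R).

Definition sqint f :=
  measurable_fun D f /\ (\int[m]_(x in D) ((f x) ^+ 2)%:E < +oo)%E.

Definition dot f g := \int[m]_(x in D) (f x * g x).

Lemma dotC f g : dot f g = dot g f.
Proof. by apply: eq_Rintegral => x _; rewrite mulrC. Qed.

Lemma sqint_sq_integrable f : sqint f -> m.-integrable D (EFin \o (fun x => f x ^+ 2)).
Proof.
move=> [mf foo]; apply/integrableP; split.
  by apply/measurable_EFinP; exact: measurable_funX.
by under eq_integral do rewrite /= ger0_norm ?sqr_ge0//.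
Qed.

Lemma sqint_mul_integrable f g : sqint f -> sqint g ->
  m.-integrable D (EFin \o (fun x => f x * g x)).
Proof.
move=> sf sg; have := integrableD mD (sqint_sq_integrable sf) (sqint_sq_integrable sg).
apply: le_integrable => //.
  by apply/measurable_EFinP; apply: measurable_funM; [exact: sf.1|exact: sg.1].
move=> x Dx; rewrite /= lee_fin [leRHS]ger0_norm ?addr_ge0 ?sqr_ge0//.
rewrite ler_norml; apply/andP; split.
  by have := sqr_ge0 (f x + g x); have := sqr_ge0 (f x); have := sqr_ge0 (g x); nra.
by have := sqr_ge0 (f x - g x); have := sqr_ge0 (f x); have := sqr_ge0 (g x); nra.
Qed.

Lemma sqint_le f g c : measurable_fun D f -> (forall x, D x -> f x ^+ 2 <= c * g x ^+ 2) ->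
  sqint g -> sqint f.
Proof.
move=> mf fg sg; split => //.
have ig : m.-integrable D (EFin \o (fun x => c * g x ^+ 2)).
  by have := integrableZl mD c (sqint_sq_integrable sg); apply: eq_integrable.
have /integrableP[_] : m.-integrable D (EFin \o (fun x => f x ^+ 2)).
  apply: le_integrable ig => //.
    by apply/measurable_EFinP; exact: measurable_funX.
  move=> x Dx /=; rewrite lee_fin ger0_norm ?sqr_ge0//.
  by apply: le_trans (ler_norm _); exact: fg.
by under eq_integral do rewrite /= ger0_norm ?sqr_ge0//.
Qed.

Lemma sqintZ a f : sqint f -> sqint (fun x => a * f x).
Proof.
move=> sf; apply: (@sqint_le _ f (a ^+ 2)) => //; last by move=> x _; rewrite exprMn.
by apply: measurable_funM => //; exact: sf.1.
Qed.

Lemma sqintD f g : sqint f -> sqint g -> sqint (fun x => f x + g x).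
Proof.
move=> sf sg; split; first by apply: measurable_funD; [exact: sf.1|exact: sg.1].
have ig : m.-integrable D (EFin \o (fun x => 2 * (f x ^+ 2 + g x ^+ 2))).
  have := integrableZl mD 2 (integrableD mD (sqint_sq_integrable sf) (sqint_sq_integrable sg)).
  by apply: eq_integrable => // x _.
have /integrableP[_] : m.-integrable D (EFin \o (fun x => (f x + g x) ^+ 2)).
  apply: le_integrable ig => //.
    apply/measurable_EFinP; apply: measurable_funX; apply: measurable_funD;
    [exact: sf.1|exact: sg.1].
  move=> x Dx /=; rewrite lee_fin ger0_norm ?sqr_ge0//.
  apply: le_trans (ler_norm _); have := sqr_ge0 (f x - g x); nra.
by under eq_integral do rewrite /= ger0_norm ?sqr_ge0//.
Qed.

Lemma sqintB f g : sqint f -> sqint g -> sqint (fun x => f x - g x).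
Proof.
move=> sf sg; have -> : (fun x => f x - g x) = (fun x => f x + (-1) * g x).
  by apply/funext => x; rewrite mulN1r.
by apply: sqintD => //; exact: sqintZ.
Qed.

Lemma sqint0 : sqint (fun=> 0).
Proof.
split; first exact: measurable_cst.
by under eq_integral do rewrite expr0n/=; rewrite integral0.
Qed.

Lemma sqint_bounded f c : measurable_fun D f -> (m D < +oo)%E ->
  (forall x, D x -> `|f x| <= c) -> sqint f.
Proof.
move=> mf moo fc; split => //.
have [->|/set0P[y Dy]] := eqVneq D set0; first by rewrite integral_set0.
have c0 : 0 <= c by rewrite (le_trans _ (fc y Dy)).
apply: (@le_lt_trans _ _ (\int[m]_(x in D) (cst (c ^+ 2)%:E) x)%E).
  apply: ge0_le_integral => //.
  - by move=> x _; rewrite lee_fin sqr_ge0.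
  - by apply/measurable_EFinP; exact: measurable_funX.
  - move=> x Dx; rewrite lee_fin -real_normK ?num_real// ler_sqr ?nnegrE//.
    exact: fc.
by rewrite integral_cst// lte_mul_pinfty// lee_fin sqr_ge0.
Qed.

Lemma dotDl f g h : sqint f -> sqint g -> sqint h ->
  dot (fun x => f x + g x) h = dot f h + dot g h.
Proof.
move=> sf sg sh; rewrite /dot -RintegralD//; try exact: sqint_mul_integrable.
by apply: eq_Rintegral => x _; rewrite mulrDl.
Qed.

Lemma dotZl a f g : sqint f -> sqint g -> dot (fun x => a * f x) g = a * dot f g.
Proof.
move=> sf sg; rewrite /dot -RintegralZl//; last exact: sqint_mul_integrable.
by apply: eq_Rintegral => x _; rewrite mulrA.
Qed.

Lemma dotBl f g h : sqint f -> sqint g -> sqint h ->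
  dot (fun x => f x - g x) h = dot f h - dot g h.
Proof.
move=> sf sg sh; rewrite /dot -RintegralB//; try exact: sqint_mul_integrable.
by apply: eq_Rintegral => x _; rewrite mulrBl.
Qed.

Lemma dotDr f g h : sqint f -> sqint g -> sqint h ->
  dot h (fun x => f x + g x) = dot h f + dot h g.
Proof. by move=> *; rewrite dotC dotDl// dotC (dotC g). Qed.

Lemma dotBr f g h : sqint f -> sqint g -> sqint h ->
  dot h (fun x => f x - g x) = dot h f - dot h g.
Proof. by move=> *; rewrite dotC dotBl// dotC (dotC g). Qed.

Lemma dotZr a f g : sqint f -> sqint g -> dot g (fun x => a * f x) = a * dot g f.
Proof. by move=> *; rewrite dotC dotZl// dotC. Qed.

Lemma dot_ge0 f : 0 <= dot f f.
Proof. by apply: Rintegral_ge0 => x _; rewrite -expr2 sqr_ge0. Qed.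

Lemma sqint_dotE f : sqint f -> (\int[m]_(x in D) ((f x) ^+ 2)%:E = (dot f f)%:E)%E.
Proof.
move=> sf; rewrite /dot /Rintegral fineK.
  by apply: eq_integral => x _; rewrite expr2.
have := integrable_fin_num mD (sqint_mul_integrable sf sf).
by under eq_integral do rewrite /=.
Qed.

Lemma dot_sub_self f g : sqint f -> sqint g ->
  dot (fun x => f x - g x) (fun x => f x - g x) = dot f f - 2 * dot f g + dot g g.
Proof.
move=> sf sg; have sfg := sqintB sf sg.
by rewrite dotBl// !dotBr// (dotC g f); ring.
Qed.

Lemma dot_CS f g : sqint f -> sqint g -> dot f g ^+ 2 <= dot f f * dot g g.
Proof.
move=> sf sg.
have H t : 0 <= dot f f - 2 * t * dot f g + t ^+ 2 * dot g g.
  have := dot_ge0 (fun x => f x - t * g x).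
  rewrite dot_sub_self//; last exact: sqintZ.
  by rewrite dotZr// dotZl ?dotZr//; [nra|exact: sqintZ].
have [g0|g0] := eqVneq (dot g g) 0.
  have [->|ne] := eqVneq (dot f g) 0; first by rewrite g0; nra.
  (* With [dot g g = 0] the quadratic is affine in [t], and this [t] would give it the value -1. *)
  have := H ((dot f f + 1) / (2 * dot f g)); rewrite g0.
  have -> : 2 * ((dot f f + 1) / (2 * dot f g)) * dot f g = dot f f + 1 by field.
  by nra.
have gp : 0 < dot g g by rewrite lt_neqAle eq_sym g0 dot_ge0.
have := H (dot f g / dot g g).
have -> : dot f f - 2 * (dot f g / dot g g) * dot f g + (dot f g / dot g g) ^+ 2 * dot g g
   = (dot f f * dot g g - dot f g ^+ 2) / dot g g by field.
by rewrite pmulr_lge0 ?invr_gt0// subr_ge0.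
Qed.

Lemma dot_CS_sqrt f g : sqint f -> sqint g ->
  `|dot f g| <= Num.sqrt (dot f f) * Num.sqrt (dot g g).
Proof.
move=> sf sg; rewrite -sqrtrM ?dot_ge0// -[leLHS]ger0_norm// -sqrtr_sqr ler_wsqrtr//.
by rewrite real_normK ?num_real//; exact: dot_CS.
Qed.

Lemma dot_young f g : sqint f -> sqint g -> 2 * `|dot f g| <= dot f f + dot g g.
Proof.
move=> sf sg; have := dot_CS sf sg; have := dot_ge0 f; have := dot_ge0 g.
move=> g0 f0 h; rewrite -(@ler_pXn2r _ 2)// ?nnegrE ?addr_ge0 ?mulr_ge0//.
rewrite exprMn real_normK ?num_real//.
by have := sqr_ge0 (dot f f - dot g g); nra.
Qed.

Lemma dot_add_self_le f g : sqint f -> sqint g ->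
  dot (fun x => f x + g x) (fun x => f x + g x) <= 2 * (dot f f + dot g g).
Proof.
move=> sf sg; have sfg := sqintD sf sg.
rewrite dotDl// !dotDr// (dotC g f); have := dot_young sf sg.
by have := ler_norm (dot f g); lra.
Qed.

Lemma dot_ae_eq f g f' g' : {ae m, forall x, D x -> f x = f' x} ->
  {ae m, forall x, D x -> g x = g' x} -> dot f g = dot f' g'.
Proof.
move=> ff gg; apply: Rintegral_ae_eq.
by apply: filterS2 ff gg => x h1 h2 Dx; rewrite h1 ?h2.
Qed.

Lemma dot_self_eq0 f : sqint f -> dot f f = 0 -> {ae m, forall x, D x -> f x = 0}.
Proof.
move=> sf f0; have := sqint_dotE sf; rewrite f0 => h.
have mf : measurable_fun D (EFin \o (fun x => f x ^+ 2)).
  by apply/measurable_EFinP; apply: measurable_funX; exact: sf.1.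
have : (\int[m]_(x in D) `|((f x ^+ 2)%R)%:E|)%E = 0%E.
  by rewrite -[RHS]h; apply: eq_integral => x _; rewrite /= ger0_norm// sqr_ge0.
move/(ae_eq_integral_abs m mD mf); apply: filterS => x h' Dx.
by have [] := h' Dx; move/eqP; rewrite sqrf_eq0 => /eqP.
Qed.

Lemma le_dot_self f g (c : R) : 0 <= c -> sqint f -> sqint g ->
  (forall x, D x -> f x ^+ 2 <= c * g x ^+ 2) -> dot f f <= c * dot g g.
Proof.
move=> c0 sf sg fg; rewrite -lee_fin EFinM -!sqint_dotE//.
rewrite -ge0_integralZl_EFin//; last 2 first.
- by move=> x _; rewrite lee_fin sqr_ge0.
- by apply/measurable_EFinP; apply: measurable_funX; exact: sg.1.
- under [leRHS]eq_integral do rewrite -EFinM.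
  apply: ge0_le_integral => //.
  + by move=> x _; rewrite lee_fin sqr_ge0.
  + by apply/measurable_EFinP; apply: measurable_funX; exact: sf.1.
  + apply/measurable_EFinP; apply: measurable_funM => //.
    by apply: measurable_funX; exact: sg.1.
Qed.

Lemma sqint_ae_eq f g : measure_is_complete m ->
  {ae m, forall x, D x -> f x = g x} -> sqint f -> sqint g.
Proof.
move=> mc fg [mf foo]; split.
  apply/measurable_EFinP; apply: (ae_measurable_fun mc (f := EFin \o f)).
    by apply: filterS fg => x h Dx /=; rewrite h.
  exact/measurable_EFinP.
rewrite (_ : integral _ _ _ = (\int[m]_(x in D) ((f x) ^+ 2)%:E)%E)//.
by apply: integral_ae_eq_nonmeasurable; apply: filterS fg => x h Dx; rewrite h.
Qed.

(** A Borel-Cantelli argument: the sum of the [f n] has finite integral, so it is finite almost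
    everywhere, and the tails of a finite sum tend to 0. *)
Lemma ae_cvg0_summable (f : nat -> T -> \bar R) :
  (forall n, measurable_fun D (f n)) -> (forall n x, 0 <= f n x)%E ->
  (\sum_(n <oo) \int[m]_(x in D) f n x < +oo)%E ->
  {ae m, forall x, D x -> exists n0, forall n, (n0 <= n)%N -> (f n x < 1)%E}.
Proof.
move=> mf f0 foo.
have ie : m.-integrable D (fun x => \sum_(n <oo) f n x)%E.
  apply/integrableP; split.
    by apply: ge0_emeasurable_sum => // k x _ _; exact: f0.
  under eq_integral do rewrite gee0_abs ?nneseries_ge0//.
  by rewrite integral_nneseries.
have := integrable_ae mD ie; apply: filterS => x h Dx.
have /fin_numPlt/andP[_ h'] := h Dx.
have := nneseries_tail_cvg h' (fun k _ => f0 k x).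
move=> /fine_cvgP[_ /cvgrPdist_lt/(_ _ ltr01)].
move=> /= [n0 _ Hn].
have tf : \forall k \near \oo, (\sum_(k <= n <oo) f n x)%E \is a fin_num.
  near=> k; rewrite ge0_fin_numE ?nneseries_ge0//.
  apply: le_lt_trans h'; rewrite [leRHS](nneseries_split _ k)//= leeDr//.
  by rewrite sume_ge0.
exists n0 => n nn.
have := Hn n nn; rewrite /= sub0r normrN.
have h2 : ((\sum_(n <= k <oo) f k x) < +oo)%E.
  apply: le_lt_trans h'; rewrite [leRHS](nneseries_split _ n)//= leeDr//.
  by rewrite sume_ge0.
rewrite ger0_norm ?fine_ge0 ?nneseries_ge0// => lt1.
apply: le_lt_trans (_ : ((\sum_(n <= k <oo) f k x) < 1)%E).
  rewrite (nneseries_split _ 1)//= addn1 big_nat1.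
  by rewrite leeDl// nneseries_ge0.
by rewrite -[ltLHS]fineK ?ge0_fin_numE ?nneseries_ge0// lte_fin.
Unshelve. all: by end_near. Qed.

(** Fatou's lemma for the squares. It also yields the square integrability of the limit, which later
    puts limits of functions of [V] back into [V]. *)
Lemma dot_le_liminf (f : nat -> T -> R) g c :
  (forall n, sqint (f n)) -> measurable_fun D g ->
  {ae m, forall x, D x -> f n x @[n --> \oo] --> g x} ->
  (\forall n \near \oo, dot (f n) (f n) <= c) ->
  sqint g /\ dot g g <= c.
Proof.
move=> sf mg fg fc.
have H : (\int[m]_(x in D) ((g x) ^+ 2)%:E <= c%:E)%E.
  rewrite (@integral_ae_eq_nonmeasurable _ _ _ _ _ _
    (fun x => limn_einf (fun n => ((f n x) ^+ 2)%:E))); last first.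
    apply: filterS fg => x h Dx; apply/esym.
    have cg : ((f n x) ^+ 2)%:E @[n --> \oo] --> ((g x) ^+ 2)%:E.
      apply: cvg_EFin; first exact: nearW.
      by rewrite [X in X @ _ --> _]/comp/=; under eq_fun do rewrite expr2; rewrite expr2; apply: cvgM; exact: h.
    by rewrite (cvg_limn_einf_sup cg).1.
  apply: le_trans (fatou m mD _ _) _.
  - by move=> n; apply/measurable_EFinP; apply: measurable_funX; exact: (sf n).1.
  - by move=> n x _; rewrite lee_fin sqr_ge0.
  under eq_fun do rewrite sqint_dotE//.
  rewrite limn_einf_lim; apply: lime_le; first exact: is_cvg_einfs.
  near=> n. apply: le_trans (_ : ((dot (f n) (f n))%:E <= _)%E).
    by apply: ereal_inf_lbound => /=; exists n => //=.
  by rewrite lee_fin; near: n.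
have sg : sqint g by split => //; apply: le_lt_trans H _; rewrite ltry.
by split => //; rewrite -lee_fin -sqint_dotE.
Unshelve. all: by end_near. Qed.

(** The functions [4 ^ n * h n ^ 2] have integrals at most [c * 2^-n], hence are summable and
    eventually below 1. The rate [8^-n] is chosen so that it still decays after this weight [4 ^ n];
    it recurs wherever a fast sequence is needed. *)
Lemma ae_small_of_fast (h : nat -> T -> R) (c : R) : (forall n, sqint (h n)) ->
  (forall n, dot (h n) (h n) <= c * (8%:R^-1) ^+ n) ->
  {ae m, forall x, D x -> exists n0, forall n, (n0 <= n)%N -> `|h n x| <= (2^-1) ^+ n}.
Proof.
move=> sh hc.
have mh n : measurable_fun D (fun x => (4 ^+ n * h n x ^+ 2)%:E).
  apply/measurable_EFinP; apply: measurable_funM => //.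
  by apply: measurable_funX; exact: (sh n).1.
have ih n : (\int[m]_(x in D) (4 ^+ n * h n x ^+ 2)%:E <= (c * 2^-1 ^+ n)%:E)%E.
  under eq_integral do rewrite EFinM.
  rewrite ge0_integralZl_EFin//; last 2 first.
  - by move=> x _; rewrite lee_fin sqr_ge0.
  - by apply/measurable_EFinP; apply: measurable_funX; exact: (sh n).1.
  rewrite sqint_dotE// -EFinM lee_fin.
  apply: le_trans (ler_wpM2l _ (hc n)) _; first by rewrite exprn_ge0.
  rewrite mulrCA -exprMn (_ : 4 * 8%:R^-1 = 2^-1 :> R)//.
  by field.
have h0 n x : (0 <= (4 ^+ n * h n x ^+ 2)%:E)%E.
  by rewrite lee_fin mulr_ge0 ?sqr_ge0// exprn_ge0.
have : (\sum_(n <oo) \int[m]_(x in D) (4 ^+ n * h n x ^+ 2)%:E < +oo)%E.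
  apply: (@le_lt_trans _ _ (\sum_(n <oo) (c * 2^-1 ^+ n)%:E)%E).
    by apply: lee_nneseries => n *; [apply: integral_ge0 => x _; exact: h0|exact: ih].
  have -> : (\sum_(n <oo) (c * 2^-1 ^+ n)%:E = (c * (1 - 2^-1)^-1)%:E)%E; last by rewrite ltry.
  apply/cvg_lim => //.
  have := @cvg_geometric_series R c 2^-1.
  have h12 : `|2^-1| < 1 :> R by rewrite ger0_norm ?invr_ge0// invf_lt1// ltr1n.
  move=> /(_ h12) H.
  rewrite (_ : (fun n => _) = (EFin \o series (geometric c 2^-1))); last first.
    by apply/funext => n /=; rewrite /series/= -sumEFin.
  by apply: cvg_EFin; [exact: nearW|exact: H].
move/(ae_cvg0_summable mh h0); apply: filterS => x hx Dx.
have [n0 Hn] := hx Dx; exists n0 => n nn; have := Hn n nn; rewrite lte_fin => {}Hn.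
rewrite -(@ler_pXn2r _ 2)// ?nnegrE ?exprn_ge0// real_normK ?num_real//.
rewrite -exprM mulnC exprM (_ : (2^-1) ^+ 2 = 4^-1 :> R); last by field.
by rewrite exprVn -[leRHS]mul1r ler_pdivlMr ?exprn_gt0// mulrC ltW.
Qed.

Lemma riesz_fischer_fast (f : nat -> T -> R) : (forall n, sqint (f n)) ->
  (forall n, dot (fun x => f n.+1 x - f n x) (fun x => f n.+1 x - f n x) <= (8%:R^-1) ^+ n) ->
  exists g, [/\ sqint g, {ae m, forall x, D x -> f n x @[n --> \oo] --> g x} &
    forall n, dot (fun x => f n x - g x) (fun x => f n x - g x) <= 4 * (8%:R^-1) ^+ n].
Proof.
move=> sf fast.
have := @ae_small_of_fast (fun n x => f n.+1 x - f n x) 1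
  (fun n => sqintB (sf n.+1) (sf n)).
move=> /(_ _)[n|Z [mZ Z0 ZP]]; first by rewrite mul1r.
have cvx x : D x -> ~ Z x -> cvgn (fun n => f n x).
  move=> Dx nZ; have [n0 Hn] : exists n0, forall n, (n0 <= n)%N ->
      `|f n.+1 x - f n x| <= (2^-1) ^+ n.
    by apply: contrapT => h; apply: nZ; apply: ZP => /= /(_ Dx).
  have cs : cvgn (series (fun k => f (k + n0).+1 x - f (k + n0)%N x)).
    apply: normed_cvg; apply: (@series_le_cvg _ _ (geometric 1 2^-1)).
    - by move=> n /=.
    - by move=> n; rewrite /= mul1r exprn_ge0.
    - move=> n /=; rewrite mul1r; apply: le_trans (Hn _ (leq_addl _ _)) _.
      by rewrite exprD ler_piMr ?exprn_ge0// exprn_ile1// invf_le1// ler1n.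
    - by apply: is_cvg_geometric_series; rewrite ger0_norm ?invr_ge0// invf_lt1// ltr1n.
  apply/cvg_ex; exists (f n0 x + limn (series (fun k => f (k + n0).+1 x - f (k + n0)%N x))).
  rewrite -(cvg_shiftn n0).
  rewrite (_ : (fun n => f (n + n0)%N x) = (fun n => f n0 x +
     series (fun k => f (k + n0).+1 x - f (k + n0)%N x) n)); last first.
    apply/funext; elim => [|n ih]; first by rewrite /series/= big_geq// addr0.
    by rewrite /series/= big_nat_recr//= addrA -[X in X + _]ih addSn addrC subrK.
  by apply: cvgD; [exact: cvg_cst|exact: cs].
(* Setting the sequence to 0 on the null set makes it converge at every point of [D], so that its
   limit is measurable. *)
pose h n x := f n x * \1_(~` Z) x.
pose g x := limn (h ^~ x).
have hg x : D x -> h n x @[n --> \oo] --> g x.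
  move=> Dx; apply/cvg_ex; rewrite /h indicE; have [Zx|Zx] := boolP (x \in ~` Z); last first.
    by exists 0; under eq_fun do rewrite mulr0; exact: cvg_cst.
  rewrite inE in Zx; have /cvg_ex[l ll] := cvx x Dx Zx; exists l.
  by under eq_fun do rewrite mulr1.
have mg : measurable_fun D g.
  apply: (measurable_fun_cvg (h := h)) => // n; apply: measurable_funM; first exact: (sf n).1.
  by apply: measurable_indic; exact: measurableC.
have fg : {ae m, forall x, D x -> f n x @[n --> \oo] --> g x}.
  exists Z; split => // x /= hx; apply: contrapT => nZ; apply: hx => Dx.
  have := hg x Dx; rewrite /h indicE mem_set//=.
  by under eq_fun do rewrite mulr1.
have ffs n k : sqint (fun x => f n x - f k x) by exact: sqintB.
(* The induction closes because [2 * (4 / 8 + 1) = 3] is at most 4. *)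
have tail k n : dot (fun x => f (n + k)%N x - f n x) (fun x => f (n + k)%N x - f n x)
    <= 4 * (8%:R^-1) ^+ n.
  elim: k n => [|k ih] n.
    rewrite addn0 (_ : dot _ _ = 0) ?mulr_ge0 ?exprn_ge0//.
    rewrite /dot; under eq_Rintegral do rewrite subrr mul0r.
    by rewrite /Rintegral integral0.
  have -> : (fun x => f (n + k.+1)%N x - f n x) =
      (fun x => (f (n.+1 + k)%N x - f n.+1 x) + (f n.+1 x - f n x)).
    by apply/funext => x; rewrite addrA subrK addSnnS.
  apply: le_trans (dot_add_self_le (ffs _ _) (ffs _ _)) _.
  have := ih n.+1; have := fast n; rewrite exprS.
  by have : 0 <= 8%:R^-1 ^+ n :> R; [rewrite exprn_ge0|lra].
have gf n : sqint (fun x => g x - f n x) /\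
   dot (fun x => g x - f n x) (fun x => g x - f n x) <= 4 * (8%:R^-1) ^+ n.
  apply: (@dot_le_liminf (fun k x => f (n + k)%N x - f n x)) => //.
  - by apply: measurable_funB => //; exact: (sf n).1.
  - apply: filterS fg => x hx Dx; apply: cvgB; last exact: cvg_cst.
    by have := hx Dx; rewrite -(cvg_shiftn n); under eq_fun do rewrite addnC.
  - by near=> k; exact: tail.
exists g; split => //.
  have := sqintD (gf 0%N).1 (sf 0%N); congr sqint.
  by apply/funext => x; rewrite subrK.
move=> n; apply: le_trans (gf n).2; rewrite le_eqVlt; apply/orP; left; apply/eqP.
by apply: eq_Rintegral => x _; ring.
Unshelve. all: by end_near. Qed.

Lemma fast_subsequence (f : nat -> T -> R) g :
  (forall e, 0 < e -> exists n0, forall n, (n0 <= n)%N ->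
     dot (fun x => f n x - g x) (fun x => f n x - g x) <= e) ->
  exists phi : nat -> nat, (forall n, (n <= phi n)%N) /\ forall n,
     dot (fun x => f (phi n) x - g x) (fun x => f (phi n) x - g x) <= (8%:R^-1) ^+ n.
Proof.
move=> fg.
have /choice[phi Hphi] n : exists k, (n <= k)%N /\
    dot (fun x => f k x - g x) (fun x => f k x - g x) <= (8%:R^-1) ^+ n.
  have [|n0 H] := fg ((8%:R^-1) ^+ n); first by rewrite exprn_gt0// invr_gt0.
  by exists (maxn n n0); split; [exact: leq_maxl|apply: H; exact: leq_maxr].
by exists phi; split => n; have [] := Hphi n.
Qed.

Lemma riesz_fischer (f : nat -> T -> R) : (forall n, sqint (f n)) ->
  (forall e, 0 < e -> exists n0, forall n k, (n0 <= n)%N -> (n0 <= k)%N ->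
     dot (fun x => f n x - f k x) (fun x => f n x - f k x) <= e) ->
  exists g, sqint g /\ forall e, 0 < e -> exists n0, forall n, (n0 <= n)%N ->
     dot (fun x => f n x - g x) (fun x => f n x - g x) <= e.
Proof.
move=> sf cf.
have /choice[N HN] n : exists n0, forall k l, (n0 <= k)%N -> (n0 <= l)%N ->
    dot (fun x => f k x - f l x) (fun x => f k x - f l x) <= (8%:R^-1) ^+ n.
  by apply: cf; rewrite exprn_gt0// invr_gt0.
(* Summation makes [phi k] exceed [N n] for every [n <= k], and also [k] itself. *)
pose phi n := (\sum_(i < n.+1) (N i + i))%N.
have Nphi n k : (n <= k)%N -> (N n <= phi k)%N.
  move=> nk; rewrite /phi (bigD1 (Ordinal (nk : (n < k.+1)%N)))//= -addnA.
  exact: leq_addr.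
have phin n : (n <= phi n)%N by rewrite /phi big_ord_recr/= addnA leq_addl.
have [|g [sg _ gP]] := @riesz_fischer_fast (fun n => f (phi n)) (fun n => sf (phi n)).
  by move=> n; apply: HN; apply: Nphi.
exists g; split => // e e0.
have e4 : 0 < e / 4 by rewrite divr_gt0.
have [n0 Hn0] := cf _ e4.
have : (8%:R^-1) ^+ n @[n --> \oo] --> (0 : R).
  by apply: cvg_expr; rewrite ger0_norm// invf_lt1// ltr1n.
(* The rate of the subsequence is [4 * 8^-n], so [8^-n < e / 16] gives [e / 4]; two such errors add
   up to [2 * (e / 4 + e / 4) = e]. *)
move=> /cvgrPdist_lt/(_ (e / 16)); rewrite divr_gt0// => /(_ isT)[n1 _ H1].
exists n0 => n nn.
pose k2 := maxn n1 n0.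
have Hk2 : dot (fun x => f (phi k2) x - g x) (fun x => f (phi k2) x - g x) <= e / 4.
  have := H1 k2 (leq_maxl _ _); rewrite /= sub0r normrN ger0_norm ?exprn_ge0// => h.
  by apply: le_trans (gP k2) _; lra.
have Hk3 : dot (fun x => f n x - f (phi k2) x) (fun x => f n x - f (phi k2) x) <= e / 4.
  by apply: Hn0 => //; rewrite (leq_trans (leq_maxr n1 n0))// phin.
have -> : (fun x => f n x - g x) = (fun x => (f n x - f (phi k2) x) + (f (phi k2) x - g x)).
  by apply/funext => x; rewrite addrA subrK.
by apply: le_trans (dot_add_self_le (sqintB _ _) (sqintB _ _)) _ => //; lra.
Qed.

Definition cvg2 (f : nat -> T -> R) (g : T -> R) : Prop :=
  dot (fun x => f n x - g x) (fun x => f n x - g x) @[n --> \oo] --> (0 : R).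

Lemma cvg2_dot (f : nat -> T -> R) g h : (forall n, sqint (f n)) -> sqint g -> sqint h ->
  cvg2 f g -> dot (f n) h @[n --> \oo] --> dot g h.
Proof.
move=> sf sg sh fg; apply/cvgrPdist_le => e e0.
have h0 : 0 < dot h h + 1 by rewrite ltr_wpDl// dot_ge0.
have e1 : 0 < e ^+ 2 / (dot h h + 1) by rewrite divr_gt0// exprn_gt0.
move/cvgr0Pnorm_le : fg => /(_ _ e1); apply: filterS => n.
rewrite ger0_norm ?dot_ge0// ler_pdivlMr// => H.
rewrite distrC -dotBl//; have := dot_CS (sqintB (sf n) sg) sh => C.
rewrite -(@ler_pXn2r _ 2)// ?nnegrE ?(ltW e0)// real_normK ?num_real//.
apply: le_trans C (le_trans _ H); rewrite ler_wpM2l ?dot_ge0//.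
by rewrite lerDl.
Qed.

Lemma cvg2_ae_subseq (f : nat -> T -> R) g : (forall n, sqint (f n)) -> sqint g -> cvg2 f g ->
  exists phi : nat -> nat, (forall n, (n <= phi n)%N) /\
    {ae m, forall x, D x -> f (phi n) x @[n --> \oo] --> g x}.
Proof.
move=> sf sg fg.
have [e e0|phi [phin Hphi]] := @fast_subsequence f g.
  move/cvgr0Pnorm_le : fg => /(_ _ e0)[n0 _ H]; exists n0 => n nn.
  by have := H n nn; rewrite /= ger0_norm ?dot_ge0.
exists phi; split => //.
have := @ae_small_of_fast (fun n x => f (phi n) x - g x) 1 (fun n => sqintB (sf _) sg).
move=> /(_ (fun n => _)) H.
have {}H := H (fun n => le_trans (Hphi n) _).
apply: filterS (H _) => [x hx Dx|n]; last by rewrite mul1r.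
have [n0 Hn] := hx Dx; apply/cvgrPdist_le => e e0.
have : (2^-1) ^+ n @[n --> \oo] --> (0 : R).
  by apply: cvg_expr; rewrite ger0_norm// invf_lt1// ltr1n.
move=> /cvgrPdist_lt/(_ e e0)[n1 _ H1]; exists (maxn n0 n1) => // n /=.
rewrite geq_max => /andP[n0n n1n]; rewrite distrC (le_trans (Hn _ n0n))//.
by have := H1 n n1n; rewrite /= sub0r normrN ger0_norm ?exprn_ge0//; exact: ltW.
Qed.

End square_integrable.

(** * Lebesgue measure on R^N *)

Section measure_preserving.
Context d (T : measurableType d) (R : realType) (m : {measure set T -> \bar R}).
Variables (phi : T -> T) (mphi : measurable_fun setT phi).
Hypothesis phim : forall A, measurable A -> m (phi @^-1` A) = m A.

Lemma measure_preserving_integrable (f : T -> \bar R) :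
  m.-integrable setT f -> m.-integrable setT (f \o phi).
Proof.
move=> /integrableP[mf foo]; apply/integrableP; split; first exact: measurableT_comp.
have maf : measurable_fun setT (abse \o f) by exact: measurableT_comp.
have := @ge0_integral_pushforward _ _ _ _ _ phi mphi m setT (abse \o f) measurableT maf.
rewrite preimage_setT => /= <- //.
by rewrite (eq_measure_integral m)// => A mA _; exact: phim.
Qed.

Lemma measure_preserving_integral (f : T -> \bar R) : m.-integrable setT f ->
  (\int[m]_x f (phi x) = \int[m]_x f x)%E.
Proof.
move=> intf; have := @integral_pushforward _ _ _ _ _ phi mphi m setT f.
rewrite preimage_setT => <- //.
- by rewrite (eq_measure_integral m)// => A mA _; exact: phim.
- exact: (measurable_int _ intf).
- exact: measure_preserving_integrable.
Qed.

End measure_preserving.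

(** * Lebesgue measure: open sets, outer regularity, translation invariance *)

Section lebesgue_RN.
Context {R : realType} {N : nat}.
Local Notation RN := 'rV[R]_N.
Local Notation cara := (caratheodory_type (@lebesgue_outer R N)).
Implicit Types (A X : set RN).

Lemma le_box_volume A B : A `<=` B -> (box_volume A <= box_volume B :> \bar R)%E.
Proof.
move=> AB; have [->|A0] := eqVneq A set0; first by rewrite box_volume0 box_volume_ge0.
rewrite /box_volume !asboolF; last 2 first.
- by move=> B0; move/eqP : A0; apply; apply/seteqP; split => // x /AB; rewrite B0.
- exact/eqP.
apply: le_ereal_inf_tmp => _ [p [/= p12 Bp] <-].
by apply: ereal_inf_lbound; exists p => //; split => //; exact: subset_trans Bp.
Qed.

Lemma box_volume_le_prod A (p : RN * RN) : (forall i, p.1 0 i <= p.2 0 i) ->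
  A `<=` box p.1 p.2 -> (box_volume A <= (\prod_(i < N) (p.2 0 i - p.1 0 i))%:E)%E.
Proof.
move=> p12 Ap; rewrite /box_volume; case: ifPn => [_|_].
  by rewrite lee_fin prodr_ge0// => i _; rewrite subr_ge0.
by apply: ereal_inf_lbound; exists p.
Qed.

Lemma box_volume_halfspace A (i : 'I_N) (a : R) :
  (box_volume (A `&` [set x | (x 0 i < a)%R]) + box_volume (A `&` ~` [set x | (x 0 i < a)%R])
   <= box_volume A)%E.
Proof.
(* If [A] lies on one side of the hyperplane nothing is cut. Otherwise a point on each side shows
   that [a] lies between [x_i] and [y_i]; then the two half boxes are nondegenerate, and the lengths
   of their [i]-th sides add up to the original one. *)
have [H0|/set0P[z [Az /= za]]] := eqVneq (A `&` [set x | x 0 i < a]) set0.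
  by rewrite H0 box_volume0 add0e; exact: le_box_volume.
have [H0|/set0P[w [Aw /= /negP]]] := eqVneq (A `&` ~` [set x | x 0 i < a]) set0.
  by rewrite H0 box_volume0 adde0; exact: le_box_volume.
rewrite -leNgt => aw.
rewrite {3}/box_volume asboolF; last by move=> A0; rewrite A0 in Az.
apply: le_ereal_inf_tmp => _ [[x y] [/= xy Axy] <-].
have /andP[xz _] := Axy _ Az i; have /andP[_ wy] := Axy _ Aw i.
have xa := le_lt_trans xz za; have ay := le_trans aw wy.
pose y' : RN := \row_j if j == i then a else y 0 j.
pose x' : RN := \row_j if j == i then a else x 0 j.
have H1 : (box_volume (A `&` [set x0 | (x0 0 i < a)%R]) <=
    (\prod_(j < N) (y' 0 j - x 0 j))%:E)%E.
  apply: (@box_volume_le_prod _ (x, y')) => [j|v [Av /= va] j] /=.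
    by rewrite mxE; case: eqP => // ->; exact: ltW.
  rewrite mxE; have /andP[-> vy] := Axy _ Av j; rewrite /=.
  by case: eqP => // ->; exact: ltW.
have H2 : (box_volume (A `&` ~` [set x0 | (x0 0 i < a)%R]) <=
    (\prod_(j < N) (y 0 j - x' 0 j))%:E)%E.
  apply: (@box_volume_le_prod _ (x', y)) => [j|v [Av /= /negP]] /=.
    by rewrite mxE; case: eqP => // ->.
  rewrite -leNgt => va j; rewrite mxE; have /andP[xv ->] := Axy _ Av j.
  by rewrite andbT; case: eqP => // ->.
apply: le_trans (leeD H1 H2) _; rewrite -EFinD lee_fin.
rewrite (bigD1 i)//= [X in _ + X](bigD1 i)//= [leRHS](bigD1 i)//= !mxE eqxx.
rewrite (eq_bigr (fun j => y 0 j - x 0 j)); last first.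
  by move=> j ji; rewrite mxE (negbTE ji).
rewrite [X in _ + _ * X](eq_bigr (fun j => y 0 j - x 0 j)); last first.
  by move=> j ji; rewrite mxE (negbTE ji).
by rewrite -mulrDl le_eqVlt; apply/orP; left; apply/eqP; congr (_ * _); ring.
Qed.

(** Cutting every set of a cover along the hyperplane does not increase the total box volume, and
    this is Caratheodory's criterion. *)
Lemma leb_halfspace (i : 'I_N) (a : R) :
  measurable ([set x | x 0 i < a] : set cara).
Proof.
apply: le_caratheodory_measurable => X.
rewrite /= [leRHS]/lebesgue_outer; apply: le_ereal_inf_tmp => _ [A /= XA <-].
set H := [set x : RN | x 0 i < a].
apply: (@le_trans _ _ (\sum_(k <oo) box_volume (A k `&` H) +
                       \sum_(k <oo) box_volume (A k `&` ~` H))%E).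
  apply: leeD; apply: ereal_inf_lbound.
  - by exists (fun k => A k `&` H) => //= x [/XA[k _ Ax] Hx]; exists k.
  - by exists (fun k => A k `&` ~` H) => //= x [/XA[k _ Ax] Hx]; exists k.
rewrite -nneseriesD; try by move=> *; exact: box_volume_ge0.
apply: lee_nneseries => k *; last exact: box_volume_halfspace.
by rewrite adde_ge0// box_volume_ge0.
Qed.

Lemma leb_coord_measurable (i : 'I_N) : measurable_fun setT (fun x : cara => (x : RN) 0 i : R).
Proof.
apply: (measurability _ (RGenInftyO.measurableE R)) => // _ [_ [a ->] <-].
rewrite setTI (_ : _ @^-1` _ = [set x : cara | (x : RN) 0 i < a]).
  exact: leb_halfspace.
by apply/seteqP; split=> x /=; rewrite in_itv.
Qed.

Definition obox (p q : RN) : set RN := [set z | forall i, p 0 i < z 0 i < q 0 i].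

Lemma obox_measurable p q : measurable (obox p q : set cara).
Proof.
rewrite (_ : obox p q = \bigcap_(i in [set: 'I_N])
   ((fun x : cara => (x : RN) 0 i) @^-1` `]p 0 i, q 0 i[)).
  apply: fin_bigcap_measurable => // i _; rewrite -[X in measurable X]setTI.
  exact: leb_coord_measurable.
by apply/seteqP; split=> [z zpq i _|z zpq i] /=; [rewrite in_itv/=|have := zpq i I; rewrite /= in_itv/=].
Qed.

(** The norm of [RN] is the sup norm, so balls are boxes and rational endpoints fit inside them. The
    countability of the family is the point: it gives the measurability of open sets here, and the
    sigma-finiteness of [mu] on [Gamma] later. *)
Lemma open_obox_rat (O : set RN) : open O ->
  O = \bigcup_(pq in [set pq : 'rV[rat]_N * 'rV[rat]_N |
     obox (map_mx ratr pq.1) (map_mx ratr pq.2) `<=` O])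
      obox (map_mx ratr pq.1) (map_mx ratr pq.2).
Proof.
move=> oO; apply/seteqP; split=> [x Ox|x [pq /= pqO /pqO//]].
have /nbhs_ballP[e /= e0 eO] : nbhs x O by exact: open_nbhs_nbhs.
have /choice[p Hp] i : exists p : rat, x 0 i - e < ratr p < x 0 i.
  have [|p Hp] := @rat_in_itvoo R (x 0 i - e) (x 0 i); first by rewrite ltrBlDr ltrDl.
  by exists p; rewrite in_itv/= in Hp.
have /choice[q Hq] i : exists q : rat, x 0 i < ratr q < x 0 i + e.
  have [|q Hq] := @rat_in_itvoo R (x 0 i) (x 0 i + e); first by rewrite ltrDl.
  by exists q; rewrite in_itv/= in Hq.
exists (\row_i p i, \row_i q i) => /=.
- move=> z Hz; apply: eO; rewrite -ball_normE/= /ball_.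
  rewrite (_ : `|x - z| = mx_norm (x - z))// mx_normrE.
  apply: bigmax_lt => // -[j i] _ /=; rewrite ord1 !mxE.
  have := Hz i; rewrite !mxE => /andP[h1 h2].
  have /andP[h3 _] := Hp i; have /andP[_ h4] := Hq i.
  rewrite ltr_norml; apply/andP; split; lra.
- move=> i; rewrite !mxE; have /andP[_ ->] := Hp i.
  by have /andP[-> _] := Hq i.
Qed.

Lemma leb_open_measurable (O : set RN) : open O -> measurable (O : set cara).
Proof.
move=> oO; rewrite (open_obox_rat oO) bigcup_mkcond.
apply: countable_bigcupT_measurable => [|pq]; first exact: countableP.
by case: ifP => // _; exact: obox_measurable.
Qed.

Lemma obox_open p q : open (obox p q).
Proof.
rewrite openE => z zpq.
have H : \forall y \near z, forall i, p 0 i < (y : RN) 0 i < q 0 i; last exact: H.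
apply: (@filter_forall RN 'I_N (fun i y => p 0 i < (y : RN) 0 i < q 0 i) (nbhs (z : RN))) => i.
have /andP[pz zq] := zpq i; near=> y; apply/andP; split; near: y.
- exact: (cvgr_gt _ (@coord_continuous R 1 N 0 i z)).
- exact: (cvgr_lt _ (@coord_continuous R 1 N 0 i z)).
Unshelve. all: by end_near. Qed.

Lemma box_volume_open_cover A (d : R) : 0 < d -> (box_volume A < +oo)%E ->
  exists O : set RN, [/\ open O, A `<=` O & (box_volume O <= box_volume A + d%:E)%E].
Proof.
move=> d0 Aoo; have [->|/eqP A0] := eqVneq A set0.
  by exists set0; rewrite box_volume0 add0e lee_fin (ltW d0); split => //; exact: open0.
have d20 : 0 < d / 2 by rewrite divr_gt0.
have Afin : box_volume A \is a fin_num by rewrite ge0_fin_numE// box_volume_ge0.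
have [v [[p [/= p12 Ap] <-]]] : exists v, [set (\prod_(i < N) (p.2 0 i - p.1 0 i))%:E | p in
    [set p : 'rV[R]_N * 'rV[R]_N |
      (forall i, p.1 0 i <= p.2 0 i) /\ A `<=` box p.1 p.2]] v /\ (v < box_volume A + (d / 2)%:E)%E.
  rewrite /box_volume asboolF// in Afin *.
  by have [v Hv vlt] := lb_ereal_inf_adherent d20 Afin; exists v.
move=> plt.
(* The volume of the box enlarged by [x] on every side is a polynomial in [x]; its continuity at 0
   makes the cost of a small enlargement as small as desired. *)
pose P : {poly R} := \prod_(i < N) ((p.2 0 i - p.1 0 i)%:P + 2 *: 'X).
have PE x : P.[x] = \prod_(i < N) (p.2 0 i - p.1 0 i + 2 * x).
  by rewrite /P horner_prod; apply: eq_bigr => i _; rewrite !hornerE.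
have := @continuous_horner R P 0 => /cvgrPdist_lt/(_ _ d20)/nbhs_ballP[e /= e0 He].
pose x := e / 2.
have x0 : 0 < x by rewrite divr_gt0.
have /ltW : `|P.[0] - P.[x]| < d / 2.
  by apply: He; rewrite -ball_normE/= sub0r normrN gtr0_norm// /x; lra.
rewrite !PE ler_distlC => /andP[_ Px].

exists (obox (\row_i (p.1 0 i - x)) (\row_i (p.2 0 i + x))); split.
- exact: obox_open.
- move=> z /Ap Hz i; have /andP[h1 h2] := Hz i; rewrite !mxE.
  by apply/andP; split; lra.
- apply: (@le_trans _ _ (\prod_(i < N) (p.2 0 i - p.1 0 i + 2 * x))%:E).
    have := @box_volume_le_prod (obox (\row_i (p.1 0 i - x)) (\row_i (p.2 0 i + x)))
      (\row_i (p.1 0 i - x), \row_i (p.2 0 i + x)).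
    under eq_bigr do rewrite !mxE.
    rewrite (eq_bigr (fun i => p.2 0 i - p.1 0 i + 2 * x)); last by move=> i _; ring.
    apply => [i|z Hz i] /=; first by rewrite !mxE; have := p12 i; lra.
    by have /andP[h1 h2] := Hz i; rewrite !ltW.
  apply: (@le_trans _ _ ((\prod_(i < N) (p.2 0 i - p.1 0 i) + d / 2)%:E)).
    rewrite lee_fin; apply: le_trans Px _.
    by rewrite le_eqVlt; apply/orP; left; apply/eqP; congr (_ + _); apply: eq_bigr => i _; rewrite mulr0 addr0.
  rewrite EFinD; apply: (@le_trans _ _ (box_volume A + (d / 2)%:E + (d / 2)%:E)%E).
    by apply: leeD => //; exact: ltW.
  by rewrite -addeA -EFinD -splitr.
Qed.

Lemma lebesgue_outer_le_series X (A : (set RN)^nat) : X `<=` \bigcup_k A k ->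
  (lebesgue_outer N X <= \sum_(k <oo) box_volume (A k))%E.
Proof. by move=> XA; apply: ereal_inf_lbound; exists A. Qed.

Lemma lebesgue_outer_le_box_volume X : (lebesgue_outer N X <= box_volume X)%E.
Proof.
apply: le_trans (@lebesgue_outer_le_series X (fun k => if k is 0%N then X else set0) _) _.
  by move=> x Xx; exists 0%N.
rewrite (nneseries_split _ 1)//; last by move=> *; exact: box_volume_ge0.
rewrite add0n big_nat1 eseries0 ?adde0// => -[|k]// _ _.
by rewrite box_volume0.
Qed.

Lemma lebesgue_outer_open_cover X (e : R) : 0 < e -> (lebesgue_outer N X < +oo)%E ->
  exists O : set RN, [/\ open O, X `<=` O & (lebesgue_outer N O <= lebesgue_outer N X + e%:E)%E].
Proof.
move=> e0 Xoo.
have e20 : 0 < e / 2 by rewrite divr_gt0.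
have Xfin : lebesgue_outer N X \is a fin_num.
  by rewrite ge0_fin_numE//; exact: outer_measure_ge0.
have [_ [A /= XA <-] Alt] := lb_ereal_inf_adherent e20 Xfin.
have Aoo k : (box_volume (A k) < +oo)%E.
  apply: (@le_lt_trans _ _ (\sum_(k <oo) box_volume (A k))%E).
    rewrite (nneseries_split _ k.+1); last by move=> *; exact: box_volume_ge0.
    rewrite add0n big_nat_recr//= -addeA addeCA leeDl// adde_ge0//.
      by apply: sume_ge0 => *; exact: box_volume_ge0.
    by apply: nneseries_ge0 => *; exact: box_volume_ge0.
  by apply: lt_trans Alt _; rewrite -/(lebesgue_outer N X) -(fineK Xfin) -EFinD ltry.
have ek k : 0 < e / 2 / (2 ^ k.+1)%:R by rewrite divr_gt0// ltr0n expn_gt0.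
have /choice[U HU] := (fun k => @box_volume_open_cover (A k) (e / 2 / (2 ^ k.+1)%:R) (ek k) (Aoo k)).
exists (\bigcup_k U k); split.
- by apply: bigcup_open => k _; have [] := HU k.
- by move=> x /XA[k _ Akx]; exists k => //; have [_ + _] := HU k; apply.
- apply: le_trans (lebesgue_outer_le_series (fun x h => h)) _.
  apply: (@le_trans _ _ (\sum_(k <oo) (box_volume (A k) + (e / 2 / (2 ^ k.+1)%:R)%:E))%E).
    by apply: lee_nneseries => [k *|k *]; [exact: box_volume_ge0|have [] := HU k].
  apply: le_trans (epsilon_trick _ _ _) _; [by move=> *; exact: box_volume_ge0|exact: ltW|].
  apply: (@le_trans _ _ (lebesgue_outer N X + (e / 2)%:E + (e / 2)%:E)%E).
    by apply: leeD => //; exact: ltW.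
  by rewrite -addeA -EFinD -splitr.
Qed.

Lemma coord_le_norm (x : RN) i : `|x 0 i| <= `|x|.
Proof.
rewrite [leRHS](_ : _ = mx_norm x)// mx_normrE.
exact: (le_bigmax_cond _ (fun ij => `|x ij.1 ij.2|) (j := (0, i))).
Qed.

Lemma lebesgue_outer_bounded A : bounded_set A -> (lebesgue_outer N A < +oo)%E.
Proof.
move=> [M0 [_ M0A]]; pose M := M0 + 1.
have AM x : A x -> `|x| <= M by move=> Ax; apply: M0A => //; rewrite /M ltrDl.
apply: le_lt_trans (lebesgue_outer_le_box_volume A) _.
have [->|/set0P[y Ay]] := eqVneq A set0; first by rewrite box_volume0.
have M00 : 0 <= M by rewrite (le_trans _ (AM _ Ay)).
apply: le_lt_trans (@box_volume_le_prod _ (const_mx (- M), const_mx M) _ _) _.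
- by move=> i /=; rewrite !mxE; lra.
- move=> x Ax i /=; rewrite !mxE -ler_norml; apply: le_trans (AM _ Ax).
  exact: coord_le_norm.
- by rewrite ltry.
Qed.

Lemma box_volume_shift_le (h : RN) A :
  (box_volume ((fun x => x + h)%R @^-1` A) <= box_volume A)%E.
Proof.
have [->|/eqP A0] := eqVneq A set0; first by rewrite preimage_set0 box_volume0.
rewrite [leRHS]/box_volume asboolF//.
apply: le_ereal_inf_tmp => _ [p [/= p12 Ap] <-].
apply: le_trans (@box_volume_le_prod _ (p.1 - h, p.2 - h) _ _) _.
- by move=> i /=; rewrite !mxE; have := p12 i; lra.
- move=> x /= /Ap Hx i /=; have := Hx i; rewrite !mxE => /andP[h1 h2].
  by apply/andP; split; lra.
- rewrite lee_fin le_eqVlt; apply/orP; left; apply/eqP.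
  by apply: eq_bigr => i _; rewrite /= !mxE; ring.
Qed.

Lemma lebesgue_outer_shift_le (h : RN) X :
  (lebesgue_outer N ((fun x => x + h)%R @^-1` X) <= lebesgue_outer N X)%E.
Proof.
rewrite [leRHS]/lebesgue_outer; apply: le_ereal_inf_tmp => _ [A /= XA <-].
apply: le_trans (@lebesgue_outer_le_series _ (fun k => (fun x => x + h)%R @^-1` A k) _) _.
  by move=> x /= /XA[k _ Ax]; exists k.
apply: lee_nneseries => *; [exact: box_volume_ge0|exact: box_volume_shift_le].
Qed.

Lemma lebesgue_outer_shift (h : RN) X :
  lebesgue_outer N ((fun x => x + h) @^-1` X) = lebesgue_outer N X.
Proof.
apply/eqP; rewrite eq_le lebesgue_outer_shift_le/=.
apply: le_trans (lebesgue_outer_shift_le (- h) _).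
rewrite -comp_preimage (_ : _ \o _ = id) ?preimage_id//.
by apply/funext => x /=; rewrite subrK.
Qed.

Lemma leb_shift_measurable (h : RN) :
  measurable_fun [set: cara] ((fun x : RN => x + h) : cara -> cara).
Proof.
move=> _ Y mY; rewrite setTI; move=> X; move: X.
suff H (X : set RN) : lebesgue_outer N X = (lebesgue_outer N (X `&` +%R^~ h @^-1` Y) +
  lebesgue_outer N (X `&` ~` (+%R^~ h @^-1` Y)))%E by exact: H.
have := mY ((fun x : RN => x - h) @^-1` X); rewrite /= lebesgue_outer_shift => ->.
rewrite -[in RHS](lebesgue_outer_shift (- h)) -[X in _ = _ + X](lebesgue_outer_shift (- h)).
congr (lebesgue_outer N _ + lebesgue_outer N _)%E;
  by apply/seteqP; split=> x /=; rewrite subrK.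
Qed.

Lemma Rintegral_shift (h : RN) (f : RN -> R) :
  (@leb R N).-integrable setT (EFin \o f) ->
  \int[leb N]_x f (x + h) = \int[leb N]_x f x.
Proof.
move=> intf; pose phi : cara -> cara := fun x : RN => x + h.
have mphi : measurable_fun setT phi by exact: leb_shift_measurable.
rewrite /Rintegral; congr fine.
apply: (measure_preserving_integral mphi _ intf) => A mA.
exact: (lebesgue_outer_shift h A).
Qed.

Lemma integrable_shift (h : RN) (f : RN -> R) :
  (@leb R N).-integrable setT (EFin \o f) ->
  (@leb R N).-integrable setT (EFin \o (fun x => f (x + h))).
Proof.
move=> intf; pose phi : cara -> cara := fun x : RN => x + h.
have mphi : measurable_fun setT phi by exact: leb_shift_measurable.
apply: (measure_preserving_integrable mphi _ intf) => A mA.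
exact: (lebesgue_outer_shift h A).
Qed.

End lebesgue_RN.

(** * Smooth steps in one variable *)

Section smooth_functions.
Context {R : realType}.
Implicit Types f g : R -> R.

(** Continuous differentiability up to order [n] with the derivative as a witness instead of
    [derive1 f]: closure under sums, products and inverses then follows from the rules for
    [is_derive]. *)
Fixpoint Cn (n : nat) f : Prop :=
  match n with
  | 0%N => continuous f
  | n'.+1 => exists f', (forall x : R, is_derive x 1 f (f' x)) /\ Cn n' f'
  end.

Definition smooth f := forall n, Cn n f.

Lemma is_derive_continuous f (f' : R -> R) :
  (forall x : R, is_derive x 1 f (f' x)) -> continuous f.
Proof.
move=> ff' x; have [df _] := ff' x.
by apply: differentiable_continuous; apply/derivable1_diffP.
Qed.

Lemma is_derive_derive1 f (f' : R -> R) :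
  (forall x : R, is_derive x 1 f (f' x)) -> derive1 f = f'.
Proof. by move=> ff'; apply/funext => x; rewrite derive1E; have [_ ->] := ff' x. Qed.

Lemma CnW n f : Cn n.+1 f -> Cn n f.
Proof.
elim: n f => [f [f' [ff' _]]|n ih f [f' [ff' Cf']]]; first exact: is_derive_continuous ff'.
by exists f'; split => //; exact: ih.
Qed.

Lemma Cn_cst n (c : R) : Cn n (fun=> c).
Proof.
elim: n c => [|n ih] c; first exact: cst_continuous.
by exists (fun=> 0); split => [x|]; [exact: is_derive_cst|exact: ih].
Qed.

Lemma Cn_add n f g : Cn n f -> Cn n g -> Cn n (fun x => f x + g x).
Proof.
elim: n f g => [f g cf cg x|n ih f g [f' [ff' cf]] [g' [gg' cg]]].
  exact: continuousD (cf x) (cg x).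
exists (fun x => f' x + g' x); split; last exact: ih.
by move=> x; apply: is_deriveD.
Qed.

Lemma Cn_mul n f g : Cn n f -> Cn n g -> Cn n (fun x => f x * g x).
Proof.
elim: n f g => [f g cf cg x|n ih f g Cf Cg].
  exact: continuousM (cf x) (cg x).
have [f' [ff' cf']] := Cf; have [g' [gg' cg']] := Cg.
exists (fun x => f x * g' x + g x * f' x); split.
  by move=> x; apply: is_deriveM.
by apply: Cn_add; apply: ih => //; exact: CnW.
Qed.

Lemma Cn_affine n f (a b : R) : Cn n f -> Cn n (fun x => f (a * x + b)).
Proof.
elim: n f => [f cf x|n ih f [f' [ff' cf']]].
  apply: (@continuous_comp _ _ _ (fun x => a * x + b) f) => //; last exact: cf.
  apply: continuousD; last exact: cst_continuous.
  by apply: continuousM; [exact: cst_continuous|exact: cvg_id].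
exists (fun x => f' (a * x + b) * a); split.
  move=> x; apply: (@is_derive1_comp _ f (fun x => a * x + b) x _ _ (ff' _)).
  have -> : a = a *: 1 + 0 by rewrite addr0 /GRing.scale/= mulr1.
  apply: is_deriveD; rewrite addr0 scaler1.
  by have := is_deriveZ a (is_derive_id x (1 : R)); rewrite /GRing.scale/= mulr1.
by apply: Cn_mul; [exact: ih|exact: Cn_cst].
Qed.

Lemma Cn_inv n f : (forall x, f x != 0) -> Cn n f -> Cn n (fun x => (f x)^-1).
Proof.
move=> f0; elim: n f f0 => [f f0 cf x|n ih f f0 Cf].
  by apply: continuousV => //; exact: cf.
have [f' [ff' cf']] := Cf.
exists (fun x => - 1 * ((f x)^-1 * (f x)^-1) * f' x); split.
  move=> x; have := is_deriveV (f0 x) (ff' x); congr is_derive.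
  by rewrite /GRing.scale/= -exprVn expr2; ring.
have Ci : Cn n (fun x => (f x)^-1) by apply: ih => //; exact: CnW.
by apply: Cn_mul => //; apply: Cn_mul; [exact: Cn_cst|exact: Cn_mul].
Qed.

Lemma smooth_derive1n f : smooth f ->
  forall n x, derivable (derive1n n f) x 1.
Proof.
move=> sf n; elim: n f sf => [|n ih] f sf x.
  by have [f' [ff' _]] := sf 1%N; have [] := ff' x.
rewrite derive1Sn; apply: ih => k.
by have [f' [ff' Cf']] := sf k.+1; rewrite (is_derive_derive1 ff').
Qed.

Lemma is_derive_quadratic_error f (x l C : R) :
  (forall h, `|h| <= 1 -> `|f (x + h) - f x - l * h| <= C * h ^+ 2) -> is_derive x 1 f l.
Proof.
move=> fC.
have C0 : 0 <= C.
  by have := le_trans (normr_ge0 _) (fC 1 _); rewrite normr1 expr1n mulr1; apply.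
have H : (fun h => h^-1 *: (f (h *: 1 + x) - f x)) @ 0^' --> l.
  apply/cvgrPdist_le => e e0; near=> h.
  have h0 : h != 0 by near: h; exact: nbhs_dnbhs_neq.
  have h1 : `|h| <= 1.
    by near: h; exact: dnbhs0_le.
  have h2 : `|h| <= e / (C + 1).
    by near: h; apply: dnbhs0_le; rewrite divr_gt0// ltr_wpDl.
  have := fC h h1; rewrite /GRing.scale/= mulr1 (addrC h x) => fh.
  have -> : l - h^-1 * (f (x + h) - f x) = - (h^-1 * (f (x + h) - f x - l * h)).
    by field.
  rewrite normrN normrM normfV ler_pdivrMl ?normr_gt0//.
  apply: le_trans fh _; rewrite -real_normK ?num_real// expr2 mulrA mulrC.
  apply: ler_wpM2l => //; rewrite ler_pdivlMr ?ltr_wpDl// in h2.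
  by have := normr_ge0 h; nra.
by apply: DeriveDef; [apply/cvg_ex; exists l; exact: H|exact: cvg_lim H].
Unshelve. all: by end_near. Qed.

(** Monomial by monomial: [y ^ i] is [i ^ i * (y / i) ^ i], and [y / i] is at most [expR (y / i)],
    whose [i]-th power is [expR y]. *)
Lemma poly_le_expR (p : {poly R}) : exists C, forall y, 0 <= y -> `|p.[y]| <= C * expR y.
Proof.
exists (\sum_(i < size p) (`|p`_i| * i%:R ^+ i)) => y y0.
rewrite horner_coef (le_trans (ler_norm_sum _ _ _))// mulr_suml.
apply: ler_sum => -[i /= _] _; rewrite normrM -mulrA ler_wpM2l// normrX ger0_norm//.
case: i => [|i]; first by rewrite !expr0 mul1r -(expR0) ler_expR.
have -> : y = (i.+1%:R * (y / i.+1%:R)) by rewrite mulrC divfK// pnatr_eq0.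
rewrite expRM_natl exprMn ler_wpM2l ?exprn_ge0//.
apply: lerXn2r; rewrite ?nnegrE ?expR_ge0 ?divr_ge0//.
by apply: le_trans (expR_ge1Dx _); rewrite lerDr.
Qed.

(** A family closed under differentiation: on the positive side the derivative of [p(1/x) exp(-1/x)]
    is of the same kind, with the polynomial [X^2 (p - p')]. Smoothness of the standard flat
    function, the case [p = 1], follows by induction. *)
Definition expinv (p : {poly R}) (x : R) : R :=
  if 0 < x then p.[x^-1] * expR (- x^-1) else 0.

Lemma expinv_is_derive (p : {poly R}) (x : R) :
  is_derive x 1 (expinv p) (expinv ('X^2 * (p - p^`()%R)) x).
Proof.
have [x0|x0|<-] := ltrgtP 0 x.
- have inv' : is_derive x 1 (fun y : R => y^-1) (- x ^- 2 *: 1).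
    by apply: (@is_deriveV R id x 1 1); rewrite ?gt_eqF//; exact: is_derive_id.
  have d1 : is_derive x 1 (horner p \o (fun y : R => y^-1)) (p^`()%R.[x^-1] * (- x ^- 2 *: 1)).
    have dp : is_derive (x^-1 : R) 1 (horner p) (p^`()%R.[x^-1]).
      by apply: DeriveDef; [exact: derivable_horner|rewrite -derive1E derivE].
    exact: (is_derive1_comp dp inv').
  have d2 : is_derive x 1 (expR \o (fun y : R => - y^-1)) (expR (- x^-1) * (- (- x ^- 2 *: 1))).
    by apply: is_derive1_comp; exact: is_deriveN.
  have := is_deriveM d1 d2 => d.
  apply: (near_eq_is_derive (f := (horner p \o (fun y : R => y^-1)) * (expR \o (fun y : R => - y^-1)))).
    by near=> y; rewrite /expinv ifT//; near: y; exact: (cvgr_gt _ (@cvg_id _ (nbhs x))).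
  have E : expinv ('X^2 * (p - p^`()%R)) x = (x ^- 2) * (p.[x^-1] - p^`()%R.[x^-1]) * expR (- x^-1).
    by rewrite /expinv x0 hornerM hornerXn hornerD hornerN exprVn.
  rewrite E; move: d; congr is_derive; rewrite /GRing.scale/=; ring.
- apply: (near_eq_is_derive (f := fun=> 0)).
    near=> y; rewrite /expinv ifF//; apply/negbTE; rewrite -leNgt ltW//.
    by near: y; exact: (cvgr_lt _ (@cvg_id _ (nbhs x))).
  have := is_derive_cst (0 : R) x (1 : R); congr is_derive.
  by rewrite /expinv ifF//; apply/negbTE; rewrite -leNgt ltW.
- rewrite [X in is_derive _ _ _ X]/expinv ltxx.
  (* At 0 the formula changes. With [y = 1 / h], the bound of [y ^ 2 * p(y)] by [C * expR y] says
     that [expinv p h] is at most [C * h ^ 2], hence the derivative is 0. *)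
  have [C HC] := poly_le_expR ('X^2 * p).
  have C0 : 0 <= C.
    by have := HC 0 (lexx _); rewrite expR0 mulr1; exact: le_trans.
  apply: (@is_derive_quadratic_error _ _ _ C) => h _.
  rewrite add0r mul0r /expinv ltxx !subr0; case: ifPn => [h0|_]; last first.
    by rewrite normr0 mulr_ge0// sqr_ge0.
  have := HC h^-1; rewrite invr_ge0 (ltW h0) => /(_ isT).
  rewrite hornerM hornerXn normrM normrX (ger0_norm (ltW _)) ?invr_gt0// => H.
  rewrite normrM (ger0_norm (expR_ge0 _)) expRN ler_pdivrMr ?expR_gt0//.
  move: H; rewrite exprVn mulrC ler_pdivrMr ?exprn_gt0// => H; apply: le_trans H _.
  by rewrite -mulrA (mulrC (expR _)) mulrA.
Unshelve. all: by end_near. Qed.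

Lemma expinv_smooth p : smooth (expinv p).
Proof.
move=> n; elim: n p => [|n ih] p.
  exact: is_derive_continuous (expinv_is_derive p).
exists (expinv ('X^2 * (p - p^`()%R))); split; last exact: ih.
exact: expinv_is_derive.
Qed.

Lemma expinv1_ge0 x : 0 <= expinv 1 x.
Proof. by rewrite /expinv; case: ifP => // _; rewrite hornerE mul1r expR_ge0. Qed.

Lemma expinv1_gt0 x : 0 < x -> 0 < expinv 1 x.
Proof. by rewrite /expinv => ->; rewrite hornerE mul1r expR_gt0. Qed.

(** The standard smooth transition from 0 to 1 on [[0, 1]]; [1 - x] is written as in [Cn_affine]. *)
Definition smooth_step (x : R) : R := expinv 1 x * (expinv 1 x + expinv 1 ((- 1) * x + 1))^-1.

Lemma smooth_step_den x : 0 < expinv 1 x + expinv 1 (-1 * x + 1).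
Proof.
have [x0|x0] := ltP 0 x; first by rewrite ltr_pwDl ?expinv1_ge0 ?expinv1_gt0.
by rewrite ltr_wpDl ?expinv1_ge0// expinv1_gt0//; lra.
Qed.

Lemma smooth_step_smooth : smooth smooth_step.
Proof.
move=> n; apply: Cn_mul; first exact: expinv_smooth.
apply: Cn_inv => [x|]; first by rewrite gt_eqF// smooth_step_den.
apply: Cn_add; first exact: expinv_smooth.
by apply: Cn_affine; exact: expinv_smooth.
Qed.

Lemma smooth_step_ge0 x : 0 <= smooth_step x.
Proof. by rewrite mulr_ge0 ?expinv1_ge0// invr_ge0 ltW// smooth_step_den. Qed.

Lemma smooth_step_le1 x : smooth_step x <= 1.
Proof.
rewrite ler_pdivrMr ?smooth_step_den// mul1r lerDl expinv1_ge0//.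
Qed.

Lemma smooth_step0 x : x <= 0 -> smooth_step x = 0.
Proof. by move=> x0; rewrite /smooth_step {1}/expinv ltNge x0/= mul0r. Qed.

Lemma smooth_step1 x : 1 <= x -> smooth_step x = 1.
Proof.
move=> x1; have E0 : expinv 1 (-1 * x + 1) = 0.
  by rewrite /expinv ifF//; apply/negbTE; rewrite -leNgt; lra.
by have := smooth_step_den x; rewrite /smooth_step E0 addr0 => /lt0r_neq0 ?; rewrite divff.
Qed.

(** A bump supported in [[-1, 1]]. As a difference of consecutive steps, its integer translates
    telescope, and finitely many of them sum to 1 on a given bounded interval: a smooth partition of
    unity. *)
Definition smooth_tent (x : R) : R := smooth_step (x + 1) - smooth_step x.

Lemma smooth_tent_smooth : smooth smooth_tent.
Proof.
move=> n; rewrite (_ : smooth_tent = fun x => smooth_step (1 * x + 1) + (-1) * smooth_step (1 * x + 0)).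
  apply: Cn_add; first exact: Cn_affine (smooth_step_smooth n).
  by apply: Cn_mul; [exact: Cn_cst|exact: Cn_affine (smooth_step_smooth n)].
by apply/funext => x; rewrite mulN1r !mul1r addr0.
Qed.

Lemma smooth_tent_ge0 x : 0 <= smooth_tent x.
Proof.
rewrite /smooth_tent subr_ge0; have [x0|x0] := leP x 0.
  by rewrite (smooth_step0 x0) smooth_step_ge0.
by rewrite (@smooth_step1 (x + 1)) ?smooth_step_le1//; lra.
Qed.

Lemma smooth_tent_eq0 x : 1 <= `|x| -> smooth_tent x = 0.
Proof.
rewrite /smooth_tent ler_normr => /orP[x1|x1].
  by rewrite !smooth_step1 ?subrr//; lra.
by rewrite !smooth_step0 ?subrr//; lra.
Qed.

Lemma smooth_tent_sum (M : nat) x :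
  \sum_(j < M.*2.+1) smooth_tent (x + M%:R - j%:R) =
  smooth_step (x + M%:R + 1) - smooth_step (x - M%:R).
Proof.
have H k : \sum_(j < k.+1) smooth_tent (x + M%:R - j%:R) =
    smooth_step (x + M%:R + 1) - smooth_step (x + M%:R - k%:R).
  elim: k => [|k ih]; first by rewrite big_ord1 /smooth_tent subr0.
  rewrite big_ord_recr/= ih /smooth_tent.
  have -> : x + M%:R - k.+1%:R + 1 = x + M%:R - k%:R by rewrite -natr1; ring.
  by rewrite addrA subrK.
rewrite H; congr (_ - smooth_step _).
by rewrite -addnn natrD; ring.
Qed.

End smooth_functions.

(** * Density of test functions *)

Lemma continuous_distP {R : realType} {N : nat} (f : 'rV[R]_N -> R) (x : 'rV[R]_N) :
  {for x, continuous f} <->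
  forall e : R, 0 < e -> exists2 d : R, 0 < d & forall y, `|x - y| < d -> `|f x - f y| < e.
Proof.
split=> [cf e e0|H].
  have := cf; rewrite /continuous_at => /cvgrPdist_lt/(_ e e0)/nbhs_ballP[d /= d0 Hd].
  by exists d => // y xy; apply: Hd; rewrite -ball_normE.
move=> A /nbhs_ballP[e /= e0 eA]; have [d d0 Hd] := H e e0.
suff : nbhs (x : 'rV[R]_N) (f @^-1` A) by [].
apply/nbhs_ballP; exists d => // y; rewrite -ball_normE => xy.
by apply: eA; rewrite -ball_normE; exact: Hd.
Qed.

(** * Distance to the complement and inner sets *)

Section distance_to_complement.
Context {R : realType} {N : nat}.
Local Notation RN := 'rV[R]_N.
Implicit Types (O K : set RN) (x y : RN).

(* The cut-off at 1 keeps the infimum over a nonempty set when O is everything. *)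
Definition distc O x : R := inf ([set `|x - y| | y in ~` O] `|` [set 1]).

Let distc_set_lb O x : has_inf ([set `|x - y| | y in ~` O] `|` [set (1 : R)]).
Proof.
split; first by exists 1; right.
by exists 0 => _ [[y _ <-]|->].
Qed.

Lemma distc_ge0 O x : 0 <= distc O x.
Proof. by apply: lb_le_inf; [exists 1; right|move=> _ [[y _ <-]|->]]. Qed.

Lemma distc_le O x y : ~ O y -> distc O x <= `|x - y|.
Proof. by move=> Oy; apply: ge_inf; [exact: (distc_set_lb O x).2|left; exists y]. Qed.

Lemma distc_le1 O x : distc O x <= 1.
Proof. by apply: ge_inf; [exact: (distc_set_lb O x).2|right]. Qed.

Lemma distc_lip O x y : distc O x <= `|x - y| + distc O y.
Proof.
rewrite -lerBlDl; apply: lb_le_inf; first by exists 1; right.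
move=> _ [[z Oz <-]|->]; last by rewrite lerBlDl (le_trans (distc_le1 _ _))// lerDr.
rewrite lerBlDl (le_trans (distc_le x Oz))//.
by rewrite -[x - z](subrKA y) ler_normD.
Qed.

Lemma distc_gt0 O x : open O -> O x -> 0 < distc O x.
Proof.
move=> oO Ox.
have /nbhs_ballP[e /= e0 eO] : nbhs x O by exact: open_nbhs_nbhs.
apply: (@lt_le_trans _ _ (Num.min e 1)); first by rewrite lt_min e0/=.
apply: lb_le_inf; first by exists 1; right.
move=> _ [[y Oy <-]|->]; last by rewrite ge_min lexx orbT.
rewrite ge_min leNgt; apply/orP; left; apply/negP => xy; apply: Oy; apply: eO.
by rewrite -ball_normE.
Qed.

Lemma distc_gt0_in O x : 0 < distc O x -> O x.
Proof.
move=> d0; apply: contrapT => Ox; have := distc_le x Ox.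
by rewrite subrr normr0 leNgt d0.
Qed.

Lemma distc_mono O O' x : O `<=` O' -> distc O x <= distc O' x.
Proof.
move=> OO; apply: lb_le_inf; first by exists 1; right.
move=> _ [[y Oy <-]|->]; last exact: distc_le1.
by apply: distc_le => /OO.
Qed.

Lemma distc_continuous O : continuous (distc O).
Proof.
move=> x; apply/continuous_distP => e e0; exists e => // y xy.
rewrite ltr_distl; have := distc_lip O x y; have := distc_lip O y x.
by rewrite distrC => h1 h2; apply/andP; split; lra.
Qed.

Definition inner O (c : R) : set RN := [set x | c <= distc O x].

Lemma inner_sub O c : 0 < c -> inner O c `<=` O.
Proof. by move=> c0 x cx; apply: distc_gt0_in; exact: lt_le_trans cx. Qed.

Lemma inner_compact O c : bounded_set O -> 0 < c -> compact (inner O c).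
Proof.
move=> [M [Mr MO]] c0; apply: bounded_closed_compact.
  by exists M; split => // x Mx y /(inner_sub c0) Oy; exact: MO.
rewrite (_ : inner O c = distc O @^-1` [set r | c <= r])//.
by apply: closed_comp => [x _|]; [exact: distc_continuous|exact: closed_ge].
Qed.

Lemma compact_inner O K : open O -> compact K -> K `<=` O ->
  exists c : R, 0 < c /\ K `<=` inner O c.
Proof.
move=> oO cK KO; have [->|K0] := eqVneq K set0; first by exists 1; split.
have cd : {within K, continuous (distc O)}.
  by apply: continuous_subspaceT; exact: distc_continuous.
have [|y Ky ymin] := compact_EVT_min _ cK cd; first exact/set0P.
exists (distc O y); split => [|x Kx]; first by apply: distc_gt0 => //; exact/KO/set_mem.
exact: ymin (mem_set Kx).
Qed.

Lemma inner_shift O c e x y : inner O c x -> `|x - y| <= e -> inner O (c - e) y.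
Proof. by rewrite /inner/= => h1 h2; have := distc_lip O x y; lra. Qed.

Lemma compact_support_unif_continuous K (chi : RN -> R) : compact K ->
  continuous chi -> (forall x, ~ K x -> chi x = 0) ->
  forall e : R, 0 < e -> exists2 d : R, 0 < d & forall x y, `|x - y| < d -> `|chi x - chi y| <= e.
Proof.
move=> /compact_near_coveringP cK cc c0 e e0.
pose P (d : R) (x : RN) := forall y, `|x - y| < d -> `|chi x - chi y| <= e.
have [d Pd] : exists d, 0 < d /\ K `<=` P d.
  have : \forall d \near 0^'+, K `<=` P d.
    apply: cK => x Kx.
    have := cc x; move=> /cvgrPdist_lt/(_ (e / 2)).
    rewrite divr_gt0// => /(_ isT)/nbhs_ballP[r /= r0 Hr].
    have r20 : 0 < r / 2 by rewrite divr_gt0.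
    exists (ball x (r / 2), [set d | d < r / 2]).
      split => /=; first exact: nbhsx_ballx.
      by apply: nbhs_right_lt.
    move=> [z d] [/= xz dr] y zy.
    rewrite -ball_normE/= in xz.
    have xz' : ball x r z by rewrite -ball_normE/=; lra.
    have xy' : ball x r y.
      rewrite -ball_normE/=; have := ler_distD z x y; lra.
    have := Hr _ xz'; have := Hr _ xy'; rewrite /= => h1 h2.
    by have := ler_distD (chi x) (chi z) (chi y); rewrite (distrC (chi z) (chi x)); lra.
  move=> H; have : \forall d \near 0^'+, 0 < d /\ K `<=` P d.
    near=> d; split; last by near: d.
    by near: d; exact: nbhs_right_gt.
  by move=> /filter_ex[d Hd]; exists d.
exists d => [|x y xy]; first exact: Pd.1.
have [Kx|Kx] := pselect (K x); first exact: Pd.2.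
have [Ky|Ky] := pselect (K y); first by rewrite distrC; apply: Pd.2; rewrite // distrC.
by rewrite !c0// subrr normr0 ltW.
Unshelve. all: by end_near. Qed.

End distance_to_complement.

(** * Smooth product functions and approximation by test functions *)

Section test_functions.
Context {R : realType} {N : nat}.
Local Notation RN := 'rV[R]_N.

Definition prodfun (b : 'I_N -> R -> R) (x : RN) : R := \prod_(i < N) b i (x 0 i).

Lemma prodfun_continuous b : (forall i, continuous (b i)) -> continuous (prodfun b).
Proof.
move=> cb; rewrite /prodfun; elim: (index_enum _) => [|i r ih].
  by under eq_fun do rewrite big_nil; move=> x; exact: cst_continuous.
under eq_fun do rewrite big_cons; move=> x; apply: continuousM; last exact: ih.
apply: (@continuous_comp _ _ _ (fun y : RN => y 0 i) (b i)); last exact: cb.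
exact: coord_continuous.
Qed.

Lemma is_derive_prodfun b (j : 'I_N) (b' : R -> R) (x : RN) :
  is_derive (x 0 j : R) 1 (b j) (b' (x 0 j)) ->
  is_derive x (evec j) (prodfun b) (prodfun (fun i => if i == j then b' else b i) x).
Proof.
move=> [db vb].
pose P := \prod_(i < N | i != j) b i (x 0 i).
have H : (fun h => h^-1 *: (prodfun b (h *: evec j + x) - prodfun b x)) =
    (fun h => P * (h^-1 *: (b j (h *: 1 + x 0 j) - b j (x 0 j)))).
  apply/funext => h; rewrite /prodfun (bigD1 j)//= [X in _ - X](bigD1 j)//=.
  rewrite !mxE !eqxx mulr1 (eq_bigr (fun i => b i (x 0 i))); last first.
    by move=> i ij; rewrite !mxE (negbTE ij) andbF mulr0 add0r.
  by rewrite -/P /GRing.scale/= mulr1; ring.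
have V : prodfun (fun i => if i == j then b' else b i) x = P * b' (x 0 j).
  rewrite /prodfun (bigD1 j)//= eqxx mulrC; congr (_ * _).
  by apply: eq_bigr => i /negbTE ->.
have C : (fun h => h^-1 *: (prodfun b (h *: evec j + x) - prodfun b x)) @ 0^' -->
   P * b' (x 0 j).
  rewrite H; apply: cvgM; first exact: cvg_cst.
  by rewrite -vb; exact: db.
by apply: DeriveDef; [apply/cvg_ex; exists (P * b' (x 0 j))|rewrite V; exact: cvg_lim C].
Qed.

Lemma prodfun_Ck k b : (forall i, smooth (b i)) -> Ck k (prodfun b).
Proof.
elim: k b => [|k ih] b sb; first by apply: prodfun_continuous => i; exact: sb i 0%N.
split; first by apply: prodfun_continuous => i; exact: sb i 0%N.
move=> j.
have [b' Hb'] : exists b', smooth b' /\ forall x : R, is_derive x 1 (b j) (b' x).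
  have [b' [bb' _]] := sb j 1%N; exists b'; split => // n.
  have [b'' [bb'' Cb'']] := sb j n.+1.
  by rewrite -(is_derive_derive1 bb') (is_derive_derive1 bb'').
have D x := is_derive_prodfun (x := x) (Hb'.2 (x 0 j)).
split; first by move=> x; have [] := D x.
rewrite (_ : 'D_(evec j) (prodfun b) = prodfun (fun i => if i == j then b' else b i)).
  by apply: ih => i; case: ifP => // _; exact: Hb'.1.
by apply/funext => x; have [_ ->] := D x.
Qed.

Lemma Ck_continuous k (f : RN -> R) : Ck k f -> continuous f.
Proof. by case: k => // k []. Qed.

Lemma Ck_add k (f g : RN -> R) : Ck k f -> Ck k g -> Ck k (fun x => f x + g x).
Proof.
elim: k f g => [f g cf cg x|k ih f g [cf Df] [cg Dg]]; first exact: continuousD (cf x) (cg x).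
split=> [x|i]; first exact: continuousD (cf x) (cg x).
split; first by move=> x; apply: derivableD; [exact: (Df i).1|exact: (Dg i).1].
rewrite (_ : 'D_(evec i) _ = fun x => 'D_(evec i) f x + 'D_(evec i) g x).
  by apply: ih; [exact: (Df i).2|exact: (Dg i).2].
by apply/funext => x; rewrite -deriveD//; [exact: (Df i).1|exact: (Dg i).1].
Qed.

Lemma Ck_scale k (c : R) (f : RN -> R) : Ck k f -> Ck k (fun x => c * f x).
Proof.
elim: k f => [f cf x|k ih f [cf Df]]; first by apply: continuousM; [exact: cst_continuous|exact: cf].
split=> [x|i]; first by apply: continuousM; [exact: cst_continuous|exact: cf].
split; first by move=> x; apply: (@derivableZ _ _ _ f c); exact: (Df i).1.
rewrite (_ : 'D_(evec i) _ = fun x => c * 'D_(evec i) f x).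
  by apply: ih; exact: (Df i).2.
by apply/funext => x; rewrite -[RHS](@deriveZ _ _ _ f c)//; exact: (Df i).1.
Qed.

Lemma Ck0 k : Ck k (fun _ : RN => 0 : R).
Proof.
elim: k => [|k ih]; first by move=> x; exact: cst_continuous.
split=> [x|i]; first exact: cst_continuous.
split; first by move=> x; exact: derivable_cst.
rewrite (_ : 'D_(evec i) _ = fun=> 0)//.
by apply/funext => x; rewrite derive_cst.
Qed.

Lemma Ck_sum k (I : Type) (r : seq I) (F : I -> RN -> R) :
  (forall i, Ck k (F i)) -> Ck k (fun x => \sum_(i <- r) F i x).
Proof.
move=> CF; elim: r => [|i r ih].
  by under eq_fun do rewrite big_nil; exact: Ck0.
by under eq_fun do rewrite big_cons; exact: Ck_add.
Qed.

(** Interpolation of [chi] on a grid by the products of smooth tents: on [Om], [phi x] is a weighted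
    average of values of [chi] at nodes within the mesh size of [x]. The smooth approximation is
    thus a finite sum and involves no convolution. The loss of margin from [c + c] to [c] leaves
    room for the supports of the tents. *)
Lemma test_fun_dense (Om : set RN) (c : R) (chi : RN -> R) : bounded_set Om -> 0 < c ->
  continuous chi -> (forall x, ~ inner Om (c + c) x -> chi x = 0) ->
  forall e : R, 0 < e -> exists phi, [/\ test_fun Om phi,
    forall x, ~ inner Om c x -> phi x = 0 & forall x, `|chi x - phi x| <= e].
Proof.
move=> bOm c0 cchi chi0 e e0.
have cc0 : 0 < c + c by rewrite addr_gt0.
have [d d0 Hd] := compact_support_unif_continuous (inner_compact bOm cc0) cchi chi0 e0.
(* The mesh is below the modulus of uniform continuity, for the error, and at most [c], for the
   support. *)
pose dl := Num.min (d / 2) c.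
have dl0 : 0 < dl by rewrite lt_min divr_gt0.
have dld : dl < d by rewrite gt_min; apply/orP; left; lra.
have dlc : dl <= c by rewrite ge_min lexx orbT.
have [M HM] : exists M : nat, forall x, Om x -> forall i, `|dl^-1 * x 0 i| <= M%:R.
  have [M0 [_ M0A]] := bOm; pose M1 : R := `|M0| + 1.
  have AM x : Om x -> `|x| <= M1.
    by move=> Ax; apply: M0A => //; rewrite /M1; have := ler_norm M0; lra.
  exists (Num.bound (dl^-1 * M1)) => x Ox i.
  apply: ltW; apply: le_lt_trans (archi_boundP _); last first.
    by rewrite mulr_ge0 ?invr_ge0 ?(ltW dl0)// addr_ge0.
  rewrite normrM gtr0_norm ?invr_gt0// ler_wpM2l ?invr_ge0 ?(ltW dl0)//.
  exact: le_trans (coord_le_norm _ _) (AM _ Ox).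
pose J := {ffun 'I_N -> 'I_M.*2.+1}.
pose node (k : J) : RN := \row_i (dl * ((k i)%:R - M%:R)).
pose w (k : J) : RN -> R := prodfun (fun i y => smooth_tent (dl^-1 * y + (M%:R - (k i)%:R))).
have w0 k x : 0 <= w k x by apply: prodr_ge0 => i _; exact: smooth_tent_ge0.
have wsupp k x : w k x != 0 -> `|x - node k| <= dl.
  move=> wk; rewrite [leLHS](_ : _ = mx_norm (x - node k))// mx_normrE.
  apply: bigmax_le; first exact: ltW.
  move=> [j i] _ /=; rewrite ord1 !mxE leNgt; apply/negP => xi.
  move/eqP : wk; apply; rewrite /w /prodfun (bigD1 i)//= smooth_tent_eq0 ?mul0r//.
  have -> : dl^-1 * x 0 i + (M%:R - (k i)%:R) = dl^-1 * (x 0 i - dl * ((k i)%:R - M%:R)).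
    by field; rewrite gt_eqF.
  by rewrite normrM gtr0_norm ?invr_gt0// ler_pdivlMl// mulr1 ltW.
have wsum x : \sum_k w k x = \prod_(i < N)
    (smooth_step (dl^-1 * x 0 i + M%:R + 1) - smooth_step (dl^-1 * x 0 i - M%:R)).
  under [RHS]eq_bigr do rewrite -smooth_tent_sum.
  rewrite bigA_distr_bigA/=; apply: eq_bigr => k _; apply: eq_bigr => i _.
  by rewrite addrA.
have wsum_ge0 x : 0 <= \sum_k w k x by apply: sumr_ge0.
have wsum_le1 x : \sum_k w k x <= 1.
  rewrite wsum; apply: (@le_trans _ _ (\prod_(i < N) 1)); last by rewrite big1.
  apply: ler_prod => i _; apply/andP; split; last first.
    by rewrite lerBlDr (le_trans (smooth_step_le1 _))// lerDl smooth_step_ge0.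
  rewrite -smooth_tent_sum; apply: sumr_ge0 => j _; exact: smooth_tent_ge0.
have wsum1 x : Om x -> \sum_k w k x = 1.
  move=> Ox; rewrite wsum big1// => i _; have := HM x Ox i; rewrite ler_norml => /andP[h1 h2].
  by rewrite smooth_step1 ?smooth_step0 ?subr0//; lra.
pose phi x := \sum_k chi (node k) * w k x.
have phis x : ~ inner Om c x -> phi x = 0.
  move=> ix; rewrite /phi big1// => k _; have [->|wk] := eqVneq (w k x) 0; first by rewrite mulr0.
  rewrite chi0 ?mul0r// => ik; apply: ix.
  have := wsupp _ _ wk; rewrite distrC => h.
  by have := inner_shift ik h; rewrite /inner/=; lra.
exists phi; split => //.
- split.
    move=> k; apply: Ck_sum => j; apply: Ck_scale; apply: prodfun_Ck => i n.
    exact: Cn_affine (smooth_tent_smooth n).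
  exists (inner Om c); split => //; [exact: inner_compact|exact: inner_sub].
- move=> x.
  have -> : chi x - phi x = chi x * (1 - \sum_k w k x) + \sum_k (chi x - chi (node k)) * w k x.
    have -> : \sum_k (chi x - chi (node k)) * w k x = chi x * (\sum_k w k x) - phi x.
      by rewrite mulr_sumr /phi -sumrB; apply: eq_bigr => k _; rewrite mulrBl.
    by ring.
  (* Outside [Om] the weights may fail to sum to 1, but [chi] vanishes there. *)
  have -> : chi x * (1 - \sum_k w k x) = 0.
    have [Ox|Ox] := pselect (Om x); first by rewrite wsum1// subrr mulr0.
    by rewrite chi0 ?mul0r// => /(inner_sub cc0).
  rewrite add0r; apply: le_trans (ler_norm_sum _ _ _) _.
  apply: (@le_trans _ _ (\sum_k e * w k x)); last first.
    by rewrite -mulr_sumr ler_piMr// ltW.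
  apply: ler_sum => k _; rewrite normrM (ger0_norm (w0 k x)).
  have [->|wk] := eqVneq (w k x) 0; first by rewrite !mulr0.
  by apply: ler_wpM2r => //; apply: Hd; exact: le_lt_trans (wsupp _ _ wk) dld.
Qed.

End test_functions.

(** * The fundamental lemma of the calculus of variations *)

Section fundamental_lemma.
Context {R : realType} {N : nat}.
Local Notation RN := 'rV[R]_N.
Local Notation cara := (caratheodory_type (@lebesgue_outer R N)).
Local Notation lebN := (@leb R N).

Lemma open_continuous_measurable (O : set RN) (u : RN -> R) : open O ->
  (forall x, O x -> {for x, continuous u}) ->
  measurable_fun (O : set cara) (u : cara -> R).
Proof.
move=> oO cu; apply: (measurability _ (RGenInftyO.measurableE R)) => // _ [_ [a ->] <-].
apply: leb_open_measurable.
rewrite openE => x [/= Ox]; rewrite in_itv/= => ua.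
have /nbhs_ballP[e /= e0 eO] : nbhs x O by exact: open_nbhs_nbhs.
have := cu x Ox => /continuous_distP/(_ (a - u x)); rewrite subr_gt0 => /(_ ua)[d d0 Hd].
suff : nbhs (x : RN) (O `&` u @^-1` `]-oo, a[%classic) by [].
apply/nbhs_ballP; exists (Num.min e d); first by rewrite /= lt_min e0.
move=> y; rewrite -ball_normE/= lt_min => /andP[xe xd]; split.
  by apply: eO; rewrite -ball_normE.
have := Hd y xd; rewrite /= in_itv/= ltr_distl => /andP[h1 h2]; lra.
Qed.

Lemma bounded_leb_lty (Om : set RN) : bounded_set Om -> (lebN Om < +oo)%E.
Proof. exact: lebesgue_outer_bounded. Qed.

Variables (Om : set RN) (Om_open : open Om) (Om_bounded : bounded_set Om).

Let mOm : measurable (Om : set cara).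
Proof. exact: leb_open_measurable. Qed.

Lemma Om_sqint_integrable (g : RN -> R) : sqint lebN Om g -> lebN.-integrable Om (EFin \o g).
Proof.
move=> sg; have s1 : sqint lebN Om (fun=> 1).
  apply: (@sqint_bounded _ _ _ _ _ mOm _ 1); [exact: measurable_cst|exact: bounded_leb_lty|].
  by move=> x _; rewrite normr1.
have := sqint_mul_integrable mOm sg s1; apply: eq_integrable => // x _ /=.
by rewrite mulr1.
Qed.

Lemma test_fun_measurable (phi : RN -> R) : test_fun Om phi ->
  measurable_fun (Om : set cara) (phi : cara -> R).
Proof.
move=> [Cphi _]; apply: open_continuous_measurable => // x _.
exact: (Ck_continuous (Cphi 0%N)).
Qed.

(** The orthogonality passes from test functions to indicators of open sets by dominated
    convergence, and from these to indicators of measurable sets by outer regularity and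
    Cauchy-Schwarz. A function whose integral over every measurable subset vanishes is 0 almost
    everywhere. *)
Lemma fundamental_lemma (g : RN -> R) : sqint lebN Om g ->
  (forall phi, test_fun Om phi -> \int[lebN]_(x in Om) (g x * phi x) = 0) ->
  ae_in Om (fun x => g x = 0).
Proof.
move=> sg gphi; have ig := Om_sqint_integrable sg.
have mg : measurable_fun (Om : set cara) (g : cara -> R) by exact: sg.1.
have open0 (O : set RN) : open O -> O `<=` Om -> \int[lebN]_(x in Om) (g x * \1_O x) = 0.
  move=> oO OOm.
  (* This vanishes where the distance to the complement of [O] is at most [1 / (n + 1)] and equals 1
     where it is at least [2 / (n + 1)], so it tends to the indicator of [O]. The margin is split in
     two halves for [test_fun_dense]. *)
  pose chi (n : nat) (x : RN) := Num.min 1 (Num.max 0 (n.+1%:R * distc O x - 1)).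
  have chic n : continuous (chi n).
    move=> x; apply: (continuous_min (f := fun=> 1 : R^o)
        (g := fun x => Num.max 0 (n.+1%:R * distc O x - 1) : R^o)); first exact: cst_continuous.
    apply: (continuous_max (f := fun=> 0 : R^o) (g := fun x => n.+1%:R * distc O x - 1 : R^o)).
      exact: cst_continuous.
    apply: continuousD; last exact: cst_continuous.
    by apply: continuousM; [exact: cst_continuous|exact: distc_continuous].
  have chis n x : ~ inner Om ((2 * n.+1%:R)^-1 + (2 * n.+1%:R)^-1) x -> chi n x = 0.
    move=> ix; rewrite /chi max_l ?min_r// lerBlDl addr0.
    have n0 : 0 < n.+1%:R :> R by rewrite ltr0n.
    rewrite [leRHS](_ : _ = n.+1%:R * ((2 * n.+1%:R)^-1 + (2 * n.+1%:R)^-1)); last first.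
      by field; rewrite gt_eqF.
    rewrite ler_pM2l//; apply: le_trans (distc_mono x OOm) _.
    by rewrite leNgt; apply/negP => /ltW.
  have c0 n : 0 < (2 * n.+1%:R)^-1 :> R by rewrite invr_gt0 mulr_gt0// ltr0n.
  have n0 n : 0 < n.+1%:R^-1 :> R by rewrite invr_gt0 ltr0n.
  have /choice[phi Hphi] := (fun n => test_fun_dense Om_bounded (c0 n) (chic n) (@chis n) (n0 n)).
  have chi01 n x : 0 <= chi n x <= 1.
    by rewrite /chi ge_min lexx/= andbT le_min ler01/= le_max lexx.
  have phi2 n x : `|phi n x| <= 2.
    have [_ _ /(_ x)] := Hphi n; have /andP[h1 h2] := chi01 n x.
    have : n.+1%:R^-1 <= 1 :> R by rewrite invf_le1 ?ltr0n// ler1n.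
    move: (n.+1%:R^-1 : R) => r.
    by rewrite !ler_norml => h3 /andP[h4 h5]; apply/andP; split; lra.
  have philim x : Om x -> phi n x @[n --> \oo] --> (\1_O x : R).
    move=> Omx; apply/cvgrPdist_le => e e0.
    have [Ox|Ox] := pselect (O x).
      have dx := distc_gt0 oO Ox.
      near=> n.
      have -> : \1_O x = chi n x :> R.
        rewrite indicE mem_set// /chi min_l// le_max; apply/orP; right.
        rewrite lerBrDr -ler_pdivrMr//; apply: ltW; apply: lt_le_trans (archi_boundP _) _ => //.
          by rewrite divr_ge0// ltW.
        rewrite ler_nat; apply: leqW; near: n; exact: nbhs_infty_ge.
      have [_ _ /(_ x)] := Hphi n; move/le_trans; apply.
      by apply: ltW; near: n; exact: (near_infty_natSinv_lt (PosNum e0)).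
    near=> n.
    have -> : \1_O x = chi n x :> R.
      rewrite indicE memNset//= /chi max_l ?min_r//.
      have -> : distc O x = 0.
        apply/eqP; rewrite eq_le distc_ge0 andbT leNgt.
        by apply/negP => /distc_gt0_in.
      by rewrite mulr0 sub0r oppr_le0.
    have [_ _ /(_ x)] := Hphi n; move/le_trans; apply.
    by apply: ltW; near: n; exact: (near_infty_natSinv_lt (PosNum e0)).
  have i2g : lebN.-integrable Om (fun x => (2 * `|g x|)%:E).
    have := integrableZl mOm 2 (integrable_abse ig).
    by apply: eq_integrable => // x _.
  have := @dominated_convergence _ _ _ lebN Om mOm (fun n x => (g x * phi n x)%:E)
    (fun x => (g x * \1_O x)%:E) (fun x => (2 * `|g x|)%:E) _ _ _ i2g _.
  case.
  - move=> n; apply/measurable_EFinP; apply: measurable_funM => //.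
    by apply: test_fun_measurable; have [] := Hphi n.
  - apply/measurable_EFinP; apply: measurable_funM => //.
    by apply: measurable_indic; exact: leb_open_measurable.
  - apply: aeW => x Omx; apply: cvg_EFin; first exact: nearW.
    by apply: cvgM; [exact: cvg_cst|exact: philim].
  - apply: aeW => x n Omx; rewrite /= lee_fin normrM mulrC ler_wpM2r//.
  move=> _ _ H; rewrite /Rintegral.
  have -> : (\int[lebN]_(x in Om) (g x * \1_O x)%:E = 0)%E; last by [].
  rewrite -(cvg_lim _ H)//; apply/cvg_lim => //.
  under eq_fun => n.
    rewrite (_ : integral _ _ _ = (\int[lebN]_(x in Om) (g x * phi n x))%:E); last first.
      rewrite /Rintegral fineK//; apply: integrable_fin_num => //.
      apply: sqint_mul_integrable => //; split.
        by apply: test_fun_measurable; have [] := Hphi n.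
      have : sqint lebN Om (phi n).
        apply: (@sqint_bounded _ _ _ _ _ mOm _ 2) => //.
        - by apply: test_fun_measurable; have [] := Hphi n.
        - exact: bounded_leb_lty.
      by case.
    rewrite gphi; last by have [] := Hphi n.
    over.
  exact: cvg_cst.
have meas0 (E : set RN) : measurable (E : set cara) -> E `<=` Om ->
    \int[lebN]_(x in Om) (g x * \1_E x) = 0.
  move=> mE EOm.
  have Eoo : (lebesgue_outer N E < +oo)%E.
    by apply: le_lt_trans (bounded_leb_lty Om_bounded); exact: le_outer_measure.
  have sE1 (A : set RN) : measurable (A : set cara) -> sqint lebN Om (\1_A).
    move=> mA; apply: (@sqint_bounded _ _ _ _ _ mOm _ 1).
    - exact: measurable_indic.
    - exact: bounded_leb_lty.
    - by move=> x _; rewrite indicE; case: (_ \in _); rewrite ?normr1 ?normr0.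
  (* The indicator of [E] differs from that of an open set, against which [g] integrates to 0, by a
     set of measure at most [e]. *)
  have small e : 0 < e -> dot lebN Om g (\1_E) ^+ 2 <= dot lebN Om g g * e.
    move=> e0; have [U [oU EU UE]] := lebesgue_outer_open_cover e0 Eoo.
    pose O := U `&` Om.
    have oO : open O by exact: openI.
    have mO : measurable (O : set cara) by exact: leb_open_measurable.
    have EO : E `<=` O by move=> x Ex; split; [exact: EU|exact: EOm].
    have H1 : dot lebN Om g (\1_O) = 0 by apply: open0 => // x [].
    have -> : dot lebN Om g (\1_E) = - dot lebN Om g (fun x => \1_O x - \1_E x).
      by rewrite dotBr// ?H1 ?sub0r ?opprK//; exact: sE1.
    rewrite sqrrN; apply: le_trans (dot_CS mOm sg (sqintB mOm (sE1 _ mO) (sE1 _ mE))) _.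
    rewrite ler_wpM2l ?dot_ge0//.
    have mOE : measurable (O `\` E : set cara) by exact: measurableD.
    have -> : (fun x => \1_O x - \1_E x) = (\1_(O `\` E) : RN -> R).
      apply/funext => x; rewrite !indicE in_setD.
      have [Ex|Ex] := boolP (x \in E); last by rewrite andbT subr0.
      by rewrite mem_set ?subrr//; apply: EO; rewrite inE in Ex.
    rewrite -lee_fin -sqint_dotE//; last exact: sE1.
    rewrite (eq_integral (fun x : cara => (\1_(O `\` E) (x : RN))%:E)); last first.
      by move=> x _; rewrite indicE; case: (_ \in _); rewrite ?expr1n ?expr0n.
    rewrite integral_indic//.
    apply: (@le_trans _ _ (lebN (O `\` E))); first by apply: le_measure; rewrite ?inE//; exact: measurableI.
    have Ofin : (lebN O < +oo)%E.
      apply: le_lt_trans (bounded_leb_lty Om_bounded).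
      by apply: le_measure; rewrite ?inE// => x [].
    rewrite measureD// (_ : O `&` E = E); last by apply/setIidPr.
    rewrite leeBlDl; last by rewrite ge0_fin_numE//; exact: outer_measure_ge0.
    apply: le_trans UE; apply: le_outer_measure; exact: subIsetl.
  rewrite -/(dot lebN Om g (\1_E)).
  apply/eqP; rewrite -sqrf_eq0 eq_le sqr_ge0 andbT leNgt; apply/negP => p0.
  have k0 : 0 < dot lebN Om g g + 1 by rewrite ltr_wpDl// dot_ge0.
  (* For this [e] the bound would make the positive number [dot g (\1_E) ^ 2] at most its own
     half. *)
  have := small (dot lebN Om g (\1_E) ^+ 2 / (2 * (dot lebN Om g g + 1))).
  rewrite divr_gt0// ?mulr_gt0// => /(_ isT).
  rewrite mulrA ler_pdivlMr ?mulr_gt0//.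
  by have := dot_ge0 lebN Om g; nra.
have := @integral_ae_eq _ _ _ lebN Om mOm (cst 0%E) (EFin \o g) ig.
move=> /(_ (measurable_cst _)) H.
suff /H : forall E : set cara, E `<=` Om -> measurable E ->
    (\int[lebN]_(x in E) (EFin \o g) x = \int[lebN]_(x in E) cst 0%R x)%E.
  by apply: filterS => x h Omx; have [] := h Omx.
move=> {H} E EOm mE; rewrite integral0.
have -> : E = Om `&` E by apply/esym/setIidPr.
rewrite integral_mkcondr.
have := meas0 E mE EOm; rewrite /Rintegral => H.
transitivity (\int[lebN]_(x in Om) (g x * \1_E x)%:E)%E.
  apply: eq_integral => x _; rewrite patchE indicE /=.
  by case: (x \in E); rewrite ?mulr1 ?mulr0.
rewrite -[LHS]fineK ?H//; apply: integrable_fin_num => //.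
apply: sqint_mul_integrable => //.
apply: (@sqint_bounded _ _ _ _ _ mOm _ 1).
- exact: measurable_indic.
- exact: bounded_leb_lty.
- by move=> x _; rewrite indicE; case: (_ \in _); rewrite ?normr1 ?normr0.
Unshelve. all: by end_near. Qed.

End fundamental_lemma.

(** * Weak gradients and the chain rule *)

Section test_function_calculus.
Context {R : realType} {N : nat}.
Local Notation RN := 'rV[R]_N.

Lemma norm_evec_le (h : R) (i : 'I_N) : `|h *: (evec i : RN)| <= `|h|.
Proof.
rewrite [leLHS](_ : _ = mx_norm (h *: (evec i : RN)))// mx_normrE.
apply: bigmax_le => // -[j k] _ /=; rewrite !mxE normrM ler_piMr//.
by case: (_ && _); rewrite ?normr1 ?normr0.
Qed.

Lemma is_derive_line (f : RN -> R) (x v : RN) (t : R) : derivable f (x + t *: v) v ->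
  is_derive t 1 (fun r => f (x + r *: v)) ('D_v f (x + t *: v)).
Proof.
move=> df.
have E : (fun h => h^-1 *: (f (x + (h *: 1 + t) *: v) - f (x + t *: v))) =
    (fun h => h^-1 *: (f (h *: v + (x + t *: v)) - f (x + t *: v))).
  apply/funext => h; congr (_ *: (f _ - _)).
  by rewrite [h *: 1]mulr1 scalerDl addrCA.
have C : (fun h => h^-1 *: (f (x + (h *: 1 + t) *: v) - f (x + t *: v))) @ 0^' -->
    ('D_v f (x + t *: v)).
  by rewrite E; exact: df.
by apply: DeriveDef; [apply/cvg_ex; exists ('D_v f (x + t *: v))|exact: cvg_lim C].
Qed.

Lemma compact_support_bounded (K : set RN) (f : RN -> R) : compact K ->
  continuous f -> (forall x, ~ K x -> f x = 0) -> exists M : R, forall x, `|f x| <= M.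
Proof.
move=> cK cf f0; have [K0|/set0P K0] := eqVneq K set0.
  by exists 0 => x; rewrite f0 ?normr0// K0.
have cn : {within K, continuous (fun x => `|f x|)}.
  apply: continuous_subspaceT => x; apply: continuous_comp; first exact: cf.
  exact: norm_continuous.
have [y Ky ymax] := compact_EVT_max K0 cK cn.
exists `|f y| => x; have [Kx|Kx] := pselect (K x); first exact: ymax (mem_set Kx).
by rewrite f0// normr0.
Qed.

Lemma derive_out_support (K : set RN) (f : RN -> R) (v x : RN) : closed K ->
  (forall x, ~ K x -> f x = 0) -> ~ K x -> 'D_v f x = 0.
Proof.
move=> cK f0 Kx.
rewrite -(derive_cst (0 : R) x v); apply: near_eq_derive.
have : nbhs (x : RN) (~` K) by apply: open_nbhs_nbhs; split => //; exact: closed_openC.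
by apply: filterS => y Ky; exact: f0.
Qed.

Lemma shift_continuous (h : RN) : continuous (fun x : RN => x + h).
Proof.
move=> x A /nbhs_ballP[e /= e0 eA].
suff : nbhs (x : RN) ((fun x : RN => x + h) @^-1` A) by [].
apply/nbhs_ballP; exists e => // y; rewrite -ball_normE/= => xy.
by apply: eA; rewrite -ball_normE/= opprD addrACA subrr addr0.
Qed.

Lemma derive_shiftv (f : RN -> R) (h x v : RN) :
  (derivable f (x + h) v -> derivable (fun y => f (y + h)) x v) /\
  'D_v (fun y => f (y + h)) x = 'D_v f (x + h).
Proof.
have E : (fun t : R => t^-1 *: ((fun y => f (y + h)) (t *: v + x) - f (x + h))) =
    (fun t => t^-1 *: (f (t *: v + (x + h)) - f (x + h))).
  by apply/funext => t; rewrite addrA.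
split; first by rewrite /derivable E.
by rewrite /derive E.
Qed.

Lemma Ck_shift k (f : RN -> R) (h : RN) : Ck k f -> Ck k (fun x => f (x + h)).
Proof.
have csh g : continuous g -> continuous (fun x : RN => g (x + h) : R).
  move=> cg x; apply: (@continuous_comp _ _ _ (fun x : RN => x + h) g); last exact: cg.
  exact: shift_continuous.
elim: k f => [f /csh//|k ih f [cf Df]].
split; first exact: csh.
move=> i; split; first by move=> x; apply: (derive_shiftv f h x (evec i)).1; exact: (Df i).1.
have := ih _ (Df i).2; congr Ck.
by apply/funext => x; apply/esym; exact: (derive_shiftv f h x (evec i)).2.
Qed.

Lemma test_fun_derive_bounded (Om : set RN) (phi : RN -> R) i : test_fun Om phi ->
  exists M : R, forall x, `|'D_(evec i) phi x| <= M.
Proof.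
move=> [Cphi [K [cK _ phi0]]].
apply: (compact_support_bounded cK).
  by have [_ /(_ i)[_]] := Cphi 1%N.
by move=> x; apply: derive_out_support => //; apply: compact_closed => //.
Qed.

Lemma test_fun_bounded (Om : set RN) (phi : RN -> R) : test_fun Om phi ->
  exists M : R, forall x, `|phi x| <= M.
Proof.
move=> [Cphi [K [cK _ phi0]]].
by apply: (compact_support_bounded cK) => //; exact: Ck_continuous (Cphi 0%N).
Qed.

Lemma test_fun_derivable (Om : set RN) (phi : RN -> R) i x : test_fun Om phi ->
  derivable phi x (evec i).
Proof. by move=> [Cphi _]; have [_ /(_ i)[]] := Cphi 1%N. Qed.

Lemma test_fun_derive_continuous (Om : set RN) (phi : RN -> R) i : test_fun Om phi ->
  continuous ('D_(evec i) phi).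
Proof. by move=> [Cphi _]; have [_ /(_ i)[_]] := Cphi 1%N. Qed.

Lemma test_fun_lip (Om : set RN) (phi : RN -> R) i (M : R) (x : RN) (h : R) :
  test_fun Om phi -> (forall x, `|'D_(evec i) phi x| <= M) -> 0 < h ->
  `|phi (x + h *: evec i) - phi x| <= M * h.
Proof.
move=> tphi HM h0.
have D (t : R) : is_derive t 1 (fun r => phi (x + r *: evec i)) ('D_(evec i) phi (x + t *: evec i)).
  by apply: is_derive_line; exact: test_fun_derivable tphi.
have [] := @MVT _ (fun r => phi (x + r *: evec i)) (fun t => 'D_(evec i) phi (x + t *: evec i)) 0 h h0
  (fun t _ => D t).
- by apply: derivable_within_continuous => t _; have [] := D t.
move=> t _; rewrite scale0r addr0 subr0 => ->.
by rewrite normrM (gtr0_norm h0) ler_wpM2r// ltW.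
Qed.

End test_function_calculus.

(** * Translations and weak difference quotients *)

Section translation.
Context {R : realType} {N : nat} (Om : set 'rV[R]_N).
Hypotheses (Om_open : open Om) (Om_bounded : bounded_set Om).
Local Notation RN := 'rV[R]_N.
Local Notation cara := (caratheodory_type (@lebesgue_outer R N)).
Local Notation lebN := (@leb R N).

Lemma mOm : measurable (Om : set cara).
Proof. exact: leb_open_measurable. Qed.

Lemma continuous_measurable_in (f : RN -> R) : continuous f -> measurable_in Om f.
Proof. by move=> cf; apply: open_continuous_measurable => // x _; exact: cf. Qed.

Lemma measurable_inM (f g : RN -> R) : measurable_in Om f -> measurable_in Om g ->
  measurable_in Om (fun x => f x * g x).
Proof. exact: measurable_funM. Qed.

Lemma measurable_inB (f g : RN -> R) : measurable_in Om f -> measurable_in Om g ->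
  measurable_in Om (fun x => f x - g x).
Proof. exact: measurable_funB. Qed.

Lemma measurable_in_cst (k : R) : measurable_in Om (fun=> k).
Proof. exact: measurable_cst. Qed.

Lemma Om_dominated_convergence (f : nat -> RN -> R) (F G : RN -> R) :
  (forall n, measurable_in Om (f n)) -> measurable_in Om F ->
  (forall x, Om x -> f n x @[n --> \oo] --> F x) ->
  lebN.-integrable Om (EFin \o G) -> (forall n x, Om x -> `|f n x| <= G x) ->
  \int[lebN]_(x in Om) f n x @[n --> \oo] --> \int[lebN]_(x in Om) F x.
Proof.
move=> mf mF fF iG fG.
by apply: (Rintegral_dominated_convergence mOm mf mF _ iG fG); exact: aeW.
Qed.

Lemma bounded_sqint (f : RN -> R) M : measurable_in Om f -> (forall x, Om x -> `|f x| <= M) ->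
  sqint lebN Om f.
Proof.
move=> mf fM; apply: (@sqint_bounded _ _ _ _ _ mOm _ M) => //.
exact: bounded_leb_lty.
Qed.

(** The integrand is extended by zero and translated in the whole space. Wherever [X x] is nonzero,
    the support condition puts both [x] and [x - v] in [Om], so the translated extension is again an
    extension by zero. *)
Lemma translate_integral (F X : RN -> R) (c : R) (v : RN) :
  lebN.-integrable Om (EFin \o (fun x => F x * X (x + v))) ->
  `|v| <= c -> 0 < c -> (forall x, ~ inner Om (c + c) x -> X x = 0) ->
  lebN.-integrable Om (EFin \o (fun x => F (x - v) * X x)) /\
  \int[lebN]_(x in Om) (F x * X (x + v)) = \int[lebN]_(x in Om) (F (x - v) * X x).
Proof.
move=> iFX vc c0 X0.
have cc0 : 0 < c + c by rewrite addr_gt0.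
pose P x := ((fun x => F x * X (x + v)) \_ Om) x.
have iP : lebN.-integrable setT (EFin \o P).
  have /(integrable_mkcond _ mOm) := iFX; apply: eq_integrable => // x _.
  by rewrite /P /= restrict_EFin.
have PE : (fun x => P (x - v)) = (fun x => F (x - v) * X x) \_ Om.
  apply/funext => x; rewrite /P !patchE subrK.
  have [Xx|Xx] := eqVneq (X x) 0.
    by rewrite Xx !mulr0; do 2 case: ifP.
  have Omx : inner Om (c + c) x by apply: contrapT => /X0 h; rewrite h eqxx in Xx.
  have h1 : x \in Om by rewrite inE; exact: inner_sub cc0 _ Omx.
  have h2 : x - v \in Om.
    rewrite inE; apply: (inner_sub c0).
    have := @inner_shift _ _ _ _ c _ (x - v) Omx.
    by rewrite addrK; apply; rewrite opprB addrCA subrr addr0.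
  by rewrite h1 h2.
split.
  apply/(integrable_mkcond _ mOm); have := integrable_shift (- v) iP.
  rewrite (_ : EFin \o (fun x => P (x - v)) = EFin \o ((fun x => F (x - v) * X x) \_ Om)).
    by apply: eq_integrable => // x _; rewrite /= restrict_EFin.
  by rewrite PE.
rewrite Rintegral_mkcond [RHS]Rintegral_mkcond.
by rewrite -[LHS](Rintegral_shift (- v) iP) PE.
Qed.

Lemma derive_integral_shift (u chi : RN -> R) i (t : R) : sqint lebN Om u ->
  test_fun Om chi ->
  is_derive t 1 (fun r => \int[lebN]_(x in Om) (u x * chi (x + r *: evec i)))
    (\int[lebN]_(x in Om) (u x * 'D_(evec i) chi (x + t *: evec i))).
Proof.
move=> su tchi; have iu := Om_sqint_integrable Om_open Om_bounded su.
have [M HM] := test_fun_derive_bounded i tchi.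
have [M1 HM1] := test_fun_bounded tchi.
have M0 : 0 <= M by rewrite (le_trans _ (HM 0)).
pose f (r : R) (x : cara) := u x * chi ((x : RN) + r *: evec i).
have cshift r (g : RN -> R) : continuous g -> continuous (fun x : RN => g (x + r *: evec i) : R).
  move=> cg x; apply: (@continuous_comp _ _ _ (fun x : RN => x + r *: evec i) g); last exact: cg.
  exact: shift_continuous.
have cchi : continuous chi by case: tchi => Cchi _; exact: Ck_continuous (Cchi 0%N).
have D (r : R) x : is_derive r 1 (fun r => chi (x + r *: evec i)) ('D_(evec i) chi (x + r *: evec i)).
  by apply: is_derive_line; exact: test_fun_derivable tchi.
have Df (r : R) x : is_derive r 1 (f^~ x) (u x * 'D_(evec i) chi (x + r *: evec i)).
  have := @is_deriveZ _ _ _ _ (u x) _ _ _ (D r x); exact.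
have It : (`]t - 1, t + 1[%classic : set R) t by rewrite /= in_itv/=; apply/andP; split; lra.
have intf r : `]t - 1, t + 1[%classic r -> lebN.-integrable Om (EFin \o f r).
  move=> _; apply: sqint_mul_integrable; [exact: mOm|exact: su|].
  apply: (bounded_sqint (M := M1)); last by move=> x _.
  by apply: continuous_measurable_in; exact: cshift.
have iG : lebN.-integrable Om (EFin \o (fun x => M * `|u x|)).
  have := integrableZl mOm M (integrable_abse iu).
  by apply: eq_integrable => //; exact: mOm.
have H := @cvg_differentiation_under_integral _ _ _ lebN f Om mOm t (t - 1) (t + 1) It intf
  (fun r x _ _ => @ex_derive _ _ _ _ _ _ _ (Df r x)) (fun x => M * `|u x|)
  (fun x => mulr_ge0 M0 (normr_ge0 _)) iG.
have {}H : h^-1 *: ((fun r => \int[lebN]_(x in Om) f r x) (h + t) -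
     (fun r => \int[lebN]_(x in Om) f r x) t) @[h --> 0^'] -->
     \int[lebN]_(x in Om) (u x * 'D_(evec i) chi (x + t *: evec i)).
  rewrite (_ : \int[lebN]_(x in Om) (u x * 'D_(evec i) chi (x + t *: evec i)) =
     \int[lebN]_(x in Om) (partial1of2 f t x)); last first.
    by apply: eq_Rintegral => x _; rewrite partial1of2E; have [_ ->] := Df t x.
  apply: H => r x _ _; rewrite partial1of2E; have [_ ->] := Df r x.
  by rewrite normrM mulrC ler_wpM2r.
have {}H : (fun h => h^-1 *: ((fun r => \int[lebN]_(x in Om) f r x) (h *: 1 + t) -
     (fun r => \int[lebN]_(x in Om) f r x) t)) @ 0^' -->
     \int[lebN]_(x in Om) (u x * 'D_(evec i) chi (x + t *: evec i)).
  by under eq_fun do rewrite [_ *: 1]mulr1.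
by apply: DeriveDef; [apply/cvg_ex; eexists; exact: H|exact: cvg_lim H].
Qed.

Lemma test_fun_shift (chi : RN -> R) (c : R) (v : RN) : 0 < c -> `|v| <= c ->
  test_fun Om chi -> (forall x, ~ inner Om (c + c) x -> chi x = 0) ->
  test_fun Om (fun x => chi (x + v)).
Proof.
move=> c0 vc [Cchi _] chi0; split; first by move=> k; exact: Ck_shift.
exists (inner Om c); split; [exact: inner_compact|exact: inner_sub|].
move=> x ix; apply: chi0 => ixv; apply: ix.
have := @inner_shift _ _ _ _ c _ x ixv.
by rewrite addrK; apply; rewrite addrAC subrr add0r.
Qed.

(** The mean value theorem in the length of the shift, followed by the defining identity of the weak
    gradient for the shifted test function, whose support is still inside [Om]. *)
Lemma weak_difference_quotient_test (u chi : RN -> R) (g : 'I_N -> RN -> R) i (c h : R) :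
  sqint lebN Om u -> weak_gradient Om u g -> test_fun Om chi ->
  0 < h -> h <= c -> (forall x, ~ inner Om (c + c) x -> chi x = 0) ->
  exists2 t, 0 <= t <= h &
  \int[lebN]_(x in Om) (u x * chi (x + h *: evec i)) - \int[lebN]_(x in Om) (u x * chi x) =
  - h * \int[lebN]_(x in Om) (g i x * chi (x + t *: evec i)).
Proof.
move=> su wg tchi h0 hc chi0.
have D (t : R) := derive_integral_shift i t su tchi.
have [] := @MVT _ (fun r => \int[lebN]_(x in Om) (u x * chi (x + r *: evec i)))
  (fun t => \int[lebN]_(x in Om) (u x * 'D_(evec i) chi (x + t *: evec i))) 0 h h0
  (fun t _ => D t).
- by apply: derivable_within_continuous => t _; have [] := D t.
move=> t; rewrite in_itv/= => /andP[t0 th].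
under [X in _ - X = _ -> _]eq_Rintegral do rewrite scale0r addr0.
move=> ->; exists t; first by rewrite !ltW.
have tchit : test_fun Om (fun x => chi (x + t *: evec i)).
  apply: (@test_fun_shift _ c) => //; first exact: lt_le_trans hc.
  by apply: le_trans (norm_evec_le _ _) _; rewrite gtr0_norm// ltW// (lt_le_trans th).
have := wg.2 _ i tchit.
rewrite (_ : \int[lebN]_(x in Om) (u x * 'D_(evec i) (fun x => chi (x + t *: evec i)) x) =
  \int[lebN]_(x in Om) (u x * 'D_(evec i) chi (x + t *: evec i))); last first.
  by apply: eq_Rintegral => x _; rewrite (derive_shiftv chi _ x (evec i)).2.
by move=> ->; rewrite subr0; ring.
Qed.

Lemma dot_sub_le (u f1 f2 : RN -> R) (d : R) : sqint lebN Om u ->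
  sqint lebN Om f1 -> sqint lebN Om f2 -> (forall x, Om x -> `|f1 x - f2 x| <= d) ->
  `|\int[lebN]_(x in Om) (u x * f1 x) - \int[lebN]_(x in Om) (u x * f2 x)| <=
  d * \int[lebN]_(x in Om) `|u x|.
Proof.
move=> su s1 s2 fd; have iu := Om_sqint_integrable Om_open Om_bounded su.
rewrite -RintegralB; [|exact: mOm|exact: (sqint_mul_integrable mOm su s1)|exact: (sqint_mul_integrable mOm su s2)].
have E : (fun x => u x * f1 x - u x * f2 x) = (fun x => u x * (f1 x - f2 x)).
  by apply/funext => x; rewrite mulrBr.
rewrite E; have i12 := sqint_mul_integrable mOm su (sqintB mOm s1 s2).
apply: le_trans (le_normr_Rintegral mOm i12) _.
rewrite -RintegralZl; [|exact: mOm|exact: integrable_norm].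
apply: le_Rintegral; [exact: mOm|exact: integrable_norm| |].
  have := integrableZl mOm d (integrable_abse iu).
  by apply: eq_integrable => //; exact: mOm.
by move=> x Omx; rewrite normrM mulrC ler_wpM2r//; exact: fd.
Qed.

(** The multiplier of the chain rule is merely continuous, so it is approximated by a test function.
    The length [t] comes from the mean value theorem for that test function and depends on it; this
    is why the identity is kept with an error [e]. *)
Lemma weak_difference_quotient (u X : RN -> R) (g : 'I_N -> RN -> R) i (c h e : R) :
  sqint lebN Om u -> sqint lebN Om (g i) -> weak_gradient Om u g -> continuous X ->
  0 < h -> h <= c -> (forall x, ~ inner Om ((c + c) + (c + c)) x -> X x = 0) -> 0 < e ->
  exists2 t, 0 <= t <= h &
  `|\int[lebN]_(x in Om) (u x * X (x + h *: evec i)) - \int[lebN]_(x in Om) (u x * X x) +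
    h * \int[lebN]_(x in Om) (g i x * X (x + t *: evec i))| <= e.
Proof.
move=> su sg wg cX h0 hc X0 e0.
have c0 : 0 < c by exact: lt_le_trans hc.
have cc0 : 0 < c + c by rewrite addr_gt0.
pose Iu := \int[lebN]_(x in Om) `|u x|; pose Ig := \int[lebN]_(x in Om) `|g i x|.
have Iu0 : 0 <= Iu by apply: Rintegral_ge0.
have Ig0 : 0 <= Ig by apply: Rintegral_ge0.
have D0 : 0 < 2 * Iu + h * Ig + 1.
  by rewrite ltr_wpDl// addr_ge0// mulr_ge0// ltW.
(* Replacing [X] by [phi] costs [d * Iu] in each of the first two integrals and [h * d * Ig] in the
   third; the 1 keeps the denominator positive. *)
pose d := e / (2 * Iu + h * Ig + 1).
have d0 : 0 < d by rewrite divr_gt0.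
have [phi [tphi phi0 Xphi]] := test_fun_dense Om_bounded cc0 cX X0 d0.
have [t t0h H] := weak_difference_quotient_test i su wg tphi h0 hc phi0.
exists t => //.
have cphi : continuous phi by case: tphi => Cphi _; exact: Ck_continuous (Cphi 0%N).
have [MX HMX] := compact_support_bounded
  (inner_compact Om_bounded (addr_gt0 cc0 cc0)) cX X0.
have [Mp HMp] := test_fun_bounded tphi.
have cshift (v : RN) (f : RN -> R) : continuous f -> continuous (fun x : RN => f (x + v) : R).
  move=> cf x; apply: (@continuous_comp _ _ _ (fun x : RN => x + v) f); last exact: cf.
  exact: shift_continuous.
have sX v : sqint lebN Om (fun x => X (x + v)).
  by apply: (bounded_sqint (M := MX)) => //; apply: continuous_measurable_in; exact: cshift.
have sp v : sqint lebN Om (fun x => phi (x + v)).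
  by apply: (bounded_sqint (M := Mp)) => //; apply: continuous_measurable_in; exact: cshift.
have cmp (w : RN -> R) v : sqint lebN Om w ->
    `|\int[lebN]_(x in Om) (w x * X (x + v)) - \int[lebN]_(x in Om) (w x * phi (x + v))| <=
    d * \int[lebN]_(x in Om) `|w x|.
  by move=> sw; apply: dot_sub_le => // x _; exact: Xphi.
have h1 := cmp u (h *: evec i) su.
have h2 := cmp u 0 su.
rewrite (_ : (fun x => u x * X (x + 0)) = (fun x => u x * X x)) in h2; last first.
  by apply/funext => x; rewrite addr0.
rewrite (_ : (fun x => u x * phi (x + 0)) = (fun x => u x * phi x)) in h2; last first.
  by apply/funext => x; rewrite addr0.
have h3 := cmp (g i) (t *: evec i) sg.
move: h1 h2 h3 H; rewrite -/Iu -/Ig.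
set A := Rintegral _ _ _; set A' := Rintegral _ _ _; set B := Rintegral _ _ _.
set B' := Rintegral _ _ _; set C := Rintegral _ _ _; set C' := Rintegral _ _ _.
move=> h1 h2 h3 H.
have -> : A - B + h * C = (A - A') - (B - B') + h * (C - C').
  by move: H; move: (h * C') => q; rewrite mulrBr; nra.
have h4 : `|h * (C - C')| <= h * (d * Ig) by rewrite normrM (gtr0_norm h0) ler_wpM2l// ltW.
have dE : d * (2 * Iu + h * Ig + 1) = e by rewrite /d divfK// gt_eqF.
have e1 : d * Iu + d * Iu + h * (d * Ig) <= e by nra.
apply: le_trans e1; apply: le_trans (ler_normD _ _) _; apply: lerD => //.
by apply: le_trans (ler_normB _ _) _; exact: lerD.
Qed.

Lemma continuous_mul_support (K : set RN) (F psi : RN -> R) : closed K ->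
  continuous psi -> (forall x, ~ K x -> psi x = 0) ->
  (forall x, K x -> {for x, continuous F}) -> continuous (fun x => F x * psi x).
Proof.
move=> cK cpsi psi0 cF x; have [Kx|Kx] := pselect (K x).
  by apply: continuousM; [exact: cF|exact: cpsi].
apply/continuous_distP => e e0.
have : nbhs (x : RN) (~` K) by apply: open_nbhs_nbhs; split => //; exact: closed_openC.
move=> /nbhs_ballP[d /= d0 Hd]; exists d => // y xy.
rewrite !psi0//; first by rewrite !mulr0 subrr normr0.
by apply: Hd; rewrite -ball_normE.
Qed.

Lemma L2_sqint (u : RN -> R) : L2 Om u <-> sqint lebN Om u.
Proof.
split=> [[mu uoo]|[mu uoo]]; split => //.
  by apply: lty_poweRy uoo; rewrite invr_eq0.
exact: poweR_lty.
Qed.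

End translation.

(** * A smooth truncation and its divided differences *)

Section truncation.
Context {R : realType}.

(* A smooth substitute for the truncation |s| /\ 1: nonnegative, vanishing at 0,
   at least 1 where |s| >= 1, with bounded derivative. *)
Definition tr (s : R) : R := 2 - 2 * (1 + s ^+ 2)^-1.
Definition dtr (s : R) : R := 4 * s * ((1 + s ^+ 2)^-1 * (1 + s ^+ 2)^-1).
(** The divided difference of [tr], in a form that is continuous across the diagonal, where it
    equals [dtr]. It makes the chain rule an exact identity before any limit is taken. *)
Definition trq (a b : R) : R := 2 * (a + b) * ((1 + a ^+ 2)^-1 * (1 + b ^+ 2)^-1).

Lemma tr_den (s : R) : 0 < 1 + s ^+ 2.
Proof. by rewrite ltr_pwDl// sqr_ge0. Qed.

Lemma trB a b : tr a - tr b = (a - b) * trq a b.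
Proof.
by rewrite /tr /trq; field; rewrite !gt_eqF ?tr_den.
Qed.

Lemma trq_diag s : trq s s = dtr s.
Proof. by rewrite /trq /dtr; ring. Qed.

Lemma tr_inv_le1 (s : R) : 0 <= (1 + s ^+ 2)^-1 <= 1.
Proof. by rewrite invr_ge0 ltW ?tr_den//= invf_le1 ?tr_den// lerDl sqr_ge0. Qed.

Lemma tr_half (s : R) : `|s * (1 + s ^+ 2)^-1| <= 2^-1.
Proof.
rewrite normrM normfV (gtr0_norm (tr_den _)) ler_pdivrMr ?tr_den//.
by rewrite -real_normK ?num_real//; have := sqr_ge0 (`|s| - 1); nra.
Qed.

Lemma trq_bounded a b : `|trq a b| <= 2.
Proof.
have -> : trq a b = 2 * ((a * (1 + a ^+ 2)^-1) * (1 + b ^+ 2)^-1 +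
    (b * (1 + b ^+ 2)^-1) * (1 + a ^+ 2)^-1) by rewrite /trq; ring.
have := tr_half a; have := tr_half b.
have /andP[a0 a1] := tr_inv_le1 a; have /andP[b0 b1] := tr_inv_le1 b.
move: (a * _) (b * _) => p q hq hp.
rewrite normrM (@ger0_norm _ 2)//.
have : `|p * (1 + b ^+ 2)^-1 + q * (1 + a ^+ 2)^-1| <= 1; last by lra.
apply: le_trans (ler_normD _ _) _; rewrite !normrM (ger0_norm a0) (ger0_norm b0).
by have := normr_ge0 p; have := normr_ge0 q; nra.
Qed.

Lemma dtr_bounded s : `|dtr s| <= 2.
Proof. by rewrite -trq_diag; exact: trq_bounded. Qed.

Lemma tr0 : tr 0 = 0.
Proof. by rewrite /tr expr0n/= addr0 invr1 mulr1 subrr. Qed.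

Lemma tr_ge0 s : 0 <= tr s.
Proof. by rewrite /tr; have /andP[] := tr_inv_le1 s; lra. Qed.

Lemma tr_le2 s : tr s <= 2.
Proof. by rewrite /tr; have /andP[] := tr_inv_le1 s; lra. Qed.

Lemma tr_ge1 s : 1 <= `|s| -> 1 <= tr s.
Proof.
move=> s1; have : (1 + s ^+ 2)^-1 <= 2^-1; last by rewrite /tr; lra.
rewrite lef_pV2 ?posrE ?tr_den// -real_normK ?num_real//.
by have := sqr_ge0 (`|s| - 1); nra.
Qed.

Lemma tr_le s : tr s <= 2 * `|s|.
Proof.
have := trB s 0; rewrite tr0 !subr0 => ->; apply: le_trans (ler_norm _) _.
by rewrite normrM mulrC ler_wpM2r// trq_bounded.
Qed.

Lemma tr_lip a b : `|tr a - tr b| <= 2 * `|a - b|.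
Proof. by rewrite trB normrM mulrC ler_wpM2r// trq_bounded. Qed.

Lemma trq_cvg (T : Type) (F : set_system T) (FF : Filter F) (a b : T -> R) (l l' : R) :
  a @ F --> l -> b @ F --> l' -> (fun y => trq (a y) (b y)) @ F --> trq l l'.
Proof.
move=> ca cb.
have ci (c : T -> R) (k : R) : c @ F --> k -> (fun y => (1 + c y ^+ 2)^-1) @ F --> (1 + k ^+ 2)^-1.
  move=> cc; apply: cvgV; first by rewrite gt_eqF ?tr_den.
  by apply: cvgD; [exact: cvg_cst|exact: cvgM].
apply: cvgM; last by apply: cvgM; exact: ci.
by apply: cvgM; [exact: cvg_cst|exact: cvgD].
Qed.

Lemma trq_continuous (T : topologicalType) (a b : T -> R) (x : T) :
  {for x, continuous a} -> {for x, continuous b} ->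
  {for x, continuous (fun y => trq (a y) (b y))}.
Proof. by move=> ca cb; exact: trq_cvg ca cb. Qed.

Lemma tr_cvg (T : Type) (F : set_system T) (FF : Filter F) (a : T -> R) (l : R) :
  a @ F --> l -> (fun y => tr (a y)) @ F --> tr l.
Proof.
move=> ca; rewrite (_ : (fun y => tr (a y)) = fun y => (a y - 0) * trq (a y) 0); last first.
  by apply/funext => y; rewrite -trB tr0 subr0.
have -> : tr l = (l - 0) * trq l 0 by rewrite -trB tr0 subr0.
apply: cvgM; first by apply: cvgB => //; exact: cvg_cst.
by apply: trq_cvg => //; exact: cvg_cst.
Qed.

Lemma tr_continuous (T : topologicalType) (a : T -> R) (x : T) :
  {for x, continuous a} -> {for x, continuous (fun y => tr (a y))}.
Proof. by move=> ca; exact: tr_cvg ca. Qed.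

Lemma dtr_cvg (T : Type) (F : set_system T) (FF : Filter F) (a : T -> R) (l : R) :
  a @ F --> l -> (fun y => dtr (a y)) @ F --> dtr l.
Proof.
move=> ca; rewrite (_ : (fun y => dtr (a y)) = fun y => trq (a y) (a y)); last first.
  by apply/funext => y; rewrite trq_diag.
by rewrite -trq_diag; exact: trq_cvg.
Qed.

Lemma dtr_continuous (T : topologicalType) (a : T -> R) (x : T) :
  {for x, continuous a} -> {for x, continuous (fun y => dtr (a y))}.
Proof. by move=> ca; exact: dtr_cvg ca. Qed.

End truncation.

(** * The chain rule for the truncation *)

Section chain_rule.
Context {R : realType} {N : nat} (Om : set 'rV[R]_N).
Hypotheses (Om_open : open Om) (Om_bounded : bounded_set Om).
Local Notation RN := 'rV[R]_N.
Local Notation cara := (caratheodory_type (@lebesgue_outer R N)).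
Local Notation lebN := (@leb R N).
Let mOm : measurable (Om : set cara) := mOm Om_open.

(** The shifted difference of [tr (u)] against [psi] equals that of [u] against the multiplier
    [X n], which contains [trq]. [weak_difference_quotient] turns the latter into an integral of
    [g i], and dominated convergence replaces [trq] by its diagonal [dtr]. Pointwise continuity of
    [u] in [Om] is what makes [X n] continuous. *)
Lemma chain_rule_tr (u : RN -> R) (g : 'I_N -> RN -> R) :
  sqint lebN Om u -> (forall x, Om x -> {for x, continuous u}) -> weak_gradient Om u g ->
  weak_gradient Om (fun x => tr (u x)) (fun i x => dtr (u x) * g i x).
Proof.
move=> su cu wg.
have sg i : sqint lebN Om (g i) by apply/(L2_sqint Om); exact: wg.1.
have mdtr : measurable_in Om (fun x => dtr (u x)).
  apply: open_continuous_measurable => // x Omx.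
  by apply: dtr_continuous; exact: cu.
split=> [i|psi i tpsi].
  apply/L2_sqint; apply: (sqint_le (g := g i) (c := 4) mOm _ _ (sg i)).
    exact: measurable_inM mdtr (sg i).1.
  move=> x _; rewrite exprMn ler_wpM2r ?sqr_ge0//.
  by rewrite -real_normK ?num_real//; have := dtr_bounded (u x); have := normr_ge0 (dtr (u x)); nra.
have [Cpsi [K [cK KOm psi0K]]] := tpsi.
have [c4 [c40 Kc4]] := compact_inner Om_open cK KOm.
(* [weak_difference_quotient] asks for four margins [c] between the support and the complement of
   [Om]. *)
pose c := c4 / 4.
have c0 : 0 < c by rewrite divr_gt0.
have cE : (c + c) + (c + c) = c4 by rewrite /c; field.
have psi0 x : ~ inner Om ((c + c) + (c + c)) x -> psi x = 0.
  by move=> ix; apply: psi0K => /Kc4; rewrite -cE.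
have cpsi : continuous psi by exact: Ck_continuous (Cpsi 0%N).
have [M HM] := test_fun_derive_bounded i tpsi.
have [Mp HMp] := test_fun_bounded tpsi.
have M0 : 0 <= M by exact: le_trans (HM 0).
pose h n : R := c * n.+1%:R^-1.
have h0 n : 0 < h n by rewrite mulr_gt0// invr_gt0 ltr0n.
have hc n : h n <= c by rewrite ler_piMr ?(ltW c0)// invf_le1 ?ltr0n// ler1n.
have hcvg : h n @[n --> \oo] --> 0.
  by rewrite -[X in _ --> X](mulr0 c); apply: cvgM; [exact: cvg_cst|exact: cvg_harmonic].
(* With this choice [trB] gives that [u (x - h) - u x] times [X n x] is [tr (u (x - h)) - tr (u x)]
   times [psi x], where [h] stands for [h n *: evec i]. *)
pose X n (x : RN) := trq (u (x - h n *: evec i)) (u x) * psi x.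
have icl : closed (inner Om ((c + c) + (c + c))).
  apply: compact_closed; first exact: norm_hausdorff.
  by apply: inner_compact => //; rewrite !addr_gt0.
have in_c x v : inner Om ((c + c) + (c + c)) x -> `|v| <= c -> Om (x + v).
  move=> ix vc; apply: (@inner_sub _ _ _ ((c + c) + (c + c) - c)); first by rewrite cE /c; lra.
  by apply: inner_shift ix _; rewrite opprD addrA subrr sub0r normrN.
have hv n : `|h n *: (evec i : RN)| <= c.
  by apply: le_trans (norm_evec_le _ _) _; rewrite gtr0_norm.
have cshift (v x : RN) (f : RN -> R) : {for x + v, continuous f} ->
    {for x, continuous (fun x : RN => f (x + v) : R)}.
  move=> cf; apply: (@continuous_comp _ _ _ (fun x : RN => x + v) f); last exact: cf.
  exact: shift_continuous.
have cX n : continuous (X n).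
  apply: (continuous_mul_support icl) => // x ix.
  apply: trq_continuous; last by apply: cu; rewrite -[x]addr0; apply: in_c => //; rewrite normr0 ltW.
  by apply: cshift; apply: cu; apply: in_c => //; rewrite normrN.
have X0 n x : ~ inner Om ((c + c) + (c + c)) x -> X n x = 0.
  by move=> /psi0 px; rewrite /X px mulr0.
(* The tolerance carries a factor [h n], so that it still vanishes after division by [h n]. *)
have e0 n : 0 < h n * n.+1%:R^-1 by rewrite mulr_gt0// invr_gt0 ltr0n.
have HX n := weak_difference_quotient Om_open Om_bounded su (sg i) wg (cX n) (h0 n) (hc n) (@X0 n) (e0 n).
have [t Ht] : exists t : nat -> R, forall n, 0 <= t n <= h n /\
  `|\int[lebN]_(x in Om) (u x * X n (x + h n *: evec i)) - \int[lebN]_(x in Om) (u x * X n x) +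
    h n * \int[lebN]_(x in Om) (g i x * X n (x + t n *: evec i))| <= h n * n.+1%:R^-1.
  have /choice[t Ht] n : exists t : R, 0 <= t <= h n /\
    `|\int[lebN]_(x in Om) (u x * X n (x + h n *: evec i)) - \int[lebN]_(x in Om) (u x * X n x) +
    h n * \int[lebN]_(x in Om) (g i x * X n (x + t *: evec i))| <= h n * n.+1%:R^-1.
    by have [t t1 t2] := HX n; exists t.
  by exists t.
have mu' : measurable_in Om (fun x => tr (u x)).
  apply: open_continuous_measurable => // x Omx.
  by apply: tr_continuous; exact: cu.
have str : sqint lebN Om (fun x => tr (u x)).
  apply: (bounded_sqint Om_open Om_bounded (M := 2)) => // x _.
  by rewrite ger0_norm ?tr_ge0// tr_le2.
have spsi v : sqint lebN Om (fun x => psi (x + v)).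
  apply: (bounded_sqint Om_open Om_bounded (M := Mp)) => //.
  by apply: continuous_measurable_in => // x; apply: cshift; exact: cpsi.
have XB n x : `|X n x| <= 2 * Mp.
  by rewrite /X normrM; apply: ler_pM => //; exact: trq_bounded.
have sX n v : sqint lebN Om (fun x => X n (x + v)).
  apply: (bounded_sqint Om_open Om_bounded (M := 2 * Mp)) => //.
  by apply: continuous_measurable_in => // x; apply: cshift; exact: cX.
have key n : \int[lebN]_(x in Om) (u x * X n (x + h n *: evec i)) - \int[lebN]_(x in Om) (u x * X n x)
   = \int[lebN]_(x in Om) (tr (u x) * psi (x + h n *: evec i)) - \int[lebN]_(x in Om) (tr (u x) * psi x).
  have sub42 x : ~ inner Om (c + c) x -> ~ inner Om ((c + c) + (c + c)) x.
    by apply: contra_not; rewrite /inner/=; lra.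
  have [i1 ->] := translate_integral Om_open (sqint_mul_integrable mOm su (sX n _)) (hv n) c0
    (fun x ix => X0 n x (sub42 x ix)).
  have [i2 ->] := translate_integral Om_open (sqint_mul_integrable mOm str (spsi _)) (hv n) c0
    (fun x ix => psi0 x (sub42 x ix)).
  have spsi0 : sqint lebN Om psi.
    by have := spsi 0; congr sqint; apply/funext => x; rewrite addr0.
  have sX0 : sqint lebN Om (X n).
    by have := sX n 0; congr sqint; apply/funext => x; rewrite addr0.
  rewrite -(RintegralB mOm i1 (sqint_mul_integrable mOm su sX0)).
  rewrite -(RintegralB mOm i2 (sqint_mul_integrable mOm str spsi0)).
  by apply: eq_Rintegral => x _; rewrite -!mulrBl trB /X mulrA.
pose Q n x := tr (u x) * ((h n)^-1 * (psi (x + h n *: evec i) - psi x)).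
have QE n : \int[lebN]_(x in Om) Q n x = (h n)^-1 *
   (\int[lebN]_(x in Om) (tr (u x) * psi (x + h n *: evec i)) - \int[lebN]_(x in Om) (tr (u x) * psi x)).
  have spsi0 : sqint lebN Om psi.
    by have := spsi 0; congr sqint; apply/funext => x; rewrite addr0.
  rewrite -(RintegralB mOm (sqint_mul_integrable mOm str (spsi _)) (sqint_mul_integrable mOm str spsi0)).
  have := @RintegralZl _ _ _ lebN Om (fun x => tr (u x) * psi (x + h n *: evec i) - tr (u x) * psi x) (h n)^-1 mOm.
  move=> <-; last first.
    have := integrableB mOm (sqint_mul_integrable mOm str (spsi (h n *: evec i))) (sqint_mul_integrable mOm str spsi0).
    by apply: eq_integrable.
  by apply: eq_Rintegral => x _; rewrite /Q; ring.
have cst_int (k : R) : lebN.-integrable Om (EFin \o (fun=> k)).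
  apply: Om_sqint_integrable => //; apply: (bounded_sqint Om_open Om_bounded (M := `|k|)) => //.
  exact: measurable_cst.
have seq_cvg (v : nat -> RN) x : (forall n, `|v n| <= h n) -> x + v n @[n --> \oo] --> x.
  move=> vh; apply/cvgrPdist_lt => e e0'.
  move/cvgrPdist_lt : hcvg => /(_ e e0'); apply: filterS => n.
  rewrite sub0r normrN gtr0_norm// => hn.
  by rewrite opprD addrA subrr sub0r normrN; exact: le_lt_trans (vh n) hn.
have L1 : \int[lebN]_(x in Om) Q n x @[n --> \oo] -->
    \int[lebN]_(x in Om) (tr (u x) * 'D_(evec i) psi x).
  apply: (Om_dominated_convergence Om_open (G := fun=> 2 * M)); last 1 first.
  - move=> n x Omx; rewrite /Q normrM; apply: ler_pM; [exact: normr_ge0|exact: normr_ge0| |].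
      by rewrite ger0_norm ?tr_ge0// tr_le2.
    rewrite normrM gtr0_norm ?invr_gt0// ler_pdivrMl// mulrC.
    exact: test_fun_lip tpsi HM (h0 n).
  - move=> n; apply: measurable_inM; first exact: mu'.
    apply: measurable_inM; first exact: measurable_in_cst.
    apply: measurable_inB; last exact: continuous_measurable_in Om_open _ cpsi.
    by apply: (continuous_measurable_in Om_open) => x; apply: cshift; exact: cpsi.
  - apply: measurable_inM; first exact: mu'.
    apply: (continuous_measurable_in Om_open).
    exact: test_fun_derive_continuous tpsi.
  - move=> x Omx; apply: cvgM; first exact: cvg_cst.
    have D : (fun r => r^-1 *: (psi (r *: evec i + x) - psi x)) @ 0^' --> 'D_(evec i) psi x.
      exact: test_fun_derivable tpsi.
    rewrite (_ : (fun n => _) = (fun n => (h n)^-1 *: (psi (h n *: evec i + x) - psi x))).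
      exact: (cvgr_dnbhsP _ _ _).1 D h (conj (fun n => lt0r_neq0 (h0 n)) hcvg).
    by apply/funext => n; rewrite [x + _]addrC.
  - exact: cst_int.
have L2 : \int[lebN]_(x in Om) (g i x * X n (x + t n *: evec i)) @[n --> \oo] -->
    \int[lebN]_(x in Om) (dtr (u x) * g i x * psi x).
  apply: (Om_dominated_convergence Om_open (G := fun x => (2 * Mp) * `|g i x|)); last 1 first.
  - by move=> n x _; rewrite normrM mulrC ler_wpM2r ?normr_ge0.
  - move=> n; apply: measurable_inM; first exact: (sg i).1.
    by apply: (continuous_measurable_in Om_open) => x; apply: cshift; exact: cX.
  - apply: measurable_inM; last exact: continuous_measurable_in Om_open _ cpsi.
    by apply: measurable_inM; [exact: mdtr|exact: (sg i).1].
  - move=> x Omx; rewrite (mulrC (dtr _)) -mulrA; apply: cvgM; first exact: cvg_cst.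
    have te n : `|t n *: (evec i : RN)| <= h n.
      by apply: le_trans (norm_evec_le _ _) _; have [/andP[t0 th] _] := Ht n; rewrite ger0_norm.
    have y1 := seq_cvg _ x te.
    have y2 : x + t n *: evec i - h n *: evec i @[n --> \oo] --> x.
      have := @seq_cvg (fun n => (t n - h n) *: evec i) x.
      under eq_fun do rewrite scalerBl addrA.
      apply => n; apply: le_trans (norm_evec_le _ _) _; have [/andP[t0 th] _] := Ht n.
      by rewrite ler0_norm ?subr_le0// opprB lerBlDr lerDl.
    apply: cvgM; last by apply: (continuous_cvg _ (cpsi x)).
    rewrite -trq_diag; apply: trq_cvg; by apply: (continuous_cvg _ (cu x Omx)).
  - have := integrableZl mOm (2 * Mp) (integrable_abse (Om_sqint_integrable Om_open Om_bounded (sg i))).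
    by apply: eq_integrable; first exact: mOm.
have L3 : \int[lebN]_(x in Om) Q n x + \int[lebN]_(x in Om) (g i x * X n (x + t n *: evec i))
    @[n --> \oo] --> (0 : R).
  apply/cvgr0Pnorm_le => e e0'; near=> n.
  rewrite QE -key; have [_ H] := Ht n.
  have hn0 : h n != 0 by rewrite gt_eqF.
  rewrite -(mulKf hn0 (\int[lebN]_(x in Om) (g i x * X n (x + t n *: evec i)))) -mulrDr normrM.
  rewrite gtr0_norm ?invr_gt0// ler_pdivrMl//; apply: le_trans H _.
  by rewrite ler_pM2l//; apply: ltW; near: n; exact: (near_infty_natSinv_lt (PosNum e0')).
have H1 := cvg_lim (@Rhausdorff R) (cvgD L1 L2).
have H2 := cvg_lim (@Rhausdorff R) L3.
by apply/eqP; rewrite -addr_eq0; apply/eqP; exact: etrans (esym (H1 _ _)) (H2 _).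
Unshelve. all: by end_near. Qed.

End chain_rule.

(** * Square-integrable functions on Om *)

Section ae_domain.
Context {d : measure_display} {T : measurableType d} {R : realType}.
Variables (m : {measure set T -> \bar R}) (D : set T).
Implicit Types (P Q S : T -> Prop).

Lemma ae_dom_imp P Q : (forall x, D x -> P x -> Q x) ->
  {ae m, forall x, D x -> P x} -> {ae m, forall x, D x -> Q x}.
Proof. by move=> PQ; apply: filterS => x p Dx; apply: PQ => //; exact: p. Qed.

Lemma ae_dom_imp2 P Q S : (forall x, D x -> P x -> Q x -> S x) ->
  {ae m, forall x, D x -> P x} -> {ae m, forall x, D x -> Q x} ->
  {ae m, forall x, D x -> S x}.
Proof.
by move=> PQ; apply: filterS2 => x p q Dx; apply: PQ => //; [exact: p|exact: q].
Qed.

Lemma ae_dom_forall (P : nat -> T -> Prop) : (forall n, {ae m, forall x, D x -> P n x}) ->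
  {ae m, forall x, D x -> forall n, P n x}.
Proof. by move=> /ae_foralln; apply: filterS => x h Dx n; exact: h. Qed.

End ae_domain.

Section ae_in_theory.
Context {R : realType} {N : nat} (Om : set 'rV[R]_N).
Local Notation RN := 'rV[R]_N.
Implicit Types (u v : RN -> R).

Lemma ae_in_imp (P Q : RN -> Prop) : (forall x, Om x -> P x -> Q x) ->
  ae_in Om P -> ae_in Om Q.
Proof. exact: (@ae_dom_imp _ _ _ (@leb R N)). Qed.

Lemma ae_in_imp2 (P Q S : RN -> Prop) : (forall x, Om x -> P x -> Q x -> S x) ->
  ae_in Om P -> ae_in Om Q -> ae_in Om S.
Proof. exact: (@ae_dom_imp2 _ _ _ (@leb R N)). Qed.

Lemma ae_inT (P : RN -> Prop) : (forall x, Om x -> P x) -> ae_in Om P.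
Proof. by move=> H; rewrite /ae_in; apply: aeW => x; exact: H. Qed.

Lemma ae_in_forall (P : nat -> RN -> Prop) : (forall n, ae_in Om (P n)) ->
  ae_in Om (fun x => forall n, P n x).
Proof. exact: (@ae_dom_forall _ _ _ (@leb R N)). Qed.

End ae_in_theory.

(* Locked, because unfolding these makes unification compare measurable
   structures. *)
HB.lock Definition lsq {R : realType} {N : nat} (Om : set 'rV[R]_N) (u : 'rV[R]_N -> R) : Prop :=
  sqint (@leb R N) Om u.
HB.lock Definition ldot {R : realType} {N : nat} (Om : set 'rV[R]_N) (u v : 'rV[R]_N -> R) : R :=
  L2dot Om u v.
HB.lock Definition lcvg {R : realType} {N : nat} (Om : set 'rV[R]_N)
    (f : nat -> 'rV[R]_N -> R) (u : 'rV[R]_N -> R) : Prop :=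
  cvg2 (@leb R N) Om f u.

Section L2_theory.
Context {R : realType} {N : nat} (Om : set 'rV[R]_N).
Hypotheses (Om_open : open Om) (Om_bounded : bounded_set Om).
Local Notation RN := 'rV[R]_N.
Local Notation cara := (caratheodory_type (@lebesgue_outer R N)).
Local Notation lebN := (@leb R N).
Implicit Types (u v w : RN -> R).
Let mOm : measurable (Om : set cara) := mOm Om_open.

Lemma leb_complete : measure_is_complete lebN.
Proof. exact: measure_is_complete_caratheodory. Qed.

Local Notation sq := (lsq Om).
Local Notation dt := (ldot Om).
Local Notation lcvg := (lcvg Om).

Lemma lsqP u : L2 Om u <-> sq u.
Proof. rewrite ?lsq.unlock ?ldot.unlock ?lcvg.unlock; exact: L2_sqint. Qed.

Lemma lsq_measurable u : sq u -> measurable_in Om u.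
Proof. rewrite ?lsq.unlock ?ldot.unlock ?lcvg.unlock; by case. Qed.

Lemma lsq_ae u v : ae_in Om (fun x => u x = v x) -> sq u -> sq v.
Proof. rewrite ?lsq.unlock ?ldot.unlock ?lcvg.unlock; exact: (sqint_ae_eq leb_complete). Qed.

Lemma ldot_ae u v u' v' : ae_in Om (fun x => u x = u' x) -> ae_in Om (fun x => v x = v' x) ->
  dt u v = dt u' v'.
Proof. rewrite ?lsq.unlock ?ldot.unlock ?lcvg.unlock; exact: dot_ae_eq. Qed.

Lemma lsqD u v : sq u -> sq v -> sq (fun x => u x + v x).
Proof. rewrite ?lsq.unlock ?ldot.unlock ?lcvg.unlock; exact: sqintD. Qed.

Lemma lsqB u v : sq u -> sq v -> sq (fun x => u x - v x).
Proof. rewrite ?lsq.unlock ?ldot.unlock ?lcvg.unlock; exact: sqintB. Qed.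

Lemma lsqZ a u : sq u -> sq (fun x => a * u x).
Proof. rewrite ?lsq.unlock ?ldot.unlock ?lcvg.unlock; exact: sqintZ. Qed.

Lemma lsq0 : sq (fun=> 0).
Proof. rewrite ?lsq.unlock ?ldot.unlock ?lcvg.unlock; exact: sqint0. Qed.

Lemma lsq_bounded u (M : R) : measurable_in Om u -> (forall x, Om x -> `|u x| <= M) -> sq u.
Proof. rewrite ?lsq.unlock ?ldot.unlock ?lcvg.unlock; exact: bounded_sqint. Qed.

Lemma lsq_le u v (c : R) : measurable_in Om u -> (forall x, Om x -> u x ^+ 2 <= c * v x ^+ 2) ->
  sq v -> sq u.
Proof. by rewrite lsq.unlock => mu H sv; exact: (sqint_le (g := v) (c := c) mOm mu H sv). Qed.

Lemma ldotC u v : dt u v = dt v u.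
Proof. rewrite ?lsq.unlock ?ldot.unlock ?lcvg.unlock; exact: dotC. Qed.

Lemma ldot_ge0 u : 0 <= dt u u.
Proof. rewrite ?lsq.unlock ?ldot.unlock ?lcvg.unlock; exact: dot_ge0. Qed.

Lemma ldotDl u v w : sq u -> sq v -> sq w -> dt (fun x => u x + v x) w = dt u w + dt v w.
Proof. rewrite ?lsq.unlock ?ldot.unlock ?lcvg.unlock; exact: dotDl. Qed.

Lemma ldotBl u v w : sq u -> sq v -> sq w -> dt (fun x => u x - v x) w = dt u w - dt v w.
Proof. rewrite ?lsq.unlock ?ldot.unlock ?lcvg.unlock; exact: dotBl. Qed.

Lemma ldotBr u v w : sq u -> sq v -> sq w -> dt w (fun x => u x - v x) = dt w u - dt w v.
Proof. by move=> su sv sw; rewrite ldotC ldotBl// ldotC (ldotC v). Qed.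

Lemma ldotZl a u v : sq u -> sq v -> dt (fun x => a * u x) v = a * dt u v.
Proof. rewrite ?lsq.unlock ?ldot.unlock ?lcvg.unlock; exact: dotZl. Qed.

Lemma ldotZr a u v : sq u -> sq v -> dt u (fun x => a * v x) = a * dt u v.
Proof. by move=> su sv; rewrite ldotC ldotZl// ldotC. Qed.

Lemma ldot0 u : dt (fun=> 0) u = 0.
Proof.
by rewrite ldot.unlock /L2dot; under eq_Rintegral do rewrite mul0r; rewrite /Rintegral integral0.
Qed.

Lemma ldotB_self u v : sq u -> sq v ->
  dt (fun x => u x - v x) (fun x => u x - v x) = dt u u - 2 * dt u v + dt v v.
Proof. rewrite ?lsq.unlock ?ldot.unlock ?lcvg.unlock; exact: dot_sub_self. Qed.

Lemma ldotD_le u v : sq u -> sq v ->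
  dt (fun x => u x + v x) (fun x => u x + v x) <= 2 * (dt u u + dt v v).
Proof. rewrite ?lsq.unlock ?ldot.unlock ?lcvg.unlock; exact: dot_add_self_le. Qed.

Lemma ldot_CS u v : sq u -> sq v -> dt u v ^+ 2 <= dt u u * dt v v.
Proof. rewrite ?lsq.unlock ?ldot.unlock ?lcvg.unlock; exact: dot_CS. Qed.

Lemma ldot_CS_sqrt u v : sq u -> sq v ->
  `|dt u v| <= Num.sqrt (dt u u) * Num.sqrt (dt v v).
Proof. rewrite ?lsq.unlock ?ldot.unlock ?lcvg.unlock; exact: dot_CS_sqrt. Qed.

Lemma ldot_le u v (c : R) : 0 <= c -> sq u -> sq v ->
  (forall x, Om x -> u x ^+ 2 <= c * v x ^+ 2) -> dt u u <= c * dt v v.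
Proof. by rewrite lsq.unlock ldot.unlock => c0 su sv H; exact: (le_dot_self mOm c0 su sv H). Qed.

Lemma ldot_self_eq0 u : sq u -> dt u u = 0 -> ae_in Om (fun x => u x = 0).
Proof. rewrite ?lsq.unlock ?ldot.unlock ?lcvg.unlock; exact: dot_self_eq0. Qed.

Lemma lsq_dotE u : sq u -> (\int[lebN]_(x in Om) (u x ^+ 2)%:E)%E = (dt u u)%:E.
Proof. rewrite ?lsq.unlock ?ldot.unlock ?lcvg.unlock; exact: sqint_dotE. Qed.

Lemma lcvg_dot f u v : (forall n, sq (f n)) -> sq u -> sq v -> lcvg f u ->
  dt (f n) v @[n --> \oo] --> dt u v.
Proof. rewrite ?lsq.unlock ?ldot.unlock ?lcvg.unlock; exact: cvg2_dot. Qed.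

Lemma lcvg_ae_subseq f u : (forall n, sq (f n)) -> sq u -> lcvg f u ->
  exists phi : nat -> nat, (forall n, (n <= phi n)%N) /\
    ae_in Om (fun x => f (phi n) x @[n --> \oo] --> u x).
Proof. rewrite ?lsq.unlock ?ldot.unlock ?lcvg.unlock; exact: cvg2_ae_subseq. Qed.

Lemma L2_complete f : (forall n, sq (f n)) ->
  (forall e : R, 0 < e -> exists n0, forall n k, (n0 <= n)%N -> (n0 <= k)%N ->
     dt (fun x => f n x - f k x) (fun x => f n x - f k x) <= e) ->
  exists u, sq u /\ lcvg f u.
Proof.
rewrite lsq.unlock ldot.unlock lcvg.unlock => sf H.
have [u [su Hu]] := riesz_fischer mOm sf H.
exists u; split=> //; apply/cvgrPdist_le => e e0.
have [n0 Hn] := Hu e e0; exists n0 => // n /= nn; rewrite sub0r normrN.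
by rewrite ger0_norm; [exact: Hn|exact: dot_ge0].
Qed.

Lemma ldotE u v : dt u v = \int[lebN]_(x in Om) (u x * v x).
Proof. rewrite ?lsq.unlock ?ldot.unlock ?lcvg.unlock; by []. Qed.

Lemma lsqE u : sq u -> sqint lebN Om u.
Proof. rewrite ?lsq.unlock ?ldot.unlock ?lcvg.unlock; by []. Qed.

Lemma lcvgE f u : lcvg f u <->
  (dt (fun x => f n x - u x) (fun x => f n x - u x) @[n --> \oo] --> (0 : R)).
Proof. rewrite ?lsq.unlock ?ldot.unlock ?lcvg.unlock; by []. Qed.

End L2_theory.

(** * The space W12tilde *)

Section sobolev_space.
Context {R : realType} {N : nat} (Om : set 'rV[R]_N).
Hypotheses (Om_open : open Om) (Om_bounded : bounded_set Om).
Local Notation RN := 'rV[R]_N.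
Local Notation cara := (caratheodory_type (@lebesgue_outer R N)).
Local Notation lebN := (@leb R N).
Local Notation sq := (lsq Om).
Local Notation dt := (ldot Om).
Local Notation cv := (lcvg Om).
Implicit Types (u v : RN -> R) (g k : 'I_N -> RN -> R).
Local Notation sqD := (lsqD Om_open).
Local Notation sqB := (lsqB Om_open).
Local Notation sqZ := (lsqZ Om_open).

Lemma W12_sq u : W12 Om u -> sq u.
Proof. by move=> [/lsqP]. Qed.

Lemma wg_sq u g i : weak_gradient Om u g -> sq (g i).
Proof. by move=> [/(_ i)/lsqP]. Qed.

Lemma test_fun_sq phi : test_fun Om phi -> sq phi.
Proof.
move=> tphi; have [M HM] := test_fun_bounded tphi.
apply: (lsq_bounded Om_open Om_bounded (M := M)) => [|x _]; last exact: HM.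
exact: test_fun_measurable.
Qed.

Lemma test_fun_derive_sq phi i : test_fun Om phi -> sq ('D_(evec i) phi).
Proof.
move=> tphi; have [M HM] := test_fun_derive_bounded i tphi.
apply: (lsq_bounded Om_open Om_bounded (M := M)) => [|x _]; last exact: HM.
apply: (continuous_measurable_in Om_open); exact: test_fun_derive_continuous tphi.
Qed.

Lemma wg_dot u g phi i : weak_gradient Om u g -> test_fun Om phi ->
  dt u ('D_(evec i) phi) = - dt (g i) phi.
Proof. by move=> [_ H] tphi; rewrite !ldotE; exact: H. Qed.

Lemma wg_unique u g k : weak_gradient Om u g -> weak_gradient Om u k ->
  forall i, ae_in Om (fun x => g i x = k i x).
Proof.
move=> wg wk i; have sg := wg_sq i wg; have sk := wg_sq i wk.
have : ae_in Om (fun x => g i x - k i x = 0).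
  apply: (fundamental_lemma Om_open Om_bounded (lsqE (sqB sg sk))) => phi tphi.
  have sphi := test_fun_sq tphi.
  rewrite -ldotE ldotBl//.
  apply/eqP; rewrite subr_eq0; apply/eqP; apply: oppr_inj.
  by rewrite -(wg_dot i wg tphi) -(wg_dot i wk tphi).
by apply: ae_in_imp => x _ h; apply/eqP; rewrite -subr_eq0; apply/eqP; exact: h.
Qed.

Lemma wg_lin a u v g k : sq u -> sq v -> weak_gradient Om u g -> weak_gradient Om v k ->
  weak_gradient Om (fun x => a * u x + v x) (fun i x => a * g i x + k i x).
Proof.
move=> su sv wg wk; split=> [i|phi i tphi].
  apply/lsqP; exact: (sqD (sqZ a (wg_sq i wg)) (wg_sq i wk)).
have sphi := test_fun_sq tphi; have sD := test_fun_derive_sq i tphi.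
have E f h l : sq f -> sq h -> sq l ->
  \int[lebN]_(x in Om) ((a * f x + h x) * l x) = a * dt f l + dt h l.
  move=> sf sh sl; rewrite -ldotE.
  by rewrite (ldotDl Om_open (sqZ a sf) sh sl) (ldotZl Om_open a sf sl).
rewrite (E _ _ _ su sv sD) (E _ _ _ (wg_sq i wg) (wg_sq i wk) sphi).
by rewrite (wg_dot i wg tphi) (wg_dot i wk tphi); ring.
Qed.

(** Stated as an equality of sets, so that [get] picks literally the same gradient for both
    functions. *)
Lemma wg_ae u v : ae_in Om (fun x => u x = v x) ->
  (weak_gradient Om u : set _) = weak_gradient Om v.
Proof.
move=> uv; apply/seteqP; split=> g [sg wg]; split=> // phi i tphi; rewrite -wg//;
  by apply: Rintegral_ae_eq; move: uv; apply: ae_in_imp => x _ ->.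
Qed.

Lemma grad_ae_eq u v : ae_in Om (fun x => u x = v x) -> grad Om u = grad Om v.
Proof. by move=> uv; rewrite /grad (wg_ae uv). Qed.

Lemma W12_grad u : W12 Om u -> weak_gradient Om u (grad Om u).
Proof. by move=> [_ H]; exact: getPex. Qed.

Lemma grad_ae u g i : weak_gradient Om u g -> ae_in Om (fun x => grad Om u i x = g i x).
Proof. by move=> wg; apply: (wg_unique (u := u)) => //; apply: getPex; exists g. Qed.

Local Opaque grad.

Lemma grad_sq u i : W12 Om u -> sq (grad Om u i).
Proof. by move=> /W12_grad; exact: wg_sq. Qed.

Lemma W12_ae u v : ae_in Om (fun x => u x = v x) -> W12 Om u -> W12 Om v.
Proof.
move=> uv [Lu [g wg]]; split; first by apply/lsqP; apply: lsq_ae uv _; exact/lsqP.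
by exists g; rewrite -(wg_ae uv).
Qed.

Lemma W12_of_wg u g : sq u -> weak_gradient Om u g -> W12 Om u.
Proof. by move=> su wg; split; [exact/lsqP|exists g]. Qed.

Lemma W12_lin a u v : W12 Om u -> W12 Om v -> W12 Om (fun x => a * u x + v x).
Proof.
move=> Wu Wv; have su := W12_sq Wu; have sv := W12_sq Wv.
apply: W12_of_wg (wg_lin a su sv (W12_grad Wu) (W12_grad Wv)).
exact: (sqD (sqZ a su) sv).
Qed.

Lemma W12B u v : W12 Om u -> W12 Om v -> W12 Om (fun x => u x - v x).
Proof.
move=> Wu Wv; have := W12_lin (-1) Wv Wu; congr W12.
by apply/funext => x; ring.
Qed.

Lemma wg0 : weak_gradient Om (fun=> 0) (fun _ _ => 0).
Proof.
split=> [i|phi i tphi]; first by apply/lsqP; exact: lsq0.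
by rewrite -!ldotE !ldot0 oppr0.
Qed.

Lemma W120 : W12 Om (fun=> 0).
Proof.
apply: (@W12_of_wg _ (fun _ _ => 0)); first exact: lsq0.
exact: wg0.
Qed.

Definition n2 u : R := dt u u + \sum_(i < N) dt (grad Om u i) (grad Om u i).

Lemma n2_ge0 u : 0 <= n2 u.
Proof. by rewrite addr_ge0 ?ldot_ge0// sumr_ge0// => i _; exact: ldot_ge0. Qed.

Lemma n2_dot_le u : dt u u <= n2 u.
Proof. by rewrite lerDl sumr_ge0// => i _; exact: ldot_ge0. Qed.

Lemma n2E u g : weak_gradient Om u g -> n2 u = dt u u + \sum_(i < N) dt (g i) (g i).
Proof.
move=> wg; congr (_ + _); apply: eq_bigr => i _.
by apply: ldot_ae; exact: grad_ae.
Qed.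

Lemma n2_ae u v : ae_in Om (fun x => u x = v x) -> n2 u = n2 v.
Proof. by move=> uv; rewrite /n2 (grad_ae_eq uv) (ldot_ae uv uv). Qed.

Lemma W12norm2E u : W12 Om u -> W12norm2 Om u = (n2 u)%:E.
Proof.
move=> Wu; have su := W12_sq Wu.
have H (r : seq 'I_N) :
  lebN.-integrable Om (EFin \o (fun x => \sum_(i <- r) grad Om u i x ^+ 2)) /\
  \int[lebN]_(x in Om) (\sum_(i <- r) grad Om u i x ^+ 2) =
  \sum_(i <- r) dt (grad Om u i) (grad Om u i).
  elim: r => [|i r [ih1 ih2]].
    split; last by rewrite big_nil; under eq_Rintegral do rewrite big_nil; rewrite /Rintegral integral0.
    have := integrable0 lebN Om; apply: eq_integrable; first exact: (mOm Om_open).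
    by move=> x _; rewrite /= big_nil.
  have i1 := sqint_sq_integrable (lsqE (grad_sq i Wu)).
  split.
    have := integrableD (mOm Om_open) i1 ih1; apply: eq_integrable; first exact: (mOm Om_open).
    by move=> x _; rewrite /= big_cons.
  rewrite big_cons -ih2.
  have i2 := sqint_mul_integrable (mOm Om_open) (lsqE (grad_sq i Wu)) (lsqE (grad_sq i Wu)).
  rewrite ldotE -(RintegralD (mOm Om_open) i2 ih1).
  by apply: eq_Rintegral => x _; rewrite big_cons expr2.
have [i1 E1] := H (index_enum _).
have i0 := sqint_sq_integrable (lsqE su).
rewrite /W12norm2 /n2 -E1 (_ : dt u u = \int[lebN]_(x in Om) (u x ^+ 2)); last first.
  by rewrite ldotE; apply: eq_Rintegral => x _; rewrite expr2.
rewrite -(RintegralD (mOm Om_open) i0 i1) /Rintegral fineK//.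
exact: (integrable_fin_num (mOm Om_open) (integrableD (mOm Om_open) i0 i1)).
Qed.

Lemma W12norm2_lt u (e : R) : W12 Om u -> (W12norm2 Om u < e%:E)%E = (n2 u < e).
Proof. by move=> Wu; rewrite W12norm2E// lte_fin. Qed.

Lemma n2_lin_le a u v : W12 Om u -> W12 Om v ->
  n2 (fun x => a * u x + v x) <= 2 * (a ^+ 2 * n2 u + n2 v).
Proof.
move=> Wu Wv; have su := W12_sq Wu; have sv := W12_sq Wv.
rewrite (n2E (wg_lin a su sv (W12_grad Wu) (W12_grad Wv))).
have E f h : sq f -> sq h -> dt (fun x => a * f x + h x) (fun x => a * f x + h x) <=
   2 * (a ^+ 2 * dt f f + dt h h).
  move=> sf sh; apply: le_trans (ldotD_le Om_open (sqZ a sf) sh) _.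
  have saf := sqZ a sf; rewrite (ldotZl Om_open a sf saf) (ldotZr Om_open a sf sf).
  by rewrite mulrA expr2.
have S : \sum_(i < N) dt (fun x => a * grad Om u i x + grad Om v i x)
      (fun x => a * grad Om u i x + grad Om v i x) <=
    \sum_(i < N) 2 * (a ^+ 2 * dt (grad Om u i) (grad Om u i) + dt (grad Om v i) (grad Om v i)).
  by apply: ler_sum => i _; apply: E; exact: grad_sq.
apply: le_trans (lerD (E _ _ su sv) S) _.
rewrite -mulr_sumr big_split/= -mulr_sumr /n2 -mulrDr ler_pM2l ?ltr0n//.
by rewrite mulrDr addrACA.
Qed.

Lemma n2D_le u v : W12 Om u -> W12 Om v -> n2 (fun x => u x + v x) <= 2 * (n2 u + n2 v).
Proof.
move=> Wu Wv; have := n2_lin_le 1 Wu Wv; rewrite expr1n mul1r.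
by under eq_fun do rewrite mul1r.
Qed.

Lemma n2Z_le a u : W12 Om u -> n2 (fun x => a * u x) = a ^+ 2 * n2 u.
Proof.
move=> Wu; have su := W12_sq Wu.
have w0 : weak_gradient Om (fun=> 0) (fun _ _ => 0).
  exact: wg0.
have := n2E (wg_lin a su (lsq0 Om) (W12_grad Wu) w0).
rewrite (_ : (fun x => a * u x + 0) = (fun x => a * u x)); last by apply/funext => x; rewrite addr0.
move=> ->; rewrite /n2 mulrDr mulr_sumr; congr (_ + _).
  by rewrite (ldotZl Om_open a su (sqZ a su)) (ldotZr Om_open a su su) mulrA expr2.
apply: eq_bigr => i _; rewrite (_ : (fun x => a * grad Om u i x + 0) = (fun x => a * grad Om u i x)).
  have sg := grad_sq i Wu.
  by rewrite (ldotZl Om_open a sg (sqZ a sg)) (ldotZr Om_open a sg sg) mulrA expr2.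
by apply/funext => x; rewrite addr0.
Qed.

Lemma weak_gradient_limit (f : nat -> RN -> R) (G : nat -> 'I_N -> RN -> R) u g :
  (forall n, sq (f n)) -> sq u -> (forall n, weak_gradient Om (f n) (G n)) ->
  (forall i, sq (g i)) -> cv f u -> (forall i, cv (fun n => G n i) (g i)) ->
  weak_gradient Om u g.
Proof.
move=> sf su wG sg fu Gg; split=> [i|phi i tphi]; first exact/lsqP.
have L1 := lcvg_dot Om_open sf su (test_fun_derive_sq i tphi) fu.
have L2 := lcvg_dot Om_open (fun n => wg_sq i (wG n)) (sg i) (test_fun_sq tphi) (Gg i).
have L3 : dt (f n) ('D_(evec i) phi) @[n --> \oo] --> - dt (g i) phi.
  under eq_fun do rewrite (wg_dot i (wG _) tphi).
  exact: cvgN.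
rewrite -!ldotE; exact: (cvg_unique _ L1 L3).
Qed.

Lemma cvg0_le (a b : nat -> R) (c : R) : (forall n, 0 <= a n) -> (forall n, a n <= c * b n) ->
  b n @[n --> \oo] --> (0 : R) -> a n @[n --> \oo] --> (0 : R).
Proof.
move=> a0 ab b0.
apply: (@squeeze_cvgr _ _ _ _ (fun=> 0) (fun n => c * b n)); last 2 first.
- exact: cvg_cst.
- by rewrite -[X in _ --> X](mulr0 c); apply: cvgM => //; exact: cvg_cst.
by apply: nearW => n; rewrite a0 ab.
Qed.

Lemma eq_cvg_seq (a b : nat -> R) (l : R) : a =1 b -> b n @[n --> \oo] --> l ->
  a n @[n --> \oo] --> l.
Proof. by move=> /funext ->. Qed.

Lemma lcvg_le (f h : nat -> RN -> R) u w (c : R) : 0 <= c ->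
  (forall n, sq (f n)) -> sq u -> (forall n, sq (h n)) -> sq w ->
  (forall n x, Om x -> (f n x - u x) ^+ 2 <= c * (h n x - w x) ^+ 2) ->
  cv h w -> cv f u.
Proof.
move=> c0 sf su sh sw H /lcvgE hw; apply/lcvgE.
apply: (cvg0_le (c := c)) hw => n; first exact: ldot_ge0.
by apply: (ldot_le Om_open c0 (sqB (sf n) su) (sqB (sh n) sw)) => x Omx; exact: H.
Qed.

Lemma lsq_bounded_mul (w u : RN -> R) (M : R) : measurable_in Om w ->
  (forall x, `|w x| <= M) -> sq u ->
  sq (fun x => w x * u x) /\ dt (fun x => w x * u x) (fun x => w x * u x) <= M ^+ 2 * dt u u.
Proof.
move=> mw wM su.
have H x : Om x -> (w x * u x) ^+ 2 <= M ^+ 2 * u x ^+ 2.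
  move=> _; rewrite exprMn ler_wpM2r ?sqr_ge0// -[w x ^+ 2]real_normK ?num_real//.
  by rewrite lerXn2r// nnegrE ?(le_trans _ (wM x)).
have s : sq (fun x => w x * u x).
  by apply: (lsq_le Om_open _ H su); apply: measurable_inM => //; exact: lsq_measurable su.
by split=> //; apply: (ldot_le Om_open _ s su H); exact: sqr_ge0.
Qed.

Lemma Om_dominated_convergence_ae (f : nat -> RN -> R) (F G : RN -> R) :
  (forall n, measurable_in Om (f n)) -> measurable_in Om F ->
  ae_in Om (fun x => f n x @[n --> \oo] --> F x) ->
  lebN.-integrable Om (EFin \o G) ->
  (forall n x, Om x -> `|f n x| <= G x) ->
  \int[lebN]_(x in Om) f n x @[n --> \oo] --> \int[lebN]_(x in Om) F x.
Proof. exact: (@Rintegral_dominated_convergence _ _ _ lebN Om f F G (mOm Om_open)). Qed.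

Lemma lcvg_bounded_mul (w : nat -> RN -> R) (w0 u : RN -> R) (M : R) :
  (forall n, measurable_in Om (w n)) -> measurable_in Om w0 ->
  (forall n x, `|w n x| <= M) -> (forall x, `|w0 x| <= M) -> sq u ->
  ae_in Om (fun x => w n x @[n --> \oo] --> w0 x) ->
  cv (fun n x => w n x * u x) (fun x => w0 x * u x).
Proof.
move=> mw mw0 wM w0M su ww; apply/lcvgE.
apply: (eq_cvg_seq (fun n => ldotE _ _ _)).
have -> : (0 : R) = \int[lebN]_(x in Om) (0 : R) by rewrite /Rintegral integral0.
have M0 (x : RN) : 0 <= M by exact: le_trans (w0M x).
apply: (Om_dominated_convergence_ae (G := fun x => (2 * M) ^+ 2 * u x ^+ 2)).
- move=> n; have m1 : measurable_in Om (fun x => w n x * u x - w0 x * u x).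
    by apply: measurable_inB; apply: measurable_inM => //; exact: lsq_measurable su.
  exact: (measurable_inM m1 m1).
- exact: measurable_cst.
- move: ww; apply: ae_in_imp => x Omx cw.
  rewrite [X in _ --> X](_ : 0 = (w0 x * u x - w0 x * u x) * (w0 x * u x - w0 x * u x)); last first.
    by rewrite subrr mul0r.
  by apply: cvgM; apply: cvgB; try exact: cvg_cst; apply: cvgM => //; exact: cvg_cst.
- apply: (integrableZl (mOm Om_open) _ (sqint_sq_integrable (lsqE su))).
move=> n x _; rewrite -mulrBl mulrACA -!expr2 ger0_norm; last first.
  by rewrite mulr_ge0// sqr_ge0.
rewrite ler_wpM2r ?sqr_ge0// -[(w n x - _) ^+ 2]real_normK ?num_real//.
rewrite lerXn2r// ?nnegrE ?mulr_ge0 ?(M0 x)//.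
by apply: le_trans (ler_normB _ _) _; rewrite mulr_natl lerD.
Qed.

Lemma n2_weak_gradientB u v g k : sq u -> sq v -> weak_gradient Om u g -> weak_gradient Om v k ->
  n2 (fun x => u x - v x) = dt (fun x => u x - v x) (fun x => u x - v x) +
    \sum_(i < N) dt (fun x => g i x - k i x) (fun x => g i x - k i x).
Proof.
move=> su sv wg wk; have := n2E (wg_lin (-1) sv su wk wg).
have E (a b : RN -> R) : (fun x => -1 * b x + a x) = (fun x => a x - b x).
  by apply/funext => x; rewrite mulN1r addrC.
by rewrite E => ->; under eq_bigr do rewrite E.
Qed.

Lemma n2_cvg (f : nat -> RN -> R) (G : nat -> 'I_N -> RN -> R) u g :
  (forall n, sq (f n)) -> sq u -> (forall n, weak_gradient Om (f n) (G n)) ->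
  weak_gradient Om u g -> cv f u -> (forall i, cv (fun n => G n i) (g i)) ->
  n2 (fun x => f n x - u x) @[n --> \oo] --> (0 : R).
Proof.
move=> sf su wG wg fu Gg.
apply: (eq_cvg_seq (fun n => n2_weak_gradientB (sf n) su (wG n) wg)).
rewrite -[X in _ --> X]addr0; apply: cvgD; first exact/lcvgE.
elim: (index_enum _) => [|i r ih].
  by apply: (eq_cvg_seq (fun n => big_nil _ _ _ _)); exact: cvg_cst.
apply: (eq_cvg_seq (fun n => big_cons _ _ _ _ _ _)).
by rewrite -[X in _ --> X]addr0; apply: cvgD ih; exact/lcvgE.
Qed.

Lemma W12_complete (f : nat -> RN -> R) : (forall n, W12 Om (f n)) ->
  (forall e : R, 0 < e -> exists n0, forall n m : nat, (n0 <= n)%N -> (n0 <= m)%N ->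
     n2 (fun x => f n x - f m x) <= e) ->
  exists u, W12 Om u /\ (n2 (fun x => f n x - u x) @[n --> \oo] --> (0 : R)).
Proof.
move=> Wf H; have sf n := W12_sq (Wf n).
have [u [su fu]] : exists u, sq u /\ cv f u.
  apply: (L2_complete Om_open sf) => e e0; have [n0 Hn] := H e e0.
  by exists n0 => n k nn nk; apply: le_trans (n2_dot_le _) _; exact: Hn.
have /choice[g Hg] : forall i, exists h : RN -> R, sq h /\ cv (fun n => grad Om (f n) i) h.
  move=> i; apply: (L2_complete Om_open (fun n => grad_sq i (Wf n))) => e e0.
  have [n0 Hn] := H e e0; exists n0 => n k nn nk; apply: le_trans (Hn _ _ nn nk).
  rewrite (n2_weak_gradientB (sf n) (sf k) (W12_grad (Wf n)) (W12_grad (Wf k))).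
  rewrite (bigD1 i)//= addrCA lerDl addr_ge0 ?ldot_ge0// sumr_ge0// => j _.
  exact: ldot_ge0.
have wg : weak_gradient Om u g.
  apply: (weak_gradient_limit sf su (fun n => W12_grad (Wf n))) fu _ => i.
    by have [] := Hg i.
  by have [] := Hg i.
exists u; split; first exact: W12_of_wg su wg.
by apply: n2_cvg sf su (fun n => W12_grad (Wf n)) wg fu _ => i; have [] := Hg i.
Qed.

Lemma W12C_lin a u v : W12C Om u -> W12C Om v -> W12C Om (fun x => a * u x + v x).
Proof.
move=> [Wu cu] [Wv cv]; split; first exact: W12_lin.
move=> x; apply: cvgD; last exact: cv.
by apply: cvgM; [exact: cvg_cst|exact: cu].
Qed.

Lemma W12tilde_W12 u : W12tilde Om u -> W12 Om u.
Proof. by case. Qed.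

Lemma n2_sub_self u : n2 (fun x => u x - u x) = 0.
Proof.
rewrite (n2E (g := fun _ _ => 0)); last first.
  by rewrite (_ : (fun x => _) = fun=> 0); [exact: wg0|apply/funext => x; rewrite subrr].
rewrite (_ : (fun x => u x - u x) = fun=> 0); last by apply/funext => x; rewrite subrr.
by rewrite ldot0 add0r big1// => i _; exact: ldot0.
Qed.

Lemma W12tildeP u : W12tilde Om u <-> W12 Om u /\ forall e : R, 0 < e ->
  exists v, W12C Om v /\ n2 (fun x => u x - v x) < e.
Proof.
split=> -[Wu H]; split=> // e e0; have [v [Cv h]] := H e e0; exists v; split=> //.
  by rewrite -W12norm2_lt//; apply: W12B => //; case: Cv.
by rewrite W12norm2_lt//; apply: W12B => //; case: Cv.
Qed.

Lemma W12C_tilde u : W12C Om u -> W12tilde Om u.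
Proof.
move=> Cu; apply/W12tildeP; split; first by case: Cu.
by move=> e e0; exists u; rewrite n2_sub_self.
Qed.

(** The rate is that of [ae_small_of_fast]; taking every second term turns it into [64^-n]. *)
Lemma W12tilde_seq u : W12tilde Om u ->
  exists v : nat -> RN -> R, (forall n, W12C Om (v n)) /\
    forall n, n2 (fun x => u x - v n x) <= 8^-1 ^+ n.
Proof.
move=> /W12tildeP[_ H].
have /choice[v Hv] : forall n : nat, exists v, W12C Om v /\ n2 (fun x => u x - v x) <= 8^-1 ^+ n.
  by move=> n; have [|v [? /ltW ?]] := H (8^-1 ^+ n); [rewrite exprn_gt0|exists v].
by exists v; split=> n; have [] := Hv n.
Qed.

Lemma n2_sub_triangle u v w : W12 Om u -> W12 Om v -> W12 Om w ->
  n2 (fun x => u x - w x) <= 2 * (n2 (fun x => u x - v x) + n2 (fun x => v x - w x)).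
Proof.
move=> Wu Wv Ww; have := n2D_le (W12B Wu Wv) (W12B Wv Ww).
by rewrite (_ : (fun x => _ + _) = (fun x => u x - w x))//; apply/funext => x; rewrite subrKA.
Qed.

Lemma n2_subC u v : W12 Om u -> W12 Om v ->
  n2 (fun x => u x - v x) = n2 (fun x => v x - u x).
Proof.
move=> Wu Wv; have := n2Z_le (-1) (W12B Wu Wv); rewrite sqrrN expr1n mul1r => <-.
by congr n2; apply/funext => x; ring.
Qed.

Lemma W12tilde_closed (f : nat -> RN -> R) u : (forall n, W12tilde Om (f n)) -> W12 Om u ->
  n2 (fun x => f n x - u x) @[n --> \oo] --> (0 : R) -> W12tilde Om u.
Proof.
move=> Tf Wu fu; apply/W12tildeP; split=> // e e0.
have e4 : 0 < e / 4 by rewrite divr_gt0.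
have /cvgrPdist_lt/(_ _ e4)[n0 _ /(_ n0 (leqnn n0))] := fu.
rewrite /= sub0r normrN ger0_norm ?n2_ge0// => h1.
have /W12tildeP[Wf /(_ _ e4)[v [Cv h2]]] := Tf n0.
exists v; split=> //; have Wv : W12 Om v by case: Cv.
apply: le_lt_trans (n2_sub_triangle Wu Wf Wv) _.
by rewrite n2_subC//; lra.
Qed.

Lemma W12tilde_lin a u v : W12tilde Om u -> W12tilde Om v -> W12tilde Om (fun x => a * u x + v x).
Proof.
move=> Tu Tv; have [f [Cf fu]] := W12tilde_seq Tu; have [h [Ch hv]] := W12tilde_seq Tv.
have Wu := W12tilde_W12 Tu; have Wv := W12tilde_W12 Tv.
apply: (W12tilde_closed (f := fun n x => a * f n x + h n x)).
- by move=> n; apply: W12C_tilde; exact: W12C_lin.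
- exact: W12_lin.
have geo : (8^-1 : R) ^+ n @[n --> \oo] --> (0 : R).
  by apply: cvg_expr; rewrite ger0_norm// invf_lt1// ltr1n.
apply: (cvg0_le (c := 2 * (a ^+ 2 + 1))) geo => n; first exact: n2_ge0.
have Wf : W12 Om (f n) by case: (Cf n).
have Wh : W12 Om (h n) by case: (Ch n).
rewrite (_ : (fun x => _) = (fun x => a * (f n x - u x) + (h n x - v x))); last first.
  by apply/funext => x; ring.
apply: le_trans (n2_lin_le _ (W12B Wf Wu) (W12B Wh Wv)) _.
rewrite -mulrA ler_wpM2l// mulrDl mul1r n2_subC// (n2_subC Wh)// lerD ?hv//.
by rewrite ler_wpM2l ?sqr_ge0.
Qed.

Lemma W12tilde_ae u v : ae_in Om (fun x => u x = v x) -> W12tilde Om u -> W12tilde Om v.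
Proof.
move=> uv /W12tildeP[Wu H]; apply/W12tildeP; split; first exact: W12_ae Wu.
move=> e /H[w [Cw h]]; exists w; split=> //; apply: le_lt_trans h.
by rewrite le_eqVlt (n2_ae (v := fun x => v x - w x)) ?eqxx//; apply: ae_in_imp uv => x _ ->.
Qed.

Lemma W12tildeB u v : W12tilde Om u -> W12tilde Om v -> W12tilde Om (fun x => u x - v x).
Proof.
move=> Tu Tv; have := W12tilde_lin (-1) Tv Tu; congr W12tilde.
by apply/funext => x; ring.
Qed.

Lemma W12tildeD u v : W12tilde Om u -> W12tilde Om v -> W12tilde Om (fun x => u x + v x).
Proof.
move=> Tu Tv; have := W12tilde_lin 1 Tu Tv; congr W12tilde.
by apply/funext => x; ring.
Qed.

Lemma W12tilde0 : W12tilde Om (fun=> 0).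
Proof.
by apply: W12C_tilde; split; [exact: W120|move=> x; exact: cvg_cst].
Qed.

Lemma W12tilde_complete (f : nat -> RN -> R) : (forall n, W12tilde Om (f n)) ->
  (forall e : R, 0 < e -> exists n0, forall n m : nat, (n0 <= n)%N -> (n0 <= m)%N ->
     n2 (fun x => f n x - f m x) <= e) ->
  exists u, W12tilde Om u /\ (n2 (fun x => f n x - u x) @[n --> \oo] --> (0 : R)).
Proof.
move=> Tf /(W12_complete (fun n => W12tilde_W12 (Tf n)))[u [Wu fu]].
by exists u; split=> //; exact: W12tilde_closed fu.
Qed.

Lemma measurable_in_comp (F : R -> R) u : continuous F -> measurable_in Om u ->
  measurable_in Om (fun x => F (u x)).
Proof.
by move=> cF mu; exact: (measurableT_comp (continuous_measurable_fun cF) mu).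
Qed.

Lemma W12C_tr u : W12C Om u ->
  weak_gradient Om (fun x => tr (u x)) (fun i x => dtr (u x) * grad Om u i x) /\
  W12C Om (fun x => tr (u x)).
Proof.
move=> [Wu cu]; have su := W12_sq Wu.
have w : weak_gradient Om (fun x => tr (u x)) (fun i x => dtr (u x) * grad Om u i x).
  apply: (chain_rule_tr Om_open Om_bounded (lsqE su)) (W12_grad Wu) => x Omx.
  have : {within Om, continuous u} by apply: continuous_subspaceW cu; exact: subset_closure.
  by rewrite continuous_open_subspace// => /(_ x); apply; rewrite inE.
split=> //; split; last by move=> x; apply: tr_continuous; exact: cu.
apply: W12_of_wg w; apply: (lsq_bounded Om_open Om_bounded (M := 2)).
  by apply: measurable_in_comp; [move=> s; exact: tr_continuous|exact: lsq_measurable su].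
by move=> x _; rewrite ger0_norm ?tr_ge0 ?tr_le2.
Qed.

(* Truncation by the smooth bounded function [tr] is what makes it possible to
   work with nonnegative functions in the capacity. *)
Lemma W12tilde_tr u : W12tilde Om u ->
  W12tilde Om (fun x => tr (u x)) /\ n2 (fun x => tr (u x)) <= 4 * n2 u.
Proof.
move=> Tu; have Wu := W12tilde_W12 Tu; have su := W12_sq Wu.
have mu := lsq_measurable su.
have [v [Cv vu]] := W12tilde_seq Tu.
have Wv n : W12 Om (v n) by case: (Cv n).
have geo : (8^-1 : R) ^+ n @[n --> \oo] --> (0 : R).
  by apply: cvg_expr; rewrite ger0_norm// invf_lt1// ltr1n.
have vu' n : n2 (fun x => v n x - u x) <= 1 * 8^-1 ^+ n by rewrite mul1r n2_subC.
have cvu : cv v u.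
  apply/lcvgE; apply: (cvg0_le (c := 1)) geo => n; first exact: ldot_ge0.
  exact: le_trans (n2_dot_le _) (vu' n).
have cvg i : cv (fun n => grad Om (v n) i) (grad Om u i).
  apply/lcvgE; apply: (cvg0_le (c := 1)) geo => n; first exact: ldot_ge0.
  apply: le_trans (vu' n).
  rewrite (n2_weak_gradientB (W12_sq (Wv n)) su (W12_grad (Wv n)) (W12_grad Wu)).
  rewrite (bigD1 i)//= addrCA lerDl addr_ge0 ?ldot_ge0// sumr_ge0// => j _.
  exact: ldot_ge0.
have [phi [phin aev]] := lcvg_ae_subseq Om_open (fun n => W12_sq (Wv n)) su cvu.
pose w n := v (phi n).
have phioo : phi n @[n --> \oo] --> \oo.
  move=> A [n0 _ An]; exists n0 => // n /= nn; apply: An => /=.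
  exact: leq_trans nn (phin n).
have ctr : continuous (@tr R) by move=> s; exact: tr_continuous.
have cdtr : continuous (@dtr R) by move=> s; exact: dtr_continuous.
have mw n : measurable_in Om (w n) by exact: lsq_measurable (W12_sq (Wv _)).
have str (z : RN -> R) : measurable_in Om z -> sq (fun x => tr (z x)).
  move=> mz; apply: (lsq_bounded Om_open Om_bounded (M := 2)).
    exact: measurable_in_comp.
  by move=> x _; rewrite ger0_norm ?tr_ge0 ?tr_le2.
have mdtr (z : RN -> R) : measurable_in Om z -> measurable_in Om (fun x => dtr (z x)).
  by move=> mz; exact: measurable_in_comp.
have bdtr (z : RN -> R) x : `|dtr (z x)| <= 2 by exact: dtr_bounded.
have sG n i := grad_sq i (Wv n).
have c1 : cv (fun n x => tr (w n x)) (fun x => tr (u x)).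
  apply: (lcvg_le (c := 4) (h := w) (w := u)) => //.
  - by move=> n; exact: str.
  - exact: str.
  - by move=> n; exact: W12_sq (Wv _).
  - move=> n x _; rewrite -real_normK ?num_real// -[(w n x - _) ^+ 2]real_normK ?num_real//.
    have -> : (4 : R) = 2 ^+ 2 by rewrite expr2; ring.
    by rewrite -exprMn lerXn2r ?nnegrE ?mulr_ge0// tr_lip.
  - move/lcvgE: cvu => cvu; apply/lcvgE; exact: (cvg_comp _ _ phioo cvu).
have s1 n i : sq (fun x => dtr (w n x) * grad Om (w n) i x).
  by have [] := lsq_bounded_mul (mdtr _ (mw n)) (bdtr (w n)) (grad_sq i (Wv (phi n))).
have s2 i : sq (fun x => dtr (u x) * grad Om u i x).
  by have [] := lsq_bounded_mul (mdtr _ mu) (bdtr u) (grad_sq i Wu).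
have s3 n i : sq (fun x => dtr (w n x) * grad Om u i x).
  by have [] := lsq_bounded_mul (mdtr _ (mw n)) (bdtr (w n)) (grad_sq i Wu).
have c2 i : cv (fun n x => dtr (w n x) * grad Om (w n) i x) (fun x => dtr (u x) * grad Om u i x).
  have c3 : cv (fun n x => dtr (w n x) * grad Om u i x) (fun x => dtr (u x) * grad Om u i x).
    apply: (lcvg_bounded_mul (M := 2)) => //.
    - by move=> n; exact: mdtr.
    - exact: mdtr.
    - exact: grad_sq.
    - by move: aev; apply: ae_in_imp => x _ h; exact: dtr_cvg.
  move/lcvgE: c3 => c3; have /lcvgE c4 := cvg i.
  have {}c4 := cvg_comp _ _ phioo c4.
  apply/lcvgE.
  apply: (cvg0_le (c := 2) (b := fun n => 4 * dt (fun x => grad Om (w n) i x - grad Om u i x)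
      (fun x => grad Om (w n) i x - grad Om u i x) +
      dt (fun x => dtr (w n x) * grad Om u i x - dtr (u x) * grad Om u i x)
      (fun x => dtr (w n x) * grad Om u i x - dtr (u x) * grad Om u i x))).
  - by move=> n; exact: ldot_ge0.
  - move=> n.
    have [q1 q2] := lsq_bounded_mul (mdtr _ (mw n)) (bdtr (w n))
      (sqB (sG (phi n) i) (grad_sq i Wu)).
    (* The first summand is small because the gradients converge and [dtr] is bounded, the second by
       dominated convergence along the almost everywhere convergent subsequence. *)
    rewrite (_ : (fun x => dtr (w n x) * grad Om (w n) i x - _) =
      (fun x => dtr (w n x) * (grad Om (v (phi n)) i x - grad Om u i x) +
        (dtr (w n x) * grad Om u i x - dtr (u x) * grad Om u i x))); last first.
      by apply/funext => x; rewrite /w; ring.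
    apply: le_trans (ldotD_le Om_open q1 (sqB (s3 n i) (s2 i))) _.
    rewrite ler_pM2l// lerD2r; apply: le_trans q2 _.
    by rewrite le_eqVlt; apply/orP; left; apply/eqP; rewrite /w; ring.
  - rewrite -[X in _ --> X](addr0 0) -[X in X + _](mulr0 4).
    by apply: cvgD c3; apply: cvgM c4; exact: cvg_cst.
have wG n : weak_gradient Om (fun x => tr (w n x)) (fun i x => dtr (w n x) * grad Om (w n) i x).
  by have [] := W12C_tr (Cv (phi n)).
have su' := str _ mu; have sw' n := str _ (mw n).
have wu := weak_gradient_limit sw' su' wG s2 c1 c2.
split.
  apply: (W12tilde_closed (f := fun n x => tr (w n x))).
  - by move=> n; apply: W12C_tilde; have [] := W12C_tr (Cv (phi n)).
  - exact: W12_of_wg wu.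
  - exact: n2_cvg sw' su' wG wu c1 c2.
rewrite (n2E wu) /n2 mulrDr lerD//.
  apply: (ldot_le Om_open _ su' su) => // x _.
  rewrite -real_normK ?num_real// -[u x ^+ 2]real_normK ?num_real//.
  have -> : (4 : R) = 2 ^+ 2 by rewrite expr2; ring.
  rewrite -exprMn lerXn2r ?nnegrE ?mulr_ge0//.
  by rewrite ger0_norm ?tr_ge0// tr_le.
rewrite mulr_sumr; apply: ler_sum => i _.
have [_] := lsq_bounded_mul (mdtr _ mu) (bdtr u) (grad_sq i Wu).
by rewrite (_ : 2 ^+ 2 = 4 :> R)//; ring.
Qed.

End sobolev_space.

(** * Capacity and quasi-continuity *)

Section continuous_on.
Context {R : realType} {N : nat}.
Local Notation RN := 'rV[R]_N.
Implicit Types (F G U : set RN) (f g : RN -> R).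

Definition cont_on F f : Prop := forall x, F x -> forall e : R, 0 < e ->
  exists d : R, 0 < d /\ forall y, F y -> `|x - y| < d -> `|f x - f y| < e.

Lemma cont_onP F f : {within F, continuous f} <-> cont_on F f.
Proof.
rewrite subspace_continuousP; split=> H x Fx.
  move=> e e0; have /cvgrPdist_lt/(_ e e0) := H x Fx.
  rewrite near_withinE => /nbhs_ballP[d /= d0 Hd]; exists d; split=> // y Fy xy.
  by apply: (Hd y) => //; rewrite -ball_normE.
apply/cvgrPdist_lt => e e0; have [d [d0 Hd]] := H x Fx e e0.
rewrite near_withinE; apply/nbhs_ballP; exists d => //= y; rewrite -ball_normE/= => xy Fy.
exact: Hd.
Qed.

Lemma cont_on_sub F G f : F `<=` G -> cont_on G f -> cont_on F f.
Proof.
move=> FG H x Fx e e0; have [d [d0 Hd]] := H x (FG _ Fx) e e0.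
by exists d; split=> // y Fy; apply: Hd; exact: FG.
Qed.

Lemma cont_onB F f g : cont_on F f -> cont_on F g -> cont_on F (fun x => f x - g x).
Proof.
move=> H K x Fx e e0; have e2 : 0 < e / 2 by rewrite divr_gt0.
have [d [d0 Hd]] := H x Fx _ e2; have [c [c0 Hc]] := K x Fx _ e2.
exists (Num.min d c); rewrite lt_min d0 c0; split=> // y Fy.
rewrite lt_min => /andP[/(Hd y Fy) h1 /(Hc y Fy) h2].
rewrite (_ : _ - _ = (f x - f y) - (g x - g y)); last by ring.
by apply: le_lt_trans (ler_normB _ _) _; rewrite [e]splitr ltrD.
Qed.

Lemma cont_on_preimage F f (P : set R) : open P -> cont_on F f ->
  exists G, open G /\ forall x, F x -> (G x <-> P (f x)).
Proof.
move=> oP H; exists [set y | exists x (d : R), `|x - y| < d /\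
  forall z, F z -> `|x - z| < d -> P (f z)]; split.
  rewrite openE => y [x [d [xy Hd]]]; apply/nbhs_ballP; exists (d - `|x - y|).
    by rewrite /= subr_gt0.
  move=> z; rewrite -ball_normE/= => yz; exists x, d; split=> //.
  by rewrite -(subrKA y); apply: le_lt_trans (ler_normD _ _) _; rewrite addrC -ltrBrDr.
move=> x Fx; split=> [[z [d [zx]]]|Px]; first exact.
have /nbhs_ballP[e /= e0 eP] : nbhs (f x) P by exact: open_nbhs_nbhs.
have [d [d0 Hd]] := H x Fx e e0.
exists x, d; rewrite subrr normr0; split=> // z Fz /(Hd z Fz) h.
by apply: eP; rewrite -ball_normE.
Qed.

Lemma cont_on_superlevel F f (t : R) : cont_on F f ->
  exists G, open G /\ forall x, F x -> (G x <-> t < `|f x|).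
Proof.
move=> cf; apply: (@cont_on_preimage F f [set s | t < `|s|]) => //.
rewrite (_ : mkset _ = (fun s : R => `|s|) @^-1` [set s | t < s])//.
by apply: open_comp; [move=> s _; exact: norm_continuous|exact: open_gt].
Qed.

Lemma fast_cvg_seq (a : nat -> R) (n0 : nat) :
  (forall n, (n0 <= n)%N -> `|a n.+1 - a n| <= 2^-1 ^+ n) ->
  a n @[n --> \oo] --> limn a /\ forall n, (n0 <= n)%N -> `|limn a - a n| <= 2 * 2^-1 ^+ n.
Proof.
move=> H.
(* The subtracted tail [2 * 2^-1 ^+ (n + k)] is what lets the induction on [k] close. *)
have D n k : (n0 <= n)%N -> `|a (n + k)%N - a n| <= 2 * 2^-1 ^+ n - 2 * 2^-1 ^+ (n + k).
  move=> nn; elim: k => [|k ih]; first by rewrite addn0 !subrr normr0.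
  rewrite addnS -(subrKA (a (n + k)%N)); apply: le_trans (ler_normD _ _) _.
  have := H (n + k)%N (leq_trans nn (leq_addr _ _)).
  rewrite exprS; move: ih; move: (`|a (n + k).+1 - _|) (`|a (n + k)%N - _|) => b c.
  by move: (2^-1 ^+ (n + k)) (2^-1 ^+ n) => p q; lra.
have D' n m : (n0 <= n)%N -> (n <= m)%N -> `|a m - a n| <= 2 * 2^-1 ^+ n.
  move=> nn nm; have := D n (m - n)%N nn; rewrite subnKC//.
  by move=> h; apply: le_trans h _; rewrite lerBlDr lerDl mulr_ge0// exprn_ge0.
have geo : (2^-1 : R) ^+ n @[n --> \oo] --> (0 : R).
  by apply: cvg_expr; rewrite ger0_norm// invf_lt1// ltr1n.
have ca : cvgn a.
  apply/cauchy_cvgP; apply: cauchy_exP => e e0.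
  have e2 : 0 < e / 2 by rewrite divr_gt0.
  have /cvgrPdist_lt/(_ _ e2)[m _ Hm] := geo.
  exists (a (maxn n0 m)); exists (maxn n0 m) => // n /= nn.
  rewrite -ball_normE/= distrC; apply: le_lt_trans (D' _ _ (leq_maxl _ _) nn) _.
  have := Hm (maxn n0 m) (leq_maxr _ _); rewrite /= sub0r normrN ger0_norm ?exprn_ge0//.
  by lra.
split=> // n nn.
have c2 : `|a m - a n| @[m --> \oo] --> `|limn a - a n|.
  by apply: cvg_norm; apply: cvgB; [exact: ca|exact: cvg_cst].
apply: (ler_cvg_to c2 (cvg_cst _)); exists n => // m /= nm.
exact: D'.
Qed.

Lemma cont_on_fast_limit F (f : nat -> RN -> R) (n0 : nat) :
  (forall n, (n0 <= n)%N -> cont_on F (f n)) ->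
  (forall n x, (n0 <= n)%N -> F x -> `|f n.+1 x - f n x| <= 2^-1 ^+ n) ->
  cont_on F (fun x => limn (f ^~ x)).
Proof.
move=> cf H x Fx e e0; have e6 : 0 < e / 6 by rewrite divr_gt0.
have geo : (2^-1 : R) ^+ n @[n --> \oo] --> (0 : R).
  by apply: cvg_expr; rewrite ger0_norm// invf_lt1// ltr1n.
have /cvgrPdist_lt/(_ _ e6)[m _ Hm] := geo.
have := Hm (maxn n0 m) (leq_maxr _ _); rewrite /= sub0r normrN ger0_norm ?exprn_ge0//.
set n := maxn n0 m => small; have nn : (n0 <= n)%N := leq_maxl _ _.
have L y : F y -> `|limn (f ^~ y) - f n y| <= 2 * 2^-1 ^+ n.
  move=> Fy; have [_] := @fast_cvg_seq (f ^~ y) n0 (fun k nk => H k y nk Fy).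
  exact.
have e3 : 0 < e / 3 by rewrite divr_gt0.
have [d [d0 Hd]] := cf n nn x Fx _ e3.
exists d; split=> // y Fy xy.
have h1 := L x Fx; have h2 := L y Fy; have h3 := Hd y Fy xy.
rewrite (_ : _ - _ = (limn (f ^~ x) - f n x) + (f n x - f n y) - (limn (f ^~ y) - f n y)); last by ring.
apply: le_lt_trans (ler_normB _ _) _.
apply: (@le_lt_trans _ _ (`|limn (f ^~ x) - f n x| + `|f n x - f n y| + `|limn (f ^~ y) - f n y|)).
  by rewrite lerD2r ler_normD.
by lra.
Qed.

End continuous_on.

(** * Capacity, quasi-continuous versions and their limits *)

Section capacity.
Context {R : realType} {N : nat} (Om : set 'rV[R]_N).
Hypotheses (Om_open : open Om) (Om_bounded : bounded_set Om).
Local Notation RN := 'rV[R]_N.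
Local Notation n2 := (n2 Om).
Local Notation cl := (closure Om).
Implicit Types (u v w f g : RN -> R) (A B U : set RN) (e : R).

(* The capacity is compared with the one where the admissible functions are
   moreover nonnegative, for which countable unions can be handled by summing. *)
Definition cap_lt A e : Prop := exists w, [/\ W12tilde Om w,
  ae_in Om (fun x => 0 <= w x), n2 w < e &
  exists U, [/\ open U, A `<=` U & ae_in Om (fun x => U x -> 1 <= w x)]].

Lemma cap_ltW A e : cap_lt A e -> (cap Om A < e%:E)%E.
Proof.
move=> [w [Tw _ we [U HU]]]; apply: (@le_lt_trans _ _ (W12norm2 Om w)).
  by apply: ereal_inf_lbound; exists w => //; split=> //; exists U.
by rewrite (W12norm2E Om_open (W12tilde_W12 Tw)) lte_fin.
Qed.

(** The truncation is nonnegative and at least 1 where [|u|] is; the factor 4 is its cost in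
    [W12tilde_tr]. *)
Lemma cap_lt_of_tr u A e : W12tilde Om u -> n2 u < e ->
  (exists U, [/\ open U, A `<=` U & ae_in Om (fun x => U x -> 1 <= `|u x|)]) ->
  cap_lt A (4 * e).
Proof.
move=> Tu ue [U [oU AU HU]]; have [Tt tle] := W12tilde_tr Om_open Om_bounded Tu.
exists (fun x => tr (u x)); split=> //.
- by apply: ae_inT => x _; exact: tr_ge0.
- by apply: le_lt_trans tle _; rewrite ltr_pM2l.
exists U; split=> //; move: HU; apply: ae_in_imp => x _ h Ux.
by apply: tr_ge1; exact: h.
Qed.

Lemma cap_lt_of_cap A e : (cap Om A < e%:E)%E -> cap_lt A (4 * e).
Proof.
move=> /ereal_inf_lt[_ [u [Tu [U [oU AU HU]]] <-]].
rewrite (W12norm2E Om_open (W12tilde_W12 Tu)) lte_fin => ue.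
apply: cap_lt_of_tr ue _ => //; exists U; split=> //.
move: HU; apply: ae_in_imp => x _ h Ux; exact: le_trans (h Ux) (ler_norm _).
Qed.

Lemma cap_lt_sub A B e e' : A `<=` B -> e <= e' -> cap_lt B e -> cap_lt A e'.
Proof.
move=> AB ee [w [Tw w0 we [U [oU BU HU]]]]; exists w; split=> //.
  exact: lt_le_trans we ee.
by exists U; split=> //; exact: subset_trans BU.
Qed.

Lemma cap_lt_open A e : cap_lt A e -> exists U, [/\ open U, A `<=` U & cap_lt U e].
Proof.
move=> [w [Tw w0 we [U [oU AU HU]]]]; exists U; split=> //.
by exists w; split=> //; exists U; split=> //; exact: subset_refl.
Qed.

Lemma cap_ltU A B e e' : cap_lt A e -> cap_lt B e' -> cap_lt (A `|` B) (2 * (e + e')).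
Proof.
move=> [w [Tw w0 we [U [oU AU HU]]]] [v [Tv v0 ve [V [oV BV HV]]]].
exists (fun x => w x + v x); split.
- exact: W12tildeD.
- by move: w0 v0; apply: ae_in_imp2 => x _; exact: addr_ge0.
- apply: le_lt_trans (n2D_le Om_open Om_bounded (W12tilde_W12 Tw) (W12tilde_W12 Tv)) _.
  by rewrite ltr_pM2l// ltrD.
exists (U `|` V); split; first exact: openU.
  by apply: setUSS.
have h1 : ae_in Om (fun x => U x -> 1 <= w x + v x).
  by move: HU v0; apply: ae_in_imp2 => x _ h vx Ux; rewrite -[1]addr0 lerD// h.
have h2 : ae_in Om (fun x => V x -> 1 <= w x + v x).
  by move: HV w0; apply: ae_in_imp2 => x _ h vx Ux; rewrite -[1]add0r lerD// h.
by move: h1 h2; apply: ae_in_imp2 => x _ ? ? [].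
Qed.

(** The block [w m + ... + w (m + k - 1)], peeled from the front: each peeling costs the factor 2 of
    [n2D_le], which the decay from [8^-m] to [8^-(m + 1)] more than compensates. *)
Fixpoint fsum (w : nat -> RN -> R) (m k : nat) : RN -> R :=
  if k is k'.+1 then fun x => w m x + fsum w m.+1 k' x else fun=> 0.

Lemma fsumE (w : nat -> RN -> R) (m k : nat) x : fsum w m k x = \sum_(m <= i < m + k) w i x.
Proof.
elim: k m => [|k ih] m /=; first by rewrite addn0 big_geq.
by rewrite ih [RHS]big_ltn ?addSnnS// addnS ltnS leq_addr.
Qed.

Lemma n2_fsum_le (w : nat -> RN -> R) (e : R) : 0 <= e -> (forall n, W12tilde Om (w n)) ->
  (forall n, n2 (w n) <= e * 8^-1 ^+ n) -> forall k m,
  W12tilde Om (fsum w m k) /\ n2 (fsum w m k) <= 4 * e * 8^-1 ^+ m.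
Proof.
move=> e0 Tw we; elim=> [|k ih] m /=.
  split; first exact: W12tilde0.
  have := n2_sub_self Om_open Om_bounded (fun=> 0); rewrite (_ : (fun x => 0 - 0) = fun=> 0).
    by move=> ->; rewrite !mulr_ge0// exprn_ge0.
  by apply/funext => x; rewrite subrr.
have [T1 h1] := ih m.+1; split; first exact: (W12tildeD Om_open Om_bounded (Tw m) T1).
apply: le_trans (n2D_le Om_open Om_bounded (W12tilde_W12 (Tw m)) (W12tilde_W12 T1)) _.
have h2 := we m; move: h1 h2; rewrite exprS.
have p0 : 0 <= (8^-1 : R) ^+ m by rewrite exprn_ge0.
have := mulr_ge0 e0 p0; move: (8^-1 ^+ m) => p.
move: (n2 (w m)) (n2 (fsum w m.+1 k)) => a b ep h1 h2.
(* The constant reproduces itself: [2 * (1 + 4 / 8) = 3] is at most 4. *)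
by have : 4 * e * (8^-1 * p) = e * p / 2; [by field|lra].
Qed.

(** The partial sums are Cauchy, and nonnegativity makes them increase, so each term stays below the
    limit almost everywhere. This domination is the reason for restricting the capacity to
    nonnegative functions. *)
Lemma W12tilde_series (w : nat -> RN -> R) (e : R) : 0 <= e ->
  (forall n, W12tilde Om (w n)) -> (forall n, ae_in Om (fun x => 0 <= w n x)) ->
  (forall n, n2 (w n) <= e * 8^-1 ^+ n) ->
  exists S, [/\ W12tilde Om S, n2 S <= 16 * e &
    ae_in Om (fun x => forall n, 0 <= w n x <= S x)].
Proof.
move=> e0 Tw w0 we.
pose f n := fsum w 0 n.
have fE n x : f n x = \sum_(0 <= i < n) w i x by rewrite /f fsumE add0n.
have fS n m : (n <= m)%N -> (fun x => f m x - f n x) = fsum w n (m - n).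
  move=> nm; apply/funext => x; rewrite !fE fsumE subnKC// (big_cat_nat _ nm)//=.
  by rewrite addrAC subrr add0r.
have Tf n : W12tilde Om (f n) by have [] := n2_fsum_le e0 Tw we n 0.
have geo : (8^-1 : R) ^+ n @[n --> \oo] --> (0 : R).
  by apply: cvg_expr; rewrite ger0_norm// invf_lt1// ltr1n.
have Wf n := W12tilde_W12 (Tf n).
have [|S [TS fSS]] := W12tilde_complete Om_open Om_bounded Tf.
  move=> d d0; have : 4 * e * (8^-1 : R) ^+ n @[n --> \oo] --> (0 : R).
    by rewrite -[X in _ --> X](mulr0 (4 * e)); apply: cvgM geo; exact: cvg_cst.
  move=> /cvgrPdist_lt/(_ _ d0)[n0 _ Hn]; exists n0.
  have G n m : (n0 <= n)%N -> (n <= m)%N -> n2 (fun x => f m x - f n x) <= d.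
    move=> nn nm; rewrite (fS _ _ nm).
    have [_ h] := n2_fsum_le e0 Tw we (m - n) n; apply: le_trans h _.
    have := Hn n nn; rewrite /= sub0r normrN => /ltW; apply: le_trans.
    exact: ler_norm.
  move=> n m nn nm; case/orP: (leq_total n m) => h; last exact: G.
  by rewrite (n2_subC Om_open Om_bounded (Wf n) (Wf m)); exact: G.
have WS := W12tilde_W12 TS.
have SE n : n2 S <= 2 * (n2 (fun x => f n x - S x) + 4 * e).
  rewrite {1}(_ : S = (fun x => (S x - f n x) + f n x)); last by apply/funext => x; rewrite subrK.
  apply: le_trans (n2D_le Om_open Om_bounded (W12B Om_open Om_bounded WS (Wf n)) (Wf n)) _.
  rewrite ler_pM2l// (n2_subC Om_open Om_bounded (Wf n) WS) lerD2l.
  by have [_] := n2_fsum_le e0 Tw we n 0; rewrite expr0 mulr1.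
exists S; split=> //.
  have c8 : 2 * (n2 (fun x => f n x - S x) + 4 * e) @[n --> \oo] --> (2 * (0 + 4 * e) : R).
    by apply: cvgM; [exact: cvg_cst|apply: cvgD; [exact: fSS|exact: cvg_cst]].
  apply: (@le_trans _ _ (2 * (0 + 4 * e))); last by lra.
  by apply: (ler_cvg_to (cvg_cst _) c8); exact: nearW.
have sf n := W12_sq (Wf n); have sS := W12_sq WS.
have cf : lcvg Om f S.
  apply/lcvgE; apply: (cvg0_le (c := 1)) fSS => n; first exact: ldot_ge0.
  by rewrite mul1r; exact: n2_dot_le.
have [phi [phin aeS]] := lcvg_ae_subseq Om_open sf sS cf.
move: aeS (ae_in_forall w0); apply: ae_in_imp2 => x _ cx wx n; rewrite wx/=.
apply: (ler_cvg_to (cvg_cst _) cx); exists n.+1 => // m /= nm.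
have nphi : (n < phi m)%N := leq_trans nm (phin m).
rewrite fE (big_cat_nat (n := n.+1))//= big_nat_recr//= -[X in X <= _]add0r.
rewrite -[X in X <= _]addr0 lerD// ?lerD2r; last by apply: sumr_ge0.
by apply: sumr_ge0.
Qed.

(** The sum of the competitors is a competitor for the union. The constant is 17 instead of the 16
    of [W12tilde_series] because [cap_lt] is strict. *)
Lemma cap_lt_bigcup (A : nat -> set RN) (e : R) : 0 < e ->
  (forall n, cap_lt (A n) (e * 8^-1 ^+ n)) -> cap_lt (\bigcup_n A n) (17 * e).
Proof.
move=> e0 /choice[w H].
have [S [TS SE HS]] : exists S, [/\ W12tilde Om S, n2 S <= 16 * e &
    ae_in Om (fun x => forall n, 0 <= w n x <= S x)].
  apply: W12tilde_series; first exact: ltW.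
  - by move=> n; case: (H n).
  - by move=> n; case: (H n).
  - by move=> n; case: (H n) => _ _ /ltW.
have /choice[U HU] : forall n, exists U, [/\ open U, A n `<=` U & ae_in Om (fun x => U x -> 1 <= w n x)].
  by move=> n; case: (H n).
exists S; split=> //.
- by move: HS; apply: ae_in_imp => x _ /(_ 0%N)/andP[]; exact: le_trans.
- by apply: le_lt_trans SE _; rewrite ltr_pM2r// ltr_nat.
exists (\bigcup_n U n); split.
- by apply: bigcup_open => n _; case: (HU n).
- by apply: subset_bigcup => n _; case: (HU n).
have h : ae_in Om (fun x => forall n, U n x -> 1 <= w n x).
  by apply: ae_in_forall => n; case: (HU n).
move: h HS; apply: ae_in_imp2 => x _ h k [n _ Ux].
by apply: le_trans (h n Ux) _; have /andP[] := k n.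
Qed.

Definition cap_null A : Prop := forall e : R, 0 < e -> cap_lt A e.

Lemma cap_ge0 A : (0 <= cap Om A)%E.
Proof.
apply: le_ereal_inf_tmp => _ [u [Tu _] <-].
by rewrite (W12norm2E Om_open (W12tilde_W12 Tu)) lee_fin n2_ge0.
Qed.

Lemma cap_nullP A : cap_null A <-> cap Om A = 0%E.
Proof.
split=> [H|H e e0].
  apply/eqP; rewrite eq_le cap_ge0 andbT; apply/lee_addgt0Pr => e e0.
  by rewrite add0e; apply/ltW/cap_ltW; exact: H.
have e4 : 0 < e / 4 by rewrite divr_gt0.
have := @cap_lt_of_cap A (e / 4); rewrite H lte_fin => /(_ e4).
by rewrite mulrC divfK.
Qed.

Lemma cap_null_sub A B : A `<=` B -> cap_null B -> cap_null A.
Proof. by move=> AB H e e0; apply: cap_lt_sub (H e e0). Qed.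

Lemma cap_null_bigcup (A : nat -> set RN) : (forall n, cap_null (A n)) ->
  cap_null (\bigcup_n A n).
Proof.
move=> H e e0; have e17 : 0 < e / 17 by rewrite divr_gt0.
rewrite (_ : e = 17 * (e / 17)); last by field.
apply: cap_lt_bigcup => // n; apply: H; rewrite mulr_gt0// exprn_gt0.
Qed.

Lemma cap_nullU A B : cap_null A -> cap_null B -> cap_null (A `|` B).
Proof.
move=> HA HB e e0; have e4 : 0 < e / 4 by rewrite divr_gt0.
by apply: cap_lt_sub (cap_ltU (HA _ e4) (HB _ e4)) => //; lra.
Qed.

Lemma cap_null0 : cap_null set0.
Proof.
move=> e e0; exists (fun=> 0); split=> //.
- exact: W12tilde0.
- by apply: ae_inT.
- have := n2_sub_self Om_open Om_bounded (fun=> 0); rewrite (_ : (fun x => 0 - 0) = fun=> 0).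
    by move=> ->.
  by apply/funext => x; rewrite subrr.
by exists set0; split=> //; apply: ae_inT.
Qed.

(** The competitors are at least 1 on [A], while their norms decay fast enough to force them to 0
    almost everywhere. *)
Lemma cap_null_ae A : cap_null A -> ae_in Om (fun x => ~ A x).
Proof.
move=> H.
have /choice[w Hw] : forall n : nat, exists w, [/\ lsq Om w, ldot Om w w <= 1 * 8^-1 ^+ n &
    ae_in Om (fun x => A x -> 1 <= w x)].
  move=> n; have [|w [Tw _ we [U [_ AU HU]]]] := H (8^-1 ^+ n); first by rewrite exprn_gt0.
  exists w; split; first exact: W12_sq (W12tilde_W12 Tw).
    by rewrite mul1r ltW//; apply: le_lt_trans we; exact: n2_dot_le.
  by move: HU; apply: ae_in_imp => x _ h Ax; apply: h; exact: AU.
have h1 : ae_in Om (fun x => exists n0, forall n, (n0 <= n)%N -> `|w n x| <= 2^-1 ^+ n).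
  have s n : sqint (@leb R N) Om (w n) by have [/lsqE] := Hw n.
  apply: (ae_small_of_fast (c := 1) (mOm Om_open) s) => n.
  by have [_] := Hw n; rewrite ldotE.
have h2 : ae_in Om (fun x => forall n, A x -> 1 <= w n x).
  by apply: ae_in_forall => n; have [] := Hw n.
move: h1 h2; apply: ae_in_imp2 => x _ [n0 h1] h2 Ax.
have := h1 n0.+1 (leqnSn _); have := h2 n0.+1 Ax.
have : (2^-1 : R) ^+ n0.+1 <= 2^-1.
  by rewrite exprS ler_piMr// exprn_ile1// invf_le1// ler1n.
have := ler_norm (w n0.+1 x); lra.
Qed.

Definition quasi_cont f : Prop := forall e : R, 0 < e ->
  exists U, [/\ open U, cap_lt U e & cont_on (cl `\` U) f].

Lemma quasi_contP f : quasi_cont f <-> quasi_continuous Om f.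
Proof.
split=> H e e0.
  have [U [oU Ue cf]] := H e e0; exists U; split=> //; last exact/cont_onP.
  by apply: cap_ltW; apply: cap_lt_sub Ue => //; exact: subIsetl.
have e4 : 0 < e / 4 by rewrite divr_gt0.
have [U [oU /cap_lt_of_cap Ue /cont_onP cf]] := H _ e4.
rewrite mulrC divfK// in Ue; have [V [oV UV Ve]] := cap_lt_open Ue.
exists V; split=> //; apply: cont_on_sub cf => x [clx Vx]; split=> // Ux.
by apply: Vx; apply: UV.
Qed.

Lemma quasi_contB f g : quasi_cont f -> quasi_cont g -> quasi_cont (fun x => f x - g x).
Proof.
move=> Hf Hg e e0; have e4 : 0 < e / 4 by rewrite divr_gt0.
have [U [oU Ue cf]] := Hf _ e4; have [V [oV Ve cg]] := Hg _ e4.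
exists (U `|` V); split; first exact: openU.
  by apply: cap_lt_sub (cap_ltU Ue Ve) => //; lra.
by apply: cont_onB; [apply: cont_on_sub cf|apply: cont_on_sub cg];
  move=> x [clx UVx]; split=> // Ux; apply: UVx; [left|right].
Qed.

Lemma quasi_cont_continuous f : {within cl, continuous f} -> quasi_cont f.
Proof.
move=> /cont_onP cf e e0; exists set0; split; first exact: open0.
  exact: cap_null0.
by apply: cont_on_sub cf => x [].
Qed.

(* Where [g] is continuous, [{t < |g|}] is relatively open, so [tr (u / t)] is
   admissible for it up to a set of small capacity. *)
Lemma cap_superlevel u g (t e : R) : 0 < t -> 0 < e -> W12tilde Om u -> quasi_cont g ->
  ae_in Om (fun x => g x = u x) -> n2 u < e * t ^+ 2 ->
  cap_lt [set x | cl x /\ t < `|g x|] (9 * e).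
Proof.
move=> t0 e0 Tu Hg gu ue.
have e8 : 0 < e / 8 by rewrite divr_gt0.
have [U [oU Ue cg]] := Hg _ e8.
have [G [oG HG]] := cont_on_superlevel t cg.
pose v x := t^-1 * u x + 0.
have Tv : W12tilde Om v.
  exact: (W12tilde_lin Om_open Om_bounded _ Tu (W12tilde0 Om_open Om_bounded)).
have vE : v = (fun x => t^-1 * u x) by apply/funext => x; rewrite /v addr0.
have ve : n2 v < e.
  rewrite vE (n2Z_le Om_open Om_bounded _ (W12tilde_W12 Tu)) exprVn mulrC.
  by rewrite ltr_pdivrMr ?exprn_gt0.
have [Tt tle] := W12tilde_tr Om_open Om_bounded Tv.
have [w [Tw w0 we [V [oV UV HV]]]] := Ue.
exists (fun x => tr (v x) + w x); split.
- exact: (W12tildeD Om_open Om_bounded Tt Tw).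
- by move: w0; apply: ae_in_imp => x _ wx; rewrite addr_ge0// tr_ge0.
(* [2 * (4 * e + e / 8)] is below [9 * e]. *)
- apply: le_lt_trans (n2D_le Om_open Om_bounded (W12tilde_W12 Tt) (W12tilde_W12 Tw)) _.
  by lra.
exists (G `|` V); split; first exact: openU.
  move=> x [clx tx]; have [Ux|Ux] := pselect (U x); first by right; exact: UV.
  by left; apply/HG.
have h : ae_in Om (fun x => (V x -> 1 <= w x) /\ 0 <= w x).
  by move: HV w0; apply: ae_in_imp2.
move: gu h; apply: ae_in_imp2 => x Omx gux [h1 h2] GVx.
have [Vx|Vx] := pselect (V x); first by rewrite -[1]add0r lerD ?tr_ge0// h1.
rewrite -[1]addr0 lerD// tr_ge1//.
have {GVx}Gx : G x by case: GVx.
have clU : (cl `\` U) x by split; [exact: subset_closure|move=> Ux; apply: Vx; exact: UV].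
have := (HG _ clU).1 Gx; rewrite gux vE normrM normfV (gtr0_norm t0) => tu.
by rewrite ler_pdivlMl// mulr1 ltW.
Qed.

(** The sets where [|f (n + 1) - f n|] exceeds [2^-n] have capacity of order [16^-n], as [64^-n]
    divided by [(2^-n)^2] is [16^-n]. Outside a union of late ones the convergence is uniform, so
    continuity passes to the limit. *)
Lemma quasi_cont_limit (u f : nat -> RN -> R) (c : R) : 0 < c ->
  (forall n, W12tilde Om (u n)) -> (forall n, quasi_cont (f n)) ->
  (forall n, ae_in Om (fun x => f n x = u n x)) ->
  (forall n, n2 (fun x => u n.+1 x - u n x) <= c * 64^-1 ^+ n) ->
  quasi_cont (fun x => limn (f ^~ x)) /\
  cap_null [set x | cl x /\ ~ (f n x @[n --> \oo] --> limn (f ^~ x))].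
Proof.
move=> c0 Tu qf fu uu.
have Acap n : cap_lt [set x | cl x /\ 2^-1 ^+ n < `|f n.+1 x - f n x|] (18 * c * 16^-1 ^+ n).
  rewrite (_ : 18 * c * _ = 9 * (2 * c * 16^-1 ^+ n)); last by ring.
  apply: (@cap_superlevel (fun x => u n.+1 x - u n x) (fun x => f n.+1 x - f n x)).
  - by rewrite exprn_gt0.
  - by rewrite !mulr_gt0// exprn_gt0.
  - exact: (W12tildeB Om_open Om_bounded (Tu n.+1) (Tu n)).
  - exact: quasi_contB.
  - by move: (fu n.+1) (fu n); apply: ae_in_imp2 => x _ -> ->.
  apply: le_lt_trans (uu n) _.
  rewrite -mulrA -exprM mulnC exprM -exprMn.
  rewrite (_ : 16^-1 * 2^-1 ^+ 2 = 64^-1 :> R); last by field.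
  by rewrite ltr_pM2r ?exprn_gt0//; lra.
have /choice[U HU] := fun n => cap_lt_open (Acap n).
have key e : 0 < e -> exists W (m : nat), [/\ open W, cap_lt W e,
    forall n, cont_on (cl `\` W) (f n) &
    forall n x, (m <= n)%N -> (cl `\` W) x -> `|f n.+1 x - f n x| <= 2^-1 ^+ n].
  (* Two countable unions and one binary union cost [2 * (17 * d + 17 * d) = 68 * d], which is below
     [e]. *)
  move=> e0; pose d := e / 100; have d0 : 0 < d by rewrite divr_gt0.
  have /choice[P HP] : forall n : nat, exists P, [/\ open P, cap_lt P (d * 8^-1 ^+ n) & cont_on (cl `\` P) (f n)].
    by move=> n; apply: qf; rewrite mulr_gt0// exprn_gt0.
  have [m Hm] : exists m : nat, 18 * c * 16^-1 ^+ m <= d.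
    have d18 : 0 < d / (18 * c) by rewrite divr_gt0// mulr_gt0.
    have geo : (16^-1 : R) ^+ n @[n --> \oo] --> (0 : R).
      by apply: cvg_expr; rewrite ger0_norm// invf_lt1// ltr1n.
    have /cvgrPdist_lt/(_ _ d18)[m _ /(_ m (leqnn m))] := geo.
    rewrite /= sub0r normrN ger0_norm ?exprn_ge0// => /ltW h; exists m.
    by rewrite mulrC -ler_pdivlMr// mulr_gt0.
  exists ((\bigcup_n P n) `|` (\bigcup_n U (m + n)%N)), m; split.
  - apply: openU; apply: bigcup_open => n _; first by case: (HP n).
    by case: (HU (m + n)%N).
  - have h1 : cap_lt (\bigcup_n P n) (17 * d).
      by apply: cap_lt_bigcup => // n; case: (HP n).
    have h2 : cap_lt (\bigcup_n U (m + n)%N) (17 * d).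
      apply: cap_lt_bigcup => // n; case: (HU (m + n)%N) => _ _; apply: cap_lt_sub => //.
      rewrite exprD mulrA; apply: le_trans (_ : d * 16^-1 ^+ n <= _).
        by rewrite ler_wpM2r// exprn_ge0.
      rewrite ler_wpM2l ?(ltW d0)// lerXn2r// ?nnegrE//.
      by rewrite lef_pV2 ?posrE// ler_nat.
    by apply: cap_lt_sub (cap_ltU h1 h2) => //; rewrite /d; lra.
  - move=> n; have [_ _] := HP n; apply: cont_on_sub => x [clx h]; split=> // Px.
    by apply: h; left; exists n.
  - move=> n x mn [clx h]; rewrite leNgt; apply/negP => lt; apply: h; right.
    by exists (n - m)%N => //; rewrite subnKC//; case: (HU n) => _ + _; apply.
split=> e e0; have [W [m [oW We cf Wf]]] := key e e0.
  exists W; split=> //; exact: (cont_on_fast_limit (n0 := m) (fun n _ => cf n) Wf).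
apply: cap_lt_sub We => // x [clx h]; apply: contrapT => Wx; apply: h.
by have [] := @fast_cvg_seq R (f ^~ x) m (fun n mn => Wf n x mn (conj clx Wx)).
Qed.

(** [f - g] is a quasi-continuous representative of 0, whose norm is below every [e * t ^ 2]; hence
    each superlevel set of [|f - g|] has zero capacity by [cap_superlevel]. *)
Lemma quasi_cont_unique f g : quasi_cont f -> quasi_cont g ->
  ae_in Om (fun x => f x = g x) -> cap_null [set x | cl x /\ f x <> g x].
Proof.
move=> qf qg fg.
apply: (@cap_null_sub _ (\bigcup_n [set x | cl x /\ n.+1%:R^-1 < `|f x - g x|])).
  move=> x [clx fgx].
  have h : 0 < `|f x - g x| by rewrite normr_gt0 subr_eq0; apply/eqP.
  by have [n hn] := ltr_add_invr h; exists n => //; split=> //; rewrite add0r in hn.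
apply: cap_null_bigcup => n e e0; have e9 : 0 < e / 9 by rewrite divr_gt0.
rewrite (_ : e = 9 * (e / 9)); last by field.
apply: (@cap_superlevel (fun=> 0) (fun x => f x - g x)) => //.
- exact: W12tilde0.
- exact: quasi_contB.
- by move: fg; apply: ae_in_imp => x _ ->; rewrite subrr.
have := n2_sub_self Om_open Om_bounded (fun=> 0); rewrite (_ : (fun x => 0 - 0) = fun=> 0).
  by move=> ->; rewrite mulr_gt0// exprn_gt0.
by apply/funext => x; rewrite subrr.
Qed.

Lemma quasi_cont_limit_ae (u f : nat -> RN -> R) (v : RN -> R) :
  (forall n, W12tilde Om (u n)) -> W12tilde Om v ->
  (forall n, ae_in Om (fun x => f n x = u n x)) ->
  n2 (fun x => u n x - v x) @[n --> \oo] --> (0 : R) ->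
  cap_null [set x | cl x /\ ~ (f n x @[n --> \oo] --> limn (f ^~ x))] ->
  ae_in Om (fun x => limn (f ^~ x) = v x).
Proof.
move=> Tu Tv fu uv /cap_null_ae fl.
have cu : lcvg Om u v.
  apply/lcvgE; apply: (cvg0_le (c := 1)) uv => n; first exact: ldot_ge0.
  by rewrite mul1r; exact: n2_dot_le.
have [phi [phin aeu]] := lcvg_ae_subseq Om_open (fun n => W12_sq (W12tilde_W12 (Tu n)))
  (W12_sq (W12tilde_W12 Tv)) cu.
have phioo : phi n @[n --> \oo] --> \oo.
  move=> A [n0 _ An]; exists n0 => // n /= nn; apply: An => /=.
  exact: leq_trans nn (phin n).
have := ae_in_forall fu; move: aeu => h1 h2.
have h : ae_in Om (fun x => f (phi n) x @[n --> \oo] --> v x).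
  move: h1 h2; apply: ae_in_imp2 => x _ h1 h2.
  by apply: (eq_cvg_seq (b := fun n => u (phi n) x)) => // n; exact: h2.
move: h fl; apply: ae_in_imp2 => x Omx h fl.
have {}fl : f n x @[n --> \oo] --> limn (f ^~ x).
  by apply: contrapT => k; apply: fl; split=> //; exact: subset_closure.
exact: (cvg_unique _ (cvg_comp _ _ phioo fl) h).
Qed.

Lemma quasi_cont_exists u : W12tilde Om u ->
  exists f, quasi_cont f /\ ae_in Om (fun x => f x = u x).
Proof.
move=> Tu; have [v0 [Cv0 v0u]] := W12tilde_seq Om_open Om_bounded Tu.
(* Doubling the index squares the rate [8^-n] into the [64^-n] of [quasi_cont_limit]. *)
pose v n := v0 (n + n)%N.
have Tv n : W12tilde Om (v n) by exact: (W12C_tilde Om_open Om_bounded (Cv0 _)).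
have vu n : n2 (fun x => u x - v n x) <= 64^-1 ^+ n.
  apply: le_trans (v0u _) _; rewrite addnn -mul2n exprM (_ : 8^-1 ^+ 2 = 64^-1 :> R)//.
  by field.
have Wv n := W12tilde_W12 (Tv n); have Wu := W12tilde_W12 Tu.
have vv n : n2 (fun x => v n.+1 x - v n x) <= 4 * 64^-1 ^+ n.
  apply: le_trans (n2_sub_triangle Om_open Om_bounded (Wv _) Wu (Wv _)) _.
  rewrite (n2_subC Om_open Om_bounded (Wv _) Wu).
  have h1 := vu n.+1; have h2 := vu n.
  have : (64^-1 : R) ^+ n.+1 <= 64^-1 ^+ n.
    by rewrite exprS ler_piMl ?exprn_ge0// invf_le1// ler1n.
  by lra.
have cvu : n2 (fun x => v n x - u x) @[n --> \oo] --> (0 : R).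
  have geo : (64^-1 : R) ^+ n @[n --> \oo] --> (0 : R).
    by apply: cvg_expr; rewrite ger0_norm// invf_lt1// ltr1n.
  apply: (cvg0_le (c := 1)) geo => n; first exact: n2_ge0.
  by rewrite mul1r (n2_subC Om_open Om_bounded (Wv _) Wu).
have qv n : quasi_cont (v n) by apply: quasi_cont_continuous; case: (Cv0 (n + n)%N).
have vae n : ae_in Om (fun x => v n x = v n x) by apply: ae_inT.
have c4 : (0 : R) < 4 by [].
have [q c] := quasi_cont_limit c4 Tv qv vae vv.
exists (fun x => limn (v ^~ x)); split=> //.
exact: quasi_cont_limit_ae Tv Tu vae cvu c.
Qed.

Lemma qcP u : W12tilde Om u -> quasi_cont (qc Om u) /\ ae_in Om (fun x => qc Om u x = u x).
Proof.
move=> /quasi_cont_exists[f [/quasi_contP qf fu]].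
have [] : [set v | quasi_continuous Om v /\ ae_in Om (fun x => v x = u x)] (qc Om u).
  by apply: getPex; exists f.
by move=> /quasi_contP.
Qed.

Lemma qc_ae u v : ae_in Om (fun x => u x = v x) -> qc Om u = qc Om v.
Proof.
move=> uv; rewrite /qc; congr (get _); apply/seteqP; split=> g [qg gu]; split=> //.
  by move: gu uv; apply: ae_in_imp2 => x _ ->.
by move: gu uv; apply: ae_in_imp2 => x _ -> ->.
Qed.

Lemma qc_unique u f : W12tilde Om u -> quasi_cont f -> ae_in Om (fun x => f x = u x) ->
  cap_null [set x | cl x /\ f x <> qc Om u x].
Proof.
move=> /qcP[q1 q2] qf fu; apply: quasi_cont_unique => //.
by move: fu q2; apply: ae_in_imp2 => x _ -> ->.
Qed.

(** A fast subsequence has a quasi-continuous pointwise limit, and uniqueness identifies that limit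
    with [qc Om v] up to zero capacity. *)
Lemma qc_cvg (u : nat -> RN -> R) (v : RN -> R) :
  (forall n, W12tilde Om (u n)) -> W12tilde Om v ->
  n2 (fun x => u n x - v x) @[n --> \oo] --> (0 : R) ->
  exists phi : nat -> nat, (forall n, (n <= phi n)%N) /\
   cap_null [set x | cl x /\ ~ (qc Om (u (phi n)) x @[n --> \oo] --> qc Om v x)].
Proof.
move=> Tu Tv uv.
have /choice[phi Hphi] : forall n : nat, exists k : nat, (n <= k)%N /\
    n2 (fun x => u k x - v x) <= 64^-1 ^+ n.
  move=> n; have p0 : 0 < (64^-1 : R) ^+ n by rewrite exprn_gt0.
  have /cvgrPdist_le/(_ _ p0)[m _ Hm] := uv.
  exists (maxn n m); rewrite leq_maxl; split=> //.
  have := Hm (maxn n m) (leq_maxr _ _); rewrite /= sub0r normrN.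
  by apply: le_trans; exact: ler_norm.
have phin n : (n <= phi n)%N by have [] := Hphi n.
have phiv n : n2 (fun x => u (phi n) x - v x) <= 64^-1 ^+ n by have [] := Hphi n.
exists phi; split=> //.
have Wu n := W12tilde_W12 (Tu n); have Wv := W12tilde_W12 Tv.
have uu n : n2 (fun x => u (phi n.+1) x - u (phi n) x) <= 4 * 64^-1 ^+ n.
  apply: le_trans (n2_sub_triangle Om_open Om_bounded (Wu _) Wv (Wu _)) _.
  rewrite (n2_subC Om_open Om_bounded Wv (Wu _)).
  have h1 := phiv n.+1; have h2 := phiv n.
  have : (64^-1 : R) ^+ n.+1 <= 64^-1 ^+ n.
    by rewrite exprS ler_piMl ?exprn_ge0// invf_le1// ler1n.
  by lra.
have cvu : n2 (fun x => u (phi n) x - v x) @[n --> \oo] --> (0 : R).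
  have geo : (64^-1 : R) ^+ n @[n --> \oo] --> (0 : R).
    by apply: cvg_expr; rewrite ger0_norm// invf_lt1// ltr1n.
  by apply: (cvg0_le (c := 1)) geo => n; rewrite ?n2_ge0 ?mul1r.
pose f n := qc Om (u (phi n)).
have qf n : quasi_cont (f n) by have [] := qcP (Tu (phi n)).
have fu n : ae_in Om (fun x => f n x = u (phi n) x) by have [] := qcP (Tu (phi n)).
have c4 : (0 : R) < 4 by [].
have [q c] := quasi_cont_limit c4 (fun n => Tu (phi n)) qf fu uu.
have lv := quasi_cont_limit_ae (fun n => Tu (phi n)) Tv fu cvu c.
have c2 := qc_unique Tv q lv.
apply: cap_null_sub (cap_nullU c c2) => x [clx h].
have [E|E] := pselect (limn (f ^~ x) = qc Om v x); last by right; split.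
by left; split=> // k; apply: h; rewrite -E.
Qed.

End capacity.

(** * Double integrals *)

Section sigma_finite_restriction.
Context {d : measure_display} {T : measurableType d} {R : realType}.

(** Product measures require a sigma-finite factor, whereas the boundary measure is infinite on
    every ball around a point of [Gamma_inf]. The restriction to [D] is sigma-finite on the whole
    space, since it gives measure 0 to the complement of [D]. *)
Lemma sigma_finite_restriction (m : {measure set T -> \bar R}) (D : set T) :
  measurable D -> sigma_finite D m ->
  exists m' : {sigma_finite_measure set T -> \bar R},
    forall A, measurable A -> A `<=` D -> m' A = m A.
Proof.
move=> mD [F DF HF].
have sf : sigma_finite setT (mrestr m mD).
  exists (fun n => if n is n'.+1 then F n' else ~` D).
    apply/seteqP; split=> // x _; have [Dx|Dx] := pselect (D x); last by exists 0%N.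
    by move: Dx; rewrite DF => -[n _ Fx]; exists n.+1.
  case=> [|n]; split; [exact: measurableC| |exact: (HF n).1|].
    by rewrite /= /mrestr setICl measure0.
  apply: le_lt_trans (HF n).2; rewrite /mrestr; apply: le_measure; rewrite ?inE//.
  - by apply: measurableI => //; exact: (HF n).1.
  - exact: (HF n).1.
pose b := Measure_isSigmaFinite.Build _ _ _ (mrestr m mD) sf.
pose m' : {sigma_finite_measure set T -> \bar R} := HB.pack (mrestr m mD) b.
by exists m' => A mA AD; rewrite /= /mrestr; congr (m _); exact/setIidPl.
Qed.

End sigma_finite_restriction.

Section double_integral.
Context {d : measure_display} {T : measurableType d} {R : realType}.
Variables (m : {sigma_finite_measure set T -> \bar R}) (D : set T) (mD : measurable D).
Local Notation DD := (D `*` D).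

Lemma measurable_square : measurable DD.
Proof. exact: measurableX. Qed.

Lemma double_integral_ge0 (F : T -> T -> R) :
  measurable_fun DD (fun z => F z.1 z.2) -> (forall x y, D x -> D y -> 0 <= F x y) ->
  (\int[m]_(x in D) \int[m]_(y in D) (F x y)%:E =
   \int[m \x m]_(z in DD) (F z.1 z.2)%:E)%E.
Proof.
move=> mF F0; rewrite [RHS]integral_mkcond fubini_tonelli1.
- rewrite integral_mkcond; apply: eq_integral => x _; rewrite patchE /fubini_F.
  case: ifPn => xD.
    rewrite [LHS]integral_mkcond; apply: eq_integral => y _; rewrite !patchE.
    case: ifPn => yD; first by rewrite ifT// inE; split; rewrite -inE.
    by rewrite ifF//; apply/negbTE; apply: contra yD; rewrite !inE => -[].
  rewrite integral0_eq// => y _; rewrite patchE ifF//.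
  by apply/negbTE; apply: contra xD; rewrite !inE => -[].
- apply/(measurable_restrictT _ measurable_square); exact/measurable_EFinP.
- by move=> z; rewrite patchE; case: ifPn => //; rewrite inE => -[? ?]; rewrite lee_fin F0.
Qed.

(** The inner real integral is a [fine], so it agrees with the partial integral of Fubini's theorem
    only where the latter is finite, which is almost everywhere. *)
Lemma double_Rintegral (F : T -> T -> R) :
  (m \x m)%E.-integrable DD (EFin \o (fun z => F z.1 z.2)) ->
  \int[m]_(x in D) \int[m]_(y in D) F x y = \int[(m \x m)%E]_(z in DD) F z.1 z.2.
Proof.
move=> iF; rewrite /Rintegral; congr (fine _).
have if' : (m \x m)%E.-integrable setT ((EFin \o (fun z => F z.1 z.2)) \_ DD).
  exact/(integrable_mkcond _ measurable_square).
rewrite [RHS]integral_mkcond -(integral12_prod_meas1 if') integral_mkcond.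
apply: integral_ae_eq_nonmeasurable.
have := ae_integrable1 if'; apply: filterS => x ix _; rewrite patchE /fubini_F.
case: ifPn => xD; last first.
  rewrite integral0_eq// => y _; rewrite patchE ifF//.
  by apply/negbTE; apply: contra xD; rewrite !inE => -[].
rewrite [X in fine X](_ : _ = (\int[m]_y ((EFin \o (fun z => F z.1 z.2)) \_ DD) (x, y))%E).
  by rewrite fineK//; exact: integrable_fin_num ix.
rewrite [LHS]integral_mkcond; apply: eq_integral => y _; rewrite !patchE.
case: ifPn => yD; first by rewrite ifT// inE; split; rewrite -inE.
by rewrite ifF//; apply/negbTE; apply: contra yD; rewrite !inE => -[].
Qed.

Lemma ae_square (Q : T -> Prop) : {ae m, forall x, D x -> Q x} ->
  {ae (m \x m)%E, forall z, DD z -> Q z.1 /\ Q z.2}.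
Proof.
move=> [Z [mZ Z0 HZ]]; exists ((Z `*` setT) `|` (setT `*` Z)); split.
- by apply: measurableU; exact: measurableX.
- apply/eqP; rewrite eq_le measure_ge0 andbT.
  have m1 : measurable (Z `*` [set: T]) by exact: measurableX.
  have m2 : measurable ([set: T] `*` Z) by exact: measurableX.
  apply: (@le_trans _ _ ((m \x m) (Z `*` setT) + (m \x m) (setT `*` Z))%E).
    exact: measureU2.
  apply: (@le_trans _ _ (m Z * m setT + m setT * m Z)%E).
    by apply: leeD; rewrite le_eqVlt; apply/orP; left; apply/eqP; exact: product_measure1E.
  by rewrite Z0 mul0e mule0 adde0.
- move=> z /= h; apply: contrapT => nz; apply: h => -[D1 D2].
  by split; apply: contrapT => nQ; apply: nz; [left|right]; split=> //; apply: HZ => /= h; apply: nQ; exact: h.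
Qed.

End double_integral.

(** * The boundary measure on Gamma *)

Section boundary_measure.
Context {R : realType} {N : nat} (Om : set 'rV[R]_N).
Hypotheses (Om_open : open Om) (Om_bounded : bounded_set Om).
Context (mu : {outer_measure set 'rV[R]_N -> \bar R}).
Hypotheses (mu_reg : regular_borel_on_boundary Om mu) (mu_adm : admissible Om mu).
Local Notation RN := 'rV[R]_N.
Local Notation cara := (caratheodory_type mu).
Local Notation G := (Gamma Om mu).
Local Notation Ginf := (Gamma_inf Om mu).
Local Notation cl := (closure Om).
Implicit Types (A U : set RN) (f : RN -> R).

Lemma borel_open U : open U -> borel U.
Proof. by move=> oU; apply: sub_sigma_algebra. Qed.

Lemma borelC A : borel A -> borel (~` A).
Proof. by move=> bA; rewrite -setTD; exact: sigma_algebraCD. Qed.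

Lemma borel_bigcup (A : nat -> set RN) : (forall n, borel (A n)) -> borel (\bigcup_n A n).
Proof. exact: sigma_algebra_bigcup. Qed.

Lemma borel_bigcap (A : nat -> set RN) : (forall n, borel (A n)) -> borel (\bigcap_n A n).
Proof.
move=> bA; rewrite -[X in borel X]setCK setC_bigcap; apply: borelC.
by apply: borel_bigcup => n; exact: borelC.
Qed.

Lemma borelI A B : borel A -> borel B -> borel (A `&` B).
Proof.
move=> bA bB; rewrite (_ : A `&` B = \bigcap_n (if n is 0%N then A else B)).
  by apply: borel_bigcap => -[].
apply/seteqP; split=> [x [? ?] [|n] //|x h].
by split; [exact: (h 0%N)|exact: (h 1%N)].
Qed.

Lemma borel_closed A : closed A -> borel A.
Proof.
by move=> cA; rewrite -[A]setCK; apply: borelC; apply: borel_open; exact: closed_openC.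
Qed.

Lemma borel_boundary : borel (boundary Om).
Proof.
rewrite /boundary setDE; apply: borelI; first by apply: borel_closed; exact: closed_closure.
by apply: borelC; apply: borel_open; exact: open_interior.
Qed.

Lemma borel_measurable A : borel A -> measurable (A : set cara).
Proof. by move=> bA; case: mu_reg => _ + _; exact. Qed.

Lemma edist_le_sum (x y : RN) : Defs.edist x y <= \sum_(i < N) `|x 0 i - y 0 i|.
Proof.
rewrite /Defs.edist -[leRHS]ger0_norm ?sumr_ge0// -sqrtr_sqr ler_sqrt ?sqr_ge0//.
elim: (index_enum _) => [|i r ih]; first by rewrite !big_nil expr0n.
rewrite !big_cons; set a := `|x 0 i - y 0 i|; set s := \sum_(j <- r) `|_|.
have s0 : 0 <= s by exact: sumr_ge0.
have a0 : 0 <= a by exact: normr_ge0.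
rewrite -[(x 0 i - y 0 i) ^+ 2]real_normK ?num_real// -/a sqrrD.
apply: (@le_trans _ _ (a ^+ 2 + s ^+ 2)); first by rewrite lerD2l.
by rewrite lerD2r lerDl mulrn_wge0// mulr_ge0.
Qed.

Lemma coord_le_edist (x y : RN) : `|x - y| <= Defs.edist x y.
Proof.
rewrite [leLHS](_ : _ = mx_norm (x - y))// mx_normrE.
apply: bigmax_le; first exact: sqrtr_ge0.
move=> [i j] _ /=; rewrite (ord1 i) !mxE -sqrtr_sqr ler_sqrt; last first.
  by apply: sumr_ge0 => k _; exact: sqr_ge0.
by rewrite (bigD1 j)//= lerDl sumr_ge0// => k _; exact: sqr_ge0.
Qed.

Lemma edist_le_norm (x y : RN) : Defs.edist x y <= N%:R * `|x - y|.
Proof.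
apply: le_trans (edist_le_sum x y) _.
rewrite mulr_natl -[X in _ *+ X]card_ord -sumr_const; apply: ler_sum => i _.
by have := coord_le_norm (x - y) i; rewrite !mxE.
Qed.

Definition locally_finite : set RN :=
  [set z | exists2 r : R, 0 < r & (mu (eball z r `&` boundary Om) < +oo)%E].

Lemma locally_finite_rat z : locally_finite z -> exists pq : 'rV[rat]_N * 'rV[rat]_N,
  obox (map_mx ratr pq.1) (map_mx ratr pq.2) z /\
  (mu (obox (map_mx ratr pq.1) (map_mx ratr pq.2) `&` boundary Om) < +oo)%E.
Proof.
move=> [r r0 fr].
have d0 : 0 < r / (N%:R + 1) by rewrite divr_gt0// ltr_wpDl.
have : (ball z (r / (N%:R + 1)) : set RN) z by exact: ballxx.
have oB : open (ball z (r / (N%:R + 1)) : set RN) by exact: ball_open.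
rewrite {1}(open_obox_rat oB) => -[pq /= pqB zpq]; exists pq; split=> //.
apply: le_lt_trans fr; apply: le_outer_measure => y [/pqB yB by_]; split=> //.
move: yB; rewrite -ball_normE/= ltr_pdivlMr ?ltr_wpDl// => h.
apply: le_lt_trans (edist_le_norm z y) _; apply: le_lt_trans h.
by rewrite mulrC ler_wpM2l// lerDl.
Qed.

Lemma GammaE : G = boundary Om `&` locally_finite.
Proof.
apply/seteqP; split=> z.
  move=> [bz h]; split=> //; apply: contrapT => k; apply: h; split=> // r r0.
  by apply/eqP; rewrite -leye_eq leNgt; apply/negP => lt; apply: k; exists r.
by move=> [bz [r r0 fr]]; split=> // -[_ /(_ r r0) E]; rewrite E in fr.
Qed.

(** The rational boxes whose trace on the boundary has finite measure, enumerated by [unpickle]. One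
    countable family shows both that [Gamma] is Borel and that [mu] is sigma-finite on it. *)
Definition Gamma_piece (n : nat) : set RN :=
  if (unpickle n : option ('rV[rat]_N * 'rV[rat]_N)) is Some pq then
    if (mu (obox (map_mx ratr pq.1) (map_mx ratr pq.2) `&` boundary Om) < +oo)%E
    then boundary Om `&` obox (map_mx ratr pq.1) (map_mx ratr pq.2) else set0
  else set0.

Lemma borel_Gamma_piece n : borel (Gamma_piece n).
Proof.
rewrite /Gamma_piece; case: unpickle => [pq|]; last by apply: borel_open; exact: open0.
case: ifP => _; last by apply: borel_open; exact: open0.
by apply: borelI; [exact: borel_boundary|apply: borel_open; exact: obox_open].
Qed.

Lemma Gamma_pieceE : G = \bigcup_n Gamma_piece n.
Proof.
rewrite GammaE; apply/seteqP; split=> z.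
  move=> [bz /locally_finite_rat[pq [zpq fpq]]]; exists (pickle pq) => //.
  by rewrite /Gamma_piece pickleK fpq.
move=> [n _]; rewrite /Gamma_piece; case: unpickle => [pq|//].
case: ifPn => // fpq [bz zpq]; split=> //.
have /nbhs_ballP[e /= e0 eO] : nbhs z (obox (map_mx ratr pq.1) (map_mx ratr pq.2) : set RN).
  by apply: open_nbhs_nbhs; split=> //; exact: obox_open.
exists e => //; apply: le_lt_trans fpq; apply: le_outer_measure => y [zy bdy]; split=> //.
by apply: eO; rewrite -ball_normE/=; exact: le_lt_trans (coord_le_edist z y) zy.
Qed.

Lemma borel_Gamma : borel G.
Proof. by rewrite Gamma_pieceE; apply: borel_bigcup; exact: borel_Gamma_piece. Qed.

Lemma measurable_Gamma : measurable (G : set cara).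
Proof. by apply: borel_measurable; exact: borel_Gamma. Qed.

Lemma Gamma_sigma_finite : sigma_finite (G : set cara) (bmeas mu).
Proof.
exists Gamma_piece; first exact: Gamma_pieceE.
move=> n; split; first by apply: borel_measurable; exact: borel_Gamma_piece.
rewrite /Gamma_piece /bmeas /cara_measure /=; case: unpickle => [pq|]; last first.
  by rewrite outer_measure0.
by case: ifP => [|_]; [rewrite setIC|rewrite outer_measure0].
Qed.

Lemma Gamma_closure : G `<=` cl.
Proof. by move=> x [[]]. Qed.

Lemma Gamma_inf_closure : Ginf `<=` cl.
Proof. by move=> x [[]]. Qed.

(** Admissibility speaks of Borel sets only. Open neighbourhoods of capacity below [8^-n] enclose
    [A] in a countable intersection of open sets that still has zero capacity. *)
Lemma cap_null_mu A : cap_null Om A -> A `<=` G -> mu A = 0%E.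
Proof.
move=> cA AG.
have /choice[U HU] : forall n : nat, exists U, [/\ open U, A `<=` U & cap_lt Om U (8^-1 ^+ n)].
  by move=> n; apply: cap_lt_open; apply: cA; rewrite exprn_gt0.
have AB : A `<=` (\bigcap_n U n) `&` G.
  by move=> x Ax; split; [move=> n _; case: (HU n) => _ + _; exact|exact: AG].
apply/eqP; rewrite eq_le outer_measure_ge0 andbT.
apply: (@le_trans _ _ (mu ((\bigcap_n U n) `&` G))); first exact: le_outer_measure.
rewrite mu_adm//.
- apply: borelI; last exact: borel_Gamma.
  by apply: borel_bigcap => n; apply: borel_open; case: (HU n).
apply/(cap_nullP Om_open Om_bounded) => e e0.
have geo : (8^-1 : R) ^+ n @[n --> \oo] --> (0 : R).
  by apply: cvg_expr; rewrite ger0_norm// invf_lt1// ltr1n.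
have /cvgrPdist_lt/(_ _ e0)[m _ /(_ m (leqnn m))] := geo.
rewrite /= sub0r normrN ger0_norm ?exprn_ge0// => h.
have [_ _] := HU m; apply: cap_lt_sub (ltW h).
by move=> x [Ux _]; exact: Ux.
Qed.

Lemma cap_null_ae_Gamma A : cap_null Om A -> {ae bmeas mu, forall x, G x -> ~ A x}.
Proof.
move=> cA; have mA : mu (A `&` G) = 0%E.
  by apply: cap_null_mu => //; apply: cap_null_sub cA.
have mAG : measurable (A `&` G : set cara).
  apply: le_caratheodory_measurable => X.
  rewrite (_ : mu (X `&` _) = 0%E) ?add0e; first by apply: le_outer_measure; exact: subIsetl.
  apply/eqP; rewrite eq_le outer_measure_ge0 andbT -mA.
  by apply: le_outer_measure; exact: subIsetr.
exists (A `&` G); split=> // x /= h; apply: contrapT => k; apply: h => Gx Ax.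
exact: k.
Qed.

(** [Gamma] is a countable union of Borel sets on which [f] is relatively continuous, up to a
    remainder [Z] of zero capacity; [mu Z] is 0, and every subset of [Z] is Caratheodory
    measurable. *)
Lemma quasi_cont_measurable f : quasi_cont Om f ->
  measurable_fun (G : set cara) (f : cara -> R).
Proof.
move=> qf.
have /choice[U HU] : forall n : nat, exists U, [/\ open U, cap_lt Om U (8^-1 ^+ n) & cont_on (cl `\` U) f].
  by move=> n; apply: qf; rewrite exprn_gt0.
pose Z : set cara := G `&` \bigcap_n U n.
have cZ : cap_null Om Z.
  move=> e e0; have geo : (8^-1 : R) ^+ n @[n --> \oo] --> (0 : R).
    by apply: cvg_expr; rewrite ger0_norm// invf_lt1// ltr1n.
  have /cvgrPdist_lt/(_ _ e0)[m _ /(_ m (leqnn m))] := geo.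
  rewrite /= sub0r normrN ger0_norm ?exprn_ge0// => h.
  have [_ + _] := HU m; apply: cap_lt_sub (ltW h).
  by move=> x [_ /(_ m I)].
have mZ : mu Z = 0%E by apply: cap_null_mu => // x [].
have meas0 (A : set cara) : A `<=` Z -> measurable A.
  move=> AZ; apply: le_caratheodory_measurable => X.
  rewrite (_ : mu (X `&` _) = 0%E) ?add0e; first by apply: le_outer_measure; exact: subIsetl.
  apply/eqP; rewrite eq_le outer_measure_ge0 andbT -mZ.
  by apply: le_outer_measure => x [_ /AZ].
pose E n : set cara := if n is n'.+1 then G `\` U n' else Z.
have -> : (G : set cara) = \bigcup_n E n.
  apply/seteqP; split=> x; last by move=> [[|n] _ []].
  move=> Gx; have [h|/existsNP[n /not_implyP[_ h]]] := pselect (forall n, setT n -> U n x).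
    by exists 0%N.
  by exists n.+1.
have bE n : borel (G `\` U n).
  rewrite setDE; apply: borelI; first exact: borel_Gamma.
  by apply: borelC; apply: borel_open; case: (HU n).
apply/measurable_fun_bigcup => -[|n]; first exact: meas0.
  exact: (borel_measurable (bE n)).
  by move=> _ Y mY; apply: meas0 => x [].
apply: (measurability _ (RGenInftyO.measurableE R)) => // _ [_ [a ->] <-].
have [_ _ cf] := HU n.
have [V [oV HV]] := @cont_on_preimage R N (cl `\` U n) f [set s | s < a] (@open_lt _ _) cf.
rewrite (_ : E n.+1 `&` _ = (G `\` U n) `&` V).
  by apply: borel_measurable; apply: borelI; [exact: bE|exact: borel_open].
apply/seteqP; split=> x [[Gx Ux]] /=; rewrite ?in_itv/= => h; split=> //=.
  by apply/(HV x) => //; split=> //; exact: Gamma_closure.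
by apply/(HV x) => //; split=> //; exact: Gamma_closure.
Qed.

Lemma coord_measurable_mu (i : 'I_N) :
  measurable_fun (setT : set cara) (fun x : cara => (x : RN) 0 i : R).
Proof.
apply: (measurability _ (RGenInftyO.measurableE R)) => // _ [_ [a ->] <-].
rewrite setTI; apply: borel_measurable; apply: borel_open.
rewrite (_ : _ @^-1` _ = (fun x : RN => x 0 i) @^-1` [set s | s < a]).
  apply: open_comp; [move=> s _; exact: coord_continuous|exact: open_lt].
by apply/seteqP; split=> x /=; rewrite in_itv.
Qed.

Lemma Ks_measurable (s : R) :
  measurable_fun (setT : set (cara * cara)) (fun z : cara * cara => Ks s (z.1 : RN) (z.2 : RN)).
Proof.
apply: (measurableT_comp (measurable_powR _)).
apply: (measurableT_comp (@continuous_measurable_fun R (@Num.sqrt R) (@sqrt_continuous R))).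
apply: measurable_sum => i; apply: measurable_funX; apply: measurable_funB.
  exact: (measurableT_comp (coord_measurable_mu i) measurable_fst).
exact: (measurableT_comp (coord_measurable_mu i) measurable_snd).
Qed.

Lemma Ks_ge0 (s : R) (x y : RN) : 0 <= Ks s x y.
Proof. exact: powR_ge0. Qed.

End boundary_measure.

(** * The form A on V *)

Section abstract_limit.
Context {d : measure_display} {T : measurableType d} {R : realType}.
Variables (m : {measure set T -> \bar R}) (D : set T) (mD : measurable D).

(** Here the limit is prescribed in advance, as the pointwise limit of a subsequence. Fatou's lemma
    turns the Cauchy bound into a bound of the distance to [g] for the full sequence. *)
Lemma sqint_cauchy_limit (f : nat -> T -> R) (g : T -> R) (phi : nat -> nat) :
  (forall n, (n <= phi n)%N) -> (forall n, sqint m D (f n)) -> measurable_fun D g ->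
  {ae m, forall x, D x -> f (phi n) x @[n --> \oo] --> g x} ->
  (forall e : R, 0 < e -> exists n0, forall n k, (n0 <= n)%N -> (n0 <= k)%N ->
     dot m D (fun x => f n x - f k x) (fun x => f n x - f k x) <= e) ->
  sqint m D g /\ forall e : R, 0 < e -> exists n0, forall n, (n0 <= n)%N ->
     dot m D (fun x => f n x - g x) (fun x => f n x - g x) <= e.
Proof.
move=> phin sf mg fg H.
have K (e : R) : 0 < e -> exists n0, forall n, (n0 <= n)%N ->
    sqint m D (fun x => f n x - g x) /\
    dot m D (fun x => f n x - g x) (fun x => f n x - g x) <= e.
  move=> e0; have [n0 Hn] := H e e0; exists n0 => n nn.
  apply: (dot_le_liminf (f := fun k x => f n x - f (phi k) x) mD).
  - by move=> k; exact: (sqintB mD (sf n) (sf (phi k))).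
  - by apply: measurable_funB => //; case: (sf n).
  - by move: fg; apply: ae_dom_imp => x _ fg; apply: cvgB => //; exact: cvg_cst.
  - exists n0 => // k /= nk; apply: Hn => //; exact: leq_trans nk (phin k).
split.
  have [n0 /(_ n0 (leqnn n0))[s1 _]] := K 1 ltr01.
  have := sqintB mD (sf n0) s1; congr sqint.
  by apply/funext => x; rewrite opprB addrC subrK.
by move=> e /K[n0 Hn]; exists n0 => n /Hn[].
Qed.

End abstract_limit.

(** * The form as a sum of L^2 products, and its closedness *)

Section form.
Context {R : realType} {N : nat} (s : R) (Om : set 'rV[R]_N).
Hypotheses (Om_open : open Om) (Om_bounded : bounded_set Om).
Context (mu : {outer_measure set 'rV[R]_N -> \bar R}).
Hypotheses (mu_reg : regular_borel_on_boundary Om mu) (mu_adm : admissible Om mu).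
Local Notation RN := 'rV[R]_N.
Local Notation cara := (caratheodory_type mu).
Local Notation G := (Gamma Om mu : set cara).
Local Notation Ginf := (Gamma_inf Om mu).
Local Notation cl := (closure Om).
Local Notation VV := (V s Om mu).
Local Notation Af := (Aform s Om mu).
Variable m : {sigma_finite_measure set cara -> \bar R}.
Hypothesis Hm : forall A : set cara, measurable A -> A `<=` G -> m A = bmeas mu A.
Local Notation GG := (G `*` G).
Local Notation mm := ((m \x m)%E : {measure set (cara * cara) -> \bar R}).
Local Notation sqG := (sqint m G).
Local Notation dtG := (dot m G).
Local Notation sqK := (sqint mm GG).
Local Notation dtK := (dot mm GG).
Implicit Types (u w : RN -> R) (q : cara -> R).
Let mG : measurable G := measurable_Gamma mu_reg.
Let mGG : measurable GG := measurable_square mG.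

(** The square root of the kernel is absorbed into the function, so that the nonlocal term becomes
    an L^2 product over pairs of points. *)
Definition jump q (z : cara * cara) : R := Num.sqrt (Ks s (z.1 : RN) (z.2 : RN)) * (q z.1 - q z.2).

Lemma jumpM q q' x y : jump q (x, y) * jump q' (x, y) = Ks s (x : RN) (y : RN) * (q x - q y) * (q' x - q' y).
Proof.
rewrite /jump /= mulrACA -expr2 sqr_sqrtr ?mulrA//; exact: Ks_ge0.
Qed.

Lemma jump_sq q x y : jump q (x, y) ^+ 2 = Ks s (x : RN) (y : RN) * (q x - q y) ^+ 2.
Proof. by rewrite expr2 jumpM [_ ^+ 2]expr2 mulrA. Qed.

Lemma jump_measurable q : measurable_fun G q -> measurable_fun GG (jump q).
Proof.
move=> mq; apply: measurable_funM.
  apply: measurable_funTS.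
  apply: (measurableT_comp (@continuous_measurable_fun R (@Num.sqrt R) (@sqrt_continuous R))).
  exact: (Ks_measurable mu_reg).
apply: measurable_funB.
  apply: (measurable_comp (F := G)) => //; first by move=> _ [z [Gz _] <-].
  by apply: measurable_funTS; exact: measurable_fst.
apply: (measurable_comp (F := G)) => //; first by move=> _ [z [_ Gz] <-].
by apply: measurable_funTS; exact: measurable_snd.
Qed.

Lemma bmeas_integral (f : cara -> \bar R) :
  (\int[bmeas mu]_(x in G) f x = \int[m]_(x in G) f x)%E.
Proof. by apply: eq_measure_integral => A mA AG; exact/esym/Hm. Qed.

Lemma bmeas_Rintegral (f : cara -> R) :
  \int[bmeas mu]_(x in G) f x = \int[m]_(x in G) f x.
Proof. by rewrite /Rintegral bmeas_integral. Qed.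

Lemma bmeas_ae (P : cara -> Prop) : {ae bmeas mu, forall x, G x -> P x} ->
  {ae m, forall x, G x -> P x}.
Proof.
move=> [Z [mZ Z0 HZ]]; exists (Z `&` G); split.
- exact: measurableI.
- rewrite Hm; [|exact: measurableI|exact: subIsetr].
  by apply/eqP; rewrite eq_le measure_ge0 andbT -Z0; apply: le_outer_measure; exact: subIsetl.
- move=> x /= h; split; first exact: HZ.
  by apply: contrapT => nG; apply: h.
Qed.

Lemma qc_measurable u : W12tilde Om u -> measurable_fun G (qc Om u : cara -> R).
Proof.
move=> Tu; have [qu _] := qcP Om_open Om_bounded Tu.
exact: (quasi_cont_measurable Om_open Om_bounded mu_reg mu_adm qu).
Qed.

Lemma VP u : VV u <-> [/\ W12tilde Om u, cap_null Om [set x | Ginf x /\ qc Om u x != 0],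
  sqG (qc Om u) & sqK (jump (qc Om u))].
Proof.
have E1 : (\int[bmeas mu]_(x in G) ((qc Om u x) ^+ 2)%:E =
   \int[m]_(x in G) ((qc Om u x) ^+ 2)%:E)%E by exact: bmeas_integral.
have E2 : W12tilde Om u -> (\int[bmeas mu]_(x in G) \int[bmeas mu]_(y in G)
       (Ks s x y * (qc Om u x - qc Om u y) ^+ 2)%:E =
   \int[mm]_(z in GG) (jump (qc Om u) z ^+ 2)%:E)%E.
  move=> Tu; rewrite bmeas_integral.
  under eq_integral do rewrite bmeas_integral.
  rewrite (double_integral_ge0 m mG (F := fun x y => Ks s x y * (qc Om u x - qc Om u y) ^+ 2)).
  - by apply: eq_integral => -[x y] _; rewrite jump_sq.
  - have mj := jump_measurable (qc_measurable Tu).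
    have := measurable_funM mj mj; apply: eq_measurable_fun => -[x y] _ /=.
    by rewrite -expr2 jump_sq.
  - by move=> x y _ _; rewrite mulr_ge0// ?sqr_ge0//; exact: Ks_ge0.
split=> [[Tu c0 i1 i2]|[Tu c0 [_ i1] [_ i2]]]; split=> //.
- exact/(cap_nullP Om_open Om_bounded).
- by split; [exact: qc_measurable|rewrite -E1].
- by split; [exact: jump_measurable (qc_measurable Tu)|rewrite -E2].
- exact/(cap_nullP Om_open Om_bounded).
- by rewrite E1.
- by rewrite E2.
Qed.

(** With each of the three terms an L^2 product, Cauchy-Schwarz, Fatou and completeness apply to the
    form term by term. *)
Lemma AformE u w : VV u -> VV w -> Af u w =
  \sum_(i < N) ldot Om (grad Om u i) (grad Om w i) + dtG (qc Om u) (qc Om w) +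
  dtK (jump (qc Om u)) (jump (qc Om w)).
Proof.
move=> /VP[Tu _ su ju] /VP[Tw _ sw jw]; rewrite /Aform; congr (_ + _ + _).
- have Wu := W12tilde_W12 Tu; have Ww := W12tilde_W12 Tw.
  have H (r : seq 'I_N) :
    (@leb R N).-integrable Om (EFin \o (fun x => \sum_(i <- r) grad Om u i x * grad Om w i x)) /\
    \int[leb N]_(x in Om) (\sum_(i <- r) grad Om u i x * grad Om w i x) =
    \sum_(i <- r) ldot Om (grad Om u i) (grad Om w i).
    elim: r => [|i r [ih1 ih2]].
      split; last first.
        by rewrite big_nil; under eq_Rintegral do rewrite big_nil; rewrite /Rintegral integral0.
      have := integrable0 (@leb R N) Om; apply: eq_integrable; first exact: (mOm Om_open).
      by move=> x _; rewrite /= big_nil.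
    have i1 := sqint_mul_integrable (mOm Om_open) (lsqE (grad_sq i Wu)) (lsqE (grad_sq i Ww)).
    split.
      have := integrableD (mOm Om_open) i1 ih1; apply: eq_integrable; first exact: (mOm Om_open).
      by move=> x _; rewrite /= big_cons.
    rewrite big_cons -ih2 ldotE -(RintegralD (mOm Om_open) i1 ih1).
    by apply: eq_Rintegral => x _; rewrite big_cons.
  by have [] := H (index_enum _).
- exact: bmeas_Rintegral.
have ij := sqint_mul_integrable mGG ju jw.
rewrite bmeas_Rintegral; under eq_Rintegral do rewrite bmeas_Rintegral.
have := @double_Rintegral _ _ _ m _ mG (fun x y => jump (qc Om u) (x, y) * jump (qc Om w) (x, y)).
have E : (fun z : cara * cara => jump (qc Om u) (z.1, z.2) * jump (qc Om w) (z.1, z.2)) =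
   (fun z => jump (qc Om u) z * jump (qc Om w) z) by apply/funext => -[].
rewrite E => /(_ ij) H; apply: (etrans _ H).
by apply: eq_Rintegral => x _; apply: eq_Rintegral => y _; rewrite jumpM.
Qed.

(** Kept in polarized form because [grad] and [qc] are choices, linear only up to exceptional sets;
    it also lets the equation be inserted directly into each term. *)
Definition form_dist u w : R := Af u u - 2 * Af u w + Af w w.

Lemma form_distE u w : VV u -> VV w -> form_dist u w =
  \sum_(i < N) ldot Om (fun x => grad Om u i x - grad Om w i x) (fun x => grad Om u i x - grad Om w i x)
  + dtG (fun x => qc Om u x - qc Om w x) (fun x => qc Om u x - qc Om w x) +
  dtK (fun z => jump (qc Om u) z - jump (qc Om w) z) (fun z => jump (qc Om u) z - jump (qc Om w) z).
Proof.
move=> Vu Vw; rewrite /form_dist (AformE Vu Vu) (AformE Vu Vw) (AformE Vw Vw).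
move/VP: Vu => [Tu _ su ju]; move/VP: Vw => [Tw _ sw jw].
have Wu := W12tilde_W12 Tu; have Ww := W12tilde_W12 Tw.
rewrite (dot_sub_self mG su sw) (dot_sub_self mGG ju jw).
under [X in _ = X + _ + _]eq_bigr => i _ do
  rewrite (ldotB_self Om_open (grad_sq i Wu) (grad_sq i Ww)).
rewrite big_split sumrB -mulr_sumr /=.
have E (a1 a2 a3 b1 b2 b3 c1 c2 c3 : R) : a1 + b1 + c1 - 2 * (a2 + b2 + c2) + (a3 + b3 + c3) =
  a1 - 2 * a2 + a3 + (b1 - 2 * b2 + b3) + (c1 - 2 * c2 + c3) by ring.
exact: E.
Qed.

Lemma Aform_sym u w : VV u -> VV w -> Af u w = Af w u.
Proof.
move=> Vu Vw; rewrite (AformE Vu Vw) (AformE Vw Vu) (dotC m) (dotC mm).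
by congr (_ + _ + _); apply: eq_bigr => i _; exact: ldotC.
Qed.

Lemma Aform_ge0 u : VV u -> 0 <= Af u u.
Proof.
move=> Vu; rewrite AformE// !addr_ge0 ?dot_ge0// sumr_ge0// => i _; exact: ldot_ge0.
Qed.

Lemma form_dist_ge0 u w : VV u -> VV w -> 0 <= form_dist u w.
Proof.
move=> Vu Vw; rewrite form_distE// !addr_ge0 ?dot_ge0// sumr_ge0// => i _; exact: ldot_ge0.
Qed.

(** Cauchy-Schwarz for [A (u - w, xi)], kept as Young's inequality with a free weight [l]: in this
    form the bounds of the three terms simply add up. *)
Lemma Aform_young u w xi (l : R) : 0 < l -> VV u -> VV w -> VV xi ->
  2 * `|Af u xi - Af w xi| <= l * form_dist u w + l^-1 * Af xi xi.
Proof.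
move=> l0 Vu Vw Vx; rewrite (form_distE Vu Vw) (AformE Vu Vx) (AformE Vw Vx) (AformE Vx Vx).
move/VP: Vu => [Tu _ su ju]; move/VP: Vw => [Tw _ sw jw]; move/VP: Vx => [Tx _ sx jx].
have Wu := W12tilde_W12 Tu; have Ww := W12tilde_W12 Tw; have Wx := W12tilde_W12 Tx.
have Y (a b c : R) : a ^+ 2 <= b * c -> 0 <= b -> 0 <= c -> 2 * `|a| <= l * b + l^-1 * c.
  move=> h b0 c0; have lb : 0 <= l * b by rewrite mulr_ge0// ltW.
  have lc : 0 <= l^-1 * c by rewrite mulr_ge0// invr_ge0 ltW.
  have E : b * c = (l * b) * (l^-1 * c) by rewrite mulrACA divff ?gt_eqF// mul1r.
  move: h lb lc; rewrite E; move: (l * b) (l^-1 * c) => p q h p0 q0.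
  rewrite leNgt; apply/negP => lt.
  have : (p + q) ^+ 2 < (2 * `|a|) ^+ 2 by rewrite ltrXn2r ?nnegrE ?addr_ge0.
  rewrite exprMn real_normK ?num_real//; have := sqr_ge0 (p - q).
  rewrite (_ : (p + q) ^+ 2 = (p - q) ^+ 2 + 4 * (p * q)); last by ring.
  by rewrite (_ : 2 ^+ 2 = 4 :> R); [lra|ring].
have h1 : 2 * `|\sum_(i < N) ldot Om (grad Om u i) (grad Om xi i) -
      \sum_(i < N) ldot Om (grad Om w i) (grad Om xi i)| <=
   l * (\sum_(i < N) ldot Om (fun x => grad Om u i x - grad Om w i x) (fun x => grad Om u i x - grad Om w i x))
   + l^-1 * \sum_(i < N) ldot Om (grad Om xi i) (grad Om xi i).
  rewrite -sumrB !mulr_sumr -big_split/=.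
  apply: (@le_trans _ _ (\sum_(i < N) 2 * `|ldot Om (grad Om u i) (grad Om xi i) -
      ldot Om (grad Om w i) (grad Om xi i)|)).
    by rewrite -mulr_sumr ler_pM2l// ler_norm_sum.
  apply: ler_sum => i _; have gu := grad_sq i Wu; have gw := grad_sq i Ww; have gx := grad_sq i Wx.
  rewrite -(ldotBl Om_open gu gw gx); apply: Y => //; try exact: ldot_ge0.
  exact: (ldot_CS Om_open (lsqB Om_open gu gw) gx).
have h2 : 2 * `|dtG (qc Om u) (qc Om xi) - dtG (qc Om w) (qc Om xi)| <=
   l * dtG (fun x => qc Om u x - qc Om w x) (fun x => qc Om u x - qc Om w x) +
   l^-1 * dtG (qc Om xi) (qc Om xi).
  rewrite -(dotBl mG su sw sx); apply: Y => //; try exact: dot_ge0.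
  exact: (dot_CS mG (sqintB mG su sw) sx).
have h3 : 2 * `|dtK (jump (qc Om u)) (jump (qc Om xi)) - dtK (jump (qc Om w)) (jump (qc Om xi))| <=
   l * dtK (fun x => jump (qc Om u) x - jump (qc Om w) x) (fun x => jump (qc Om u) x - jump (qc Om w) x) +
   l^-1 * dtK (jump (qc Om xi)) (jump (qc Om xi)).
  rewrite -(dotBl mGG ju jw jx); apply: Y => //; try exact: dot_ge0.
  exact: (dot_CS mGG (sqintB mGG ju jw) jx).
move: h1 h2 h3; set a1 := \sum_(i < N) _; set a2 := \sum_(i < N) _; set a3 := \sum_(i < N) _.
set a4 := \sum_(i < N) _.
set b1 := dtG (qc Om u) _; set b2 := dtG (qc Om w) _; set b3 := dtG _ _; set b4 := dtG _ _.
set c1 := dtK (jump (qc Om u)) _; set c2 := dtK (jump (qc Om w)) _; set c3 := dtK _ _; set c4 := dtK _ _.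
move=> h1 h2 h3.
apply: (@le_trans _ _ (2 * (`|a1 - a2| + `|b1 - b2| + `|c1 - c2|))).
  rewrite ler_pM2l// (_ : _ - _ = (a1 - a2) + (b1 - b2) + (c1 - c2)); last by ring.
  by apply: le_trans (ler_normD _ _) _; rewrite lerD2r ler_normD.
by rewrite !mulrDr; lra.
Qed.

Lemma form_closed (f : nat -> RN -> R) w : (forall n, VV (f n)) -> lsq Om w -> lcvg Om f w ->
  (forall e : R, 0 < e -> exists n0, forall n k, (n0 <= n)%N -> (n0 <= k)%N ->
     form_dist (f n) (f k) <= e) ->
  VV w /\ forall e : R, 0 < e -> exists n0, forall n, (n0 <= n)%N -> form_dist (f n) w <= e.
Proof.
move=> Vf sw fw H.
have Tf n : W12tilde Om (f n) by have [] := (VP (f n)).1 (Vf n).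
have Wf n := W12tilde_W12 (Tf n).
pose S1 u v := \sum_(i < N) ldot Om (fun x => grad Om u i x - grad Om v i x) (fun x => grad Om u i x - grad Om v i x).
have S10 u v : 0 <= S1 u v by apply: sumr_ge0 => i _; exact: ldot_ge0.
have n2S u v : W12 Om u -> W12 Om v -> n2 Om (fun x => u x - v x) =
    ldot Om (fun x => u x - v x) (fun x => u x - v x) + S1 u v.
  move=> Wu Wv.
  exact: (n2_weak_gradientB Om_open Om_bounded (W12_sq Wu) (W12_sq Wv) (W12_grad Wu) (W12_grad Wv)).
(* The form controls the gradients and the convergence in L^2 supplies the missing part of the
   Sobolev norm. The limit [w'] obtained from completeness is then identified with [w] almost
   everywhere. *)
have [w' [Tw' fw']] : exists w', W12tilde Om w' /\
    (n2 Om (fun x => f n x - w' x) @[n --> \oo] --> (0 : R)).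
  apply: (W12tilde_complete Om_open Om_bounded Tf) => e e0.
  have e2 : 0 < e / 2 by rewrite divr_gt0.
  have [n1 Hn1] := H _ e2.
  have [n2' Hn2] : exists n0, forall n k : nat, (n0 <= n)%N -> (n0 <= k)%N ->
      ldot Om (fun x => f n x - f k x) (fun x => f n x - f k x) <= e / 2.
    have e8 : 0 < e / 8 by rewrite divr_gt0.
    move/lcvgE: fw => /cvgrPdist_le/(_ _ e8)[n0 _ Hn]; exists n0.
    have K n : (n0 <= n)%N -> ldot Om (fun x => f n x - w x) (fun x => f n x - w x) <= e / 8.
      by move=> /Hn; rewrite /= sub0r normrN => h; apply: le_trans h; exact: ler_norm.
    move=> n k nn nk.
    have E : (fun x => f n x - f k x) = (fun x => (f n x - w x) + (-1) * (f k x - w x)).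
      by apply/funext => x; ring.
    have s1 := lsqB Om_open (W12_sq (Wf n)) sw; have s2 := lsqB Om_open (W12_sq (Wf k)) sw.
    have s3 := lsqZ Om_open (-1) s2.
    rewrite E; apply: le_trans (ldotD_le Om_open s1 s3) _.
    rewrite (ldotZl Om_open _ s2 s3) (ldotZr Om_open _ s2 s2) mulrA mulrNN !mul1r.
    by have := K n nn; have := K k nk; lra.
  exists (maxn n1 n2') => n k; rewrite !geq_max => /andP[p1 p2] /andP[q1 q2].
  rewrite (n2S _ _ (Wf n) (Wf k)); have := Hn1 n k p1 q1; have := Hn2 n k p2 q2.
  rewrite (form_distE (Vf n) (Vf k)) -/(S1 _ _).
  have := dot_ge0 m G (fun x => qc Om (f n) x - qc Om (f k) x).
  have := dot_ge0 mm GG (fun x => jump (qc Om (f n)) x - jump (qc Om (f k)) x).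
  by lra.
have ww' : ae_in Om (fun x => w' x = w x).
  have sw' := W12_sq (W12tilde_W12 Tw'); have sf n := W12_sq (Wf n).
  have c' : lcvg Om f w'.
    apply/lcvgE; apply: (cvg0_le (c := 1)) fw' => n; first exact: ldot_ge0.
    by rewrite mul1r; exact: n2_dot_le.
  have E v : lsq Om v -> ldot Om w' v = ldot Om w v.
    move=> sv; exact: (cvg_unique _ (lcvg_dot Om_open sf sw' sv c') (lcvg_dot Om_open sf sw sv fw)).
  have sB := lsqB Om_open sw' sw.
  have : ldot Om (fun x => w' x - w x) (fun x => w' x - w x) = 0.
    by rewrite (ldotBl Om_open sw' sw sB) E// subrr.
  move=> /(ldot_self_eq0 Om_open sB); apply: ae_in_imp => x _ h.
  by apply/eqP; rewrite -subr_eq0 h.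
have Tw := W12tilde_ae Om_open Om_bounded ww' Tw'.
have Ww := W12tilde_W12 Tw.
have {}fw' : n2 Om (fun x => f n x - w x) @[n --> \oo] --> (0 : R).
  apply: (eq_cvg_seq _ fw') => n; apply: n2_ae.
  by move: ww'; apply: ae_in_imp => x _ ->.
have [phi [phin cphi]] := qc_cvg Om_open Om_bounded Tf Tw fw'.
have Vfs n := (VP (f n)).1 (Vf n).
have sf n : sqG (qc Om (f n)) by case: (Vfs n).
have jf n : sqK (jump (qc Om (f n))) by case: (Vfs n).
have mw := qc_measurable Tw.
have aeG : {ae m, forall x, G x -> qc Om (f (phi n)) x @[n --> \oo] --> qc Om w x}.
  apply: bmeas_ae; have := cap_null_ae_Gamma Om_open Om_bounded mu_adm cphi.
  apply: ae_dom_imp => x Gx h; apply: contrapT => k; apply: h; split=> //.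
  exact: Gamma_closure Gx.
have aeK : {ae mm, forall z, GG z ->
    jump (qc Om (f (phi n))) z @[n --> \oo] --> jump (qc Om w) z}.
  have := ae_square aeG; apply: ae_dom_imp => z _ [h1 h2].
  by rewrite /jump; apply: cvgM; [exact: cvg_cst|exact: cvgB].
have [sqw dw] : sqG (qc Om w) /\ forall e : R, 0 < e -> exists n0, forall n, (n0 <= n)%N ->
    dtG (fun x => qc Om (f n) x - qc Om w x) (fun x => qc Om (f n) x - qc Om w x) <= e.
  apply: (sqint_cauchy_limit mG phin sf mw aeG) => e /H[n0 Hn]; exists n0 => n k nn nk.
  have := Hn n k nn nk; rewrite (form_distE (Vf n) (Vf k)) -/(S1 _ _).
  have := dot_ge0 mm GG (fun x => jump (qc Om (f n)) x - jump (qc Om (f k)) x).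
  by have := S10 (f n) (f k); lra.
have [sjw dj] : sqK (jump (qc Om w)) /\ forall e : R, 0 < e -> exists n0, forall n, (n0 <= n)%N ->
    dtK (fun x => jump (qc Om (f n)) x - jump (qc Om w) x)
        (fun x => jump (qc Om (f n)) x - jump (qc Om w) x) <= e.
  apply: (sqint_cauchy_limit mGG phin jf (jump_measurable mw) aeK) => e /H[n0 Hn].
  exists n0 => n k nn nk; have := Hn n k nn nk; rewrite (form_distE (Vf n) (Vf k)) -/(S1 _ _).
  have := dot_ge0 m G (fun x => qc Om (f n) x - qc Om (f k) x).
  by have := S10 (f n) (f k); lra.
have Vw : VV w.
  apply/VP; split=> //.
  (* A nonzero value of [qc Om w] on [Gamma_inf] means that the versions do not converge to it there
     or that one of them is nonzero: a countable union of sets of zero capacity. *)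
  apply: cap_null_sub (cap_nullU Om_open Om_bounded cphi
    (cap_null_bigcup Om_open Om_bounded (A := fun n => [set x | Ginf x /\ qc Om (f (phi n)) x != 0]) _)).
    move=> x [Gx wx].
    have [h|h] := pselect (forall n, qc Om (f (phi n)) x = 0).
      left; split; first exact: Gamma_inf_closure Gx.
      have c0 : qc Om (f (phi n)) x @[n --> \oo] --> (0 : R).
        by apply: (eq_cvg_seq h); exact: cvg_cst.
      by move=> c; move/eqP: wx; apply; exact: (cvg_unique _ c c0).
    right; apply: contrapT => k; apply: h => n; apply/eqP; apply: contrapT => hn.
    by apply: k; exists n => //; split=> //; apply/negP.
  by move=> n; case: (Vfs (phi n)).
split=> // e e0; have e3 : 0 < e / 3 by rewrite divr_gt0.
have [n1 H1] := dw _ e3; have [n2' H2] := dj _ e3.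
have /cvgrPdist_le/(_ _ e3)[n3 _ H3] := fw'.
exists (maxn n1 (maxn n2' n3)) => n; rewrite !geq_max => /and3P[p1 p2 p3].
have h1 := H1 n p1; have h2 := H2 n p2; have := H3 n p3.
rewrite (form_distE (Vf n) Vw) -/(S1 _ _).
rewrite /= sub0r normrN (ger0_norm (n2_ge0 _ _)) (n2S _ _ (Wf n) Ww).
have := ldot_ge0 Om (fun x => f n x - w x); move: h1 h2 => h1 h2 h3 h4; lra.
Qed.

End form.

(** * Functions of time *)

Section measurable_version.
Context {d : measure_display} {T : measurableType d} {R : realType}.
Variables (m : {measure set T -> \bar R}) (D : set T) (mD : measurable D).

Lemma ae_limit_measurable (f : nat -> T -> R) (g : T -> R) :
  (forall n, measurable_fun D (f n)) ->
  {ae m, forall x, D x -> f n x @[n --> \oo] --> g x} ->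
  exists h : T -> R, measurable_fun D h /\ {ae m, forall x, D x -> g x = h x}.
Proof.
move=> mf [Z [mZ Z0 HZ]].
exists (fun x => g x * \1_(~` Z) x); split.
  apply: (measurable_fun_cvg (h := fun n x => f n x * \1_(~` Z) x)) => [n|x Dx].
    apply: measurable_funM; first exact: mf.
    by apply: measurable_indic; exact: measurableC.
  have [Zx|Zx] := pselect (Z x).
    rewrite indicE memNset/=; last by move=> /(_ Zx).
    by under eq_fun do rewrite mulr0; rewrite mulr0; exact: cvg_cst.
  rewrite indicE mem_set//=; apply: cvgM; last exact: cvg_cst.
  by apply: contrapT => h; apply: Zx; apply: HZ => /= /(_ Dx).
exists Z; split=> // x /= h; apply: contrapT => Zx; apply: h => Dx.
by rewrite indicE mem_set//= mulr1.
Qed.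

End measurable_version.

(** * Integrals on the line, Dini quotients and du Bois-Reymond's lemma *)

Section real_line.
Context {R : realType}.
Local Notation lebR := (@lebesgue_measure R).
Implicit Types (f g L : R -> R) (a b c r t x y : R).

Lemma measurable_cc a b : measurable (`[a, b]%classic : set (measurableTypeR R)).
Proof. exact: measurable_itv. Qed.

Definition bounded_measurable g : Prop :=
  measurable_fun setT g /\ exists M : R, forall x, `|g x| <= M.

Lemma itv_measure_lt a b : (lebR `[a, b] < +oo)%E.
Proof. by rewrite lebesgue_measure_itv/=; case: ifPn => // _; rewrite -EFinB ltry. Qed.

Lemma fine_itv_measure a b : a <= b -> fine (lebR `[a, b]) = b - a.
Proof.
move=> ab; rewrite lebesgue_measure_itv/= lte_fin; case: ltP => ab' //=.
by rewrite (le_anti (introT andP (conj ab ab'))) subrr.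
Qed.

Lemma bounded_measurable_integrable g a b : bounded_measurable g ->
  lebR.-integrable `[a, b] (EFin \o g).
Proof.
move=> [mg [M gM]]; apply: measurable_bounded_integrable => //.
- exact: itv_measure_lt.
- exact: measurable_funTS.
- exists M; rewrite num_real; split=> // y My x _; exact: le_trans (gM x) (ltW My).
Qed.

Lemma bounded_measurableB g f : bounded_measurable g -> bounded_measurable f ->
  bounded_measurable (fun x => g x - f x).
Proof.
move=> [mg [M gM]] [mf [K fK]]; split; first exact: measurable_funB.
by exists (M + K) => x; apply: le_trans (ler_normB _ _) _; exact: lerD.
Qed.

Lemma Rintegral_itvN g a b : bounded_measurable g ->
  \int[lebR]_(t in `[a, b]) (- g t) = - (\int[lebR]_(t in `[a, b]) g t).
Proof.
move=> bg; rewrite -mulN1r -RintegralZl//; last exact: bounded_measurable_integrable.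
by apply: eq_Rintegral => t _; rewrite mulN1r.
Qed.

Lemma bounded_measurableN g : bounded_measurable g -> bounded_measurable (fun x => - g x).
Proof.
move=> [mg [M gM]]; split; first exact: measurableT_comp.
by exists M => x; rewrite normrN.
Qed.

Lemma continuous_itv_integrable f a b : continuous f -> lebR.-integrable `[a, b] (EFin \o f).
Proof.
move=> cf; apply: continuous_compact_integrable; first exact: segment_compact.
exact: continuous_subspaceT.
Qed.

Lemma Rintegral_itv_add g a b c : a <= b -> b <= c ->
  lebR.-integrable `[a, c] (EFin \o g) ->
  \int[lebR]_(t in `[a, c]) g t = \int[lebR]_(t in `[a, b]) g t + \int[lebR]_(t in `[b, c]) g t.
Proof.
move=> ab bc ig.
have := @Rintegral_itvB R g (BLeft a) (BRight c) b ig; rewrite !bnd_simp => /(_ ab bc).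
move=> H; rewrite -(subrK (\int[lebR]_(t in `[a, b]) g t) (\int[lebR]_(t in `[a, c]) g t)) H addrC.
congr (_ + _); apply: Rintegral_itv_obnd_cbnd.
by apply: integrableS ig => // x /=; rewrite !in_itv/= => /andP[bx ->]; rewrite (le_trans ab (ltW bx)).
Qed.

Lemma Rintegral_itv_ge g a b : b <= a -> \int[lebR]_(t in `[a, b]) g t = 0.
Proof.
rewrite le_eqVlt => /predU1P[->|ba].
  by rewrite set_itv1 Rintegral_set1.
by rewrite set_itv_ge ?Rintegral_set0// bnd_simp -ltNge.
Qed.

Lemma Rintegral_itv_le g a b (M : R) : a <= b -> lebR.-integrable `[a, b] (EFin \o g) ->
  (forall t, a <= t <= b -> `|g t| <= M) ->
  `|\int[lebR]_(t in `[a, b]) g t| <= M * (b - a).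
Proof.
move=> ab ig gM.
apply: le_trans (le_normr_Rintegral _ ig) _; first exact: measurable_itv.
have ic : lebR.-integrable `[a, b] (EFin \o (fun=> M)).
  by apply: continuous_itv_integrable => x; exact: cvg_cst.
apply: le_trans (le_Rintegral _ _ ic _) _.
- exact: measurable_itv.
- exact: integrable_norm.
- by move=> t; rewrite /= in_itv/=; exact: gM.
rewrite (Rintegral_cst lebR (measurable_cc a b)) le_eqVlt; apply/orP; left; apply/eqP.
by congr (_ * _); exact: fine_itv_measure.
Qed.

(** The two-sided definition is rebased at a common left endpoint, which removes the distinction
    between the signs of [y]. *)
Lemma primitiveE f a y : continuous f -> a <= 0 -> a <= y ->
  primitive f y = \int[lebR]_(t in `[a, y]) f t - \int[lebR]_(t in `[a, 0]) f t.
Proof.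
move=> cf a0 ay; rewrite /primitive.
have [y0|/ltW y0] := leP 0 y.
  rewrite (Rintegral_itv_ge f y0) subr0 (Rintegral_itv_add a0 y0); first by rewrite addrAC subrr add0r.
  exact: continuous_itv_integrable.
rewrite (Rintegral_itv_ge f y0) sub0r (Rintegral_itv_add ay y0); first by rewrite opprD addNKr.
exact: continuous_itv_integrable.
Qed.

Lemma primitiveB f a b : continuous f -> a <= b ->
  primitive f b - primitive f a = \int[lebR]_(t in `[a, b]) f t.
Proof.
move=> cf ab; pose m := Num.min 0 a.
have m0 : m <= 0 by rewrite ge_min lexx.
have ma : m <= a by rewrite ge_min lexx orbT.
rewrite (primitiveE cf m0 ma) (primitiveE cf m0 (le_trans ma ab)).
rewrite (Rintegral_itv_add ma ab); last exact: continuous_itv_integrable.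
by rewrite opprB addrA subrK addrAC subrr add0r.
Qed.

Lemma primitive_derive f x : continuous f -> is_derive x (1 : R) (primitive f) (f x).
Proof.
move=> cf; pose m : R := Num.min 0 x - 1.
have min0 : Num.min 0 x <= 0 by rewrite ge_min lexx.
have m0 : m <= 0 by rewrite /m; lra.
have mx : m < x by rewrite ltrBlDr gt_min ltrDl ltr01 orbT.
have x1 : x < x + 1 by rewrite ltrDl.
have [D E] := continuous_FTC1_closed x1 (continuous_itv_integrable m (x + 1) cf) mx (cf x).
have H : is_derive x (1 : R) (fun y => \int[lebR]_(t in `[m, y]) f t) (f x).
  by apply: DeriveDef; [exact: D|rewrite -derive1E; exact: E].
have {}H : is_derive x (1 : R) (fun y => \int[lebR]_(t in `[m, y]) f t - \int[lebR]_(t in `[m, 0]) f t) (f x).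
  by apply: is_derive_eq; rewrite subr0.
apply: near_eq_is_derive H.
by apply: filterS (lt_nbhsr mx) => y /ltW my; rewrite (primitiveE cf m0 my).
Qed.

Lemma derivable_seq_cvg (F : R -> R) x (h : nat -> R) : derivable F x 1 ->
  h n @[n --> \oo] --> (0 : R) ->
  (forall n, h n != 0) -> (F (x + h n) - F x) / h n @[n --> \oo] --> derive1 F x.
Proof.
move=> dF h0 hn0; rewrite derive1E.
have hd : h n @[n --> \oo] --> (0 : R)^'.
  move=> A /= nA; have h1 : nbhs \oo (fun n => (fun y => y != 0 -> A y) (h n)) := h0 _ nA.
  by apply: (filterS _ h1) => n; apply; exact: hn0.
apply: (eq_cvg_seq (b := fun n => (h n)^-1 *: (F (h n *: 1 + x) - F x))).
  by move=> n; rewrite [_%:A]mulr1 (addrC x) mulrC.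
exact: (cvg_comp _ _ hd dF).
Qed.

Lemma Rintegral_derive f (F : R -> R) a b : a <= b -> continuous f ->
  (forall x, is_derive x (1 : R) F (f x)) -> \int[lebR]_(t in `[a, b]) f t = F b - F a.
Proof.
rewrite le_eqVlt => /predU1P[<- _ _|ab cf dF].
  by rewrite Rintegral_itv_ge// subrr.
have cF : continuous F.
  by move=> x; apply: differentiable_continuous; apply/derivable1_diffP; case: (dF x).
rewrite /Rintegral (continuous_FTC2 (F := F) ab) //.
- exact: continuous_subspaceT.
- split; first by move=> x _; case: (dF x).
  + by apply: cvg_at_right_filter; exact: cF.
  + by apply: cvg_at_left_filter; exact: cF.
- by move=> x _; rewrite derive1E; have [_ ->] := dF x.
Qed.

Definition lipschitz_on_R L (K : R) : Prop := forall x y, `|L x - L y| <= K * `|x - y|.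

Lemma lipschitz_continuous_R L (K : R) : lipschitz_on_R L K -> continuous L.
Proof.
move=> LL x; apply/cvgrPdist_lt => e e0.
have K0 : 0 <= K.
  by have := LL 0 1; rewrite sub0r normrN normr1 mulr1; exact: le_trans.
have d0 : 0 < e / (K + 1) by rewrite divr_gt0// ltr_wpDl.
apply/nbhs_ballP; exists (e / (K + 1)) => //= y xy.
have {}xy : `|x - y| < e / (K + 1) := xy.
apply: le_lt_trans (LL x y) _.
move: xy; rewrite ltr_pdivlMr ?ltr_wpDl// => h; apply: le_lt_trans h.
by rewrite mulrC ler_wpM2l// lerDl.
Qed.

(** With [P] a primitive of [L], the integral is the difference quotient of [P] at [b] minus the one
    at [a]. The fundamental theorem for Lipschitz functions is thus approached without their almost
    everywhere differentiability. *)
Lemma Rintegral_difference_quotient L (K : R) (h : nat -> R) a b : a <= b ->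
  lipschitz_on_R L K -> h n @[n --> \oo] --> (0 : R) -> (forall n, h n != 0) ->
  \int[lebR]_(t in `[a, b]) ((L (t + h n) - L t) / h n) @[n --> \oo] --> L b - L a.
Proof.
move=> ab LL h0 hn0; have cL := lipschitz_continuous_R LL.
pose P := primitive L.
have dP x : is_derive x (1 : R) P (L x) by exact: primitive_derive.
have cs n : continuous (fun t => L (t + h n)).
  by move=> t; apply: continuous_comp; [apply: cvgD; [exact: cvg_id|exact: cvg_cst]|exact: cL].
have ds n x : is_derive x (1 : R) (fun t => P (t + h n)) (L (x + h n)).
  have dh : is_derive x (1 : R) (fun t => t + h n) 1.
    by apply: is_derive_eq; rewrite addr0.
  by have := @is_derive1_comp _ P (fun t => t + h n) x _ _ (dP _) dh; rewrite mulr1.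
have E n : (P (b + h n) - P b) / h n - (P (a + h n) - P a) / h n =
   \int[lebR]_(t in `[a, b]) ((L (t + h n) - L t) / h n).
  have i1 := continuous_itv_integrable a b (cs n).
  have i2 := continuous_itv_integrable a b cL.
  rewrite (RintegralZr _ (measurable_cc a b) (integrableB (measurable_cc a b) i1 i2)).
  rewrite (RintegralB (measurable_cc a b) i1 i2).
  rewrite (Rintegral_derive ab (cs n) (ds n)) (Rintegral_derive ab cL dP) -mulrBl.
  by congr (_ / _); ring.
apply: (eq_cvg_seq (fun n => esym (E n))).
have D x : (P (x + h n) - P x) / h n @[n --> \oo] --> L x.
  have [dPx E1] := dP x; rewrite -E1 -derive1E.
  exact: (derivable_seq_cvg dPx h0 hn0).
exact: (cvgB (D b) (D a)).
Qed.

Lemma dist_min_le x y (e : R) : 0 <= e -> y - e <= x -> `|y - Num.min x y| <= e.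
Proof.
by move=> e0 h; rewrite minEle; case: ifP => xy; rewrite ?subrr ?normr0// ger0_norm ?subr_ge0//; lra.
Qed.

(* Truncating the difference quotients at [- q] gives a bounded sequence
   converging to [- q]. *)
Lemma ge_integral_of_dini L (K : R) q (h : nat -> R) a b : a <= b ->
  lipschitz_on_R L K -> bounded_measurable q ->
  h n @[n --> \oo] --> (0 : R) -> (forall n, h n != 0) ->
  {ae lebR, forall t, `[a, b]%classic t -> forall e : R, 0 < e ->
     exists n0, forall n, (n0 <= n)%N -> - q t - e <= (L (t + h n) - L t) / h n} ->
  - (\int[lebR]_(t in `[a, b]) q t) <= L b - L a.
Proof.
move=> ab LL bq h0 hn0 H; have cL := lipschitz_continuous_R LL.
have [mq [M qM]] := bq.
pose D n t := (L (t + h n) - L t) / h n.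
have cD n : continuous (D n).
  move=> t; apply: cvgM; last exact: cvg_cst.
  apply: cvgB; last exact: cL.
  by apply: continuous_comp; [apply: cvgD; [exact: cvg_id|exact: cvg_cst]|exact: cL].
have D_le n t : `|D n t| <= K.
  rewrite /D normrM normfV ler_pdivrMr ?normr_gt0//.
  by apply: le_trans (LL _ _) _; rewrite addrAC subrr add0r.
have K0 : 0 <= K by apply: le_trans (D_le 0%N 0).
have M0 : 0 <= M by apply: le_trans (qM 0).
have mD n : measurable_fun `[a, b]%classic (D n).
  by apply: measurable_funTS; exact: continuous_measurable_fun.
have mq' : measurable_fun `[a, b]%classic (fun t => - q t).
  by apply: measurable_funTS; exact: measurableT_comp.
have L1 := Rintegral_difference_quotient ab LL h0 hn0.
have L2 : \int[lebR]_(t in `[a, b]) Num.min (D n t) (- q t) @[n --> \oo] -->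
    \int[lebR]_(t in `[a, b]) (- q t).
  apply: (Rintegral_dominated_convergence (G := fun=> K + M)).
  - exact: measurable_itv.
  - by move=> n; exact: (measurable_minr (mD n) mq').
  - exact: mq'.
  - move: H; apply: ae_dom_imp => t _ Ht; apply/cvgrPdist_le => e e0.
    have [n0 Hn] := Ht e e0; exists n0 => // n /= nn; have := Hn n nn; rewrite -/(D n t).
    exact: dist_min_le (ltW e0).
  - by apply: continuous_itv_integrable => x; exact: cvg_cst.
  - move=> n t _; have := D_le n t; have := qM t.
    by rewrite minEle; case: ifP => _; rewrite ?normrN; lra.
rewrite -(Rintegral_itvN a b bq).
apply: (ler_cvg_to L2 L1); apply: nearW => n.
apply: le_Rintegral; first exact: measurable_itv.
- apply: measurable_bounded_integrable => //; first exact: itv_measure_lt.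
    exact: (measurable_minr (mD n) mq').
  exists (K + M); rewrite num_real; split=> // y My t _; apply: le_trans (ltW My).
  have := D_le n t; have := qM t.
  by rewrite minEle; case: ifP => _; rewrite ?normrN; lra.
- exact: (continuous_itv_integrable a b (cD n)).
- by move=> t _; rewrite ge_min lexx.
Qed.

(** The upper bound is the lower one applied to [- L], [- q] and the steps [- h n]. A one-sided
    bound on each side of [t] therefore suffices. *)
Lemma eq_integral_of_dini L (K : R) q (h : nat -> R) a b : a <= b ->
  lipschitz_on_R L K -> bounded_measurable q ->
  h n @[n --> \oo] --> (0 : R) -> (forall n, 0 < h n) ->
  {ae lebR, forall t, `[a, b]%classic t -> forall e : R, 0 < e ->
     exists n0, forall n, (n0 <= n)%N -> - q t - e <= (L (t + h n) - L t) / h n} ->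
  {ae lebR, forall t, `[a, b]%classic t -> forall e : R, 0 < e ->
     exists n0, forall n, (n0 <= n)%N -> (L (t - h n) - L t) / (- h n) <= - q t + e} ->
  L b - L a = - (\int[lebR]_(t in `[a, b]) q t).
Proof.
move=> ab LL bq h0 hp H1 H2; apply/eqP; rewrite eq_le; apply/andP; split; last first.
  by apply: (ge_integral_of_dini ab LL bq h0) H1 => n; rewrite gt_eqF.
have LN : lipschitz_on_R (fun x => - L x) K.
  by move=> x y; rewrite -opprD normrN; exact: LL.
have := ge_integral_of_dini ab LN (bounded_measurableN bq) (h := fun n => - h n).
rewrite (Rintegral_itvN a b bq) opprK => H.
suff : \int[lebR]_(t in `[a, b]) q t <= - L b - - L a by lra.
apply: H.
- by rewrite -oppr0; exact: cvgN.
- by move=> n; rewrite oppr_eq0 gt_eqF.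
move: H2; apply: ae_dom_imp => t _ Ht e e0; have [n0 Hn] := Ht e e0; exists n0 => n /Hn.
by rewrite opprK -opprD mulNr; lra.
Qed.

Lemma ae_derive_integral (c g : R -> R) a b : bounded_measurable g ->
  (forall t, a <= t <= b -> c t - c a = \int[lebR]_(r in `[a, t]) g r) ->
  {ae lebR, forall t, `]a, b[%classic t -> is_derive t (1 : R) c (g t)}.
Proof.
move=> bg H; pose gr := g \_ `[a, b].
have bgr : bounded_measurable gr.
  have [mg [M gM]] := bg; split.
    by apply/(measurable_restrictT _ (measurable_cc a b)); exact: measurable_funTS.
  exists M => x; rewrite /gr patchE; case: ifP => // _; rewrite normr0.
  by apply: le_trans (gM x); exact: normr_ge0.
have lg : locally_integrable setT gr.
  apply: (integrable_locally (measurable_cc a b)).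
  exact: bounded_measurable_integrable.
have := FTC1 (a := BLeft a) (fun y => bounded_measurable_integrable a y bgr) lg.
move=> F0; apply: filterS F0; first exact: (ae_filter_ringOfSetsType lebR).
move=> t Ht; rewrite /= in_itv/= => /andP[at_ tb].
have [D E] := Ht at_.
have grt : gr t = g t by rewrite /gr patchE mem_set//= in_itv/= !ltW.
have dF : is_derive t (1 : R) (fun y => \int[lebR]_(r in `[a, y]) gr r) (g t).
  by apply: DeriveDef; [exact: D|rewrite -derive1E -grt; exact: E].
have {}dF : is_derive t (1 : R) (fun y => \int[lebR]_(r in `[a, y]) gr r + c a) (g t).
  by apply: is_derive_eq; rewrite addr0.
apply: near_eq_is_derive dF.
apply: filterS2 (lt_nbhsr at_) (lt_nbhsl tb) => y ay yb.
rewrite -(subrK (c a) (c y)) H ?ltW//; congr (_ + _); apply: eq_Rintegral => r.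
rewrite inE/= in_itv/= => /andP[ar ry]; rewrite /gr patchE mem_set//= in_itv/= ar.
exact: le_trans ry (ltW yb).
Qed.

Section ramp.
Variables (r e : R).
Hypothesis e0 : 0 < e.

(** The smooth step from 0 at [r] to 1 at [r + e], with its argument [(t - r) / e] in the shape of
    [Cn_affine]. *)
Definition ramp t : R := smooth_step (e^-1 * t + - (e^-1 * r)).

Lemma ramp_arg t : e^-1 * t + - (e^-1 * r) = (t - r) / e.
Proof. by rewrite mulrBl !(mulrC _ e^-1). Qed.

Lemma ramp_smooth : smooth ramp.
Proof. by move=> n; apply: Cn_affine; exact: smooth_step_smooth. Qed.

Lemma ramp0 t : t <= r -> ramp t = 0.
Proof.
move=> tr; rewrite /ramp ramp_arg smooth_step0// pmulr_lle0 ?invr_gt0//.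
by rewrite subr_le0.
Qed.

Lemma ramp1 t : r + e <= t -> ramp t = 1.
Proof.
move=> tr; rewrite /ramp ramp_arg smooth_step1// ler_pdivlMr// mul1r.
by rewrite lerBrDl.
Qed.

Lemma ramp_ge0 t : 0 <= ramp t. Proof. exact: smooth_step_ge0. Qed.
Lemma ramp_le1 t : ramp t <= 1. Proof. exact: smooth_step_le1. Qed.

End ramp.

Lemma smooth_step_derive : exists (s' : R -> R) (B : R), [/\ continuous s',
  forall x, is_derive x (1 : R) (@smooth_step R) (s' x),
  forall x, `|s' x| <= B & forall x, ~~ (0 <= x <= 1) -> s' x = 0].
Proof.
have [s' [ds cs1]] := @smooth_step_smooth R 2%N.
have cs : continuous s' := CnW (cs1 : Cn 1%N s').
have s'0 x : ~~ (0 <= x <= 1) -> s' x = 0.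
  rewrite negb_and -!ltNge => /orP[x0|x1].
    have : is_derive x (1 : R) (@smooth_step R) 0.
      apply: (@near_eq_is_derive _ _ _ (fun=> 0)).
      by apply: filterS (lt_nbhsl x0) => y /ltW y0; rewrite smooth_step0.
    by move=> [_ <-]; have [_ ->] := ds x.
  have : is_derive x (1 : R) (@smooth_step R) 0.
    apply: (@near_eq_is_derive _ _ _ (fun=> 1 : R)).
    by apply: filterS (lt_nbhsr x1) => y /ltW y0; rewrite smooth_step1.
  by move=> [_ <-]; have [_ ->] := ds x.
have cn : {within `[0, 1], continuous (fun x => `|s' x|)}.
  apply: continuous_subspaceT => x; apply: continuous_comp; first exact: cs.
  exact: norm_continuous.
have [y _ ymax] := EVT_max ler01 cn.
exists s', `|s' y|; split=> // x.
have [x01|x01] := boolP (0 <= x <= 1); first by apply: ymax; rewrite in_itv.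
by rewrite s'0// normr0.
Qed.

(* The derivative of [ramp r e] is an approximate unit mass at [r]. *)
Lemma ramp_derive : exists2 B : R, 0 <= B & forall r e, 0 < e ->
  exists p : R -> R, [/\ continuous p, forall x, is_derive x (1 : R) (ramp r e) (p x),
    forall x, `|p x| <= B / e & forall x, ~~ (r <= x <= r + e) -> p x = 0].
Proof.
have [s' [B [cs ds sB s0]]] := smooth_step_derive.
exists B; first exact: le_trans (sB 0).
move=> r e e0; pose p x := s' (e^-1 * x + - (e^-1 * r)) * e^-1.
exists p; split.
- move=> x; apply: cvgM; last exact: cvg_cst.
  apply: (continuous_comp (f := fun x => e^-1 * x + - (e^-1 * r))) => //; last exact: cs.
  by apply: cvgD; last exact: cvg_cst; apply: cvgM; [exact: cvg_cst|exact: cvg_id].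
- move=> x; apply: (@is_derive1_comp _ _ (fun x => e^-1 * x + - (e^-1 * r)) x _ _ (ds _)).
  have -> : e^-1 = e^-1 *: 1 + 0 :> R by rewrite addr0 /GRing.scale/= mulr1.
  apply: is_deriveD; rewrite addr0 scaler1.
  by have := is_deriveZ e^-1 (is_derive_id x (1 : R)); rewrite /GRing.scale/= mulr1.
- by move=> x; rewrite /p normrM normfV (gtr0_norm e0) ler_wpM2r ?invr_ge0 ?(ltW e0).
- move=> x xr; rewrite /p ramp_arg s0 ?mul0r//; apply: contra xr => /andP[h1 h2].
  rewrite -subr_ge0 -[X in _ && X]lerBlDl.
  by move: h1 h2; rewrite pmulr_lge0 ?invr_gt0// ler_pdivrMr// mul1r => -> ->.
Qed.

Lemma Rintegral_support (D E : set R) (f : R -> R) : E `<=` D ->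
  (forall x, ~ E x -> f x = 0) -> \int[lebR]_(t in D) f t = \int[lebR]_(t in E) f t.
Proof.
move=> ED f0; rewrite Rintegral_mkcond [RHS]Rintegral_mkcond.
apply: eq_Rintegral => x _; rewrite !patchE.
have [Ex|Ex] := pselect (E x); first by rewrite !mem_set//; exact: ED.
by rewrite (memNset Ex) f0//; case: ifP.
Qed.

Lemma approximate_unit_mass (c : R -> R) r (B : R) (e : nat -> R) (p : nat -> R -> R) :
  continuous c -> 0 <= B -> (forall n, 0 < e n) -> e n @[n --> \oo] --> (0 : R) ->
  (forall n, [/\ continuous (p n), forall x, is_derive x (1 : R) (ramp r (e n)) (p n x) &
     forall x, `|p n x| <= B / e n]) ->
  \int[lebR]_(t in `[r, r + e n]) (p n t * c t) @[n --> \oo] --> c r.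
Proof.
move=> cc B0 e0 e_0 Hp; apply/cvgrPdist_le => eta eta0.
have d0 : 0 < eta / (B + 1) by rewrite divr_gt0// ltr_wpDl.
have := cc r => /cvgrPdist_le/(_ _ d0)/nbhs_ballP[d /= dd Hd].
have /cvgrPdist_lt/(_ _ dd)[n0 _ Hn] := e_0.
exists n0 => // n /= nn; have [cp dp pB] := Hp n.
have en0 := e0 n; have rr : r <= r + e n by rewrite lerDl ltW.
have end_ : e n < d by have := Hn n nn; rewrite /= sub0r normrN gtr0_norm.
have I1 : \int[lebR]_(t in `[r, r + e n]) p n t = 1.
  by rewrite (Rintegral_derive rr cp dp) ramp1// ramp0// subr0.
have cpc : continuous (fun t => p n t * c t) by move=> t; apply: cvgM; [exact: cp|exact: cc].
have E : c r - \int[lebR]_(t in `[r, r + e n]) (p n t * c t) =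
    \int[lebR]_(t in `[r, r + e n]) (p n t * (c r - c t)).
  rewrite -[X in X - _]mulr1 -I1 mulrC.
  have i1 := continuous_itv_integrable r (r + e n) cp.
  have i2 := continuous_itv_integrable r (r + e n) cpc.
  rewrite -(RintegralZr _ (measurable_cc _ _) i1) -(RintegralB (measurable_cc _ _) _ i2).
    by apply: eq_Rintegral => t _; rewrite mulrBr.
  have cpr : continuous (fun t => p n t * c r) by move=> t; apply: cvgM; [exact: cp|exact: cvg_cst].
  exact: (continuous_itv_integrable r (r + e n) cpr).
rewrite E; have cpr : continuous (fun t => p n t * (c r - c t)).
  by move=> t; apply: cvgM; [exact: cp|apply: cvgB; [exact: cvg_cst|exact: cc]].
apply: le_trans (Rintegral_itv_le (M := B / e n * (eta / (B + 1))) rr _ _) _.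
- exact: (continuous_itv_integrable r (r + e n) cpr).
- move=> t /andP[rt tr]; rewrite normrM ler_pM//.
  apply: (Hd t); rewrite -ball_normE/= distrC ger0_norm ?subr_ge0//.
  by apply: le_lt_trans end_; rewrite lerBlDl.
rewrite addrAC subrr add0r mulrAC divfK ?gt_eqF// mulrA ler_pdivrMr ?ltr_wpDl//.
by rewrite mulrC ler_wpM2l ?(ltW eta0)// lerDl.
Qed.

(** The identity is tested with the difference of two ramps based at [r1] and [r2]. As they steepen,
    the derivative concentrates at the two points and yields [c r1 - c r2] by continuity of [c],
    while the ramps themselves tend to an indicator. *)
Lemma du_bois_reymond (c g : R -> R) a b r1 r2 : a < r1 -> r1 < r2 -> r2 < b ->
  continuous c -> bounded_measurable g ->
  (forall phi, test_time a b phi ->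
     \int[lebR]_(t in `]a, b[) (derive1 phi t * c t) = - \int[lebR]_(t in `]a, b[) (phi t * g t)) ->
  c r2 - c r1 = \int[lebR]_(t in `[r1, r2]) g t.
Proof.
move=> ar1 r12 r2b cc [mg [M gM]] H.
have [B B0 Hramp] := ramp_derive.
(* The ramps rise to the right of their base points, so room is needed only between [r2] and [b]. *)
pose dl := (b - r2) / 2; have dl0 : 0 < dl by rewrite divr_gt0// subr_gt0.
pose e (n : nat) := dl * n.+1%:R^-1.
have e0 n : 0 < e n by rewrite mulr_gt0.
have ele n : e n <= dl by rewrite ler_piMr ?(ltW dl0)// invf_le1// ler1n.
have e_0 : e n @[n --> \oo] --> (0 : R).
  by rewrite -[X in _ --> X](mulr0 dl); apply: cvgM; [exact: cvg_cst|exact: cvg_harmonic].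
have /choice[p1 Hp1] n := Hramp r1 _ (e0 n).
have /choice[p2 Hp2] n := Hramp r2 _ (e0 n).
pose phi n t := ramp r1 (e n) t + (-1) * ramp r2 (e n) t.
have dphi n x : is_derive x (1 : R) (phi n) (p1 n x - p2 n x).
  have [_ d1 _ _] := Hp1 n; have [_ d2 _ _] := Hp2 n.
  have -> : phi n = (fun t => ramp r1 (e n) t - ramp r2 (e n) t).
    by apply/funext => t; rewrite /phi mulN1r.
  exact: is_deriveB.
have tphi n : test_time a b (phi n).
  split.
    apply: smooth_derive1n => k; apply: Cn_add; first exact: ramp_smooth.
    by apply: Cn_mul; [exact: Cn_cst|exact: ramp_smooth].
  exists r1, (r2 + dl); split=> //; first by rewrite /dl; lra.
  move=> t; rewrite negb_and -!ltNge => /orP[tr|rt]; rewrite /phi.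
    by rewrite (ramp0 (e0 n) (ltW tr)) (ramp0 (e0 n)) ?mulr0 ?addr0// (ltW (lt_trans tr r12)).
  have := ele n => ele'.
  by rewrite !(ramp1 (e0 n)) ?mulr1 ?subrr//; lra.
have LHS n : \int[lebR]_(t in `]a, b[) (derive1 (phi n) t * c t) =
   \int[lebR]_(t in `[r1, r1 + e n]) (p1 n t * c t) - \int[lebR]_(t in `[r2, r2 + e n]) (p2 n t * c t).
  have [c1 _ _ s1] := Hp1 n; have [c2 _ _ s2] := Hp2 n.
  have cpc (q : R -> R) : continuous q -> continuous (fun t => q t * c t).
    by move=> cq t; apply: cvgM; [exact: cq|exact: cc].
  have ic (q : R -> R) : continuous q -> lebR.-integrable `]a, b[ (EFin \o q).
    move=> cq; have := continuous_itv_integrable a b cq; apply: integrableS => //.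
    exact: subset_itv_oo_cc.
  have := ele n => ele'.
  rewrite -(@Rintegral_support `]a, b[ `[r1, r1 + e n] (fun t => p1 n t * c t)); first last.
  - by move=> t /= /negP h; rewrite s1 ?mul0r//; rewrite in_itv/= in h.
  - by move=> t; rewrite /= !in_itv/= => /andP[? ?]; apply/andP; split; move: dl0; rewrite /dl in ele' *; lra.
  rewrite -(@Rintegral_support `]a, b[ `[r2, r2 + e n] (fun t => p2 n t * c t)); first last.
  - by move=> t /= /negP h; rewrite s2 ?mul0r//; rewrite in_itv/= in h.
  - by move=> t; rewrite /= !in_itv/= => /andP[? ?]; apply/andP; split; move: dl0; rewrite /dl in ele' *; lra.
  rewrite -RintegralB//; [|exact: ic (cpc _ c1)|exact: ic (cpc _ c2)].
  apply: eq_Rintegral => t _; rewrite derive1E; have [_ ->] := dphi n t.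
  by rewrite mulrBl.
have C1 := approximate_unit_mass (p := p1) cc B0 e0 e_0 (fun n => let: And4 x y z _ := Hp1 n in And3 x y z).
have C2 := approximate_unit_mass (p := p2) cc B0 e0 e_0 (fun n => let: And4 x y z _ := Hp2 n in And3 x y z).
have L1 : \int[lebR]_(t in `]a, b[) (derive1 (phi n) t * c t) @[n --> \oo] --> c r1 - c r2.
  by apply: (eq_cvg_seq LHS); exact: cvgB.
have mphi n : measurable_fun setT (phi n).
  apply: continuous_measurable_fun => x; apply: differentiable_continuous.
  by apply/derivable1_diffP; case: (dphi n x).
have moo : measurable (`]a, b[%classic : set (measurableTypeR R)) by exact: measurable_itv.
have L2 : \int[lebR]_(t in `]a, b[) (phi n t * g t) @[n --> \oo] -->
    \int[lebR]_(t in `]a, b[) (\1_(`]r1, r2]%classic) t * g t).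
  apply: (Rintegral_dominated_convergence (G := fun=> 2 * M) moo).
  - by move=> n; apply: measurable_funTS; exact: (measurable_funM (mphi n) mg).
  - by apply: measurable_funTS; apply: measurable_funM => //; apply: measurable_indic; exact: measurable_itv.
  - apply: aeW => t _; apply: cvgM; last exact: cvg_cst.
    have R1 r : ramp r (e n) t @[n --> \oo] --> (if r < t then 1 else 0 : R).
      case: ifP => [rt|/negbT]; last first.
        rewrite -leNgt => tr; apply: (eq_cvg_seq (fun n => ramp0 (e0 n) tr)); exact: cvg_cst.
      apply: cvg_near_cst.
      have tr0 : 0 < t - r by rewrite subr_gt0.
      have /cvgrPdist_lt/(_ _ tr0)[n0 _ Hn] := e_0; exists n0 => // n /= /Hn.
      rewrite sub0r normrN gtr0_norm// => h; rewrite ramp1//; lra.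
    (* Each ramp vanishes at its own base point, hence an interval open at [r1] and closed at
       [r2]. *)
    have -> : \1_(`]r1, r2]%classic) t = (if r1 < t then 1 else 0) + (-1) * (if r2 < t then 1 else 0) :> R.
      rewrite indicE mem_setE in_itv/=.
      by case: (ltP r1 t) => h1; case: (ltP r2 t) => h2 //=; rewrite ?mulr1 ?mulr0 ?addr0 ?subrr//; lra.
    by apply: cvgD => //; apply: cvgM => //; exact: cvg_cst.
  - have cM : continuous (fun _ : R => 2 * M) by move=> x; exact: cvg_cst.
    have := continuous_itv_integrable a b cM; apply: integrableS => //.
    exact: subset_itv_oo_cc.
  move=> n t _; rewrite normrM ler_pM//.
  rewrite /phi mulN1r; have := ramp_ge0 r1 (e n) t; have := ramp_ge0 r2 (e n) t.
  by have := ramp_le1 r1 (e n) t; have := ramp_le1 r2 (e n) t; rewrite ler_norml; lra.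
have L4 : \int[lebR]_(t in `]a, b[) (derive1 (phi n) t * c t) @[n --> \oo] -->
    - (\int[lebR]_(t in `]a, b[) (\1_(`]r1, r2]%classic) t * g t)).
  apply: (eq_cvg_seq (fun n => H _ (tphi n))); exact: cvgN L2.
have E : c r1 - c r2 = - (\int[lebR]_(t in `]a, b[) (\1_(`]r1, r2]%classic) t * g t)).
  exact: (cvg_unique _ L1 L4).
rewrite -opprB E opprK.
rewrite -(Rintegral_itv_obnd_cbnd (r := r1) (b := BRight r2)); last first.
  have := bounded_measurable_integrable r1 r2 (conj mg (ex_intro _ M gM)); apply: integrableS => //.
  exact: subset_itv_oc_cc.
rewrite (@Rintegral_support `]a, b[ `]r1, r2]); first last.
- by move=> t nt; rewrite indicE memNset// mul0r.
- by move=> t; rewrite /= !in_itv/= => /andP[h1 h2]; apply/andP; split; lra.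
by apply: eq_Rintegral => t; rewrite indicE => ->; rewrite mul1r.
Qed.

End real_line.

(** * The nonlinearity on bounded functions *)

Section bounded_functions.
Context {R : realType} {N : nat} (Om : set 'rV[R]_N).
Hypotheses (Om_open : open Om) (Om_bounded : bounded_set Om).
Local Notation RN := 'rV[R]_N.
Local Notation dt := (ldot Om).
Implicit Types (u v w : RN -> R).

Lemma L2dotE u v : L2dot Om u v = dt u v.
Proof. by rewrite ldot.unlock. Qed.

(** Turns a bound that holds almost everywhere into one that holds at every point, without leaving
    the class of the function. *)
Definition clamp (M s : R) : R := Num.max (- M) (Num.min M s).

Lemma clamp_le M s : 0 <= M -> `|clamp M s| <= M.
Proof.
move=> M0; rewrite ler_norml /clamp le_max lexx/= ge_max ge_min lexx/= andbT.
by rewrite ge0_cp//.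
Qed.

Lemma clamp_id M s : `|s| <= M -> clamp M s = s.
Proof.
by rewrite ler_norml /clamp => /andP[h1 h2]; rewrite min_r// max_r.
Qed.

Lemma clamp_continuous M : continuous (clamp M).
Proof.
move=> s; apply: (@continuous_max R _ (fun=> - M) (fun s => Num.min M s)); first exact: cvg_cst.
by apply: (@continuous_min R _ (fun=> M) id); [exact: cvg_cst|exact: cvg_id].
Qed.

Lemma bounded_lsq u (M : R) : measurable_in Om u -> ae_in Om (fun x => `|u x| <= M) -> lsq Om u.
Proof.
move=> mu uM; have [M0|M0] := leP 0 M; last first.
  apply: (lsq_ae (u := fun=> 0)); last exact: lsq0.
  by move: uM; apply: ae_in_imp => x _ h; have := normr_ge0 (u x); lra.
apply: (lsq_ae (u := fun x => clamp M (u x))).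
  by move: uM; apply: ae_in_imp => x _; exact: clamp_id.
apply: (lsq_bounded Om_open Om_bounded (M := M)).
  exact: measurable_in_comp (@clamp_continuous M) mu.
by move=> x _; exact: clamp_le.
Qed.

Lemma Linf_lsq u : Linf Om u -> lsq Om u.
Proof. by move=> [mu [M uM]]; exact: bounded_lsq uM. Qed.

Lemma ldot_le_ae u v (c : R) : 0 <= c -> lsq Om u -> lsq Om v ->
  ae_in Om (fun x => u x ^+ 2 <= c * v x ^+ 2) -> dt u u <= c * dt v v.
Proof.
move=> c0 su sv H; pose w x := if u x ^+ 2 <= c * v x ^+ 2 then u x else 0.
have uw : ae_in Om (fun x => u x = w x) by move: H; apply: ae_in_imp => x _ h; rewrite /w h.
rewrite (ldot_ae uw uw); apply: (ldot_le Om_open c0 (lsq_ae uw su) sv) => x _.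
by rewrite /w; case: ifP => // _; rewrite expr0n/= mulr_ge0// sqr_ge0.
Qed.

Lemma lsq_cst (c : R) : lsq Om (fun=> c).
Proof.
apply: (lsq_bounded Om_open Om_bounded (M := `|c|)); first exact: measurable_in_cst.
by [].
Qed.

Lemma ldot_small u (e : R) : 0 <= e -> lsq Om u -> ae_in Om (fun x => `|u x| <= e) ->
  dt u u <= e ^+ 2 * dt (fun=> 1) (fun=> 1).
Proof.
move=> e0 su ue; apply: (ldot_le_ae (sqr_ge0 e) su (lsq_cst 1)).
move: ue; apply: ae_in_imp => x _ h.
by rewrite expr1n mulr1 -real_normK ?num_real// lerXn2r ?nnegrE.
Qed.

Lemma L2normE u : lsq Om u -> L2norm Om u = (Num.sqrt (dt u u))%:E.
Proof.
by move=> su; rewrite /L2norm (lsq_dotE Om_open su) poweR_EFin powR12_sqrt// ldot_ge0.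
Qed.

Lemma integrable_lsq u : lsq Om u -> (@leb R N).-integrable Om (EFin \o u).
Proof. by move=> /lsqE; exact: Om_sqint_integrable. Qed.

Lemma Rintegral_le_ae u v (c : R) : 0 <= c -> lsq Om u -> lsq Om v ->
  ae_in Om (fun x => `|u x| <= c * v x ^+ 2) ->
  `|\int[leb N]_(x in Om) u x| <= c * dt v v.
Proof.
move=> c0 su sv H; pose w x := if `|u x| <= c * v x ^+ 2 then u x else 0.
have uw : ae_in Om (fun x => u x = w x) by move: H; apply: ae_in_imp => x _ h; rewrite /w h.
have sw := lsq_ae uw su.
have -> : \int[leb N]_(x in Om) u x = \int[leb N]_(x in Om) w x by exact: Rintegral_ae_eq.
have iw := integrable_lsq sw.
have iv := sqint_sq_integrable (lsqE sv).
apply: le_trans (le_normr_Rintegral (mOm Om_open) iw) _.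
have E : c * dt v v = \int[leb N]_(x in Om) (c * v x ^+ 2).
  have -> : dt v v = \int[leb N]_(x in Om) (v x ^+ 2).
    by rewrite -L2dotE /L2dot; apply: (@eq_Rintegral _ _ _ (@leb R N) Om) => x _; rewrite expr2.
  by rewrite -(RintegralZl c (mOm Om_open) iv).
rewrite E; apply: (le_Rintegral (mOm Om_open)).
- exact: (integrable_norm iw).
- exact: (integrableZl (mOm Om_open) c iv).
by move=> x _; rewrite /w; case: ifP => // _; rewrite normr0 mulr_ge0// sqr_ge0.
Qed.

End bounded_functions.

(** * Local bounds for a C^1 function and its primitive *)

Section nonlinearity.
Context {R : realType} (f : R -> R).
Hypothesis f_C1 : C1 f.

Lemma C1_continuous : continuous f.
Proof.
move=> x; apply: differentiable_continuous; apply/derivable1_diffP.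
by have [/(_ x)] := f_C1.
Qed.

Lemma C1_is_derive x : is_derive x (1 : R) f (derive1 f x).
Proof. by have [/(_ x) d _] := f_C1; apply: DeriveDef => //; rewrite derive1E. Qed.

Lemma continuous_bounded_on (g : R -> R) (M : R) : continuous g ->
  exists K : R, 0 <= K /\ forall x, `|x| <= M -> `|g x| <= K.
Proof.
move=> cg; have [M0|M0] := leP 0 M; last first.
  by exists 0; split=> // x xM; have := normr_ge0 x; lra.
have cn : {within `[- M, M], continuous (fun x => `|g x|)}.
  apply: continuous_subspaceT => x; apply: continuous_comp; first exact: cg.
  exact: norm_continuous.
have [y _ ymax] := EVT_max (ge0_cp M0).2 cn.
by exists `|g y|; split=> // x xM; apply: ymax; rewrite in_itv/= -ler_norml.
Qed.

Lemma C1_lipschitz_on (M : R) : exists K : R, 0 <= K /\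
  forall x y, `|x| <= M -> `|y| <= M -> `|f x - f y| <= K * `|x - y|.
Proof.
have [_ cf'] := f_C1; have [K [K0 HK]] := continuous_bounded_on M cf'.
exists K; split=> // x y.
wlog xy : x y / y <= x.
  move=> H xM yM; case/orP: (le_total y x) => h; first exact: H.
  by rewrite distrC (distrC x); exact: H.
move=> xM yM; rewrite -(Rintegral_derive xy cf' C1_is_derive) [X in _ <= _ * X]ger0_norm ?subr_ge0//.
apply: Rintegral_itv_le => //; first exact: continuous_itv_integrable.
move=> t /andP[yt tx]; apply: HK.
by move: xM yM; rewrite !ler_norml => /andP[h1 h2] /andP[h3 h4]; apply/andP; split; lra.
Qed.

Lemma primitive_quadratic (M : R) : exists K : R, 0 <= K /\
  forall x y, `|x| <= M -> `|y| <= M ->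
    `|primitive f y - primitive f x - f x * (y - x)| <= K * (y - x) ^+ 2.
Proof.
have [K [K0 HK]] := C1_lipschitz_on M; have cf := C1_continuous.
exists K; split=> // x y xM yM.
(* The base point [z] may be either endpoint: this treats both orders of [x] and [y] with one
   estimate of the integral of [f t - f z]. *)
have bnd (a b z : R) : a <= b -> `|a| <= M -> `|b| <= M -> `|z| <= M -> (z = a \/ z = b) ->
   `|\int[lebesgue_measure]_(t in `[a, b]) f t - f z * (b - a)| <= K * (b - a) ^+ 2.
  move=> ab aM bM zM zab.
  have i1 := continuous_itv_integrable a b cf.
  have cz : continuous (fun _ : R => f z) by move=> ?; exact: cvg_cst.
  have i2 := continuous_itv_integrable a b cz.
  have E : f z * (b - a) = \int[lebesgue_measure]_(t in `[a, b]) f z.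
    by rewrite (Rintegral_cst _ (measurable_cc a b)); congr (_ * _); rewrite fine_itv_measure.
  rewrite E -(RintegralB (measurable_cc a b) i1 i2) expr2 mulrA.
  have cfz : continuous (fun t => f t - f z) by move=> t; apply: cvgB; [exact: cf|exact: cvg_cst].
  apply: Rintegral_itv_le => //; first exact: (continuous_itv_integrable a b cfz).
  move=> t /andP[at_ tb]; apply: le_trans (HK t z _ zM) _.
    by move: aM bM; rewrite !ler_norml => /andP[h1 h2] /andP[h3 h4]; apply/andP; split; lra.
  rewrite ler_wpM2l//; case: zab => ->; first by rewrite ger0_norm ?subr_ge0// lerB.
  by rewrite distrC ger0_norm ?subr_ge0// lerB.
case/orP: (le_total x y) => h.
  by rewrite (primitiveB cf h); apply: bnd => //; left.
rewrite (_ : primitive f y - primitive f x - f x * (y - x) =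
  - ((primitive f x - primitive f y) - f x * (x - y))); last by ring.
rewrite normrN.
rewrite (_ : (y - x) ^+ 2 = (x - y) ^+ 2); last by ring.
by rewrite (primitiveB cf h); apply: bnd => //; right.
Qed.

End nonlinearity.

(** * Increments of the solution in L^2 *)

Section window.
Context {R : realType} {N : nat} (Om : set 'rV[R]_N).
Hypotheses (Om_open : open Om) (Om_bounded : bounded_set Om).
Local Notation RN := 'rV[R]_N.
Local Notation dt := (ldot Om).
Local Notation lebR := (@lebesgue_measure R).
Variables (a b : R) (u ut : R -> RN -> R).
Local Notation J := (`]a, b[%classic : set R).
Hypothesis ab : a < b.
Hypothesis su : forall t, a <= t <= b -> lsq Om (u t).
Hypothesis cu : forall t, a <= t <= b -> forall e : R, 0 < e -> exists d : R, 0 < d /\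
  forall r, a <= r <= b -> `|r - t| < d ->
    dt (fun x => u r x - u t x) (fun x => u r x - u t x) <= e.
Hypothesis Wu : W1inf_time Om a b u ut.

Lemma measurable_oo : measurable (J : set (measurableTypeR R)).
Proof. exact: measurable_itv. Qed.

Lemma lsq_sum (I : Type) (s : seq I) (c : I -> R) (v : I -> RN -> R) :
  (forall i, lsq Om (v i)) -> lsq Om (fun x => \sum_(i <- s) c i * v i x).
Proof.
move=> sv; elim: s => [|i s ih].
  by rewrite (_ : (fun x => _) = fun=> 0); [exact: lsq0|apply/funext => x; rewrite big_nil].
rewrite (_ : (fun x => _) = fun x => c i * v i x + \sum_(j <- s) c j * v j x).
  exact: (lsqD Om_open (lsqZ Om_open _ (sv i)) ih).
by apply/funext => x; rewrite big_cons.
Qed.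

Lemma ldot_suml (I : Type) (s : seq I) (c : I -> R) (v : I -> RN -> R) w :
  (forall i, lsq Om (v i)) -> lsq Om w ->
  dt (fun x => \sum_(i <- s) c i * v i x) w = \sum_(i <- s) c i * dt (v i) w.
Proof.
move=> sv sw; elim: s => [|i s ih].
  rewrite big_nil (_ : (fun x => _) = fun=> 0); first exact: ldot0.
  by apply/funext => x; rewrite big_nil.
rewrite big_cons -ih -(ldotZl Om_open (c i) (sv i) sw).
rewrite -(ldotDl Om_open (lsqZ Om_open _ (sv i)) (lsq_sum s c sv) sw).
by congr ldot; apply/funext => x; rewrite big_cons.
Qed.

Lemma ldot_cvg_self (h : nat -> RN -> R) w : (forall n, lsq Om (h n)) -> lsq Om w ->
  lcvg Om h w -> dt (h n) (h n) @[n --> \oo] --> dt w w.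
Proof.
move=> sh sw hw; have c1 := lcvg_dot Om_open sh sw sw hw; move/lcvgE: hw => c2.
have E n : dt (h n) (h n) = dt (fun x => h n x - w x) (fun x => h n x - w x) + 2 * dt (h n) w - dt w w.
  by rewrite (ldotB_self Om_open (sh n) sw); ring.
apply: (eq_cvg_seq E).
have E2 : 0 + 2 * dt w w - dt w w = dt w w by ring.
rewrite -[X in _ --> X]E2.
exact: (cvgB (cvgD c2 (cvgM (cvg_cst (2 : R)) c1)) (cvg_cst (dt w w))).
Qed.

Lemma L2norm_cvg0 (h : nat -> RN -> R) : (forall n, lsq Om (h n)) ->
  L2norm Om (h n) @[n --> \oo] --> 0%E -> dt (h n) (h n) @[n --> \oo] --> (0 : R).
Proof.
move=> sh H.
have c : Num.sqrt (dt (h n) (h n)) @[n --> \oo] --> (0 : R).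
  have /fine_cvgP[_] : (Num.sqrt (dt (h n) (h n)))%:E @[n --> \oo] --> (0 : R)%:E.
    move: H; rewrite (_ : (fun n => L2norm Om (h n)) = (fun n => (Num.sqrt (dt (h n) (h n)))%:E))//.
    by apply/funext => n; exact: L2normE.
  by [].
apply: (eq_cvg_seq (b := fun n => Num.sqrt (dt (h n) (h n)) * Num.sqrt (dt (h n) (h n)))).
  by move=> n; rewrite -expr2 sqr_sqrtr// ldot_ge0.
by rewrite -[X in _ --> X](mulr0 0); apply: cvgM.
Qed.

(** The simple approximations are chosen together with their pieces and vectors as data, because
    measurable scalar functions are built from these below. *)
Lemma ut_simple_limit : exists p : nat -> {m : nat & (('I_m -> set R) * ('I_m -> RN -> R))%type},
  [/\ forall n i, measurable ((tagged (p n)).1 i : set (measurableTypeR R)),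
      forall n i, lsq Om ((tagged (p n)).2 i) &
      {ae lebR, forall t, J t -> lsq Om (ut t) /\
        lcvg Om (fun n x => \sum_(i < tag (p n)) \1_((tagged (p n)).1 i) t * (tagged (p n)).2 i x) (ut t)}].
Proof.
have [_ [[sn [Hs Hae]] _] _] := Wu.
have /choice[p Hp] : forall n, exists p : {m : nat & (('I_m -> set R) * ('I_m -> RN -> R))%type},
   [/\ forall i, measurable ((tagged p).1 i : set (measurableTypeR R)),
      forall i, lsq Om ((tagged p).2 i) &
      sn n = fun t x => \sum_(i < tag p) \1_((tagged p).1 i) t * (tagged p).2 i x].
  move=> n; have [m [A [v [mA Dv E]]]] := Hs n.
  by exists (existT _ m (A, v)); split=> //= i; apply/lsqP; exact: Dv.
exists p; split=> [n i|n i|]; [by case: (Hp n)|by case: (Hp n)|].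
move: Hae; apply: ae_dom_imp => t _ [/lsqP sut c]; split=> //.
have ssum n : lsq Om (fun x => \sum_(i < tag (p n)) \1_((tagged (p n)).1 i) t * (tagged (p n)).2 i x).
  by apply: lsq_sum => i; case: (Hp n).
apply/lcvgE; apply: L2norm_cvg0 => [n|]; first exact: (lsqB Om_open (ssum n) sut).
rewrite (_ : (fun n => L2norm Om _) = fun n => L2norm Om (fun x => sn n t x - ut t x))//.
by apply/funext => n; congr (L2norm Om _); apply/funext => x; have [_ _ ->] := Hp n.
Qed.

Lemma ut_bound : exists M : R, 0 <= M /\
  {ae lebR, forall t, J t -> lsq Om (ut t) /\ dt (ut t) (ut t) <= M ^+ 2}.
Proof.
have [_ [_ [M HM]] _] := Wu; exists `|M|; split=> //.
have [p [_ _ H]] := ut_simple_limit.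
move: H HM; apply: ae_dom_imp2 => t _ [st _] hM; split=> //.
move: hM; rewrite (L2normE Om_open st) lee_fin => h.
rewrite -(sqr_sqrtr (ldot_ge0 Om (ut t))) lerXn2r ?nnegrE//.
exact: le_trans h (ler_norm M).
Qed.

(** Separability of the values comes from strong measurability: at any time the value of a simple
    function is the sum over a subset of its finitely many vectors, and there are countably many
    pairs of an index and a subset. *)
Lemma ut_separable : exists psi : nat -> RN -> R, (forall k, lsq Om (psi k)) /\
  {ae lebR, forall t, J t -> forall e : R, 0 < e -> exists k,
     dt (fun x => psi k x - ut t x) (fun x => psi k x - ut t x) <= e}.
Proof.
have [p [_ sv H]] := ut_simple_limit.
pose I := {n : nat & {set 'I_(tag (p n))}}.
pose ps (i : I) x := \sum_(j < tag (p (tag i))) (j \in tagged i)%:R * (tagged (p (tag i))).2 j x.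
pose psi k := if (unpickle k : option I) is Some i then ps i else fun=> 0.
have sps i : lsq Om (ps i) by apply: lsq_sum => j; exact: sv.
exists psi; split=> [k|].
  by rewrite /psi; case: unpickle => [i|]; [exact: sps|exact: lsq0].
move: H; apply: ae_dom_imp => t _ [_ /lcvgE c] e e0.
have /cvgrPdist_le/(_ _ e0)[n _ /(_ n (leqnn n))] := c.
rewrite /= sub0r normrN ger0_norm ?ldot_ge0// => h.
(* The subset that matters at time [t] consists of the pieces containing [t]. *)
pose i : I := existT _ n [set j | `[< (tagged (p n)).1 j t >]]%SET.
exists (pickle i); rewrite /psi pickleK; apply: le_trans h.
rewrite le_eqVlt; apply/orP; left; apply/eqP.
have -> // : ps i = fun x => \sum_(j < tag (p n)) \1_((tagged (p n)).1 j) t * (tagged (p n)).2 j x.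
apply/funext => x; apply: eq_bigr => j _; rewrite indicE; congr (_%:R * _).
by rewrite /i/= inE; apply/asboolP/idP; rewrite inE.
Qed.

(** [Phi] is controlled almost everywhere in the window only. Clamping its measurable limit at [K]
    and extending by 0 gives a function that is measurable and bounded on the whole line. *)
Lemma bounded_version (Phi : R -> R) (F : nat -> R -> R) (K : R) : 0 <= K ->
  (forall n, measurable_fun (setT : set (measurableTypeR R)) (F n)) ->
  {ae lebR, forall t, J t -> F n t @[n --> \oo] --> Phi t} ->
  {ae lebR, forall t, J t -> `|Phi t| <= K} ->
  exists g, [/\ bounded_measurable g, forall t, `|g t| <= K &
    {ae lebR, forall t, J t -> Phi t = g t}].
Proof.
move=> K0 mF FP PK.
have mFJ n : measurable_fun (J : set (measurableTypeR R)) (F n).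
  exact: (@measurable_funTS _ _ (measurableTypeR R) R J (F n) (mF n)).
have [h [mh Ph]] := ae_limit_measurable mFJ FP.
pose g := (fun t => clamp K (h t)) \_ J.
have gK t : `|g t| <= K.
  by rewrite /g patchE; case: ifP => _; [exact: clamp_le|rewrite normr0].
exists g; split=> //.
  split; last by exists K.
  apply/(measurable_restrictT _ measurable_oo).
  exact: (measurableT_comp (continuous_measurable_fun (@clamp_continuous R K)) mh).
move: Ph PK; apply: ae_dom_imp2 => t Jt E h1.
by rewrite /g patchE mem_set// -E clamp_id.
Qed.

Lemma ut_dot_version psi : lsq Om psi -> forall M : R, 0 <= M ->
  {ae lebR, forall t, J t -> dt (ut t) (ut t) <= M ^+ 2} ->
  exists g, [/\ bounded_measurable g, forall t, `|g t| <= M * Num.sqrt (dt psi psi) &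
    {ae lebR, forall t, J t -> dt (ut t) psi = g t}].
Proof.
move=> sp M M0 HM; have [p [mA sv H]] := ut_simple_limit.
apply: (bounded_version (F := fun n t => \sum_(i < tag (p n)) \1_((tagged (p n)).1 i) t * dt ((tagged (p n)).2 i) psi)).
- by rewrite mulr_ge0// sqrtr_ge0.
- move=> n; apply: measurable_sum => i; apply: measurable_funM; last exact: measurable_cst.
  exact: measurable_indic.
- move: H; apply: ae_dom_imp => t _ [st c].
  apply: (eq_cvg_seq (fun n => esym (ldot_suml _ _ (sv n) sp))).
  apply: (lcvg_dot Om_open _ st sp c) => n; exact: lsq_sum.
- move: H HM; apply: ae_dom_imp2 => t _ [st _] tM.
  apply: le_trans (ldot_CS_sqrt Om_open st sp) _; rewrite ler_wpM2r ?sqrtr_ge0//.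
  by rewrite -(ger0_norm M0) -sqrtr_sqr ler_sqrt// sqr_ge0.
Qed.

Lemma ut_sq_version (M : R) : 0 <= M ->
  {ae lebR, forall t, J t -> dt (ut t) (ut t) <= M ^+ 2} ->
  exists q, bounded_measurable q /\ {ae lebR, forall t, J t -> dt (ut t) (ut t) = q t}.
Proof.
move=> M0 HM; have [p [mA sv H]] := ut_simple_limit.
have [|||//|q [bq _ Eq]] := @bounded_version (fun t => dt (ut t) (ut t))
  (fun n t => \sum_(i < tag (p n)) \1_((tagged (p n)).1 i) t *
     \sum_(j < tag (p n)) \1_((tagged (p n)).1 j) t * dt ((tagged (p n)).2 j) ((tagged (p n)).2 i)) (M ^+ 2); last by exists q.
- exact: sqr_ge0.
- move=> n; apply: measurable_sum => i; apply: measurable_funM; first exact: measurable_indic.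
  apply: measurable_sum => j; apply: measurable_funM; last exact: measurable_cst.
  exact: measurable_indic.
- move: H; apply: ae_dom_imp => t _ [st c].
  have ss n := lsq_sum (index_enum _) (fun i => \1_((tagged (p n)).1 i) t) (sv n).
  have := ldot_cvg_self ss st c.
  apply: eq_cvg_seq => n; rewrite (ldot_suml _ _ (sv n) (ss n)).
  by apply: eq_bigr => i _; congr (_ * _); rewrite ldotC (ldot_suml _ _ (sv n) (sv n i)).
- by move: HM; apply: ae_dom_imp => t _; rewrite ger0_norm// ldot_ge0.
Qed.

Lemma u_increment psi g r1 r2 : lsq Om psi -> bounded_measurable g ->
  {ae lebR, forall t, J t -> dt (ut t) psi = g t} -> a < r1 -> r1 <= r2 -> r2 < b ->
  dt (fun x => u r2 x - u r1 x) psi = \int[lebR]_(t in `[r1, r2]) g t.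
Proof.
move=> sp bg Eg ar1; rewrite le_eqVlt => /predU1P[<- _|r12 r2b].
  rewrite Rintegral_itv_ge// -[RHS](ldot0 Om psi); congr ldot.
  by apply/funext => x; rewrite subrr.
have r1ab : a <= r1 <= b by rewrite (ltW ar1) ltW// (lt_trans r12).
have r2ab : a <= r2 <= b by rewrite (ltW r2b) andbT ltW// (lt_trans ar1).
rewrite (ldotBl Om_open (su r2ab) (su r1ab) sp).
(* [du_bois_reymond] asks for continuity on the whole line, so time is retracted to [[a, b]]. *)
pose k (t : R) : R := Num.max a (Num.min b t).
have kab t : a <= k t <= b.
  by rewrite /k le_max lexx/= ge_max (ltW ab) ge_min lexx.
have kid t : a <= t <= b -> k t = t by move=> /andP[h1 h2]; rewrite /k min_r// max_r.
have kk t r : `|k t - k r| <= `|t - r|.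
  rewrite /k !maxEle !minEle; move: (kab t) (kab r).
  by case: (leP b t) => h1; case: (leP b r) => h2; rewrite ?(ltW ab)//; repeat case: ifP => ? //;
    rewrite ?subrr ?normr0//; rewrite ler_norml; have := ler_norm (t - r); have := ler_norm (- (t - r)); rewrite normrN; lra.
pose c t := dt (u (k t)) psi.
rewrite (_ : dt (u r2) psi = c r2); last by rewrite /c kid.
rewrite (_ : dt (u r1) psi = c r1); last by rewrite /c kid.
apply: (du_bois_reymond ar1 r12 r2b) => //.
  move=> t; apply/cvgrPdist_le => e e0.
  have e1 : 0 < e ^+ 2 / (dt psi psi + 1) by rewrite divr_gt0 ?exprn_gt0// ltr_wpDl// ldot_ge0.
  have [d [d0 Hd]] := cu (kab t) e1.
  apply/nbhs_ballP; exists d => //= r tr; have {}tr : `|t - r| < d := tr.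
  have h := Hd (k r) (kab r) (le_lt_trans (kk r t) _); rewrite distrC in h.
  have s1 := lsqB Om_open (su (kab t)) (su (kab r)).
  rewrite /c -(ldotBl Om_open (su (kab t)) (su (kab r)) sp).
  rewrite -(ler_pXn2r (n := 2)) ?nnegrE ?(ltW e0)// real_normK ?num_real//.
  apply: le_trans (ldot_CS Om_open s1 sp) _.
  have {}h := h tr; move: h; rewrite ler_pdivlMr ?ltr_wpDl ?ldot_ge0//.
  rewrite (_ : (fun x => u (k r) x - u (k t) x) = (fun x => -1 * (u (k t) x - u (k r) x))); last first.
    by apply/funext => x; ring.
  rewrite (ldotZl Om_open _ s1 (lsqZ Om_open _ s1)) (ldotZr Om_open _ s1 s1) mulrA mulrNN !mul1r.
  by apply: le_trans; rewrite ler_wpM2l ?ldot_ge0// lerDl.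
move=> phi tphi; have [_ _ /(_ phi psi tphi)] := Wu.
move=> /(_ ((lsqP Om psi).2 sp)) H.
transitivity (\int[lebR]_(t in `]a, b[) (phi^`()%classic t * L2dot Om (u t) psi)).
  apply: eq_Rintegral => t; rewrite inE/= in_itv/= => /andP[h1 h2].
  by rewrite L2dotE /c kid// !ltW.
rewrite H; congr (- _); apply: Rintegral_ae_eq.
by move: Eg; apply: ae_dom_imp => t _; rewrite L2dotE => ->.
Qed.

(** The increment [w] is tested against itself: its squared norm is at most [M] times its norm times
    [r2 - r1], and one factor cancels. *)
Lemma u_lipschitz (M : R) : 0 <= M -> {ae lebR, forall t, J t -> dt (ut t) (ut t) <= M ^+ 2} ->
  forall r1 r2, a < r1 < b -> a < r2 < b ->
  dt (fun x => u r2 x - u r1 x) (fun x => u r2 x - u r1 x) <= M ^+ 2 * (r2 - r1) ^+ 2.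
Proof.
move=> M0 HM r1 r2.
wlog r12 : r1 r2 / r1 <= r2.
  move=> H h1 h2; case/orP: (le_total r1 r2) => h; first exact: H.
  have sq1 : lsq Om (u r1) by apply: su; case/andP: h1 => ? ?; rewrite !ltW.
  have sq2 : lsq Om (u r2) by apply: su; case/andP: h2 => ? ?; rewrite !ltW.
  have s := lsqB Om_open sq1 sq2.
  rewrite (_ : (fun x => u r2 x - u r1 x) = (fun x => -1 * (u r1 x - u r2 x))); last first.
    by apply/funext => x; ring.
  rewrite (ldotZl Om_open _ s (lsqZ Om_open _ s)) (ldotZr Om_open _ s s) mulrA mulrNN !mul1r.
  by rewrite (_ : (r2 - r1) ^+ 2 = (r1 - r2) ^+ 2); [exact: H|ring].
move=> /andP[h1 h2] /andP[h3 h4].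
have sq1 : lsq Om (u r1) by apply: su; rewrite !ltW.
have sq2 : lsq Om (u r2) by apply: su; rewrite !ltW.
have s := lsqB Om_open sq2 sq1; set w := fun x => u r2 x - u r1 x in s *.
have [g [bg gM Eg]] := ut_dot_version s M0 HM.
have E := u_increment s bg Eg h1 r12 h4.
have X0 := ldot_ge0 Om w.
have : dt w w <= M * Num.sqrt (dt w w) * (r2 - r1).
  rewrite {1}E; apply: le_trans (ler_norm _) _; apply: Rintegral_itv_le => //.
  exact: bounded_measurable_integrable.
have X2 := sqr_sqrtr X0; rewrite -exprMn mulrAC -[X in X <= _ -> _]X2 => h0.
rewrite -[X in X <= _]X2; move: h0.
have := sqrtr_ge0 (dt w w); move: (Num.sqrt (dt w w)) => y y0.
have : 0 <= M * (r2 - r1) by rewrite mulr_ge0// subr_ge0.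
move: (M * (r2 - r1)) => z z0 h.
rewrite lerXn2r ?nnegrE//; move: y0; rewrite le_eqVlt => /predU1P[<-//|y0].
by rewrite -(ler_pM2r y0) -expr2.
Qed.

Lemma ldot_CS_le v w (A B : R) : lsq Om v -> lsq Om w -> 0 <= A -> 0 <= B ->
  dt v v <= A ^+ 2 -> dt w w <= B ^+ 2 -> `|dt v w| <= A * B.
Proof.
move=> sv sw A0 B0 hA hB; apply: le_trans (ldot_CS_sqrt Om_open sv sw) _.
have sq (X Y : R) : 0 <= Y -> X <= Y ^+ 2 -> Num.sqrt X <= Y.
  by move=> Y0 h; rewrite -[leRHS](ger0_norm Y0) -sqrtr_sqr; exact: ler_wsqrtr.
by apply: ler_pM; rewrite ?sqrtr_ge0//; exact: sq.
Qed.

Lemma is_derive_eps (F : R -> R) t (l : R) : is_derive t (1 : R) F l ->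
  forall e : R, 0 < e -> exists d : R, 0 < d /\ forall r, `|r - t| < d ->
    `|F r - F t - l * (r - t)| <= e * `|r - t|.
Proof.
move=> [/cvgrPdist_le dF dl] e e0; rewrite -/('D_1 F t) dl in dF.
have [d /= d0 Hd] := dF e e0.
exists d; split=> // r rt; have [->|r0] := eqVneq r t; first by rewrite !subrr mulr0 subr0 normr0 mulr0.
have h0 : r - t != 0 by rewrite subr_eq0.
have := Hd (r - t); rewrite /= sub0r normrN => /(_ rt h0).
rewrite -[(r - t) *: 1]/((r - t) * 1) mulr1 subrK.
rewrite -[_^-1 *: _]/(_^-1 * _) => h.
rewrite (_ : F r - F t - l * (r - t) = - (l - (r - t)^-1 * (F r - F t)) * (r - t)); last by field.
by rewrite normrM normrN ler_wpM2r.
Qed.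

(* Tested against the countable family of [ut_separable], the increments have
   derivative [ut t] at almost every [t]; density extends this to [ut t]. *)
Lemma ut_weak_derivative (M r1 r2 : R) : 0 <= M -> a < r1 -> r2 < b ->
  {ae lebR, forall t, J t -> dt (ut t) (ut t) <= M ^+ 2} ->
  {ae lebR, forall t, `]r1, r2[%classic t -> forall e : R, 0 < e -> exists d : R, 0 < d /\
     forall r, r1 < r < r2 -> `|r - t| < d ->
     `|dt (ut t) (fun x => u r x - u t x) - (r - t) * dt (ut t) (ut t)| <= e * `|r - t|}.
Proof.
move=> M0 ar1 r2b HM; have [psi [sp Hpsi]] := ut_separable.
have /choice[g Hg] : forall k, exists g, [/\ bounded_measurable g,
     forall t, `|g t| <= M * Num.sqrt (dt (psi k) (psi k)) &
     {ae lebR, forall t, J t -> dt (ut t) (psi k) = g t}].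
  by move=> k; exact: ut_dot_version.
have D : {ae lebR, forall t, `]r1, r2[%classic t -> forall k,
     is_derive t (1 : R) (fun t => dt (u t) (psi k)) (g k t)}.
  apply: ae_dom_forall => k; have [bg _ Eg] := Hg k.
  apply: ae_derive_integral => // t /andP[h1 h2].
  rewrite -(u_increment (sp k) bg Eg ar1 h1 (le_lt_trans h2 r2b)).
  by rewrite (ldotBl Om_open _ _ (sp k))//; apply: su; apply/andP; split; lra.
have Eg : {ae lebR, forall t, J t -> forall k, dt (ut t) (psi k) = g k t}.
  by apply: ae_dom_forall => k; have [] := Hg k.
have sJ (P : R -> Prop) : {ae lebR, forall t, J t -> P t} ->
    {ae lebR, forall t, `]r1, r2[%classic t -> P t}.
  move=> H; have H' : {ae lebR, forall t, `]r1, r2[%classic t -> J t -> P t}.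
    by move: H; apply: (@filterS _ _ (ae_filter_ringOfSetsType lebR)) => t h _; exact: h.
  move: H'; apply: ae_dom_imp => t; rewrite /= in_itv/= => /andP[h1 h2]; apply.
  by rewrite /= in_itv/=; apply/andP; split; lra.
have G : {ae lebR, forall t, `]r1, r2[%classic t -> lsq Om (ut t) /\ dt (ut t) (ut t) <= M ^+ 2}.
  have [M' [_ HM']] := ut_bound.
  by move: (sJ _ HM) (sJ _ HM'); apply: ae_dom_imp2 => t _ h [].
move: (ae_dom_imp2 (fun t _ => @conj _ _) (sJ _ Hpsi) (sJ _ Eg)) (ae_dom_imp2 (fun t _ => @conj _ _) D G).
apply: ae_dom_imp2 => t; rewrite /= in_itv/= => /andP[tr1 tr2] [Kt Et] [Dt [st tM]] e e0.
have M1 : 0 < 4 * (M + 1) by lra.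
(* Half of [e] goes to the derivative of the product with [psi k]. Replacing [psi k] by [ut t] costs
   at most [e / 4 * |r - t|] twice, once in the increment and once in the linear term. *)
have eta0 : 0 < e / (4 * (M + 1)) by rewrite divr_gt0.
have [k Hk] := Kt _ (exprn_gt0 2 eta0).
have [d [d0 Hd]] := is_derive_eps (Dt k) (divr_gt0 e0 (ltr0n R 2)).
exists d; split=> // r rr rt.
have tab : a < t < b by apply/andP; split; lra.
have rab : a < r < b by move: rr => /andP[? ?]; apply/andP; split; lra.
have sut : lsq Om (u t) by apply: su; move: tab => /andP[? ?]; rewrite !ltW.
have sur : lsq Om (u r) by apply: su; move: rab => /andP[? ?]; rewrite !ltW.
have sD := lsqB Om_open sur sut; have sd := lsqB Om_open (sp k) st.
have := Hd r rt; rewrite -(ldotBl Om_open sur sut (sp k)) -Et => B1.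
have LD := u_lipschitz M0 HM tab rab.
have N2 : M ^+ 2 * (r - t) ^+ 2 = (M * `|r - t|) ^+ 2.
  by rewrite exprMn real_normK ?num_real.
rewrite N2 in LD; have X0 : 0 <= M * `|r - t| by rewrite mulr_ge0.
have B2 := ldot_CS_le sd sD (ltW eta0) X0 Hk LD.
have B3 := ldot_CS_le sd st (ltW eta0) M0 Hk tM.
have := ldotBl Om_open (sp k) st sD; have := ldotBl Om_open (sp k) st st.
move: B1 B2 B3; rewrite [in dt _ (psi k)]ldotC [dt (ut t) (psi k)]ldotC.
set Delta := (fun x => u r x - u t x); set del := (fun x => psi k x - ut t x).
move: (dt (psi k) Delta) (dt (psi k) (ut t)) (dt del Delta) (dt del (ut t)) (dt (ut t) Delta) (dt (ut t) (ut t)).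
move=> x1 x2 x3 x4 x5 x6 B1 B2 B3 E1 E2.
have -> : x5 - (r - t) * x6 = (x1 - x2 * (r - t)) - x3 + (r - t) * x4 by rewrite E1 E2; ring.
have B4 : `|(r - t) * x4| <= `|r - t| * (e / (4 * (M + 1)) * M) by rewrite normrM ler_wpM2l.
have B5 : e / (4 * (M + 1)) * M <= e / 4.
  by rewrite mulrAC ler_pdivrMr //; lra.
apply: le_trans (ler_normD _ _) _; apply: le_trans (lerD (ler_normB _ _) B4) _.
have R0 := normr_ge0 (r - t); move: (e / (4 * (M + 1))) B2 B5 => z B2 B5; nra.
Qed.

End window.

(** * The superposition operator and its potential on bounded functions *)

Section superposition.
Context {R : realType} {N : nat} (Om : set 'rV[R]_N).
Hypotheses (Om_open : open Om) (Om_bounded : bounded_set Om).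
Local Notation RN := 'rV[R]_N.
Local Notation dt := (ldot Om).
Variable f : R -> R.
Hypothesis f_C1 : C1 f.
Implicit Types v w : RN -> R.

Definition bounded_by (M : R) v : Prop :=
  measurable_in Om v /\ ae_in Om (fun x => `|v x| <= M).

Definition potential v : R := \int[leb N]_(x in Om) primitive f (v x).

Lemma bounded_by_lsq M v : bounded_by M v -> lsq Om v.
Proof. by move=> [mv vM]; exact: (bounded_lsq Om_open Om_bounded mv vM). Qed.

Lemma comp_bounded_by (M K : R) (F : R -> R) v : continuous F ->
  (forall x, `|x| <= M -> `|F x| <= K) -> bounded_by M v -> bounded_by K (fun x => F (v x)).
Proof.
move=> cF FK [mv vM]; split; first exact: measurable_in_comp.
by move: vM; apply: ae_in_imp => x _; exact: FK.
Qed.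

Lemma superposition (M : R) : exists K : R, 0 <= K /\ forall v w, bounded_by M v -> bounded_by M w ->
  [/\ lsq Om (f \o v), dt (f \o v) (f \o v) <= K ^+ 2,
      dt (fun x => (f \o v) x - (f \o w) x) (fun x => (f \o v) x - (f \o w) x) <=
        K ^+ 2 * dt (fun x => v x - w x) (fun x => v x - w x) &
      `|potential w - potential v - dt (f \o v) (fun x => w x - v x)| <=
        K * dt (fun x => w x - v x) (fun x => w x - v x)].
Proof.
have cf := C1_continuous f_C1.
have cP : continuous (primitive f).
  move=> x; have [d _] := primitive_derive x cf.
  by apply: differentiable_continuous; apply/derivable1_diffP.
have [K1 [K10 H1]] := continuous_bounded_on M cf.
have [K2 [K20 H2]] := C1_lipschitz_on f_C1 M.
have [K3 [K30 H3]] := primitive_quadratic f_C1 M.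
have [K4 [K40 H4]] := continuous_bounded_on M cP.
pose o := Num.sqrt (dt (fun=> 1) (fun=> 1)).
have o0 : 0 <= o by exact: sqrtr_ge0.
have oE : o ^+ 2 = dt (fun=> 1) (fun=> 1) by rewrite sqr_sqrtr// ldot_ge0.
exists (K1 * o + K2 + K3); split; first by rewrite !addr_ge0// mulr_ge0.
have p1 : 0 <= K1 * o by rewrite mulr_ge0.
have le_sq (x y z : R) : 0 <= x -> 0 <= z -> x <= y -> x ^+ 2 * z <= y ^+ 2 * z.
  by move=> x0 z0 xy; rewrite ler_wpM2r// lerXn2r ?nnegrE// (le_trans x0).
move=> v w bv bw.
have sv := bounded_by_lsq bv; have sw := bounded_by_lsq bw.
have bfv := comp_bounded_by cf H1 bv; have bfw := comp_bounded_by cf H1 bw.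
have sfv := bounded_by_lsq bfv; have sfw := bounded_by_lsq bfw.
have sD := lsqB Om_open sv sw; have sD' := lsqB Om_open sw sv.
split.
- exact: sfv.
- have [_ ae1] := bfv; apply: le_trans (ldot_small Om_open Om_bounded K10 sfv ae1) _.
  rewrite -oE -exprMn lerXn2r ?nnegrE//; first by rewrite !addr_ge0.
  by rewrite -addrA lerDl addr_ge0.
- apply: le_trans (ldot_le_ae Om_open (sqr_ge0 K2) (lsqB Om_open sfv sfw) sD _) _.
    move: bv.2 bw.2; apply: ae_in_imp2 => x _ h1 h2.
    rewrite -exprMn -[leLHS]real_normK ?num_real// -[leRHS]real_normK ?num_real//.
    by rewrite lerXn2r ?nnegrE// normrM (ger0_norm K20); exact: H2.
  apply: le_sq => //; first exact: ldot_ge0.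
  by rewrite addrAC lerDr addr_ge0.
have sPv := bounded_by_lsq (comp_bounded_by cP H4 bv).
have sPw := bounded_by_lsq (comp_bounded_by cP H4 bw).
have iv := integrable_lsq Om_open Om_bounded sPv.
have iw := integrable_lsq Om_open Om_bounded sPw.
pose r x := primitive f (w x) - primitive f (v x) - f (v x) * (w x - v x).
pose fd x := f (v x) * (w x - v x).
have bfd : bounded_by (K1 * (M + M)) fd.
  split.
    apply: measurable_funM; first exact: bfv.1.
    by apply: measurable_funB; [exact: bw.1|exact: bv.1].
  move: bv.2 bw.2; apply: ae_in_imp2 => x _ h1 h2; rewrite /fd normrM.
  apply: ler_pM => //; first exact: H1.
  by apply: le_trans (ler_normB _ _) _; exact: lerD.
have sfd := bounded_by_lsq bfd.
have sr : lsq Om r := lsqB Om_open (lsqB Om_open sPw sPv) sfd.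
have -> : potential w - potential v - dt (f \o v) (fun x => w x - v x) = \int[leb N]_(x in Om) r x.
  have -> : dt (f \o v) (fun x => w x - v x) = \int[leb N]_(x in Om) fd x by rewrite ldotE.
  rewrite /potential -(RintegralB (mOm Om_open) iw iv).
  by rewrite -(RintegralB (mOm Om_open) (integrableB (mOm Om_open) iw iv) (integrable_lsq Om_open Om_bounded sfd)).
apply: le_trans (Rintegral_le_ae Om_open Om_bounded K30 sr sD' _) _.
  by move: bv.2 bw.2; apply: ae_in_imp2 => x _ h1 h2; exact: H3.
by rewrite ler_wpM2r ?ldot_ge0// lerDr addr_ge0.
Qed.

End superposition.

(** * The energy on a time window *)

Lemma ae_itv_dense {R : realType} (P : R -> Prop) (a b : R) :
  {ae @lebesgue_measure R, forall t, `]a, b[%classic t -> P t} ->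
  forall t d : R, a < t < b -> 0 < d -> exists r, [/\ a < r < b, `|r - t| < d & P r].
Proof.
move=> [Z [mZ Z0 HZ]] t d /andP[at_ tb] d0.
pose d' := Num.min d (b - t).
have d'0 : 0 < d' by rewrite lt_min d0 subr_gt0.
have [dd db] : d' <= d /\ d' <= b - t by rewrite /d' !ge_min !lexx orbT.
have nZ : ~ (`]t, (t + d')[%classic `<=` Z).
  move=> sub; have : (@lebesgue_measure R `]t, (t + d')%R[%classic <= @lebesgue_measure R Z)%E.
    by apply: le_measure => //; rewrite inE//; exact: measurable_itv.
  rewrite Z0 lebesgue_measure_itv/= lte_fin ltrDl d'0 -EFinB lee_fin.
  by rewrite (addrC t) addrK leNgt d'0.
apply: contrapT => H; apply: nZ => r; rewrite /= in_itv/= => /andP[h1 h2]; apply: HZ => /= h.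
apply: H; exists r.
have rab : a < r < b by apply/andP; split; lra.
by split; [|rewrite ger0_norm; lra|apply: h; rewrite /= in_itv/=].
Qed.

Lemma half_sum_le {R : realType} (x y l e : R) :
  x * (2 * (1 + l)) <= e -> y <= e / 2 -> x + (l * x + y) <= e.
Proof. by move=> h1 h2; lra. Qed.

Section form_energy.
Context {R : realType} {N : nat} (s : R) (Om : set 'rV[R]_N).
Hypotheses (Om_open : open Om) (Om_bounded : bounded_set Om).
Context (mu : {outer_measure set 'rV[R]_N -> \bar R}).
Hypotheses (mu_reg : regular_borel_on_boundary Om mu) (mu_adm : admissible Om mu).
Local Notation RN := 'rV[R]_N.
Local Notation cara := (caratheodory_type mu).
Local Notation G := (Gamma Om mu : set cara).
Local Notation VV := (V s Om mu).
Local Notation Af := (Aform s Om mu).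
Local Notation fd := (form_dist s Om mu).
Variable m : {sigma_finite_measure set cara -> \bar R}.
Hypothesis Hm : forall A : set cara, measurable A -> A `<=` G -> m A = bmeas mu A.

Lemma form_energy_cvg w : VV w -> forall e : R, 0 < e -> exists d : R, 0 < d /\
  forall v, VV v -> fd v w <= d -> `|Af v v - Af w w| <= e.
Proof.
move=> Vw e e0; have A0 := Aform_ge0 Om_open Om_bounded mu_reg mu_adm Hm Vw.
(* The energy difference is [d (v, w) + 2 (A (v, w) - A (w, w))]. This Young weight makes the term
   [l^-1 * A (w, w)] at most [e / 2]; the rest is a multiple of [d (v, w)]. *)
pose l := 2 * (Af w w + 1) / e.
have l0 : 0 < l by rewrite divr_gt0// mulr_gt0// ltr_wpDl.
have l1 : 0 < 2 * (1 + l) by rewrite mulr_gt0// addr_gt0.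
exists (e / (2 * (1 + l))); split; first by rewrite divr_gt0.
move=> v Vv; rewrite ler_pdivlMr// => h.
have D0 := form_dist_ge0 Om_open Om_bounded mu_reg mu_adm Hm Vv Vw.
have Y := Aform_young Om_open Om_bounded mu_reg mu_adm Hm l0 Vv Vw Vw.
have E : Af v v - Af w w = fd v w + 2 * (Af v w - Af w w) by rewrite /form_dist; move: (Af v v) (Af v w) (Af w w) => x y z; ring.
have li : l^-1 * Af w w <= e / 2.
  move: A0 l0 l1 Y; rewrite /l; move: (Af w w) => z A0 l0 l1 Y.
  rewrite ler_pdivrMl //.
  have -> : 2 * (z + 1) / e * (e / 2) = z + 1 by field; rewrite gt_eqF.
  by rewrite lerDl.
rewrite E; apply: le_trans (ler_normD _ _) _; rewrite (ger0_norm D0) normrM (ger0_norm (ler0n R 2)).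
apply: le_trans (lerD (lexx _) Y) _.
exact: (half_sum_le h li).
Qed.

End form_energy.

Lemma le_sqr_of_succ_le {R : realType} (C M : R) : 1 + C <= M -> 0 <= C -> C <= M ^+ 2.
Proof. by move=> h C0; nra. Qed.

Lemma exists_common_majorant {R : realType} (x y z t : R) : 0 <= x -> 0 <= y -> 0 <= z -> 0 <= t ->
  exists M : R, 0 <= M /\ [/\ x <= M, y <= M, z <= M & 1 + t <= M].
Proof. by move=> *; exists (x + y + z + (1 + t)); split; [lra|split; lra]. Qed.

Lemma eq_opp_of_sum3_eq0 {R : realType} (x y z : R) : x + z + y = 0 -> z = - (x + y).
Proof. by move=> h; lra. Qed.

Lemma dist_le_itv_length {R : realType} (a b r t : R) :
  a < r -> r < b -> a < t -> t < b -> `|r - t| <= b - a.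
Proof. by move=> h1 h2 h3 h4; rewrite ler_norml; apply/andP; split; lra. Qed.

Lemma norm_le_of_quadratic_remainder {R : realType} (M K n D p q : R) : 0 <= M -> 0 <= K -> 0 <= n -> n <= D ->
  `|p - q| <= K * (M * n) ^+ 2 -> `|q| <= K * (M * n) ->
  `|p| <= (K * M + K * M ^+ 2 * D) * n.
Proof.
move=> M0 K0 n0 nD h1 h2; rewrite -(subrK q p); apply: le_trans (ler_normD _ _) _.
apply: le_trans (lerD h1 h2) _.
have : 0 <= K * M ^+ 2 * n * (D - n) by rewrite !mulr_ge0 ?sqr_ge0// subr_ge0.
lra.
Qed.

Section evolution_window.
Context {R : realType} {N : nat} (s : R) (Om : set 'rV[R]_N).
Hypotheses (Om_open : open Om) (Om_bounded : bounded_set Om).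
Context (mu : {outer_measure set 'rV[R]_N -> \bar R}).
Hypotheses (mu_reg : regular_borel_on_boundary Om mu) (mu_adm : admissible Om mu).
Local Notation RN := 'rV[R]_N.
Local Notation cara := (caratheodory_type mu).
Local Notation G := (Gamma Om mu : set cara).
Local Notation VV := (V s Om mu).
Local Notation Af := (Aform s Om mu).
Local Notation fd := (form_dist s Om mu).
Local Notation dt := (ldot Om).
Local Notation lebR := (@lebesgue_measure R).
Variable m : {sigma_finite_measure set cara -> \bar R}.
Hypothesis Hm : forall A : set cara, measurable A -> A `<=` G -> m A = bmeas mu A.
Variables (f : R -> R) (f_C1 : C1 f).
Variables (a b B : R) (u ut : R -> RN -> R).
Local Notation J := (`]a, b[%classic : set R).
Hypothesis ab : a < b.
Hypothesis bu : forall t, a <= t <= b -> bounded_by Om B (u t).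
Hypothesis cu : forall t, a <= t <= b -> forall e : R, 0 < e -> exists d : R, 0 < d /\
  forall r, a <= r <= b -> `|r - t| < d ->
    dt (fun x => u r x - u t x) (fun x => u r x - u t x) <= e.
Hypothesis Wu : W1inf_time Om a b u ut.
Hypothesis equ : {ae lebR, forall t, J t -> VV (u t) /\
  forall xi, VV xi -> dt (ut t) xi + Af (u t) xi + dt (f \o u t) xi = 0}.

Let su t (h : a <= t <= b) : lsq Om (u t) := bounded_by_lsq Om_open Om_bounded (bu h).

Let oc t : a < t < b -> a <= t <= b. Proof. by move=> /andP[h1 h2]; rewrite !ltW. Qed.

(** Up to sign, the L^2 vector that represents the functional [A (u t, .)] where the equation
    holds. *)
Definition residual t x := ut t x + (f \o u t) x.

Definition good_time M t := [/\ VV (u t), lsq Om (ut t), dt (ut t) (ut t) <= M ^+ 2,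
  lsq Om (residual t) /\ dt (residual t) (residual t) <= M ^+ 2 &
  forall xi, VV xi -> Af (u t) xi = - dt (residual t) xi].

Definition energy_constants M :=
  [/\ 0 <= M, {ae lebR, forall t, J t -> dt (ut t) (ut t) <= M ^+ 2},
   {ae lebR, forall t, J t -> good_time M t},
   forall r t, a < r < b -> a < t < b -> lsq Om (f \o u t) /\
   `|potential Om f (u r) - potential Om f (u t) - dt (f \o u t) (fun x => u r x - u t x)| <=
        M * (r - t) ^+ 2 &
   forall r t, a < r < b -> a < t < b ->
   dt (fun x => u r x - u t x) (fun x => u r x - u t x) <= (M * `|r - t|) ^+ 2 /\
   `|potential Om f (u r) - potential Om f (u t)| <= M * `|r - t|].

Lemma lsq_V v : VV v -> lsq Om v.
Proof.
by move=> [Tv _ _ _]; have [/(lsqP Om) sv _] := W12tilde_W12 Tv.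
Qed.

Lemma exists_energy_constants : exists M, energy_constants M.
Proof.
have [M1 [M10 H1]] := ut_bound Om_open Wu.
have [K [K0 HK]] := superposition Om_open Om_bounded f_C1 B.
have hM1 : {ae lebR, forall t, J t -> dt (ut t) (ut t) <= M1 ^+ 2}.
  by move: H1; apply: ae_dom_imp => t _ [].
have Lip := u_lipschitz Om_open ab su cu Wu M10 hM1.
pose C := 2 * (M1 ^+ 2 + K ^+ 2).
have C0 : 0 <= C by rewrite mulr_ge0// addr_ge0 ?sqr_ge0.
pose L := K * M1 + K * M1 ^+ 2 * (b - a).
have L0 : 0 <= L by rewrite addr_ge0 ?mulr_ge0 ?sqr_ge0// subr_ge0 ltW.
have KM0 : 0 <= K * M1 ^+ 2 by rewrite mulr_ge0// sqr_ge0.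
(* One constant serves all bounds. It majorizes [1 + C] rather than [C] because the residual is
   bounded by [M ^ 2], and [1 + C <= M] implies [C <= M ^ 2]. *)
have [M [M0 [M1M KMM LM CM1]]] := exists_common_majorant M10 KM0 L0 C0.
have CM : C <= M ^+ 2 by exact: (le_sqr_of_succ_le CM1 C0).
have sqM x : 0 <= x -> x <= M -> x ^+ 2 <= M ^+ 2 by move=> x0 xM; rewrite lerXn2r ?nnegrE.
exists M; split=> //.
- by move: hM1; apply: ae_dom_imp => t _ h; apply: le_trans h (sqM _ M10 M1M).
- move: H1 equ; apply: ae_dom_imp2 => t; rewrite /= in_itv/= => /oc tab [st tM] [Vt eqt].
  have [sf fK _ _] := HK _ _ (bu tab) (bu tab).
  have sr : lsq Om (residual t) := lsqD Om_open st sf.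
  split=> //.
  + exact: (le_trans tM (sqM _ M10 M1M)).
  + split=> //; apply: le_trans (ldotD_le Om_open st sf) _; apply: le_trans CM.
    by rewrite ler_pM2l// lerD.
  + move=> xi Vx; have sx := lsq_V Vx.
    by have := eqt xi Vx; rewrite (ldotDl Om_open st sf sx); exact: eq_opp_of_sum3_eq0.
- move=> r t rab tab; have [sf _ _ H] := HK _ _ (bu (oc tab)) (bu (oc rab)).
  split=> //; apply: le_trans H _; apply: le_trans (ler_wpM2l K0 (Lip _ _ tab rab)) _.
  by rewrite mulrA ler_wpM2r// sqr_ge0.
- move=> r t rab tab; have LL := Lip _ _ tab rab.
  have E1 : M1 ^+ 2 * (r - t) ^+ 2 = (M1 * `|r - t|) ^+ 2.
    by rewrite exprMn real_normK ?num_real.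
  rewrite E1 in LL; have n0 := normr_ge0 (r - t).
  have p0 : 0 <= M1 * `|r - t| by rewrite mulr_ge0.
  split; first by apply: le_trans LL _; rewrite lerXn2r ?nnegrE ?mulr_ge0// ler_wpM2r.
  have [sf fK _ H] := HK _ _ (bu (oc tab)) (bu (oc rab)).
  have sD := lsqB Om_open (su (oc rab)) (su (oc tab)).
  have F := ldot_CS_le Om_open sf sD K0 p0 fK LL.
  have F2 := le_trans H (ler_wpM2l K0 LL).
  apply: le_trans (ler_wpM2r n0 LM).
  have rt : `|r - t| <= b - a.
    by move: rab tab => /andP[h1 h2] /andP[h3 h4]; exact: dist_le_itv_length.
  exact: (norm_le_of_quadratic_remainder M10 K0 n0 rt F2 F).
Qed.

End evolution_window.

(** [x] and [y] stand for the products of the residual at the first time with the two states, [z]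
    and [t] for those of the residual at the second time. Symmetry of the form identifies the mixed
    products [y] and [z]. *)
Lemma symmetric_energy_bounds {R : realType} (x y z t K : R) : - y = - z ->
  `|x - y| <= K -> `|z - t| <= K ->
  - x - 2 * (- y) + - t <= 2 * K /\ `|- x - - t| <= 2 * K.
Proof. by rewrite !ler_norml => E /andP[? ?] /andP[? ?]; split; [|apply/andP; split]; lra. Qed.

Lemma dist_le_of_common_center {R : realType} (M e x y t : R) : 0 <= M -> 0 < 4 * (M * M + 1) ->
  `|x - t| <= e / (4 * (M * M + 1)) -> `|y - t| <= e / (4 * (M * M + 1)) ->
  2 * (M * (M * `|x - y|)) <= e.
Proof.
move=> M0 K0 h1 h2; have xy : `|x - y| <= e / (4 * (M * M + 1)) + e / (4 * (M * M + 1)).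
  rewrite (_ : x - y = (x - t) - (y - t)); last by ring.
  by apply: le_trans (ler_normB _ _) (lerD _ _).
have e0 : 0 <= e / (4 * (M * M + 1)) := le_trans (normr_ge0 _) h1.
have E : e = e / (4 * (M * M + 1)) * (4 * (M * M + 1)) by rewrite divfK ?gt_eqF.
rewrite [leRHS]E; move: (e / _) e0 xy {h1 h2 E} => z z0 xy.
have MM : 0 <= M * M by rewrite mulr_ge0.
have := ler_wpM2l MM xy; lra.
Qed.

Lemma lipschitz_of_approx {R : realType} (M e t r t' r' x y x' y' : R) : 0 <= M ->
  0 < 2 + 4 * (M * M) ->
  `|t' - t| <= e / (2 + 4 * (M * M)) -> `|r' - r| <= e / (2 + 4 * (M * M)) ->
  `|x - x'| <= e / (2 + 4 * (M * M)) -> `|y' - y| <= e / (2 + 4 * (M * M)) ->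
  `|x' - y'| <= 2 * (M * (M * `|t' - r'|)) ->
  `|x - y| <= 2 * (M * (M * `|t - r|)) + e.
Proof.
move=> M0 K0; set z := e / _ => h1 h2 h3 h4 h5.
have E : e = z * (2 + 4 * (M * M)) by rewrite divfK ?gt_eqF.
rewrite [e in leRHS]E; move: z h1 h2 h3 h4 {E} => z h1 h2 h3 h4.
have MM : 0 <= M * M by rewrite mulr_ge0.
have tr : `|t' - r'| <= `|t - r| + (z + z).
  rewrite (_ : t' - r' = (t - r) + ((t' - t) - (r' - r))); last by ring.
  apply: le_trans (ler_normD _ _) _; rewrite lerD2l.
  by apply: le_trans (ler_normB _ _) (lerD _ _).
have xy : `|x - y| <= `|x' - y'| + (z + z).
  rewrite (_ : x - y = (x' - y') + ((x - x') + (y' - y))); last by ring.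
  apply: le_trans (ler_normD _ _) _; rewrite lerD2l.
  by apply: le_trans (ler_normD _ _) (lerD _ _).
have := ler_wpM2l MM tr; lra.
Qed.

Lemma half_quadratic_expansion {R : realType} (x y z : R) :
  0 <= z - 2 * (- x) + - y -> - 2 * (x - y) <= z - - y.
Proof. by move=> h; lra. Qed.

Lemma lyapunov_lipschitz_sum {R : realType} (M n x y p q : R) :
  `|x - y| <= 2 * (M * (M * n)) -> `|p - q| <= M * n ->
  `|x / 2 + p - (y / 2 + q)| <= (M * M + M) * n.
Proof. by rewrite !ler_norml => /andP[? ?] /andP[? ?]; apply/andP; split; lra. Qed.

Lemma lyapunov_increment_sum {R : realType} (x y p q z w k : R) :
  - 2 * (z + w) <= x - y -> `|p - q - w| <= k ->
  - z - k <= x / 2 + p - (y / 2 + q).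
Proof. by move=> h1; rewrite ler_norml => /andP[? ?]; lra. Qed.

(** * Lipschitz bounds and one-sided increments of the energy *)

Section evolution_window.
Context {R : realType} {N : nat} (s : R) (Om : set 'rV[R]_N).
Hypotheses (Om_open : open Om) (Om_bounded : bounded_set Om).
Context (mu : {outer_measure set 'rV[R]_N -> \bar R}).
Hypotheses (mu_reg : regular_borel_on_boundary Om mu) (mu_adm : admissible Om mu).
Local Notation RN := 'rV[R]_N.
Local Notation cara := (caratheodory_type mu).
Local Notation G := (Gamma Om mu : set cara).
Local Notation VV := (V s Om mu).
Local Notation Af := (Aform s Om mu).
Local Notation fd := (form_dist s Om mu).
Local Notation dt := (ldot Om).
Local Notation lebR := (@lebesgue_measure R).
Variable m : {sigma_finite_measure set cara -> \bar R}.
Hypothesis Hm : forall A : set cara, measurable A -> A `<=` G -> m A = bmeas mu A.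
Variables (f : R -> R) (f_C1 : C1 f).
Variables (a b B : R) (u ut : R -> RN -> R).
Local Notation J := (`]a, b[%classic : set R).
Hypothesis ab : a < b.
Hypothesis bu : forall t, a <= t <= b -> bounded_by Om B (u t).
Hypothesis cu : forall t, a <= t <= b -> forall e : R, 0 < e -> exists d : R, 0 < d /\
  forall r, a <= r <= b -> `|r - t| < d ->
    dt (fun x => u r x - u t x) (fun x => u r x - u t x) <= e.
Hypothesis Wu : W1inf_time Om a b u ut.

Variable M : R.
Hypothesis HM : energy_constants s Om mu f a b u ut M.
Local Notation good := (good_time s Om mu f u ut M).
Local Notation res := (residual f u ut).
Local Notation En t := (Af (u t) (u t)).
Local Notation L t := (Lyapunov s Om mu f (u t)).

Let oc t : a < t < b -> a <= t <= b. Proof. by move=> /andP[h1 h2]; rewrite !ltW. Qed.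

Let su t (h : a < t < b) : lsq Om (u t) := bounded_by_lsq Om_open Om_bounded (bu (oc h)).

Let M0 : 0 <= M. Proof. by have [] := HM. Qed.

Lemma good_increment t r r' : good t -> a < r < b -> a < r' < b ->
  `|dt (res t) (fun x => u r x - u r' x)| <= M * (M * `|r - r'|).
Proof.
move=> [_ _ _ [sr rM] _] hr hr'; have [_ _ _ _ /(_ r r' hr hr')[h _]] := HM.
apply: (ldot_CS_le Om_open sr (lsqB Om_open (su hr) (su hr')) M0 _ rM h).
by rewrite mulr_ge0.
Qed.

Lemma good_energy t r : good t -> good r -> a < t < b -> a < r < b ->
  fd (u t) (u r) <= 2 * (M * (M * `|t - r|)) /\ `|En t - En r| <= 2 * (M * (M * `|t - r|)).
Proof.
move=> gt gr ht hr; have i1 := good_increment gt ht hr; have i2 := good_increment gr ht hr.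
have [Vt _ _ [st _] et] := gt; have [Vr _ _ [sr _] er] := gr.
have S := Aform_sym Om_open Om_bounded mu_reg mu_adm Hm Vt Vr.
move: i1 i2; rewrite (ldotBr Om_open (su ht) (su hr) st) (ldotBr Om_open (su ht) (su hr) sr).
move: S; rewrite /form_dist (et _ Vt) (et _ Vr) (er _ Vt) (er _ Vr).
exact: symmetric_energy_bounds.
Qed.

Lemma good_dense t d : a < t < b -> 0 < d -> exists r, [/\ a < r < b, `|r - t| < d & good r].
Proof. by have [_ _ H _ _] := HM; exact: ae_itv_dense. Qed.

(** [form_closed] is applied along good times tending to [t]: [good_energy] is its Cauchy condition,
    and [form_energy_cvg] carries the values of the energy to the limit. *)
Lemma window_approx t : a < t < b -> VV (u t) /\ forall e : R, 0 < e ->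
  exists r, [/\ a < r < b, `|r - t| < e, good r & `|En r - En t| <= e].
Proof.
move=> ht.
have /choice[r Hr] : forall n : nat, exists r, [/\ a < r < b, `|r - t| < n.+1%:R^-1 & good r].
  by move=> n; apply: good_dense => //; rewrite invr_gt0.
have rab n : a < r n < b by have [] := Hr n.
have rt n : `|r n - t| <= n.+1%:R^-1 by have [_ /ltW] := Hr n.
have gr n : good (r n) by have [] := Hr n.
have Vr n : VV (u (r n)) by have [] := gr n.
have small (e : R) : 0 < e -> exists n0, forall n, (n0 <= n)%N -> n.+1%:R^-1 < e.
  move=> e0; have [n0 _ H] := near_infty_natSinv_lt (PosNum e0).
  by exists n0 => n nn; exact: H.
have lim : lcvg Om (u \o r) (u t).
  apply/lcvgE; apply/cvgrPdist_le => e e0.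
  have e1 : 0 < Num.sqrt e / (M + 1) by rewrite divr_gt0 ?sqrtr_gt0// ltr_wpDl.
  have [n0 Hn] := small _ e1; exists n0 => // n nn.
  rewrite sub0r normrN ger0_norm ?ldot_ge0//.
  have [_ _ _ _ /(_ (r n) t (rab n) ht)[h _]] := HM; apply: le_trans h _.
  rewrite -[leRHS](sqr_sqrtr (ltW e0)) lerXn2r ?nnegrE ?mulr_ge0 ?sqrtr_ge0//.
  have := le_lt_trans (rt n) (Hn n nn); rewrite ltr_pdivlMr ?ltr_wpDl// => h.
  by apply: le_trans (ltW h); rewrite mulrC ler_wpM2l// lerDl.
have cauchy (e : R) : 0 < e -> exists n0, forall n k, (n0 <= n)%N -> (n0 <= k)%N ->
    fd ((u \o r) n) ((u \o r) k) <= e.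
  move=> e0; have K0 : 0 < 4 * (M * M + 1) by rewrite mulr_gt0// ltr_wpDl// mulr_ge0.
  have [n0 Hn] := small _ (divr_gt0 e0 K0); exists n0 => n k nn nk.
  have [h _] := good_energy (gr n) (gr k) (rab n) (rab k); apply: le_trans h _.
  exact: (dist_le_of_common_center M0 K0 (le_trans (rt n) (ltW (Hn n nn))) (le_trans (rt k) (ltW (Hn k nk)))).
have [Vt Ht] := form_closed Om_open Om_bounded mu_reg mu_adm Hm Vr (su ht) lim cauchy.
split=> // e e0.
have [d [d0 Hd]] := form_energy_cvg Om_open Om_bounded mu_reg mu_adm Hm Vt e0.
have [n1 H1] := Ht d d0; have [n2 H2] := small e e0.
exists (r (maxn n1 n2)); split; [exact: rab| |exact: gr|].
  exact: (le_lt_trans (rt _) (H2 _ (leq_maxr n1 n2))).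
exact: (Hd _ (Vr _) (H1 _ (leq_maxl n1 n2))).
Qed.

Lemma window_V t : a < t < b -> VV (u t).
Proof. by case/window_approx. Qed.

Lemma energy_lipschitz t r : a < t < b -> a < r < b ->
  `|En t - En r| <= 2 * (M * (M * `|t - r|)).
Proof.
move=> ht hr; apply/ler_addgt0Pr => e e0.
pose e' := e / (2 + 4 * (M * M)).
have K0 : 0 < 2 + 4 * (M * M) by rewrite ltr_pwDl// !mulr_ge0.
have e'0 : 0 < e' by rewrite divr_gt0.
have [_ /(_ _ e'0)[t' [ht' tt' gt Et]]] := window_approx ht.
have [_ /(_ _ e'0)[r' [hr' rr' gr Er]]] := window_approx hr.
have [_ h] := good_energy gt gr ht' hr'.
rewrite distrC in Et.
exact: (lipschitz_of_approx M0 K0 (ltW tt') (ltW rr') Et Er h).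
Qed.

Lemma energy_increment t r : good t -> a < t < b -> a < r < b ->
  - 2 * dt (res t) (fun x => u r x - u t x) <= En r - En t.
Proof.
move=> gt ht hr; have [Vt _ _ [st _] et] := gt; have Vr := window_V hr.
have := form_dist_ge0 Om_open Om_bounded mu_reg mu_adm Hm Vr Vt.
rewrite /form_dist (Aform_sym Om_open Om_bounded mu_reg mu_adm Hm Vr Vt) (et _ Vt) (et _ Vr).
rewrite (ldotBr Om_open (su hr) (su ht) st); exact: half_quadratic_expansion.
Qed.

Lemma LyapunovE t : L t = En t / 2 + potential Om f (u t).
Proof. by []. Qed.

Lemma lyapunov_lipschitz t r : a < t < b -> a < r < b ->
  `|L t - L r| <= (M * M + M) * `|t - r|.
Proof.
move=> ht hr; rewrite !LyapunovE; have h1 := energy_lipschitz ht hr.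
have [_ _ _ _ /(_ t r ht hr)[_ h2]] := HM.
move: h1 h2; exact: lyapunov_lipschitz_sum.
Qed.

Lemma lyapunov_increment t r : good t -> a < t < b -> a < r < b ->
  - dt (ut t) (fun x => u r x - u t x) - M * (r - t) ^+ 2 <= L r - L t.
Proof.
move=> gt ht hr; rewrite !LyapunovE; have h1 := energy_increment gt ht hr.
have [_ st _ _ _] := gt.
have [_ _ _ /(_ r t hr ht)[sf h2] _] := HM.
move: h1 h2; rewrite (ldotDl Om_open st sf (lsqB Om_open (su hr) (su ht))).
exact: lyapunov_increment_sum.
Qed.

End evolution_window.

(** * The dissipation identity *)

Lemma ae_dom_sub {R : realType} (D D' : set R) (P : R -> Prop) : D' `<=` D ->
  {ae @lebesgue_measure R, forall x, D x -> P x} -> {ae @lebesgue_measure R, forall x, D' x -> P x}.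
Proof. by move=> D'D [Z [mZ Z0 HZ]]; exists Z; split=> // x /= h; apply: HZ => /= h'; apply: h => /D'D. Qed.

Lemma ae_itv_closed {R : realType} (r1 r2 : R) (P : R -> Prop) :
  {ae @lebesgue_measure R, forall t, `]r1, r2[%classic t -> P t} ->
  {ae @lebesgue_measure R, forall t, `[r1, r2]%classic t -> P t}.
Proof.
have neq (x : R) : {ae @lebesgue_measure R, forall t, `[r1, r2]%classic t -> t != x}.
  exists [set x]; split; first exact: measurable_set1.
    by rewrite lebesgue_measure_set1.
  by move=> t /= h; apply: contrapT => /= tx; apply: h => _; apply/eqP.
move=> H; have H' : {ae @lebesgue_measure R, forall t, `[r1, r2]%classic t -> `]r1, r2[%classic t -> P t}.
  by move: H; apply: (@filterS _ _ (ae_filter_ringOfSetsType (@lebesgue_measure R))) => t h _; exact: h.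
move: (ae_dom_imp2 (fun t _ => @conj _ _) (neq r1) (neq r2)) H'.
apply: ae_dom_imp2 => t; rewrite /= in_itv/= => /andP[h1 h2] [n1 n2]; apply.
by rewrite /= in_itv/= !lt_neqAle h1 h2 n2 eq_sym n1.
Qed.

Definition retract {R : realType} (a b t : R) : R := Num.max a (Num.min b t).

Lemma retract_itv {R : realType} (a b t : R) : a <= b -> a <= retract a b t <= b.
Proof. by move=> ab; rewrite /retract le_max lexx/= ge_max ab ge_min lexx. Qed.

Lemma retract_id {R : realType} (a b t : R) : a <= t <= b -> retract a b t = t.
Proof. by move=> /andP[h1 h2]; rewrite /retract min_r// max_r. Qed.

Lemma retract_lipschitz {R : realType} (a b t r : R) : a <= b ->
  `|retract a b t - retract a b r| <= `|t - r|.
Proof.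
move=> ab; rewrite /retract !maxEle !minEle.
by case: (leP b t) => h1; case: (leP b r) => h2; rewrite ?ab//; repeat case: ifP => ? //;
  rewrite ?subrr ?normr0//; rewrite ler_norml; have := ler_norm (t - r);
  have := ler_norm (- (t - r)); rewrite normrN; lra.
Qed.

Lemma right_quotient_ge {R : realType} (h M e x D q : R) : 0 < h -> M * h <= e / 2 ->
  - D - M * h ^+ 2 <= x -> `|D - h * q| <= e / 2 * `|h| -> - q - e <= x / h.
Proof.
move=> h0 Mh h1; rewrite (gtr0_norm h0) ler_norml => /andP[_ h2].
by rewrite ler_pdivlMr//; have := ler_wpM2r (ltW h0) Mh; lra.
Qed.

Lemma left_quotient_le {R : realType} (h M e x D q : R) : 0 < h -> M * h <= e / 2 ->
  - D - M * (- h) ^+ 2 <= x -> `|D - (- h) * q| <= e / 2 * `|- h| -> x / (- h) <= - q + e.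
Proof.
move=> h0 Mh h1; rewrite normrN (gtr0_norm h0) ler_norml => /andP[_ h2].
rewrite invrN mulrN lerNl ler_pdivlMr//; have := ler_wpM2r (ltW h0) Mh; lra.
Qed.

Lemma shift_in_itv {R : realType} (h t r1 r2 : R) : 0 < h -> r1 < t -> t < r2 ->
  h < t - r1 -> h < r2 - t -> r1 < t + h < r2 /\ r1 < t - h < r2.
Proof. by move=> *; split; apply/andP; split; lra. Qed.

Section evolution_window.
Context {R : realType} {N : nat} (s : R) (Om : set 'rV[R]_N).
Hypotheses (Om_open : open Om) (Om_bounded : bounded_set Om).
Context (mu : {outer_measure set 'rV[R]_N -> \bar R}).
Hypotheses (mu_reg : regular_borel_on_boundary Om mu) (mu_adm : admissible Om mu).
Local Notation RN := 'rV[R]_N.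
Local Notation cara := (caratheodory_type mu).
Local Notation G := (Gamma Om mu : set cara).
Local Notation VV := (V s Om mu).
Local Notation Af := (Aform s Om mu).
Local Notation fd := (form_dist s Om mu).
Local Notation dt := (ldot Om).
Local Notation lebR := (@lebesgue_measure R).
Variable m : {sigma_finite_measure set cara -> \bar R}.
Hypothesis Hm : forall A : set cara, measurable A -> A `<=` G -> m A = bmeas mu A.
Variables (f : R -> R) (f_C1 : C1 f).
Variables (a b B : R) (u ut : R -> RN -> R).
Local Notation J := (`]a, b[%classic : set R).
Hypothesis ab : a < b.
Hypothesis bu : forall t, a <= t <= b -> bounded_by Om B (u t).
Hypothesis cu : forall t, a <= t <= b -> forall e : R, 0 < e -> exists d : R, 0 < d /\
  forall r, a <= r <= b -> `|r - t| < d ->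
    dt (fun x => u r x - u t x) (fun x => u r x - u t x) <= e.
Hypothesis Wu : W1inf_time Om a b u ut.

Variable M : R.
Hypothesis HM : energy_constants s Om mu f a b u ut M.
Local Notation L t := (Lyapunov s Om mu f (u t)).

Let su t (h : a <= t <= b) : lsq Om (u t) := bounded_by_lsq Om_open Om_bounded (bu h).

Let lyap_incr := lyapunov_increment Om_open Om_bounded mu_reg mu_adm Hm bu HM.
Let lyap_lip := lyapunov_lipschitz Om_open Om_bounded mu_reg mu_adm Hm bu HM.

Lemma window_dissipation : exists q, [/\ bounded_measurable q,
  {ae lebR, forall t, J t -> dt (ut t) (ut t) = q t} &
  forall r1 r2, a < r1 -> r1 <= r2 -> r2 < b ->
    L r2 - L r1 = - (\int[lebR]_(t in `[r1, r2]) q t)].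
Proof.
have [M0 hM hg _ _] := HM.
have [q [bq Eq]] := ut_sq_version Om_open Wu M0 hM.
exists q; split=> // r1 r2 ar1; rewrite le_eqVlt => /predU1P[<- _|r12 r2b].
  by rewrite Rintegral_itv_ge// oppr0 subrr.
have r12' := ltW r12.
have rab t : r1 <= t <= r2 -> a < t < b.
  by move=> /andP[h1 h2]; rewrite (lt_le_trans ar1 h1) (le_lt_trans h2 r2b).
(* The Dini criterion is stated for functions Lipschitz on the whole line, so time is retracted to
   [[r1, r2]]. *)
pose k := retract r1 r2.
have kab t : a < k t < b by apply: rab; exact: retract_itv.
have Lk : lipschitz_on_R (fun t => L (k t)) (M * M + M).
  move=> t r; apply: le_trans (lyap_lip (kab t) (kab r)) _.
  by rewrite ler_wpM2l ?addr_ge0 ?mulr_ge0//; exact: retract_lipschitz.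
have subJ : `]r1, r2[%classic `<=` J.
  by move=> t; rewrite /= !in_itv/= => /andP[h1 h2]; apply: rab; rewrite !ltW.
have W := ut_weak_derivative Om_open ab su cu Wu M0 ar1 r2b hM.
pose h n : R := n.+1%:R^-1.
have h0 : h n @[n --> \oo] --> (0 : R) := @cvg_harmonic R.
have hp n : 0 < h n by rewrite invr_gt0.
have small (e : R) : 0 < e -> exists n0, forall n, (n0 <= n)%N -> h n < e.
  move=> e0; have [n0 _ H] := near_infty_natSinv_lt (PosNum e0).
  by exists n0 => n nn; exact: H.
have key : {ae lebR, forall t, `]r1, r2[%classic t -> forall e : R, 0 < e ->
     exists n0, forall n, (n0 <= n)%N ->
       - q t - e <= (L (k (t + h n)) - L (k t)) / h n /\
       (L (k (t - h n)) - L (k t)) / (- h n) <= - q t + e}.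
  move: (ae_dom_sub subJ Eq) (ae_dom_imp2 (fun t _ => @conj _ _) (ae_dom_sub subJ hg) W).
  apply: ae_dom_imp2 => t; rewrite /= in_itv/= => /andP[t1 t2] qt [gt Wt] e e0.
  have e2 : 0 < e / 2 by rewrite divr_gt0.
  have [d [d0 Hd]] := Wt _ e2; rewrite qt in Hd.
  have M1 : 0 < M + 1 by rewrite ltr_wpDl.
  (* The first bound is for the weak derivative of [u], the second makes the quadratic error [M * h]
     at most [e / 2], and the last two keep [t + h] and [t - h] inside the interval. *)
  have d1 : 0 < Num.min (Num.min d (e / 2 / (M + 1))) (Num.min (t - r1) (r2 - t)).
    by rewrite !lt_min d0 !subr_gt0 t1 t2 divr_gt0.
  have [n0 Hn] := small _ d1; exists n0 => n /Hn.
  rewrite !lt_min => /andP[/andP[hd hM2] /andP[hr1 hr2]].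
  have hh := hp n; have Mh : M * h n <= e / 2.
    move: hM2; rewrite ltr_pdivlMr// => /ltW; apply: le_trans.
    by rewrite mulrC ler_wpM2l ?(ltW hh)// lerDl.
  have tr : r1 < t < r2 by rewrite t1 t2.
  have kt : k t = t by rewrite /k retract_id// !ltW.
  have [p1 p2] := shift_in_itv hh t1 t2 hr1 hr2.
  have oc x : r1 < x < r2 -> r1 <= x <= r2 by move=> /andP[? ?]; rewrite !ltW.
  rewrite kt (_ : k (t + h n) = t + h n); last by apply: retract_id; exact: oc.
  rewrite (_ : k (t - h n) = t - h n); last by apply: retract_id; exact: oc.
  have tab := rab _ (oc _ tr).
  have D1 : t + h n - t = h n by rewrite addrC addKr.
  have D2 : t - h n - t = - h n by rewrite addrC addKr.
  split.
  - have := lyap_incr gt tab (rab _ (oc _ p1)); have := Hd _ p1.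
    rewrite D1 (gtr0_norm hh) => /(_ hd); rewrite -{3}(gtr0_norm hh) => B1 B2.
    exact: (right_quotient_ge hh Mh B2 B1).
  - have := lyap_incr gt tab (rab _ (oc _ p2)); have := Hd _ p2.
    rewrite D2 normrN (gtr0_norm hh) => /(_ hd); rewrite -{3}(gtr0_norm hh) -[`|h n|]normrN => B1 B2.
    exact: (left_quotient_le hh Mh B2 B1).
have E := eq_integral_of_dini r12' Lk bq h0 hp.
have k1 : k r1 = r1 by rewrite /k retract_id// lexx r12'.
have k2 : k r2 = r2 by rewrite /k retract_id// lexx r12'.
rewrite k1 k2 in E; apply: E; apply: ae_itv_closed; move: key; apply: ae_dom_imp => t _ H e /H[n0 Hn];
  by exists n0 => n /Hn[].
Qed.

Lemma window_derivative r1 r2 : a < r1 -> r2 < b ->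
  {ae lebR, forall t, `]r1, r2[%classic t ->
    is_derive t (1 : R) (fun t => L t) (- dt (ut t) (ut t))}.
Proof.
move=> ar1 r2b; have [q [bq Eq HL]] := window_dissipation.
have D : {ae lebR, forall t, `]r1, r2[%classic t -> is_derive t (1 : R) (fun t => L t) (- q t)}.
  apply: (@ae_derive_integral R (fun t => L t) (fun t => - q t)); first exact: bounded_measurableN.
  by move=> t /andP[h1 h2]; rewrite (HL _ _ ar1 h1 (le_lt_trans h2 r2b)) Rintegral_itvN.
have subJ : `]r1, r2[%classic `<=` J.
  move=> t; rewrite /= !in_itv/= => /andP[h1 h2].
  by rewrite (lt_trans ar1 h1) (lt_trans h2 r2b).
by move: (ae_dom_sub subJ Eq) D; apply: ae_dom_imp2 => t _ ->.
Qed.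

End evolution_window.

(** * Stationary solutions and equilibria *)

(** Gronwall's inequality from one-step bounds. Over [n + 1] equal steps the quadratic errors
    accumulate to at most [expR (A (b - a))] times [C (b - a)^2 / (n + 1)], which tends to 0; no
    differential inequality for [phi] enters. *)
Lemma gronwall_discrete {R : realType} (phi : R -> R) (a b A C : R) : 0 <= A -> 0 <= C -> a <= b ->
  (forall r1 r2, a <= r1 -> r1 <= r2 -> r2 <= b ->
     phi r2 <= (1 + A * (r2 - r1)) * phi r1 + C * (r2 - r1) ^+ 2) ->
  phi a <= 0 -> phi b <= 0.
Proof.
move=> A0 C0 ab H pa.
have T0 : 0 <= b - a by rewrite subr_ge0.
have step (n k : nat) (h : R) : h = (b - a) / n.+1%:R -> (k <= n.+1)%N ->
    phi (a + k%:R * h) <= expR (A * (k%:R * h)) * (C * k%:R * h ^+ 2).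
  move=> hE0; have h0 : 0 <= h by rewrite hE0 divr_ge0.
  have hE : n.+1%:R * h = b - a by rewrite hE0 mulrC divfK.
  elim: k => [_|k ih kn]; first by rewrite mul0r addr0 !mulr0 mul0r mulr0.
  have {ih} := ih (ltnW kn).
  have k0 : 0 <= k%:R :> R by [].
  have kh : k.+1%:R * h <= b - a by rewrite -hE ler_wpM2r// ler_nat.
  have kE : k.+1%:R = k%:R + 1 :> R by rewrite -natr1.
  rewrite kE in kh *; have kh0 : 0 <= k%:R * h by rewrite mulr_ge0.
  have b1 : a <= a + k%:R * h by rewrite lerDl.
  have b2 : a + k%:R * h <= a + (k%:R + 1) * h by rewrite lerD2l ler_wpM2r// lerDl.
  have b3 : a + (k%:R + 1) * h <= b by rewrite -lerBrDl.
  have := H _ _ b1 b2 b3.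
  rewrite (_ : a + (k%:R + 1) * h - (a + k%:R * h) = h); last by ring.
  move=> h1 h2; apply: le_trans h1 _.
  have Ah : 0 <= A * h by rewrite mulr_ge0.
  have e1 : 1 + A * h <= expR (A * h) := expR_ge1Dx _.
  have -> : A * ((k%:R + 1) * h) = A * (k%:R * h) + A * h by ring.
  rewrite expRD; set E := expR _ in h2 *; set F := expR _ in e1 *.
  have E1 : 1 <= E by apply: le_trans (expR_ge1Dx _); rewrite lerDl mulr_ge0.
  have F1 : 1 <= F by rewrite /F -expR0 ler_expR.
  have Ch : 0 <= C * h ^+ 2 by rewrite mulr_ge0// sqr_ge0.
  have X0 : 0 <= E * (C * k%:R * h ^+ 2).
    by rewrite mulr_ge0 ?expR_ge0// !mulr_ge0 ?sqr_ge0.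
  have -> : E * F * (C * (k%:R + 1) * h ^+ 2) =
      F * (E * (C * k%:R * h ^+ 2)) + E * F * (C * h ^+ 2) by ring.
  apply: lerD.
    apply: le_trans (ler_wpM2l _ h2) _; first by rewrite addr_ge0.
    exact: ler_wpM2r.
  rewrite -[leLHS]mul1r ler_wpM2r//; apply: le_trans E1 _.
  by rewrite ler_peMr// expR_ge0.
apply/ler_addgt0Pr => e e0; rewrite add0r.
pose Z := expR (A * (b - a)) * (C * (b - a) ^+ 2).
have Z0 : 0 <= Z by rewrite mulr_ge0 ?expR_ge0// mulr_ge0 ?sqr_ge0.
have eZ : 0 < e / (Z + 1) by rewrite divr_gt0// ltr_wpDl.
have [n _ /(_ n (leqnn n))] := near_infty_natSinv_lt (PosNum eZ).
rewrite /= ltr_pdivlMr ?ltr_wpDl// => /ltW hn.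
have := step n n.+1 _ erefl (leqnn _).
rewrite [n.+1%:R * _]mulrC divfK// (addrC a) subrK => h.
apply: le_trans h _; apply: le_trans hn.
have -> : expR (A * (b - a)) * (C * n.+1%:R * ((b - a) / n.+1%:R) ^+ 2) = n.+1%:R^-1 * Z.
  by rewrite /Z; field.
by rewrite ler_wpM2l ?invr_ge0// lerDl.
Qed.

Lemma is_derive_cst_on {R : realType} (F : R -> R) (a b t l : R) : a < t < b ->
  (forall r, a < r < b -> F r = F t) -> is_derive t (1 : R) F l -> l = 0.
Proof.
move=> /andP[at_ tb] HF dF; apply/eqP; rewrite -normr_le0; apply/ler_addgt0Pr => e e0; rewrite add0r.
have [d [d0 Hd]] := is_derive_eps dF e0.
pose h := Num.min d (b - t) / 2.
have m0 : 0 < Num.min d (b - t) by rewrite lt_min d0 subr_gt0.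
have [m1 m2] : Num.min d (b - t) <= d /\ Num.min d (b - t) <= b - t by rewrite !ge_min !lexx orbT.
have [h0 hd hb] : [/\ 0 < h, h < d & t + h < b] by rewrite /h; split; lra.
have E : t + h - t = h by rewrite addrC addKr.
have := Hd (t + h); rewrite E (gtr0_norm h0) HF; last by apply/andP; split; lra.
move=> /(_ hd); rewrite subrr sub0r normrN normrM (gtr0_norm h0) ler_pM2r//.
Qed.

Lemma Rintegral_itv_ge0_ae {R : realType} (q : R -> R) (a b : R) :
  {ae @lebesgue_measure R, forall t, `[a, b]%classic t -> 0 <= q t} ->
  0 <= \int[@lebesgue_measure R]_(t in `[a, b]) q t.
Proof.
move=> H; have -> : \int[@lebesgue_measure R]_(t in `[a, b]) q t =
    \int[@lebesgue_measure R]_(t in `[a, b]) `|q t|; last by apply: Rintegral_ge0.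
by apply: Rintegral_ae_eq; move: H; apply: ae_dom_imp => t _ h; rewrite ger0_norm.
Qed.

Lemma Rintegral_itv_le_ae {R : realType} (q : R -> R) (a b X : R) : a <= b -> bounded_measurable q ->
  {ae @lebesgue_measure R, forall t, `[a, b]%classic t -> q t <= X} ->
  \int[@lebesgue_measure R]_(t in `[a, b]) q t <= X * (b - a).
Proof.
move=> ab bq H.
have bX : bounded_measurable (fun=> X : R) by split; [exact: measurable_cst|exists `|X|].
have := bounded_measurableB bX bq => bd.
have : 0 <= \int[@lebesgue_measure R]_(t in `[a, b]) (X - q t).
  by apply: Rintegral_itv_ge0_ae; move: H; apply: ae_dom_imp => t _; rewrite subr_ge0.
rewrite (RintegralB (measurable_cc a b) (bounded_measurable_integrable a b bX) (bounded_measurable_integrable a b bq)).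
by rewrite (Rintegral_cst _ (measurable_cc a b)) fine_itv_measure// subr_ge0.
Qed.

(** In the application [x] is the product of [ut t] with [u t - w], [p] and [p1] are the squared
    distances to [w] at [t] and at the start of the step, and [y1], [y2] are increments of [u]
    within the step against [ut t]. One factor [h] of the square is bounded by the window length
    [d]. These are the constants of [equilibrium_attained]. *)
Lemma dissipation_rate_le {R : realType} (K M h d x p y1 y2 y3 p1 : R) : 0 <= K -> 0 <= M ->
  0 <= h -> h <= d ->
  x <= K * p -> p <= 2 * ((M * h) ^+ 2 + p1) -> `|y1| <= M * (M * h) -> `|y2| <= M * (M * h) ->
  y3 = 2 * x + y1 + y2 ->
  y3 <= 4 * K * p1 + (4 * K * M ^+ 2 * d + 2 * M ^+ 2) * h.
Proof.
move=> K0 M0 h0 hd h1 h2; rewrite !ler_norml => /andP[_ h3] /andP[_ h4] ->.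
have := ler_wpM2l K0 h2.
have : K * M ^+ 2 * h * h <= K * M ^+ 2 * h * d by rewrite ler_wpM2l// !mulr_ge0// sqr_ge0.
lra.
Qed.

Lemma gronwall_step {R : realType} (A C h p1 p2 i : R) : p2 - p1 = i ->
  i <= (A * p1 + C * h) * h -> p2 <= (1 + A * h) * p1 + C * h ^+ 2.
Proof. by move=> <-; rewrite lerBlDl => h1; apply: le_trans h1 _; lra. Qed.

Lemma equilibrium_balance {R : realType} (att atw awt aww ft fw : R) :
  0 <= att - 2 * atw + aww -> atw = awt -> forall (d1 d2 e1 e2 : R),
  d1 + att + ft = 0 -> d2 + atw + fw = 0 -> awt + e1 = 0 -> aww + e2 = 0 ->
  d1 - d2 <= - (ft - fw - (e1 - e2)).
Proof. by move=> h0 h1 *; lra. Qed.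

Section evolution_window.
Context {R : realType} {N : nat} (s : R) (Om : set 'rV[R]_N).
Hypotheses (Om_open : open Om) (Om_bounded : bounded_set Om).
Context (mu : {outer_measure set 'rV[R]_N -> \bar R}).
Hypotheses (mu_reg : regular_borel_on_boundary Om mu) (mu_adm : admissible Om mu).
Local Notation RN := 'rV[R]_N.
Local Notation cara := (caratheodory_type mu).
Local Notation G := (Gamma Om mu : set cara).
Local Notation VV := (V s Om mu).
Local Notation Af := (Aform s Om mu).
Local Notation fd := (form_dist s Om mu).
Local Notation dt := (ldot Om).
Local Notation lebR := (@lebesgue_measure R).
Variable m : {sigma_finite_measure set cara -> \bar R}.
Hypothesis Hm : forall A : set cara, measurable A -> A `<=` G -> m A = bmeas mu A.
Variables (f : R -> R) (f_C1 : C1 f).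
Variables (a b B : R) (u ut : R -> RN -> R).
Local Notation J := (`]a, b[%classic : set R).
Hypothesis ab : a < b.
Hypothesis bu : forall t, a <= t <= b -> bounded_by Om B (u t).
Hypothesis cu : forall t, a <= t <= b -> forall e : R, 0 < e -> exists d : R, 0 < d /\
  forall r, a <= r <= b -> `|r - t| < d ->
    dt (fun x => u r x - u t x) (fun x => u r x - u t x) <= e.
Hypothesis Wu : W1inf_time Om a b u ut.

Variable M : R.
Hypothesis HM : energy_constants s Om mu f a b u ut M.
Local Notation L t := (Lyapunov s Om mu f (u t)).

Let oc t : a < t < b -> a <= t <= b. Proof. by move=> /andP[h1 h2]; rewrite !ltW. Qed.

Let su t (h : a < t < b) : lsq Om (u t) := bounded_by_lsq Om_open Om_bounded (bu (oc h)).

Let dissip := window_dissipation Om_open Om_bounded mu_reg mu_adm Hm ab bu cu Wu HM.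

Lemma lyapunov_nonincreasing r1 r2 : a < r1 -> r1 <= r2 -> r2 < b -> L r2 <= L r1.
Proof.
move=> h1 h2 h3; have [q [bq Eq /(_ _ _ h1 h2 h3) E]] := dissip.
rewrite -subr_le0 E oppr_le0; apply: Rintegral_itv_ge0_ae.
have sub : `[r1, r2]%classic `<=` J.
  by move=> t; rewrite /= !in_itv/= => /andP[h4 h5]; rewrite (lt_le_trans h1 h4) (le_lt_trans h5 h3).
by move: (ae_dom_sub sub Eq); apply: ae_dom_imp => t _ <-; exact: ldot_ge0.
Qed.

(** Monotonicity makes the energy constant between two equal values, so its derivative, minus the
    squared norm of [ut t], vanishes wherever it exists. *)
Lemma stationary_derivative r1 r2 : a < r1 -> r1 < r2 -> r2 < b -> L r2 = L r1 ->
  {ae lebR, forall t, `]r1, r2[%classic t -> dt (ut t) (ut t) = 0}.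
Proof.
move=> h1 h2 h3 E.
have D := window_derivative Om_open Om_bounded mu_reg mu_adm Hm ab bu cu Wu HM h1 h3.
have cst r : r1 < r < r2 -> L r = L r1.
  move=> /andP[h4 h5]; apply/eqP; rewrite eq_le (lyapunov_nonincreasing h1 (ltW h4) (lt_trans h5 h3))/=.
  by rewrite -E; exact: (lyapunov_nonincreasing (lt_trans h1 h4) (ltW h5) h3).
move: D; apply: ae_dom_imp => t; rewrite /= in_itv/= => ht dL; apply/eqP; rewrite -oppr_eq0; apply/eqP.
apply: (is_derive_cst_on ht _ dL) => r hr.
by rewrite (cst r hr) (cst t ht).
Qed.

(** * Uniqueness forward in time from an equilibrium *)

Section from_equilibrium.
Variable (w : RN -> R).
Hypotheses (bw : bounded_by Om B w) (Vw : VV w).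
Hypothesis ew : forall xi, VV xi -> Af w xi + dt (f \o w) xi = 0.
Hypothesis equ : {ae lebR, forall t, J t -> VV (u t) /\
  forall xi, VV xi -> dt (ut t) xi + Af (u t) xi + dt (f \o u t) xi = 0}.
Local Notation phi t := (dt (fun x => u t x - w x) (fun x => u t x - w x)).

Let sw : lsq Om w := bounded_by_lsq Om_open Om_bounded bw.

Lemma equilibrium_increment (K : R) t : 0 <= K -> a < t < b -> lsq Om (f \o u t) -> lsq Om (f \o w) ->
  dt (fun x => (f \o u t) x - (f \o w) x) (fun x => (f \o u t) x - (f \o w) x) <= K ^+ 2 * phi t ->
  lsq Om (ut t) -> VV (u t) ->
  (forall xi, VV xi -> dt (ut t) xi + Af (u t) xi + dt (f \o u t) xi = 0) ->
  dt (ut t) (fun x => u t x - w x) <= K * phi t.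
Proof.
move=> K0 ht sf sfw hK st Vt et.
have sD := lsqB Om_open (su ht) sw.
have D0 := form_dist_ge0 Om_open Om_bounded mu_reg mu_adm Hm Vt Vw.
have S := Aform_sym Om_open Om_bounded mu_reg mu_adm Hm Vt Vw.
have H := equilibrium_balance D0 S (et _ Vt) (et _ Vw) (ew Vt) (ew Vw).
rewrite (ldotBr Om_open (su ht) sw st); apply: le_trans H _.
rewrite -(ldotBr Om_open (su ht) sw sf) -(ldotBr Om_open (su ht) sw sfw).
rewrite -(ldotBl Om_open sf sfw sD).
apply: le_trans (ler_norm _) _; rewrite normrN.
have p0 := ldot_ge0 Om (fun x => u t x - w x).
have E : phi t = Num.sqrt (phi t) ^+ 2 by rewrite sqr_sqrtr.
have Q0 := sqrtr_ge0 (phi t).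
have hK' : dt (fun x => (f \o u t) x - (f \o w) x) (fun x => (f \o u t) x - (f \o w) x) <= (K * Num.sqrt (phi t)) ^+ 2.
  by rewrite exprMn -E.
have E' : phi t <= Num.sqrt (phi t) ^+ 2 by rewrite -E.
have C := ldot_CS_le Om_open (lsqB Om_open sf sfw) sD (mulr_ge0 K0 Q0) Q0 hK' E'.
by apply: le_trans C _; rewrite -mulrA -expr2 -E.
Qed.

Lemma equilibrium_attained t1 t2 : a < t1 -> t1 <= t2 -> t2 < b -> phi t1 <= 0 -> phi t2 <= 0.
Proof.
move=> at1 t12 t2b p0.
have [K [K0 HK]] := superposition Om_open Om_bounded f_C1 B.
have [M0 hM hg _ _] := HM.
apply: (gronwall_discrete (phi := fun t => phi t) (A := 4 * K) (C := 4 * K * M ^+ 2 * (b - a) + 2 * M ^+ 2) _ _ t12) p0.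
- by rewrite mulr_ge0.
- by rewrite addr_ge0 ?mulr_ge0 ?sqr_ge0// subr_ge0 ltW.
move=> r1 r2 h1 h2 h3.
have r1ab : a < r1 < b by rewrite (lt_le_trans at1 h1) (le_lt_trans h2 (le_lt_trans h3 t2b)).
have r2ab : a < r2 < b by rewrite (lt_le_trans at1 (le_trans h1 h2)) (le_lt_trans h3 t2b).
have s1 := su r1ab; have s2 := su r2ab.
have d1 := lsqB Om_open s1 sw; have d2 := lsqB Om_open s2 sw.
(* A difference of squares: [phi r2 - phi r1] is the product of [u r2 - u r1] with this fixed
   vector, so [u_increment] expresses it as an integral. *)
pose psi x := (u r2 x - w x) + (u r1 x - w x).
have sp : lsq Om psi := lsqD Om_open d2 d1.
have [g [bg _ Eg]] := ut_dot_version Om_open Wu sp M0 hM.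
have I := u_increment Om_open ab (fun t h => bounded_by_lsq Om_open Om_bounded (bu h)) cu Wu sp bg Eg (lt_le_trans at1 h1) h2 (le_lt_trans h3 t2b).
have E : phi r2 - phi r1 = dt (fun x => u r2 x - u r1 x) psi.
  have -> : (fun x => u r2 x - u r1 x) = (fun x => (u r2 x - w x) - (u r1 x - w x)).
    by apply/funext => x; ring.
  rewrite (ldotC _ _ psi) (ldotBr Om_open d2 d1 sp) !(ldotDl Om_open d2 d1)//.
  by rewrite [dt (fun x => u r1 x - w x) (fun x => u r2 x - w x)]ldotC; ring.
have lip r t : a < r < b -> a < t < b ->
   dt (fun x => u r x - u t x) (fun x => u r x - u t x) <= (M * `|r - t|) ^+ 2.
  by move=> hr ht; have [_ _ _ _ /(_ r t hr ht)[]] := HM.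
have sub : `[r1, r2]%classic `<=` J.
  move=> t; rewrite /= !in_itv/= => /andP[h4 h5]; move: r1ab r2ab => /andP[h6 _] /andP[_ h7].
  by rewrite (lt_le_trans h6 h4) (le_lt_trans h5 h7).
have gX : {ae lebR, forall t, `[r1, r2]%classic t ->
    g t <= 4 * K * phi r1 + (4 * K * M ^+ 2 * (b - a) + 2 * M ^+ 2) * (r2 - r1)}.
  move: (ae_dom_sub sub Eg) (ae_dom_imp2 (fun t _ => @conj _ _) (ae_dom_sub sub hg) (ae_dom_sub sub equ)).
  apply: ae_dom_imp2 => t tt <- [[_ st tM _ _] [Vt et]].
  have ht : a < t < b by have := sub t tt; rewrite /= in_itv.
  move: tt; rewrite /= in_itv/= => /andP[tr1 tr2].
  have sut := su ht; have dtt := lsqB Om_open sut sw.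
  have [sf _ hK _] := HK _ _ (bu (oc ht)) bw; have [sfw _ _ _] := HK _ _ bw bw.
  have X := equilibrium_increment K0 ht sf sfw hK st Vt et.
  have n0 : 0 <= r2 - r1 by rewrite subr_ge0.
  have [n1 n2] : `|t - r1| <= r2 - r1 /\ `|r2 - t| <= r2 - r1.
    by rewrite !ger0_norm ?subr_ge0//; split; [rewrite lerD2r|rewrite lerD2l lerN2].
  have n3 : `|r1 - t| <= r2 - r1 by rewrite distrC.
  have up (y : R) : `|y| <= r2 - r1 -> (M * `|y|) ^+ 2 <= (M * (r2 - r1)) ^+ 2.
    by move=> hy; rewrite lerXn2r ?nnegrE ?mulr_ge0// ler_wpM2l.
  have Mr : 0 <= M * (r2 - r1) by rewrite mulr_ge0.
  (* [psi] is [2 (u t - w) + (u r2 - u t) + (u r1 - u t)]. The first part is controlled by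
     [equilibrium_increment], the other two by the Lipschitz bound in time. *)
  have Y1 := ldot_CS_le Om_open st (lsqB Om_open s2 sut) M0 Mr tM (le_trans (lip _ _ r2ab ht) (up _ n2)).
  have Y2 := ldot_CS_le Om_open st (lsqB Om_open s1 sut) M0 Mr tM (le_trans (lip _ _ r1ab ht) (up _ n3)).
  have P : phi t <= 2 * ((M * (r2 - r1)) ^+ 2 + phi r1).
    have -> : (fun x => u t x - w x) = (fun x => (u t x - u r1 x) + (u r1 x - w x)).
      by apply/funext => x; ring.
    apply: le_trans (ldotD_le Om_open (lsqB Om_open sut s1) d1) _.
    by rewrite ler_pM2l// lerD2r; exact: (le_trans (lip _ _ ht r1ab) (up _ n1)).
  have rd : r2 - r1 <= b - a by move: r1ab r2ab => /andP[h6 _] /andP[_ h7]; rewrite lerB// ltW.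
  apply: (dissipation_rate_le K0 M0 n0 rd X P Y1 Y2).
  rewrite /psi (ldotC _ _ (fun x => u r2 x - w x + _)) (ldotDl Om_open d2 d1 st).
  rewrite ![dt (fun x => _ - w x) _]ldotC ?(ldotBr Om_open _ _ st)//; ring.
by apply: (gronwall_step (etrans E I)); exact: Rintegral_itv_le_ae.
Qed.

End from_equilibrium.

End evolution_window.

(** * Strong solutions *)

Lemma right_point_in_itv {R : realType} (d t1 t2 : R) : 0 < d -> t1 < t2 ->
  t1 < t1 + Num.min d (t2 - t1) / 2 < t2 /\ `|t1 + Num.min d (t2 - t1) / 2 - t1| < d.
Proof.
move=> d0 t12; have m0 : 0 < Num.min d (t2 - t1) by rewrite lt_min d0 subr_gt0.
have [m1 m2] : Num.min d (t2 - t1) <= d /\ Num.min d (t2 - t1) <= t2 - t1.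
  by rewrite !ge_min !lexx orbT.
move: (Num.min _ _) m0 m1 m2 => z z0 h1 h2; split; first by apply/andP; split; lra.
by rewrite addrC addKr gtr0_norm; lra.
Qed.

Lemma midpoint_in_itv {R : realType} (t1 t2 : R) : t1 < t2 -> t1 < (t1 + t2) / 2 < t2.
Proof. by move=> t12; apply/andP; split; lra. Qed.

Lemma double_sum_le {R : realType} (x y e : R) : x <= 0 -> y <= e / 2 -> 2 * (x + y) <= e.
Proof. by move=> h1 h2; lra. Qed.

Section solution.
Context {R : realType} {N : nat} (s : R) (Om : set 'rV[R]_N).
Hypotheses (Om_open : open Om) (Om_bounded : bounded_set Om).
Context (mu : {outer_measure set 'rV[R]_N -> \bar R}).
Hypotheses (mu_reg : regular_borel_on_boundary Om mu) (mu_adm : admissible Om mu).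
Local Notation RN := 'rV[R]_N.
Local Notation VV := (V s Om mu).
Local Notation Af := (Aform s Om mu).
Local Notation dt := (ldot Om).
Local Notation lebR := (@lebesgue_measure R).
Variables (f : R -> R) (f_C1 : C1 f).
Local Notation L w := (Lyapunov s Om mu f w).

Lemma Aform_ae v w : ae_in Om (fun x => v x = w x) -> Aform s Om mu v = Aform s Om mu w.
Proof. by move=> E; apply/funext => xi; rewrite /Aform (grad_ae_eq E) (qc_ae E). Qed.

Lemma Aform_ae_r v w xi : ae_in Om (fun x => v x = w x) -> Af xi v = Af xi w.
Proof. by move=> E; rewrite /Aform (grad_ae_eq E) (qc_ae E). Qed.

Lemma lyapunov_ae v w : ae_in Om (fun x => v x = w x) -> L v = L w.
Proof.
move=> E; rewrite /Lyapunov (Aform_ae E) (Aform_ae_r w E).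
rewrite (_ : \int[leb N]_(x in Om) primitive f (v x) = \int[leb N]_(x in Om) primitive f (w x)).
  reflexivity.
by apply: Rintegral_ae_eq; move: E; apply: ae_in_imp => x _ ->.
Qed.

Lemma ldot_sub_le0 v w : lsq Om v -> lsq Om w ->
  dt (fun x => v x - w x) (fun x => v x - w x) <= 0 -> ae_in Om (fun x => v x = w x).
Proof.
move=> sv sw h; have z : dt (fun x => v x - w x) (fun x => v x - w x) = 0.
  by apply/eqP; rewrite eq_le h ldot_ge0.
move: (ldot_self_eq0 Om_open (lsqB Om_open sv sw) z).
by apply: ae_in_imp => x _ /eqP; rewrite subr_eq0 => /eqP.
Qed.

Lemma C_time_Linf_bounded T u : C_time_Linf Om T u ->
  exists B : R, forall t, 0 <= t <= T -> bounded_by Om B (u t).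
Proof.
move=> [uL uC].
(* Near each time the oscillation is at most 1, so the bound at [t] plus 1 serves nearby;
   compactness makes finitely many such bounds suffice. *)
have := @segment_compact R 0 T; rewrite compact_near_coveringP => K.
pose P (n : nat) (t : R) := 0 <= t <= T -> bounded_by Om n%:R (u t).
have cover : forall t, `[0, T]%classic t -> \forall t' \near t & n \near \oo, P n t'.
  move=> t; rewrite /= in_itv/= => ht.
  have [mt [M HM]] := uL t ht; have [d [d0 Hd]] := uC t ht 1 ltr01.
  exists (ball t d, [set n | M + 1 <= n%:R]).
    split; first exact: nbhsx_ballx.
    exact: nbhs_infty_ger.
  move=> [t' n] /= [tt' Mn] ht'; have [mt' _] := uL t' ht'; split=> //.
  have tt : `|t' - t| < d by rewrite distrC; exact: tt'.
  move: HM (Hd t' ht' tt); apply: ae_in_imp2 => x _ h1 h2; apply: le_trans Mn.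
  rewrite -(subrK (u t x) (u t' x)) addrC.
  by apply: le_trans (ler_normD _ _) _; exact: lerD.
have [n0 _ H] := K nat \oo P _ cover.
exists n0%:R => t ht; exact: (H n0 (leqnn n0) t).
Qed.

Variables (u0 : RN -> R) (u ut : R -> RN -> R).
Hypothesis hu : strong_solution s Om mu f u0 u ut.

Lemma solution_bounded b : 0 < b -> exists B : R, forall t, 0 <= t <= b -> bounded_by Om B (u t).
Proof. by move=> b0; exact: (C_time_Linf_bounded (strong_C hu b0)). Qed.

Lemma solution_lsq t : 0 <= t -> lsq Om (u t).
Proof.
move=> t0; have [uL _] := strong_C hu (ltr_wpDl t0 ltr01 : 0 < t + 1).
by apply: (Linf_lsq Om_open Om_bounded); apply: uL; rewrite t0 lerDl ler01.
Qed.

Lemma solution_continuous a b : 0 < a -> a < b -> forall t, a <= t <= b ->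
  forall e : R, 0 < e -> exists d : R, 0 < d /\ forall r, a <= r <= b -> `|r - t| < d ->
    dt (fun x => u r x - u t x) (fun x => u r x - u t x) <= e.
Proof.
move=> a0 ab t /andP[at_ tb] e e0.
have [uL uC] := strong_C hu (lt_trans a0 ab).
have ht : 0 <= t <= b by rewrite (le_trans (ltW a0) at_).
have o0 := ldot_ge0 Om (fun=> 1); set o := dt _ _ in o0.
have o1 : 0 < o + 1 by rewrite ltr_wpDl.
have e1 : 0 < Num.sqrt (e / (o + 1)) by rewrite sqrtr_gt0 divr_gt0.
have [d [d0 Hd]] := uC t ht _ e1; exists d; split=> // r /andP[ar rb] rt.
have hr : 0 <= r <= b by rewrite (le_trans (ltW a0) ar).
have sr := solution_lsq (le_trans (ltW a0) ar).
have st := solution_lsq (le_trans (ltW a0) at_).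
apply: le_trans (ldot_small Om_open Om_bounded (ltW e1) (lsqB Om_open sr st) (Hd r hr rt)) _.
rewrite sqr_sqrtr; last by rewrite divr_ge0 ?(ltW e0)// ltW.
by rewrite -/o mulrAC ler_pdivrMr// ler_wpM2l ?(ltW e0)// lerDl.
Qed.

Lemma solution_eq : {ae lebR, forall t, 0 < t -> VV (u t) /\
  forall xi, VV xi -> dt (ut t) xi + Af (u t) xi + dt (f \o u t) xi = 0}.
Proof.
move: (strong_dom hu) (strong_eq hu); apply: ae_dom_imp2 => t _ [Vt _] et; split=> // xi Vx.
by rewrite -!L2dotE; exact: et.
Qed.

Lemma solution_eq_itv a b : 0 < a -> {ae lebR, forall t, `]a, b[%classic t -> VV (u t) /\
  forall xi, VV xi -> dt (ut t) xi + Af (u t) xi + dt (f \o u t) xi = 0}.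
Proof.
move=> a0; apply: (ae_dom_sub _ solution_eq) => t /=.
by rewrite in_itv/= => /andP[h _]; exact: lt_trans h.
Qed.

Lemma solution_window a b : 0 < a -> a < b -> exists B M : R,
  [/\ forall t, a <= t <= b -> bounded_by Om B (u t), W1inf_time Om a b u ut &
      energy_constants s Om mu f a b u ut M].
Proof.
move=> a0 ab; have [B HB] := solution_bounded (lt_trans a0 ab).
have bu t : a <= t <= b -> bounded_by Om B (u t).
  by move=> /andP[h1 h2]; apply: HB; rewrite h2 andbT (le_trans (ltW a0)).
have Wu : W1inf_time Om a b u ut by apply: (strong_W1inf hu); rewrite a0.
have [M HM] := exists_energy_constants Om_open Om_bounded f_C1 ab bu (solution_continuous a0 ab) Wu (solution_eq_itv b a0).
by exists B, M.
Qed.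

Local Notation cara := (caratheodory_type mu).
Local Notation G := (Gamma Om mu : set cara).
Variable m : {sigma_finite_measure set cara -> \bar R}.
Hypothesis Hm : forall A : set cara, measurable A -> A `<=` G -> m A = bmeas mu A.

(** The window from [t / 2] to [r + 1] contains the times of interest in its interior and stays away
    from 0, where the solution has no prescribed bound on its derivative. *)
Lemma half_window (t : R) : 0 < t -> [/\ 0 < t / 2, t / 2 < t & forall r, t <= r -> t / 2 < r + 1].
Proof. by move=> t0; split=> [||r]; [rewrite divr_gt0|lra|lra]. Qed.

Lemma solution_V t : 0 < t -> VV (u t).
Proof.
move=> t0; have [a0 at_ h] := half_window t0; have ab := h t (lexx t).
have [B [M [bu Wu HM]]] := solution_window a0 ab.
by apply: (window_V Om_open Om_bounded mu_reg mu_adm Hm bu HM); rewrite at_ ltrDl ltr01.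
Qed.

Lemma solution_derivative : {ae lebR, forall t : R, 0 < t ->
  is_derive t (1 : R) (fun r => L (u r)) (- dt (ut t) (ut t))}.
Proof.
have W (n : nat) : {ae lebR, forall t : R, `]n.+1%:R^-1, n.+2%:R[%classic t ->
    is_derive t (1 : R) (fun r => L (u r)) (- dt (ut t) (ut t))}.
  have t0 : 0 < n.+1%:R^-1 :> R by rewrite invr_gt0.
  have [a0 at_ _] := half_window t0.
  have ab : n.+1%:R^-1 / 2 < n.+2%:R + 1 :> R.
    apply: lt_le_trans at_ _; apply: (@le_trans _ _ 1); first by rewrite invf_le1// ler1n.
    by rewrite lerDr.
  have [B [M [bu Wu HM]]] := solution_window a0 ab.
  apply: (window_derivative Om_open Om_bounded mu_reg mu_adm Hm ab bu (solution_continuous a0 ab) Wu HM) => //.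
  by rewrite ltrDl ltr01.
have W' : {ae lebR, forall t : R, 0 < t -> forall n, `]n.+1%:R^-1, n.+2%:R[%classic t ->
    is_derive t (1 : R) (fun r => L (u r)) (- dt (ut t) (ut t))}.
  by apply: ae_dom_forall => n; move: (W n); apply: (@filterS _ _ (ae_filter_ringOfSetsType lebR)) => t h _; exact: h.
move: W'; apply: ae_dom_imp => t /= t0 H.
(* This integer exceeds both [t] and [1 / t], so the [n]-th of the countably many windows contains
   [t]. *)
pose n := (Num.trunc (t + t^-1)).+1.
have ti : 0 < t^-1 by rewrite invr_gt0.
have tn : t + t^-1 < n%:R by rewrite /n; apply: truncnS_gt.
apply: (H n); rewrite /= in_itv/=; apply/andP; split.
  rewrite invf_plt ?posrE//; apply: lt_le_trans (le_lt_trans _ tn) _; first by rewrite lerDr ltW.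
  by rewrite ler_nat.
apply: lt_le_trans (le_lt_trans _ tn) _; first by rewrite lerDl ltW.
by rewrite ler_nat (leq_trans (leqnSn n) (leqnSn n.+1)).
Qed.

Lemma solution_nonincreasing t1 t2 : 0 < t1 -> t1 < t2 -> L (u t2) <= L (u t1).
Proof.
move=> t0 t12; have [a0 at_ h] := half_window t0; have ab := h t2 (ltW t12).
have [B [M [bu Wu HM]]] := solution_window a0 ab.
apply: (lyapunov_nonincreasing Om_open Om_bounded mu_reg mu_adm Hm ab bu (solution_continuous a0 ab) Wu HM at_ (ltW t12)).
by rewrite ltrDl ltr01.
Qed.

(** The equation need not hold at [t1] itself. It is used at a nearby time [t] where [ut t]
    vanishes, and [u t = u t1] almost everywhere because [u] is constant on []t1, t2[] and
    continuous at [t1]; the form sees only this class. *)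
Lemma stationary_equilibrium t1 t2 : 0 < t1 -> t1 < t2 -> L (u t2) = L (u t1) ->
  equilibrium s Om mu f (u t1).
Proof.
move=> t0 t12 E; have [a0 at_ h] := half_window t0; have ab := h t2 (ltW t12).
have [B [M [bu Wu HM]]] := solution_window a0 ab.
have tb : t2 < t2 + 1 by rewrite ltrDl ltr01.
have Z := stationary_derivative Om_open Om_bounded mu_reg mu_adm Hm ab bu (solution_continuous a0 ab) Wu HM at_ t12 tb E.
have [_ _ hg _ _] := HM.
have sub : `]t1, t2[%classic `<=` `]t1 / 2, (t2 + 1)%R[%classic.
  by move=> t; rewrite /= !in_itv/= => /andP[h1 h2]; rewrite (lt_trans at_ h1) (lt_trans h2 tb).
have su t : t1 <= t <= t2 -> lsq Om (u t).
  by move=> /andP[h1 _]; apply: solution_lsq; apply: le_trans h1; exact: ltW.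
have cu := solution_continuous t0 t12.
have W2 : W1inf_time Om t1 t2 u ut by apply: (strong_W1inf hu); rewrite t0.
have Z0 : {ae lebR, forall t, `]t1, t2[%classic t -> dt (ut t) (ut t) <= 0 ^+ 2}.
  by move: Z; apply: ae_dom_imp => t _ ->; rewrite expr0n.
(* With derivative bound 0 the Lipschitz estimate says that [u] is constant on the open window; the
   endpoint [t1] is reached through [cu] below. *)
have Lip := u_lipschitz Om_open t12 su cu W2 (lexx 0) Z0.
have [t [ht _ [[_ st _ _ _] [Vt et]] zt]] : exists r, [/\ t1 < r < t2, `|r - (t1 + t2) / 2| < 1,
    good_time s Om mu f u ut M r /\ (VV (u r) /\
      forall xi, VV xi -> dt (ut r) xi + Af (u r) xi + dt (f \o u r) xi = 0) &
    dt (ut r) (ut r) = 0].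
  have P := ae_dom_imp2 (fun t _ => @conj _ _) (ae_dom_sub sub hg) (solution_eq_itv t2 t0).
  have mid := midpoint_in_itv t12.
  have [r [h1 h2 [h3 h4]]] := ae_itv_dense (ae_dom_imp2 (fun t _ => @conj _ _) P Z) mid ltr01.
  by exists r; split; [exact: h1|exact: h2|exact: h3|exact: h4].
have oc r : t1 < r < t2 -> t1 <= r <= t2 by move=> /andP[? ?]; rewrite !ltW.
have s1 : lsq Om (u t1) by apply: su; rewrite lexx ltW.
have sut := su t (oc t ht).
have uE : ae_in Om (fun x => u t x = u t1 x).
  apply: (ldot_sub_le0 sut s1); apply/ler_addgt0Pr => e e0; rewrite add0r.
  have t11 : t1 <= t1 <= t2 by rewrite lexx ltW.
  have [d [d0 Hd]] := cu t1 t11 (e / 2) (divr_gt0 e0 (ltr0n R 2)).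
  have [r [hr rt _]] : exists r, [/\ t1 < r < t2, `|r - t1| < d & True].
    have [h1 h2] := right_point_in_itv d0 t12.
    by exists (t1 + Num.min d (t2 - t1) / 2); split; [exact: h1|exact: h2|].
  have sr := su r (oc r hr).
  have -> : (fun x => u t x - u t1 x) = (fun x => (u t x - u r x) + (u r x - u t1 x)).
    by apply/funext => x; ring.
  apply: le_trans (ldotD_le Om_open (lsqB Om_open sut sr) (lsqB Om_open sr s1)) _.
  have h1 := Lip _ _ hr ht; rewrite expr0n/= mul0r in h1.
  have h2 := Hd r (oc r hr) rt.
  exact: (double_sum_le h1 h2).
split.
- exact: solution_V.
- by have [uL _] := strong_C hu t0; apply: uL; rewrite lexx ltW.
- move=> xi Vx; rewrite L2dotE -(Aform_ae uE).
  have -> : dt (f \o u t1) xi = dt (f \o u t) xi.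
    apply: ldot_ae; last by apply: ae_inT.
    by move: uE; apply: ae_in_imp => x _ /= ->.
  have h0 : dt (ut t) xi = 0.
    have := ldot_CS Om_open st (lsq_V Vx); rewrite zt mul0r => h0.
    by apply/eqP; rewrite -sqrf_eq0 eq_le h0 sqr_ge0.
  have := et xi Vx; rewrite h0 add0r; exact.
Qed.

Lemma equilibrium_stationary t1 t2 : 0 < t1 -> t1 < t2 ->
  equilibrium s Om mu f (u t1) -> L (u t2) = L (u t1).
Proof.
move=> t0 t12 [Vw _ ew]; have [a0 at_ h] := half_window t0; have ab := h t2 (ltW t12).
have [B [M [bu Wu HM]]] := solution_window a0 ab.
have tb : t2 < t2 + 1 by rewrite ltrDl ltr01.
have t2p := lt_trans t0 t12.
have bw : bounded_by Om B (u t1) by apply: bu; rewrite !ltW// (lt_trans t12).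
have ew' xi : VV xi -> Af (u t1) xi + dt (f \o u t1) xi = 0 by move=> Vx; rewrite -L2dotE; exact: ew.
have s1 := solution_lsq (ltW t0); have s2 := solution_lsq (ltW t2p).
apply: lyapunov_ae; apply: (ldot_sub_le0 s2 s1).
apply: (equilibrium_attained Om_open Om_bounded mu_reg mu_adm Hm f_C1 ab bu (solution_continuous a0 ab) Wu HM bw Vw ew' (solution_eq_itv _ a0) at_ (ltW t12) tb).
have -> : (fun x => u t1 x - u t1 x) = fun=> 0 by apply/funext => x; rewrite subrr.
by rewrite ldot0.
Qed.

End solution.

Theorem lemma4p3 (R : realType) (N : nat) (hN : (2 <= N)%N)
  (s : R) (hs : 0 < s < 1)
  (Om : set 'rV[R]_N)
  (Om_open : open Om) (Om_conn : connected Om) (Om_nonempty : Om !=set0)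
  (Om_bounded : bounded_set Om)
  (mu : {outer_measure set 'rV[R]_N -> \bar R})
  (mu_reg : regular_borel_on_boundary Om mu)
  (mu_adm : admissible Om mu)
  (mu_pos : (0 < cap Om (Gamma_inf Om mu))%E \/ (0 < mu (Gamma Om mu))%E)
  (mu_emb :
    (forall A, borel A -> A `<=` boundary Om ->
       hausdorff N.-1 A = 0%E -> mu A = 0%E) \/
    (exists q : R, 1 < q /\ V_embeds_Lr s Om mu (2 * q)))
  (f : R -> R) (f_C1 : C1 f)
  (hf :
    (exists p Cf cf Cf' cf' : R,
       [/\ 1 < p, 0 < Cf, 0 < cf, 0 < Cf' & 0 < cf'] /\
       forall x : R, Cf * `|x| `^ p - cf <= f x * x <= Cf' * `|x| `^ p + cf' /\
                     - Cf <= derive1 f x) \/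
    (exists lam : R, [/\ 0 <= lam, (lam%:E < C_Om s Om mu)%E &
       ((- lam)%:E < limf_einf (fun x => (f x / x)%:E) abs_pinfty)%E]))
  (u0 : 'rV[R]_N -> R) (u0_bounded : Linf Om u0)
  (u ut : R -> 'rV[R]_N -> R) (hu : strong_solution s Om mu f u0 u ut) :
  [/\ forall t : R, 0 < t -> V s Om mu (u t),
      {ae @lebesgue_measure R, forall t : R, 0 < t ->
        is_derive t 1 (fun r => Lyapunov s Om mu f (u r))
          (- \int[leb N]_(x in Om) ((ut t x) ^+ 2))} &
      forall t1 t2 : R, 0 < t1 < t2 ->
        Lyapunov s Om mu f (u t2) <= Lyapunov s Om mu f (u t1) /\
        (Lyapunov s Om mu f (u t2) = Lyapunov s Om mu f (u t1) <->
         equilibrium s Om mu f (u t1))].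
Proof.
(* A sigma-finite measure that agrees with [mu] on [Gamma], so that the double integrals of the form
   can be read on a product space. *)
have [m Hm] := sigma_finite_restriction (measurable_Gamma mu_reg) (Gamma_sigma_finite mu_reg).
split.
- by move=> t; exact: (solution_V Om_open Om_bounded mu_reg mu_adm f_C1 hu Hm).
- move: (solution_derivative Om_open Om_bounded mu_reg mu_adm f_C1 hu Hm).
  apply: ae_dom_imp => t _; rewrite ldotE.
  by have -> : \int[leb N]_(x in Om) (ut t x * ut t x) = \int[leb N]_(x in Om) (ut t x ^+ 2)
    by apply: eq_Rintegral => x _; rewrite expr2.
move=> t1 t2 /andP[t0 t12]; split.
  exact: (solution_nonincreasing Om_open Om_bounded mu_reg mu_adm f_C1 hu Hm).
split; first exact: (stationary_equilibrium Om_open Om_bounded mu_reg mu_adm f_C1 hu Hm).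
exact: (equilibrium_stationary Om_open Om_bounded mu_reg mu_adm f_C1 hu Hm).
Qed.
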